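(* Let $\gamma(0)$ be a Jordan curve of finite length, whose curvature is everywhere defined and is a $C^\infty$ function of arc length, and which has finitely many inflection points; let $\mathcal D$ be the region it encloses. Then $T^*=T(\mathcal D)=\mathrm{Area}(\mathcal D)/2$, and the solution $\gamma(t)$ of the anisotropic curve shortening flow $\partial_t\gamma=a(\theta)k\mathbf N$ started from $\gamma(0)$ shrinks to a point as $t\to T(\mathcal D)$.
   Context: $a(\theta)=\frac{1}{2(|\cos\theta|+|\sin\theta|)^2}$; in the flow, $\theta$ is the tangent angle, $k$ the signed curvature (positive at local convexity), $\mathbf N$ the inward unit normal. Fix a family $(a^\omega)_{\omega\in(0,1)}$ of $C^\infty$, strictly positive, $\pi/2$-periodic functions, uniformly Lipschitz in $\omega$, converging uniformly to $a$ as $\omega\to0$. Let $\gamma^\omega(t)$ be the smooth solution of $\partial_t\gamma=a^\omega(\theta)k\mathbf N$ with $\gamma^\omega(0)=\gamma(0)$ (existing until it shrinks to a point) and $k^\omega$ its curvature. For $K\ge0$, $T_K=\sup\{t:\ \limsup_{\omega\to0}\sup_{t'\le t}\|k^\omega(\cdot,t')\|_\infty<K/2\}$ and $T^*=\lim_{K\to\infty}T_K$. For $t<T^*$, $\gamma(t)$ denotes the unique Jordan-curve solution of $\partial_t\gamma=a(\theta)k\mathbf N$ on $[0,T_K]$ for any $K$ with $t\le T_K$ (equivalently the Hausdorff limit of $\gamma^\omega(t)$ as $\omega\to0$). *)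

(* Defs.v *)
From HB Require Import structures.
From mathcomp Require Import all_boot all_order all_algebra.
From mathcomp Require Import all_classical all_reals all_analysis.
Set Implicit Arguments. Unset Strict Implicit. Unset Printing Implicit Defensive.
Import Order.TTheory GRing.Theory Num.Theory.
Import numFieldNormedType.Exports.
Local Open Scope classical_set_scope.
Local Open Scope ring_scope.

Section Defs.
Variable R : realType.

Definition aniso (th : R) : R :=
  (2 * (`|cos th| + `|sin th|) ^+ 2)^-1.

Definition smooth_fun (f : R -> R) : Prop :=
  forall (n : nat) (s : R), derivable (derive1n n f) s 1.

Definition du (f : R -> R -> R) : R -> R -> R :=
  fun u t => derive1 (fun v => f v t) u.
Definition dt (f : R -> R -> R) : R -> R -> R :=
  fun u t => derive1 (fun s => f u s) t.
Definition dun (n : nat) (f : R -> R -> R) := iter n du f.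
Definition dtm (m : nat) (f : R -> R -> R) := iter m dt f.

Definition curv (eps : R) (x y : R -> R -> R) (u t : R) : R :=
  eps * (du x u t * du (du y) u t - du y u t * du (du x) u t)
  / (Num.sqrt (du x u t ^+ 2 + du y u t ^+ 2)) ^+ 3.

Definition curve_image (x y : R -> R) : set (R * R) := [set (x s, y s) | s in setT].

Definition enclosed (C : set (R * R)) : set (R * R) :=
  [set p | ~ C p /\ bounded_set (connected_component (~` C) p)].

(** Jordan curve of length L, parametrized by arc length (L-periodic,
    injective on [0,L), unit speed), C^oo (so its curvature is a
    C^oo function of arc length). *)
Definition arclength_jordan (c1 c2 : R -> R) (L : R) : Prop :=
  0 < L /\ smooth_fun c1 /\ smooth_fun c2 /\
  (forall s, c1 (s + L) = c1 s /\ c2 (s + L) = c2 s) /\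
  (forall s, derive1 c1 s ^+ 2 + derive1 c2 s ^+ 2 = 1) /\
  (forall s s', 0 <= s < L -> 0 <= s' < L ->
      c1 s = c1 s' -> c2 s = c2 s' -> s = s').

(** eps (= 1 or -1) orients the curve so that eps * J T points into the
    enclosed region D, i.e. eps * J T is the inward unit normal. *)
Definition inward_orientation (c1 c2 : R -> R) (eps : R) : Prop :=
  (eps = 1 \/ eps = -1) /\
  forall s, exists2 h0 : R, 0 < h0 & forall h, 0 < h < h0 ->
    enclosed (curve_image c1 c2)
      (c1 s - eps * h * derive1 c2 s, c2 s + eps * h * derive1 c1 s).

Definition finitely_many_inflections (c1 c2 : R -> R) (L : R) : Prop :=
  finite_set [set s | 0 <= s < L /\
     derive1 c1 s * derive1n 2 c2 s - derive1 c2 s * derive1n 2 c1 s = 0].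

Definition approx_family (aw : R -> R -> R) : Prop :=
  (forall w, 0 < w < 1 -> smooth_fun (aw w)) /\
  (forall w th, 0 < w < 1 -> 0 < aw w th) /\
  (forall w th, 0 < w < 1 -> aw w (th + pi / 2) = aw w th) /\
  (exists C : R, forall w th th', 0 < w < 1 ->
       `|aw w th - aw w th'| <= C * `|th - th'|) /\
  (forall e, 0 < e -> exists2 d : R, 0 < d &
       forall w th, 0 < w < d -> w < 1 -> `|aw w th - aniso th| < e).

Definition smooth_strip (f : R -> R -> R) (T : R) : Prop :=
  (forall (m n : nat) (u t : R), 0 < t < T ->
     derivable (fun v => dtm m (dun n f) v t) u 1 /\
     derivable (fun s => dtm m (dun n f) u s) t 1 /\
     {for (u, t), continuous (fun z : R * R => dtm m (dun n f) z.1 z.2)}) /\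
  (forall (n : nat) (u t : R), 0 <= t < T ->
     derivable (fun v => dun n f v t) u 1) /\
  (forall n : nat,
     {within [set z : R * R | 0 <= z.2 < T],
        continuous (fun z : R * R => dun n f z.1 z.2)}).

Definition flow_solution (a : R -> R) (eps : R) (c1 c2 : R -> R) (L : R)
    (x y : R -> R -> R) (T : R) : Prop :=
  0 < T /\ smooth_strip x T /\ smooth_strip y T /\
  (forall u, x u 0 = c1 u /\ y u 0 = c2 u) /\
  (forall u t, 0 <= t < T -> x (u + L) t = x u t /\ y (u + L) t = y u t) /\
  (forall u t, 0 <= t < T -> du x u t ^+ 2 + du y u t ^+ 2 != 0) /\
  (forall u t th, 0 < t < T ->
     let sp := Num.sqrt (du x u t ^+ 2 + du y u t ^+ 2) in
     cos th = du x u t / sp -> sin th = du y u t / sp ->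
     dt x u t = a th * curv eps x y u t * (eps * (- du y u t / sp)) /\
     dt y u t = a th * curv eps x y u t * (eps * (du x u t / sp))) /\
  (exists p : R * R, forall e, 0 < e -> exists2 d : R, 0 < d &
     forall u t, T - d < t < T -> ball p e (x u t, y u t)).

Definition curv_sup (eps : R) (x y : R -> R -> R) (T t : R) : \bar R :=
  ereal_sup [set z : \bar R | exists u t' : R,
               0 <= t' <= t /\ t' < T /\ z = (`|curv eps x y u t'|)%:E].

Definition limsup0 (F : R -> \bar R) : \bar R :=
  ereal_inf [set ereal_sup [set F w | w in [set w | 0 < w < d]] |
             d in [set d : R | 0 < d <= 1]].

Definition T_K (eps : R) (X Y : R -> R -> R -> R) (Tw : R -> R) (K : R)
  : \bar R :=
  ereal_sup [set t%:E | t in [set t : R | 0 <= t /\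
     (limsup0 (fun w => curv_sup eps (X w) (Y w) (Tw w) t) < (K / 2)%:E)%E]].

Definition hausdorff_limit0 (X Y : R -> R -> R -> R) (Tw : R -> R) (t : R)
    (C : set (R * R)) : Prop :=
  forall e, 0 < e -> exists2 d : R, 0 < d <= 1 & forall w, 0 < w < d ->
    t < Tw w /\
    (forall u, exists2 p, C p & ball p e (X w u t, Y w u t)) /\
    (forall p, C p -> exists u, ball (X w u t, Y w u t) e p).

End Defs.

(* Main.v *)
(* The signed area of a smooth flow decreases at the constant rate given by the integral of
the mobility over [0, 2 pi] (Hopf's Umlaufsatz), which tends to 2; hence the extinction times
tend to half the enclosed area (Green). As long as the length stays away from 0, a two-point
maximum principle keeps a chord-arc profile positive, uniformly in the regularisation: the
uniform Lipschitz bound on the square root of the mobility and the numerical gap of the limit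
mobility absorb the anisotropic error terms. The chord-arc bound controls the curvature, so the
curvature stays bounded up to any time before half the area, whereas it must blow up afterwards.
The same bound forces the length to tend to 0 at extinction, and as the bounding boxes of the
flow are nested, the curves converge to a point. *)
Require Import Defs.
From HB Require Import structures.
From mathcomp Require Import all_boot all_order all_algebra.
From mathcomp Require Import all_classical all_reals all_analysis.
From mathcomp Require Import ring lra zify.
Set Implicit Arguments. Unset Strict Implicit. Unset Printing Implicit Defensive.
Import Order.TTheory GRing.Theory Num.Theory.
Import numFieldNormedType.Exports.
Local Open Scope classical_set_scope.
Local Open Scope ring_scope.

(** The limit mobility is only Lipschitz, so no bound may depend on further derivatives of the
    mobility. What is uniform in the regularisation is a Lipschitz constant [K] of its square root,
    possibly large, and a small distance [e] to the explicit limit. The square root appears because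
    the second variation is weighted by it at both ends: this turns curvatures into normal speeds
    and leaves the squared difference of the roots as error. Where the two tangents are close to the
    chord direction, a cubic reserve in the profile sized by [K] absorbs it; elsewhere the sharp
    constants of the limit do, with margins so thin that pi / 2 > 1.565 is used. The two-point
    argument runs twice. A crude profile of small, decaying slope yields a chord-arc constant; this
    confines contacts of the second, concave profile to slopes above a fixed [nu], and the second
    has slope 1 at zero, so its expansion at the diagonal bounds the curvature. The area formula
    rests on a mollified winding number whose sum over a grid is exactly the line integral; the two
    sides of the curve are told apart by offsets along normals. *)

(** * Derivatives, primitives, Leibniz' rule and an abstract first-contact principle *)

Section Calculus.
Context {R : realType}.
Implicit Types (f g F df : R -> R) (x y t u a b l m e d : R).

(** A relation carrying the value, so that a derivative is first computed by applying rules and its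
    value is adjusted afterwards by [der_eq]. *)
Definition der f x l : Prop := is_derive x (1 : R) f l.

Lemma der_eq f x l m : der f x l -> l = m -> der f x m.
Proof. by move=> h <-. Qed.
Lemma der_cst a x : der (fun=> a) x 0.
Proof. exact: is_derive_cst. Qed.
Lemma der_id x : der (fun z => z) x 1.
Proof. exact: is_derive_id. Qed.
Lemma derD f g x l m : der f x l -> der g x m -> der (fun z => f z + g z) x (l + m).
Proof. by move=> hf hg; exact: is_deriveD. Qed.
Lemma derN f x l : der f x l -> der (fun z => - f z) x (- l).
Proof. by move=> hf; exact: is_deriveN. Qed.
Lemma derB f g x l m : der f x l -> der g x m -> der (fun z => f z - g z) x (l - m).
Proof. by move=> hf hg; exact: is_deriveB. Qed.
Lemma derM f g x l m : der f x l -> der g x m ->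
der (fun z => f z * g z) x (l * g x + f x * m).
Proof.
move=> hf hg; apply: is_derive_eq (is_deriveM hf hg) _.
by rewrite /GRing.scale /= addrC [g x * l]mulrC.
Qed.
Lemma derX f n x l : der f x l -> der (fun z => f z ^+ n) x (n%:R * f x ^+ n.-1 * l).
Proof.
move=> hf; elim: n => [|n IH].
by rewrite !mul0r; exact: der_cst.
have := derM hf IH; under eq_fun do rewrite -exprS.
move=> h; apply: (der_eq h); rewrite /= -natr1.
case: n {h IH} => [|n] /=; first by rewrite expr0; ring.
by rewrite exprS; ring.
Qed.
Lemma derV f x l : f x != 0 -> der f x l -> der (fun z => (f z)^-1) x (- l / f x ^+ 2).
Proof.
move=> fx hf; apply: is_derive_eq (is_deriveV fx hf) _.
by rewrite /GRing.scale /= mulNr mulNr mulrC.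
Qed.
Lemma der_comp f g x l m : der f (g x) l -> der g x m -> der (fun z => f (g z)) x (l * m).
Proof. by move=> hf hg; exact: is_derive1_comp. Qed.
Lemma der_exp f x l : der f x l -> der (fun z => expR (f z)) x (expR (f x) * l).
Proof. by move=> hf; apply: der_comp hf; exact: is_derive_expR. Qed.
Lemma der_cos f x l : der f x l -> der (fun z => cos (f z)) x (- sin (f x) * l).
Proof. by move=> hf; apply: der_comp hf; exact: is_derive_cos. Qed.
Lemma der_sin f x l : der f x l -> der (fun z => sin (f z)) x (cos (f x) * l).
Proof. by move=> hf; apply: der_comp hf; exact: is_derive_sin. Qed.
Lemma der_sqrt f x l : 0 < f x -> der f x l ->
der (fun z => Num.sqrt (f z)) x (l / ((2 : R) * (Num.sqrt (f x) : R))).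
Proof.
move=> fx hf; apply: (der_eq (der_comp (is_derive1_sqrt fx) hf)).
by rewrite mulrC.
Qed.
Lemma der_ln f x l : 0 < f x -> der f x l -> der (fun z => ln (f z)) x (l / f x).
Proof.
move=> fx hf; apply: (der_eq (der_comp (is_derive1_ln fx) hf)).
by rewrite mulrC.
Qed.

Lemma der_unique f x l m : der f x l -> der f x m -> l = m.
Proof. by move=> [_ <-] [_ <-]. Qed.

Lemma der_derive1 f x : derivable f x 1 -> der f x (derive1 f x).
Proof. by move=> h; apply: DeriveDef => //; rewrite derive1E. Qed.

Lemma der_cvg f x l : der f x l -> {for x, continuous f}.
Proof. by move=> [h _]; apply: differentiable_continuous; apply/derivable1_diffP. Qed.

(** The increment form is free of division and valid at [h = 0]; with its converse [eps_der] it is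
    the interface to the filter definition. *)
Lemma der_eps f x l : der f x l -> forall e, 0 < e ->
exists2 d : R, 0 < d & forall h, `|h| < d -> `|f (x + h) - f x - l * h| <= e * `|h|.
Proof.
move=> [hd hl] e e0.
have : h^-1 *: (f (h *: (1:R) + x) - f x) @[h --> 0^'] --> l.
by rewrite -hl; exact: hd.
move=> /cvgrPdist_le /(_ e e0) [d /= d0 hdd].
exists d => // h hh.
have [->|h0] := eqVneq h 0.
by rewrite addr0 subrr mulr0 subr0 normr0 mulr0.
have := hdd h; rewrite /= sub0r normrN => /(_ hh h0).
have -> : f (x + h) - f x - l * h = - h * (l - h^-1 * (f (h * 1 + x) - f x)).
by rewrite mulr1 [h + x]addrC; field.
by move=> hhh; rewrite normrM normrN [X in _ <= X]mulrC; apply: ler_wpM2l.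
Qed.

Lemma eps_der f x l : (forall e, 0 < e ->
exists2 d : R, 0 < d & forall h, `|h| < d -> `|f (x + h) - f x - l * h| <= e * `|h|) ->
der f x l.
Proof.
move=> H.
have hc : h^-1 *: (f (h *: (1:R) + x) - f x) @[h --> 0^'] --> l.
apply/cvgrPdist_le => e e0; have [d d0 hd] := H e e0.
exists d => // h /=; rewrite sub0r normrN => hh h0.
have h0' : 0 < `|h| by rewrite normr_gt0.
rewrite -(ler_pM2l h0') -normrM [X in _ <= X]mulrC.
apply: le_trans (hd h hh); rewrite -normrN le_eqVlt; apply/orP; left; apply/eqP.
by congr (`|_|); rewrite /GRing.scale /= mulr1 [h + x]addrC; field.
split; last exact: (cvg_lim _ hc).
by apply/cvg_ex; exists l.
Qed.

Lemma mvt f df a b : a < b -> (forall x, a <= x <= b -> der f x (df x)) ->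
exists2 c, a < c < b & f b - f a = df c * (b - a).
Proof.
move=> ab h; have [] := @MVT _ f df a b ab.
- by move=> x; rewrite in_itv /= => /andP[/ltW xa /ltW xb]; apply: h; rewrite xa.
- apply: continuous_in_subspaceT => x; rewrite inE /= in_itv /= => hx.
exact: der_cvg (h x hx).
- by move=> c; rewrite in_itv /= => hc E; exists c.
Qed.

Lemma der_ge0_le f df a b : a <= b -> (forall x, a <= x <= b -> der f x (df x)) ->
(forall x, a <= x <= b -> 0 <= df x) -> f a <= f b.
Proof.
rewrite le_eqVlt => /predU1P[->//|ab] h hp.
have [c /andP[/ltW ac /ltW cb] E] := mvt ab h.
by rewrite -subr_ge0 E mulr_ge0 ?hp ?ac // subr_ge0 ltW.
Qed.

Lemma der_gt0_lt f df a b : a < b -> (forall x, a <= x <= b -> der f x (df x)) ->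
(forall x, a < x < b -> 0 < df x) -> f a < f b.
Proof.
move=> ab h hp; have [c cab E] := mvt ab h.
by rewrite -subr_gt0 E mulr_gt0 ?hp // subr_gt0.
Qed.

Lemma der_bound f df a b m : a <= b -> (forall x, a <= x <= b -> der f x (df x)) ->
(forall x, a <= x <= b -> `|df x| <= m) -> `|f b - f a| <= m * (b - a).
Proof.
rewrite le_eqVlt => /predU1P[->|ab] h hp; first by rewrite !subrr normr0 mulr0.
have [c /andP[/ltW ac /ltW cb] E] := mvt ab h.
by rewrite E normrM (gtr0_norm (x := b - a)) ?subr_gt0 // ler_pM2r ?subr_gt0 // hp ?ac.
Qed.

Lemma der_bound_sym f df a b m : (forall x, der f x (df x)) ->
(forall x, `|df x| <= m) -> `|f b - f a| <= m * `|b - a|.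
Proof.
move=> h hp; have [ab|/ltW ab] := leP a b.
by rewrite (@ger0_norm _ (b - a)) ?subr_ge0 //; apply: der_bound.
by rewrite distrC (distrC b) (@ger0_norm _ (a - b)) ?subr_ge0 //; apply: der_bound.
Qed.

Lemma der0_cst f a b : (forall x, der f x 0) -> f a = f b.
Proof. by move=> h; exact: is_derive_0_is_cst. Qed.

Lemma der_uniq_prim f g df : (forall x, der f x (df x)) -> (forall x, der g x (df x)) ->
forall a b, f b - f a = g b - g a.
Proof.
move=> hf hg a b; apply/eqP; rewrite -subr_eq0; apply/eqP.
have := @der0_cst (fun z => f z - g z) a b (fun x => der_eq (derB (hf x) (hg x)) (subrr _)).
lra.
Qed.

(** The fundamental theorem gives primitives on bounded intervals only. Those on [-n-1, n+1] for
    different n differ by constants, so they agree once normalised at 0 ([Gle]) and glue to a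
    primitive on the whole line. *)
Lemma primitive_exists f : continuous f -> exists F, forall x, der F x (f x).
Proof.
move=> cf.
have cw a b : {within `[a, b], continuous f}.
exact: continuous_subspaceT.
have H n : exists F, forall x, - n%:R - 1 < x < n%:R + 1 -> der F x (f x).
exists (fun x => \int[lebesgue_measure]_(t in [set` `[- n%:R - 1, x]]) (f t))%R.
move=> x /andP[x1 x2].
have [] := @continuous_FTC1_closed R f (- n%:R - 1) x (n%:R + 1) x2 _ x1 (cf x).
 apply: continuous_compact_integrable; [exact: segment_compact|exact: cw].
by move=> h1 h2; rewrite -h2; exact: der_derive1.
have [G hG] := choice H.
pose n_ (x : R) := Num.truncn `|x|.
have nP x : - (n_ x)%:R - 1 < x < (n_ x)%:R + 1.
rewrite /n_; have := truncnS_gt `|x|.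
rewrite -natr1 => h; apply/andP; split.
 by move: h; rewrite -ltrBlDr; have := ler_norm (- x); rewrite normrN; lra.
by have := ler_norm x; lra.
have Gle n k x : (n <= k)%N -> - n%:R - 1 < x < n%:R + 1 ->
 G n x - G n 0 = G k x - G k 0.
move=> nm hx.
have nmR : n%:R <= k%:R :> R by rewrite ler_nat.
have n0 : 0 <= n%:R :> R by [].
have hh y : - n%:R - 1 < y < n%:R + 1 -> der (fun z => G n z - G k z) y 0.
 move=> hy; apply: (der_eq (derB (hG n y hy) (hG k y _))); last exact: subrr.
 by move: hy; lra.
have [x0|/ltW x0] := leP 0 x.
 have : `|G n x - G k x - (G n 0 - G k 0)| <= 0 * (x - 0).
 apply: (@der_bound (fun z => G n z - G k z) (fun=> 0)) => // y hy.
  by apply: hh; move: hy hx; lra.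
 by rewrite normr0.
 by rewrite mul0r normr_le0 => /eqP; lra.
have : `|G n 0 - G k 0 - (G n x - G k x)| <= 0 * (0 - x).
 apply: (@der_bound (fun z => G n z - G k z) (fun=> 0)) => // y hy.
 by apply: hh; move: hy hx; lra.
 by rewrite normr0.
by rewrite mul0r normr_le0 => /eqP; lra.
exists (fun x => G (n_ x) x - G (n_ x) 0) => x.
(* The index is raised by one so that a whole neighbourhood of x uses the same primitive. *)
set N := ((n_ x).+1)%N.
have hN : - N%:R - 1 < x < N%:R + 1.
by move: (nP x); rewrite /N -natr1; lra.
apply: eps_der => e e0.
have [d d0 hd] := der_eps (hG N x hN) e0.
exists (Num.min d 1); first by rewrite lt_min d0 ltr01.
move=> h; rewrite lt_min => /andP[h1 h2].
have leN y : (n_ y <= N)%N -> G (n_ y) y - G (n_ y) 0 = G N y - G N 0.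
by move=> hy; apply: Gle => //; exact: nP.
rewrite !leN.
- by have := hd h h1; congr (`|_| <= _); ring.
- by rewrite /N.
- rewrite /N /n_ -ltnS -(ltr_nat R) (@le_lt_trans _ _ `|x + h|) ?truncn_le //.
have := truncnS_gt `|x|; rewrite -!natr1.
by have := ler_normD x h; lra.
Qed.

Lemma min_der0 f x l e : 0 < e -> (forall h, `|h| < e -> f x <= f (x + h)) ->
der f x l -> l = 0.
Proof.
move=> e0 hm hd; apply/eqP/negPn/negP => l0.
have l0' : 0 < `|l| by rewrite normr_gt0.
have [d d0 H] := der_eps hd (divr_gt0 l0' (ltr0Sn R 1)).
pose h0 := Num.min (e / 2) (d / 2).
have h00 : 0 < h0 by rewrite /h0 lt_min !divr_gt0.
have [h1 h2] : h0 < e /\ h0 < d.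
by split; rewrite /h0 gt_min; apply/orP; [left|right]; lra.
pose h := - Num.sg l * h0.
have nh : `|h| = h0.
by rewrite /h normrM normrN normr_sg l0 mul1r gtr0_norm.
have := H h; rewrite nh => /(_ h2).
have := hm h; rewrite nh => /(_ h1) h3.
have -> : l * h = - (`|l| * h0) by rewrite /h mulrA mulrN [l * _]mulrC -normrEsg mulNr.
rewrite ler_norml => /andP[_].
have : 0 < `|l| * h0 by rewrite mulr_gt0.
rewrite mulrAC; lra.
Qed.

Lemma min_der2 f df x l e : 0 < e -> (forall y, `|y - x| < e -> der f y (df y)) ->
der df x l -> (forall h, `|h| < e -> f x <= f (x + h)) -> 0 <= l.
Proof.
move=> e0 hd hdd hm; rewrite leNgt; apply/negP => l0.
have dfx : df x = 0 by apply: (min_der0 e0 hm); apply: hd; rewrite subrr normr0.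
have l0' : 0 < - l / 2 by lra.
have [d d0 H] := der_eps hdd l0'.
pose h0 := Num.min (e / 2) (d / 2).
have h00 : 0 < h0 by rewrite /h0 lt_min !divr_gt0.
have [h1 h2] : h0 < e /\ h0 < d.
by split; rewrite /h0 gt_min; apply/orP; [left|right]; lra.
have : - f x < - f (x + h0).
apply: (@der_gt0_lt (fun z => - f z) (fun z => - df z)); first lra.
 by move=> y hy; apply: derN; apply: hd; rewrite ger0_norm; lra.
move=> y hy; have hyx : `|y - x| = y - x by rewrite ger0_norm; lra.
have := H (y - x); rewrite hyx => /(_ _) hh.
have {}hh := hh ltac:(lra); move: hh.
have -> : x + (y - x) = y by ring.
rewrite dfx subr0 ler_norml => /andP[_ hh].
have : 0 < (- l / 2) * (y - x) by rewrite mulr_gt0 //; lra.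
move: hh; rewrite mulrBr; lra.
have := hm h0; rewrite gtr0_norm // => /(_ h1); lra.
Qed.

(** One-sided, because at a first contact only the earlier times are known to have the right
    sign. *)
Lemma left_der_le0 f x l e : 0 < e -> (forall h, 0 < h < e -> f x <= f (x - h)) ->
der f x l -> l <= 0.
Proof.
move=> e0 hm hd; rewrite leNgt; apply/negP => l0.
have [d d0 H] := der_eps hd (divr_gt0 l0 (ltr0Sn R 1)).
pose h0 := Num.min (e / 2) (d / 2).
have h00 : 0 < h0 by rewrite /h0 lt_min !divr_gt0.
have [h1 h2] : h0 < e /\ h0 < d.
by split; rewrite /h0 gt_min; apply/orP; [left|right]; lra.
have := H (- h0); rewrite normrN gtr0_norm // => /(_ h2).
have := hm h0; rewrite h00 h1 => /(_ isT) h3.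
rewrite ler_norml => /andP[_].
have : 0 < l * h0 by rewrite mulr_gt0.
rewrite mulrN mulrAC; lra.
Qed.

(** A cluster point of triples: indices beyond any bound come close to it, which replaces the
    extraction of subsequences. *)
Lemma bolzano_weierstrass3 (u v w : nat -> R) a b :
(forall n, [/\ a <= u n <= b, a <= v n <= b & a <= w n <= b]) ->
exists x y z, [/\ a <= x <= b, a <= y <= b, a <= z <= b &
 forall e N, 0 < e -> exists n, [/\ (N <= n)%N, `|u n - x| < e,
 `|v n - y| < e & `|w n - z| < e]].
Proof.
move=> H.
pose K := `[a, b]%classic : set R.
have cK : compact (K `*` (K `*` K)).
by apply: compact_setX; [|apply: compact_setX]; exact: segment_compact.
pose p n := (u n, (v n, w n)).
have := cK (p @ \oo) _ _; case.
exists 0%N => // n _ /=; have [h1 h2 h3] := H n.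
by rewrite /K /= !in_itv /=.
move=> [x [y z]] [[]]; rewrite /K /= !in_itv /= => hx [hy hz] hc.
exists x, y, z; split => // e N e0.
have := hc [set p n | n in [set n | (N <= n)%N]] (ball x e `*` (ball y e `*` ball z e)) _ _.
case.
- by exists N => // n /= hn; exists n.
- exists (ball x e, ball y e `*` ball z e) => //=; split; first exact: nbhsx_ballx.
by exists (ball y e, ball z e) => //=; split; exact: nbhsx_ballx.
- move=> [x' [y' z']] [[n /= hn [<- <- <-]]] [/= h1 [h2 h3]].
exists n; split => //; rewrite distrC; assumption.
Qed.

Lemma inv_nat_small d : 0 < d -> exists N : nat, forall n, (N <= n)%N -> n.+1%:R^-1 < d.
Proof.
move=> d0; exists (Num.truncn d^-1) => n hn; rewrite invf_plt ?posrE ?ltr0Sn //.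
by apply: (lt_le_trans (truncnS_gt _)); rewrite ler_nat.
Qed.

(** Compactness of [a, b] makes continuity at a fixed time uniform along the slice. The set [A] of
    admissible times allows the slice to sit at the initial time. *)
Lemma slice_uniform (A : set R) (f : R -> R -> R) a b t e : A t ->
(forall u, a <= u <= b -> forall e, 0 < e -> exists2 d : R, 0 < d &
 forall u' t', A t' -> `|u' - u| < d -> `|t' - t| < d -> `|f u' t' - f u t| < e) ->
0 < e -> exists2 d : R, 0 < d & forall u t', A t' -> a <= u <= b -> `|t' - t| < d ->
 `|f u t' - f u t| < e.
Proof.
move=> At H e0; apply: contrapT => /forall2NP hN.
have hN' n : exists p : R * R, [/\ a <= p.1 <= b, `|p.2 - t| < n.+1%:R^-1, A p.2 &
 e <= `|f p.1 p.2 - f p.1 t|].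
have [h|/existsNP[u /existsNP[t' /not_implyP[h0 /not_implyP[h1 /not_implyP[h2 /negP]]]]]] := hN n.+1%:R^-1.
 by case: h; rewrite invr_gt0 ltr0Sn.
by rewrite -leNgt => h3; exists (u, t').
have [p hp] := choice hN'.
have hb n : a <= (p n).1 <= b by have [] := hp n.
have [x [y1 [y2 [hx _ _ hc]]]] := @bolzano_weierstrass3 (fun n => (p n).1) (fun n => (p n).1)
(fun n => (p n).1) a b (fun n => And3 (hb n) (hb n) (hb n)).
have [d d0 hd] := H x hx (e / 2) (divr_gt0 e0 (ltr0Sn R 1)).
have [N hN1] := inv_nat_small d0.
have [n [hn h1 _ _]] := hc d N d0.
have [_ h2 h4 h3] := hp n.
have g1 := hd _ _ h4 h1 (lt_trans h2 (hN1 n hn)).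
have g2 := hd (p n).1 t At h1; rewrite subrr normr0 in g2.
have {}g2 := g2 d0.
have := ler_normB (f (p n).1 (p n).2 - f x t) (f (p n).1 t - f x t).
have -> : f (p n).1 (p n).2 - f x t - (f (p n).1 t - f x t) =
f (p n).1 (p n).2 - f (p n).1 t by ring.
lra.
Qed.

(** Integrals are differences of primitives: [S] is a primitive of f at each time, [Q] one of its
    time derivative at time t. The first-order remainder [phi] is small because its u-derivative is,
    by the mean value inequality applied first in time and then in u. *)
Lemma leibniz (f ft S : R -> R -> R) (Q : R -> R) a b t e : a <= b -> 0 < e ->
(forall u s, a <= u <= b -> `|s - t| < e -> der (S ^~ s) u (f u s)) ->
(forall u s, a <= u <= b -> `|s - t| < e -> der (f u) s (ft u s)) ->
(forall u, a <= u <= b -> der Q u (ft u t)) ->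
(forall u, a <= u <= b -> forall e, 0 < e -> exists2 d : R, 0 < d &
 forall u' t', `|u' - u| < d -> `|t' - t| < d -> `|ft u' t' - ft u t| < e) ->
der (fun s => S b s - S a s) t (Q b - Q a).
Proof.
move=> ab e0 hS hf hQ hc; apply: eps_der => k k0.
have ba0 : 0 < b - a + 1 by lra.
have [d d0 hd0] := @slice_uniform setT ft a b t _ I
(fun u hu e h => let: ex_intro2 d h1 h2 := hc u hu e h in
 ex_intro2 _ _ d h1 (fun u' t' _ => h2 u' t')) (divr_gt0 k0 ba0).
have hd u t' := hd0 u t' I.
exists (Num.min d e); first by rewrite lt_min d0.
move=> h; rewrite lt_min => /andP[h1 h2].
have et : `|t - t| < e by rewrite subrr normr0.
have eth : `|t + h - t| < e by rewrite addrC addKr.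
pose phi u := S u (t + h) - S u t - Q u * h.
pose dphi u := f u (t + h) - f u t - ft u t * h.
have hphi u : a <= u <= b -> der phi u (dphi u).
move=> hu; apply: derB; first by apply: derB; exact: hS.
by apply: der_eq (derM (hQ u hu) (der_cst h u)) _; rewrite mulr0 addr0.
have hb u : a <= u <= b -> `|dphi u| <= k / (b - a + 1) * `|h|.
move=> hu; pose r s := f u s - ft u t * s.
have hr s : `|s - t| < e -> der r s (ft u s - ft u t).
 move=> hs; apply: derB; first exact: hf.
 by apply: der_eq (derM (der_cst _ s) (der_id s)) _; rewrite mul0r mulr1 add0r.
have -> : dphi u = r (t + h) - r t by rewrite /dphi /r; ring.
have [h0|/ltW h0] := leP 0 h.
 rewrite (ger0_norm h0); have := @der_bound r (fun s => ft u s - ft u t) t (t + h)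
 (k / (b - a + 1)); rewrite [t + h - t]addrC addKr; apply; first lra.
 by move=> s hs; apply: hr; move: hs; rewrite ger0_norm in h2 => // hs; rewrite ger0_norm; lra.
 move=> s hs; apply: ltW; apply: hd => //.
 by move: hs; rewrite ger0_norm in h1 => // hs; rewrite ger0_norm; lra.
rewrite (ler0_norm h0) distrC; have := @der_bound r (fun s => ft u s - ft u t) (t + h) t
 (k / (b - a + 1)); have -> : t - (t + h) = - h by ring.
 apply; first lra.
 by move=> s hs; apply: hr; move: hs; rewrite ler0_norm in h2 => // hs; rewrite ler0_norm; lra.
move=> s hs; apply: ltW; apply: hd => //.
by move: hs; rewrite ler0_norm in h1 => // hs; rewrite ler0_norm; lra.
have := @der_bound phi dphi a b _ ab hphi hb.
have -> : phi b - phi a = S b (t + h) - S a (t + h) - (S b t - S a t) - (Q b - Q a) * h.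
by rewrite /phi; ring.
move=> /le_trans; apply; rewrite mulrAC ler_wpM2r //.
rewrite mulrAC ler_pdivrMr // ler_pM2l //; lra.
Qed.

(** The primitive vanishing at 0, picked by choice; differences of its values stand for integrals of
    continuous functions from here on. *)
Definition prim f : R -> R :=
let F := get [set F : R -> R | forall x, der F x (f x)] in fun x => F x - F 0.

Lemma prim_der f : continuous f -> forall x, der (prim f) x (f x).
Proof.
move=> /primitive_exists[F hF] x.
have := @getI _ [set F : R -> R | forall x, der F x (f x)] F hF; rewrite /= => h.
by rewrite -[f x]subr0; apply: derB; [exact: h|exact: der_cst].
Qed.

Lemma prim0 f : prim f 0 = 0.
Proof. by rewrite /prim subrr. Qed.

(** The set of times up to which F is nonnegative is closed by continuity. Were its supremum t0
    below t1, negative values at times decreasing to t0 would accumulate, modulo the period, at a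
    zero of F. The hypothesis near the diagonal keeps this zero away from q = p and from its copy q
    = p + P; the last hypothesis excludes it in between. *)
Lemma first_contact (F : R -> R -> R -> R) (P t1 : R) : 0 < P -> 0 <= t1 ->
(forall p q t, F (p + P) (q + P) t = F p q t) ->
(forall p q t, 0 <= t <= t1 -> forall e, 0 < e -> exists2 d : R, 0 < d &
 forall p' q' t', 0 <= t' <= t1 -> `|p' - p| < d -> `|q' - q| < d -> `|t' - t| < d ->
 `|F p' q' t' - F p q t| < e) ->
(forall p q, p <= q <= p + P -> 0 <= F p q 0) ->
(forall t, 0 <= t < t1 ->
 (forall s p q, 0 <= s <= t -> p <= q <= p + P -> 0 <= F p q s) ->
 exists2 d : R, 0 < d & forall s p q, t <= s <= t + d -> s <= t1 ->
 p <= q <= p + P -> q - p < d \/ p + P - q < d -> 0 <= F p q s) ->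
(forall t p q, 0 <= t < t1 ->
 (forall s p q, 0 <= s <= t -> p <= q <= p + P -> 0 <= F p q s) ->
 p < q < p + P -> F p q t = 0 -> False) ->
forall t p q, 0 <= t <= t1 -> p <= q <= p + P -> 0 <= F p q t.
Proof.
move=> P0 t10 hper hcont h0 hdiag hcontact.
pose good t := forall s p q, 0 <= s <= t -> p <= q <= p + P -> 0 <= F p q s.
pose E := [set t | 0 <= t <= t1 /\ good t].
have E0 : E 0.
split; first by rewrite lexx.
move=> s p q hs hpq; have -> : s = 0 by apply/eqP; rewrite eq_le andbC.
exact: h0.
have Eub : ubound E t1 by move=> t [/andP[]].
have hsup : has_sup E by split; [exists 0|exists t1].
have [t0 t0E] : exists t0, t0 = sup E by exists (sup E).
have t0ub s : E s -> s <= t0 by move=> Es; rewrite t0E; apply: ub_le_sup => //; exists t1.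
have t00 : 0 <= t0 by exact: t0ub.
have t01 : t0 <= t1 by rewrite t0E; apply: ge_sup => //; exists 0.
have t0t : 0 <= t0 <= t1 by rewrite t00.
have glt s p q : 0 <= s < t0 -> p <= q <= p + P -> 0 <= F p q s.
move=> /andP[s0 st0] hpq.
have ts : 0 < t0 - s by rewrite subr_gt0.
have [r [hr gr]] := sup_adherent ts hsup; rewrite -t0E => sr.
by apply: gr => //; rewrite s0 /=; lra.
have gt0 : good t0.
move=> s p q /andP[s0]; rewrite le_eqVlt => /predU1P[->|st0] hpq; last first.
 by apply: glt => //; rewrite s0.
rewrite leNgt; apply/negP => hF.
have t0p : 0 < t0.
 rewrite lt_neqAle t00 andbT; apply/eqP => t0z.
 by move: hF; rewrite -t0z ltNge h0.
have hF' : 0 < - F p q t0 by rewrite oppr_gt0.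
have [d d0 hd] := hcont p q t0 t0t _ hF'.
pose s' := Num.max 0 (t0 - d / 2).
have s'0 : 0 <= s' by rewrite le_max lexx.
have s't0 : s' < t0 by rewrite gt_max t0p /=; lra.
have s'd : t0 - d < s' by rewrite lt_max; apply/orP; right; lra.
have h1 : 0 <= F p q s' by apply: glt => //; rewrite s'0.
have := hd p q s'; rewrite !subrr normr0 => /(_ _ d0 d0) h2.
have : `|F p q s' - F p q t0| < - F p q t0.
 apply: h2; first by rewrite s'0 /=; lra.
 by rewrite ltr0_norm; lra.
by rewrite ger0_norm; lra.
have [t0t1|t1t0] := ltP t0 t1; last first.
by move=> t p q /andP[t_ge0 tt1] hpq; apply: gt0 => //; rewrite t_ge0 /=; lra.
exfalso.
have ht0 : 0 <= t0 < t1 by rewrite t00.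
have [d d0 hd] := hdiag t0 ht0 gt0.
have bad n : exists z : R * R * R, [/\ 0 <= z.1.1 <= P, z.1.1 <= z.1.2 <= z.1.1 + P,
 t0 <= z.2 <= t1, z.2 - t0 < n.+1%:R^-1 & F z.1.1 z.1.2 z.2 < 0].
have : 0 < n.+1%:R^-1 :> R by rewrite invr_gt0 ltr0Sn.
move: (n.+1%:R^-1) => i i0.
pose r := Num.min (i / 2) (t1 - t0).
have r0 : 0 < r by rewrite lt_min divr_gt0 //= subr_gt0.
have rn : r < i.
 by rewrite gt_min; apply/orP; left; lra.
have rt : r <= t1 - t0 by rewrite ge_min lexx orbT.
have : ~ good (t0 + r).
 move=> hg; have : t0 + r <= t0.
 by apply: t0ub; split => //; apply/andP; split; lra.
 lra.
move=> /existsNP[s /existsNP[p /existsNP[q /not_implyP[/andP[s0 sr] /not_implyP[hpq /negP]]]]].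
rewrite -ltNge => Fneg.
have st0 : t0 <= s.
 by rewrite leNgt; apply/negP => st0; move: Fneg; rewrite ltNge gt0 // s0 ltW.
(* Periodicity moves the bad pair into the compact range 0 <= p <= P. *)
pose k := Num.floor (p / P).
have Fk : forall j : int, F (p - j%:~R * P) (q - j%:~R * P) s = F p q s.
 have Fn (j : nat) p' q' : F (p' + j%:R * P) (q' + j%:R * P) s = F p' q' s.
 elim: j => [|j IH]; first by rewrite mul0r !addr0.
 by rewrite -natr1 mulrDl mul1r !addrA hper.
 case=> j; last by rewrite NegzE !mulrNz !mulNr !opprK Fn.
 rewrite -[p in RHS](@subrK _ (j%:R * P)) -[q in RHS](@subrK _ (j%:R * P)).
 by rewrite Fn.
exists (p - k%:~R * P, q - k%:~R * P, s); split => /=.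
- have := floor_le (p / P); rewrite -/k ler_pdivlMr // => h1.
 have := floorD1_gt (p / P); rewrite -/k ltr_pdivrMr // => h2.
 move: h2; rewrite intrD mulrDl mul1r => h2.
 by apply/andP; split; lra.
- by move: hpq; lra.
- by rewrite st0 /=; lra.
- lra.
- by rewrite Fk.
have [z hz] := choice bad.
pose M := 2 * P + t1.
have hM n : [/\ 0 <= (z n).1.1 <= M, 0 <= (z n).1.2 <= M & 0 <= (z n).2 <= M].
have [h1 h2 h3 _ _] := hz n.
by split; rewrite /M; move: h1 h2 h3; lra.
have [p [q [s [_ _ _ hc]]]] := bolzano_weierstrass3 hM.
have sE : s = t0.
apply/eqP; rewrite eq_le; apply/andP; split; rewrite leNgt; apply/negP => hs.
 have [N hN] := inv_nat_small (ltac:(lra) : 0 < (s - t0) / 2).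
 have [n [nN _ _ h3]] := hc ((s - t0) / 2) N ltac:(lra).
 have [_ _ h4 h5 _] := hz n; have := lt_trans h5 (hN n nN).
 move: h3; rewrite ltr_norml; lra.
have [n [nN _ _ h3]] := hc ((t0 - s) / 2) 0%N ltac:(lra).
have [_ _ h4 h5 _] := hz n.
move: h3; rewrite ltr_norml; lra.
rewrite {}sE in hc.
have [N hN] := inv_nat_small d0.
have hnd n : (N <= n)%N -> d <= (z n).1.2 - (z n).1.1 /\ d <= (z n).1.1 + P - (z n).1.2.
move=> hn; have [h1 h2 h3 h4 h5] := hz n; have h6 := lt_trans h4 (hN n hn).
have ha : t0 <= (z n).2 <= t0 + d by clear - h3 h6; move: h3; lra.
have hb : (z n).2 <= t1 by case/andP: h3.
split; rewrite leNgt; apply/negP => h7; move: h5; rewrite ltNge.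
 by rewrite (hd _ _ _ ha hb h2 (or_introl h7)).
by rewrite (hd _ _ _ ha hb h2 (or_intror h7)).
have pq : p < q < p + P.
have [n [nN g1 g2 _]] := hc (d / 4) N ltac:(lra).
have [h1 h2] := hnd n nN.
by move: g1 g2; rewrite !ltr_norml; lra.
apply: (hcontact t0 p q ht0 gt0 pq).
apply/eqP; rewrite eq_le; apply/andP; split; last first.
by apply: gt0; [rewrite t00 /=|move: pq; lra].
rewrite leNgt; apply/negP => Fp.
have [e e0 he] := hcont p q t0 t0t _ Fp.
have [n [nN g1 g2 g3]] := hc e N e0.
have [h1 h2 h3 h4 h5] := hz n.
have := he _ _ _ _ g1 g2 g3; rewrite ltr_norml.
by move=> /(_ ltac:(move: h3; lra)); lra.
Qed.

End Calculus.

Ltac der_step :=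
first [ eassumption | exact: der_cst | exact: der_id
  | eapply derB | eapply derD | eapply derN | eapply derM | eapply derX
  | eapply der_sin | eapply der_cos | eapply der_exp ].
Ltac der_tac := apply: der_eq; [solve [repeat der_step; eauto] | cbv beta].

(** * Second variation of a two-point function and the algebra at a contact *)

Section TwoPoint.
Context {R : realType}.
Implicit Types (x y S g : R -> R) (a b c d e p q u : R).

Lemma der_line f f1 a b c : (forall u, der f u (f1 u)) ->
der (fun h => f (a + b * h)) c (f1 (a + b * c) * b).
Proof.
move=> hf; apply: (@der_comp _ f (fun h => a + b * h)); first exact: hf.
by der_tac; ring.
Qed.

(** Along each line (p + xi h, q + eta h) the function has a local minimum at h = 0. The directions
    (0, 1) and (1, 0) give the first-order identities, a general direction gives the second-order
    inequality. *)
Lemma second_variation x x1 x2 y y1 y2 S g g1 (psi psi1 psi2 : R -> R) p q e :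
(forall u, der x u (x1 u)) -> (forall u, der x1 u (x2 u)) ->
(forall u, der y u (y1 u)) -> (forall u, der y1 u (y2 u)) ->
(forall u, der S u (g u)) -> (forall u, der g u (g1 u)) ->
(forall u, 0 < g u) ->
(forall s, 0 < s -> der psi s (psi1 s)) -> (forall s, 0 < s -> der psi1 s (psi2 s)) ->
p < q -> 0 < e ->
let F p q := (x q - x p) ^+ 2 + (y q - y p) ^+ 2 - psi (S q - S p) ^+ 2 in
F p q = 0 -> (forall p' q', `|p' - p| < e -> `|q' - q| < e -> 0 <= F p' q') ->
let A := x q - x p in let B := y q - y p in let l := S q - S p in
[/\ A * x1 q + B * y1 q = psi l * psi1 l * g q,
 A * x1 p + B * y1 p = psi l * psi1 l * g p &
 forall xi eta, 0 <= (eta * x1 q - xi * x1 p) ^+ 2 + (eta * y1 q - xi * y1 p) ^+ 2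
  + A * (eta ^+ 2 * x2 q - xi ^+ 2 * x2 p) + B * (eta ^+ 2 * y2 q - xi ^+ 2 * y2 p)
  - (psi1 l ^+ 2 + psi l * psi2 l) * (eta * g q - xi * g p) ^+ 2
  - psi l * psi1 l * (eta ^+ 2 * g1 q - xi ^+ 2 * g1 p)].
Proof.
move=> hx hx1 hy hy1 hS hg g0 hpsi hpsi1 pq e0 F F0 Fge A B l.
have Smono u v : u < v -> 0 < S v - S u.
move=> uv; rewrite subr_gt0; apply: (@der_gt0_lt _ S g) => // *; exact: hS.
pose f xi eta h := F (p + xi * h) (q + eta * h).
pose A_ xi eta h := x (q + eta * h) - x (p + xi * h).
pose B_ xi eta h := y (q + eta * h) - y (p + xi * h).
pose l_ xi eta h := S (q + eta * h) - S (p + xi * h).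
pose A1_ xi eta h := eta * x1 (q + eta * h) - xi * x1 (p + xi * h).
pose B1_ xi eta h := eta * y1 (q + eta * h) - xi * y1 (p + xi * h).
pose l1_ xi eta h := eta * g (q + eta * h) - xi * g (p + xi * h).
pose f1 xi eta h := 2 * (A_ xi eta h * A1_ xi eta h + B_ xi eta h * B1_ xi eta h
- psi (l_ xi eta h) * psi1 (l_ xi eta h) * l1_ xi eta h).
have dA xi eta h : der (A_ xi eta) h (A1_ xi eta h).
apply: der_eq (derB (der_line q eta h hx) (der_line p xi h hx)) _.
by rewrite /A1_; ring.
have dB xi eta h : der (B_ xi eta) h (B1_ xi eta h).
apply: der_eq (derB (der_line q eta h hy) (der_line p xi h hy)) _.
by rewrite /B1_; ring.
have dl xi eta h : der (l_ xi eta) h (l1_ xi eta h).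
apply: der_eq (derB (der_line q eta h hS) (der_line p xi h hS)) _.
by rewrite /l1_; ring.
have df xi eta h : 0 < l_ xi eta h -> der (f xi eta) h (f1 xi eta h).
move=> l0; have dp := der_comp (hpsi _ l0) (dl xi eta h).
apply: der_eq (derB (derD (derX 2 (dA xi eta h)) (derX 2 (dB xi eta h))) (derX 2 dp)) _.
by rewrite /f1 /= !expr1; ring.
have dA1 xi eta : der (A1_ xi eta) 0 (eta ^+ 2 * x2 q - xi ^+ 2 * x2 p).
apply: der_eq (derB (derM (der_cst eta 0) (der_line q eta 0 hx1))
     (derM (der_cst xi 0) (der_line p xi 0 hx1))) _.
by rewrite !mulr0 !addr0; ring.
have dB1 xi eta : der (B1_ xi eta) 0 (eta ^+ 2 * y2 q - xi ^+ 2 * y2 p).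
apply: der_eq (derB (derM (der_cst eta 0) (der_line q eta 0 hy1))
     (derM (der_cst xi 0) (der_line p xi 0 hy1))) _.
by rewrite !mulr0 !addr0; ring.
have dl1 xi eta : der (l1_ xi eta) 0 (eta ^+ 2 * g1 q - xi ^+ 2 * g1 p).
apply: der_eq (derB (derM (der_cst eta 0) (der_line q eta 0 hg))
     (derM (der_cst xi 0) (der_line p xi 0 hg))) _.
by rewrite !mulr0 !addr0; ring.
have l0 : 0 < l by exact: Smono.
have l_0 xi eta : l_ xi eta 0 = l by rewrite /l_ !mulr0 !addr0.
have small xi eta : exists2 r : R, 0 < r & forall h, `|h| < r ->
 [/\ `|xi * h| < e, `|eta * h| < e & 0 < l_ xi eta h].
pose K := `|xi| + `|eta| + 1.
have K0 : 0 < K by rewrite ltr_wpDl // addr_ge0.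
exists (Num.min e ((q - p) / 2) / K).
 by rewrite divr_gt0 // lt_min e0 divr_gt0 // subr_gt0.
move=> h; rewrite ltr_pdivlMr // lt_min => /andP[h1 h2].
have nx : `|xi * h| <= `|h| * K.
 by rewrite normrM mulrC ler_wpM2l // /K -addrA lerDl addr_ge0.
have ne : `|eta * h| <= `|h| * K.
 by rewrite normrM mulrC ler_wpM2l // /K addrAC lerDr addr_ge0.
split; [exact: le_lt_trans h1|exact: le_lt_trans h1|].
apply: Smono; have := le_lt_trans nx h2; have := le_lt_trans ne h2.
rewrite !ltr_norml => /andP[g2 _] /andP[_ g3]; clear - g2 g3; lra.
have fmin xi eta : exists2 r : R, 0 < r & forall h, `|h| < r ->
 0 < l_ xi eta h /\ f xi eta 0 <= f xi eta (0 + h).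
have [r r0 hr] := small xi eta; exists r => // h hh; have [h1 h2 h3] := hr h hh.
split=> //; rewrite add0r {1}/f !mulr0 !addr0 F0; apply: Fge; by rewrite addrC addKr.
have f10 xi eta : f1 xi eta 0 = 0.
have [r r0 hr] := fmin xi eta.
apply: (min_der0 r0 (f := f xi eta) (x := 0)); first by move=> h /hr[].
by apply: df; rewrite l_0.
have E1 := f10 0 1; have E2 := f10 1 0.
split.
- move: E1; rewrite /f1 l_0 /A_ /B_ /A1_ /B1_ /l1_ !mulr0 !addr0 !mul1r !mul0r !subr0.
by rewrite -/A -/B; clear; lra.
- move: E2; rewrite /f1 l_0 /A_ /B_ /A1_ /B1_ /l1_ !mulr0 !addr0 !mul1r !mul0r !sub0r.
by rewrite -/A -/B; clear; lra.
move=> xi eta.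
have [r r0 hr] := fmin xi eta.
have l00 : 0 < l_ xi eta 0 by rewrite l_0.
have dp := der_comp (hpsi _ l00) (dl xi eta 0).
have dp1 := der_comp (hpsi1 _ l00) (dl xi eta 0).
have ddf : der (f1 xi eta) 0 (2 * (A1_ xi eta 0 ^+ 2 + B1_ xi eta 0 ^+ 2
+ A * (eta ^+ 2 * x2 q - xi ^+ 2 * x2 p) + B * (eta ^+ 2 * y2 q - xi ^+ 2 * y2 p)
- (psi1 l ^+ 2 + psi l * psi2 l) * (l1_ xi eta 0) ^+ 2
- psi l * psi1 l * (eta ^+ 2 * g1 q - xi ^+ 2 * g1 p))).
apply: der_eq (derM (der_cst 2 0) (derB (derD (derM (dA xi eta 0) (dA1 xi eta))
 (derM (dB xi eta 0) (dB1 xi eta))) (derM (derM dp dp1) (dl1 xi eta)))) _.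
have -> : A_ xi eta 0 = A by rewrite /A_ !mulr0 !addr0.
have -> : B_ xi eta 0 = B by rewrite /B_ !mulr0 !addr0.
by rewrite /= !l_0; ring.
have := min_der2 r0 (f := f xi eta) (df := f1 xi eta) (x := 0) _ ddf _.
have -> : A1_ xi eta 0 = eta * x1 q - xi * x1 p by rewrite /A1_ !mulr0 !addr0.
have -> : B1_ xi eta 0 = eta * y1 q - xi * y1 p by rewrite /B1_ !mulr0 !addr0.
have -> : l1_ xi eta 0 = eta * g q - xi * g p by rewrite /l1_ !mulr0 !addr0.
rewrite pmulr_rge0 //; apply.
by move=> h; rewrite subr0 => /hr[h1 _]; exact: df.
by move=> h /hr[].
Qed.

(** Both tangents have the same cosine c with the chord, so their sines agree up to sign. If they
    agree, the variation (bp, bq) with bp = bq moves both ends in parallel; if they are opposite,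
    (-bp, bq) is used. With b the square root of the mobility, b^2 k is the normal speed, so the
    curvature terms cancel against those of the time derivative and only (bp - bq)^2 is left as
    anisotropic error. *)
Lemma contact_alg c d sp sq kp kq bp bq p2 X pt :
c ^+ 2 + sp ^+ 2 = 1 -> c ^+ 2 + sq ^+ 2 = 1 -> 0 < d ->
(forall xi eta, 0 <= xi ^+ 2 + eta ^+ 2 - 2 * xi * eta * (c ^+ 2 + sp * sq)
 - d * (eta ^+ 2 * kq * sq - xi ^+ 2 * kp * sp) - (c ^+ 2 + d * p2) * (eta - xi) ^+ 2) ->
d * (bp ^+ 2 * kp * sp - bq ^+ 2 * kq * sq) + d * c * X - d * pt <= 0 ->
(sq = sp /\ (bp = bq -> c * X <= pt)) \/
(c ^+ 2 + sp * sq = 2 * c ^+ 2 - 1 /\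
d * c * X - d * pt <= (bp - bq) ^+ 2 * (1 - c ^+ 2) - d * p2 * (bp + bq) ^+ 2).
Proof.
move=> hp hq d0 H2 Ht.
have : (sq - sp) * (sq + sp) = 0 by rewrite -subr_sqr; lra.
move=> /eqP; rewrite mulf_eq0 => /orP[/eqP e1|/eqP e1].
have sqE : sq = sp by lra.
left; split=> // bE; have := H2 bp bq; rewrite sqE bE.
rewrite subrr expr0n mulr0 subr0 -expr2 hp => h.
rewrite -subr_le0 -(pmulr_rle0 _ d0); move: Ht; rewrite sqE bE; nra.
right; have sqE : sq = - sp by lra.
split; first by rewrite sqE mulrN; lra.
have := H2 (- bp) bq; rewrite sqE in Ht *; move: Ht.
have -> : sp * - sp = c ^+ 2 - 1 by rewrite mulrN -expr2; lra.
move=> Ht h; nra.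
Qed.

End TwoPoint.

(** * Continuity in space and time, relative to a set of times *)

Section JointContinuity.
Context {R : realType}.
Implicit Types (f g : R -> R -> R) (A : set R) (T u t e d : R).

(** Restricted in time only: the flow is continuous up to the initial time but not followed before
    it. *)
Definition cont_on A f := forall u t, A t -> forall e, 0 < e -> exists2 d : R, 0 < d &
forall u' t', A t' -> `|u' - u| < d -> `|t' - t| < d -> `|f u' t' - f u t| < e.

Lemma cont_onP A f : cont_on A f <->
{within [set z : R * R | A z.2], continuous (fun z : R * R => f z.1 z.2)}.
Proof.
split=> [hf|/subspace_continuousP hf].
apply/subspace_continuousP => -[u t] /= At; apply/cvgrPdist_lt => e e0.
have [d d0 hd] := hf u t At e e0.
exists (ball u d, ball t d) => /=; first by split; exact: nbhsx_ballx.
move=> [u' t'] [/= h1 h2] At'; rewrite distrC; apply: hd => //; rewrite distrC; assumption.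
move=> u t At e e0.
have /cvgrPdist_lt /(_ e e0) := hf (u, t) At.
move=> [[U V] /= [[d1 /= d10 h1] [d2 /= d20 h2]] hUV].
exists (Num.min d1 d2); first by rewrite lt_min d10.
move=> u' t' At'; rewrite !lt_min => /andP[u1 u2] /andP[t1 t2].
rewrite distrC; apply: (hUV (u', t')) => //; split => /=.
by apply: h1; rewrite /ball_ /= distrC.
by apply: h2; rewrite /ball_ /= distrC.
Qed.

Lemma cont_on_cst A a : cont_on A (fun _ _ => a).
Proof. by move=> u t At e e0; exists 1 => // *; rewrite subrr normr0. Qed.

Lemma cont_onD A f g : cont_on A f -> cont_on A g -> cont_on A (fun u t => f u t + g u t).
Proof. by move=> /cont_onP hf /cont_onP hg; apply/cont_onP => z; exact: (cvgD (hf z) (hg z)). Qed.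
Lemma cont_onN A f : cont_on A f -> cont_on A (fun u t => - f u t).
Proof. by move=> /cont_onP hf; apply/cont_onP => z; exact: (cvgN (hf z)). Qed.
Lemma cont_onB A f g : cont_on A f -> cont_on A g -> cont_on A (fun u t => f u t - g u t).
Proof. by move=> hf hg; apply: cont_onD => //; exact: cont_onN. Qed.
Lemma cont_onM A f g : cont_on A f -> cont_on A g -> cont_on A (fun u t => f u t * g u t).
Proof. by move=> /cont_onP hf /cont_onP hg; apply/cont_onP => z; exact: (cvgM (hf z) (hg z)). Qed.
Lemma cont_onX A f n : cont_on A f -> cont_on A (fun u t => f u t ^+ n).
Proof.
move=> hf; elim: n => [|n IH]; first exact: cont_on_cst.
by under eq_fun do under eq_fun do rewrite exprS; exact: cont_onM.
Qed.

Lemma cont_on_comp A f (h : R -> R) : (forall u t, A t -> {for f u t, continuous h}) ->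
cont_on A f -> cont_on A (fun u t => h (f u t)).
Proof.
move=> hh hf u t At e e0.
have /cvgrPdist_lt /(_ e e0) [r /= r0 hr] := hh u t At.
have [d d0 hd] := hf u t At r r0.
exists d => // u' t' At' h1 h2; rewrite distrC; apply: hr.
by rewrite /= distrC; exact: hd.
Qed.

Lemma cont_onV A f : (forall u t, A t -> f u t != 0) -> cont_on A f ->
cont_on A (fun u t => (f u t)^-1).
Proof.
by move=> f0; apply: (@cont_on_comp A f (fun z => z^-1)) => u t /f0 h; exact: inv_continuous.
Qed.

Lemma cont_on_sqrt A f : cont_on A f -> cont_on A (fun u t => Num.sqrt (f u t)).
Proof. by apply: (@cont_on_comp A f Num.sqrt) => u t _; have := @sqrt_continuous R (f u t). Qed.

Lemma cont_on_sub A B f : B `<=` A -> cont_on A f -> cont_on B f.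
Proof.
move=> BA hf u t Bt e e0; have [d d0 hd] := hf u t (BA _ Bt) e e0.
by exists d => // u' t' Bt'; apply: hd; exact: BA.
Qed.

Lemma cont_on_slice A f t : A t -> cont_on A f -> continuous (f ^~ t).
Proof.
move=> At hf u; apply/cvgrPdist_lt => e e0; have [d d0 hd] := hf u t At e e0.
exists d => // u' /= h; rewrite distrC; apply: hd => //; first by rewrite distrC.
by rewrite subrr normr0.
Qed.

(** The increment splits in two: at a fixed parameter the primitives at the two times differ by the
    integral of a uniformly small function over a bounded range ([slice_uniform]), and at a fixed
    time the primitive is continuous. *)
Lemma cont_prim A f : cont_on A f -> cont_on A (fun u t => prim (f ^~ t) u).
Proof.
move=> hf u t At e e0.
have cf s : A s -> continuous (f ^~ s) by move=> As; exact: (cont_on_slice As hf).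
pose M := `|u| + 1.
have M0 : 0 < M by rewrite ltr_wpDl.
have hsl v : - M <= v <= M -> forall e, 0 < e -> exists2 d : R, 0 < d &
 forall u' t', A t' -> `|u' - v| < d -> `|t' - t| < d -> `|f u' t' - f v t| < e.
by move=> _ e' e'0; exact: hf.
have e20 : 0 < e / 2 / M by rewrite !divr_gt0.
have [d1 d10 hd1] := slice_uniform At hsl e20.
have /cvgrPdist_lt /(_ (e / 2) ltac:(lra)) [d2 /= d20 hd2] :=
der_cvg (prim_der (cf t At) u).
exists (Num.min 1 (Num.min d1 d2)); first by rewrite !lt_min ltr01 d10.
move=> u' t' At'; rewrite !lt_min => /andP[u1 /andP[_ u2]] /andP[_ /andP[t1 _]].
have uM : `|u'| <= M.
by have := ler_normD (u' - u) u; rewrite subrK /M; clear - u1; lra.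
have h2 : `|prim (f ^~ t) u' - prim (f ^~ t) u| < e / 2.
by rewrite distrC; apply: hd2; rewrite /ball_ /= distrC.
have h1 : `|prim (f ^~ t') u' - prim (f ^~ t) u'| <= e / 2.
pose phi z := prim (f ^~ t') z - prim (f ^~ t) z.
have -> : prim (f ^~ t') u' - prim (f ^~ t) u' = phi u' - phi 0.
 by rewrite /phi !prim0 subrr subr0.
have hphi z : der phi z (f z t' - f z t) by apply: derB; apply: prim_der; exact: cf.
have hb z : - M <= z <= M -> `|f z t' - f z t| <= e / 2 / M by move=> hz; apply/ltW/hd1.
have [u0|/ltW u0] := leP 0 u'.
 rewrite (ger0_norm u0) in uM.
 apply: le_trans (der_bound (m := e / 2 / M) u0 (fun z _ => hphi z) _) _.
 by move=> z hz; apply: hb; clear - hz uM M0; move: hz; lra.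
 by rewrite subr0 mulrAC ler_pdivrMr // ler_pM2l //; lra.
rewrite (ler0_norm u0) in uM; rewrite distrC.
apply: le_trans (der_bound (m := e / 2 / M) u0 (fun z _ => hphi z) _) _.
 by move=> z hz; apply: hb; clear - hz uM M0; move: hz; lra.
by rewrite sub0r mulrAC ler_pdivrMr // ler_pM2l //; lra.
have := ler_normD (prim (f ^~ t') u' - prim (f ^~ t) u') (prim (f ^~ t) u' - prim (f ^~ t) u).
by rewrite addrA subrK; clear - h1 h2; lra.
Qed.

Lemma cont_for f u t :
{for (u, t), continuous (fun z : R * R => f z.1 z.2)} ->
forall e, 0 < e -> exists2 d : R, 0 < d &
forall u' t', `|u' - u| < d -> `|t' - t| < d -> `|f u' t' - f u t| < e.
Proof.
move=> /cvgrPdist_lt h e /h [[U V] /= [[d1 /= d10 h1] [d2 /= d20 h2]] hUV].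
exists (Num.min d1 d2); first by rewrite lt_min d10.
move=> u' t'; rewrite !lt_min => /andP[u1 u2] /andP[t1 t2].
rewrite distrC; apply: (hUV (u', t')) => //; split => /=.
by apply: h1; rewrite /ball_ /= distrC.
by apply: h2; rewrite /ball_ /= distrC.
Qed.

End JointContinuity.

(** * Angles of plane vectors and lifts of the tangent direction *)

Section PlaneCurve.
Context {R : realType}.
Implicit Types (u v c s P : R).

(** The principal argument of the unit vector (c, s). *)
Definition angle_of c s : R := if 0 <= s then acos c else - acos c.

Lemma angle_ofP c s : c ^+ 2 + s ^+ 2 = 1 -> cos (angle_of c s) = c /\ sin (angle_of c s) = s.
Proof.
move=> h; have c1 : -1 <= c <= 1.
have s0 : 0 <= s ^+ 2 by exact: sqr_ge0.
by apply/andP; split; nra.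
have sE : Num.sqrt (1 - c ^+ 2) = `|s| by rewrite -h addrC addKr sqrtr_sqr.
rewrite /angle_of; case: ifPn => [s0|]; last rewrite -ltNge => s0.
by rewrite acosK // sin_acos // sE ger0_norm.
by rewrite cosN sinN acosK // sin_acos // sE ltr0_norm // opprK.
Qed.

Lemma periodic_int (T : Type) (f : R -> T) P : (forall s, f (s + P) = f s) ->
forall (k : int) s, f (s + k%:~R * P) = f s.
Proof.
move=> h; have hn (n : nat) s : f (s + n%:R * P) = f s.
elim: n => [|n IH]; first by rewrite mul0r addr0.
by rewrite -natr1 mulrDl mul1r addrA h.
case=> n s; first exact: hn.
by rewrite NegzE mulrNz mulNr -[in RHS](subrK (n.+1%:R * P) s) hn.
Qed.

Lemma cos_2pi s : cos (s + 2 * pi) = cos s :> R.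
Proof. by rewrite mulr_natl cosD2pi. Qed.
Lemma cos_eq1 s : cos s = 1 -> exists k : int, s = k%:~R * (2 * pi).
Proof.
move=> hs; pose k := Num.floor (s / (2 * pi)).
have p0 : 0 < 2 * pi :> R by rewrite mulr_gt0 // pi_gt0.
exists k; have := floor_le (s / (2 * pi)); rewrite -/k ler_pdivlMr // => h1.
have := floorD1_gt (s / (2 * pi)); rewrite -/k ltr_pdivrMr // intrD mulrDl mul1r => h2.
pose r := s - k%:~R * (2 * pi).
have cr : cos r = 1.
by rewrite -hs -(periodic_int cos_2pi (- k) s) mulrNz mulNr.
have r0 : 0 <= r < 2 * pi by rewrite /r; lra.
suff : r = 0 by rewrite /r; lra.
have [rpi|rpi] := leP r pi.
apply: (@cos_inj R); rewrite ?in_itv /= ?cr ?cos0 //.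
- by case/andP: r0 => ->.
- by rewrite lexx pi_ge0.
have : 2 * pi - r = 0.
apply: (@cos_inj R); rewrite ?in_itv /= ?cos0 //.
- by move: r0; lra.
- by rewrite lexx pi_ge0.
- by rewrite addrC cos_2pi cosN.
move: r0; lra.
Qed.

(** The cosine [C] and the sine [D] of the difference between the true direction and [th] have zero
    derivative and equal 1 and 0 at u = 0, so the lift is identified by differentiation alone. *)
Lemma tangent_angle (x1 x2 y1 y2 g k : R -> R) :
(forall u, der x1 u (x2 u)) -> (forall u, der y1 u (y2 u)) ->
(forall u, 0 < g u) -> (forall u, g u ^+ 2 = x1 u ^+ 2 + y1 u ^+ 2) ->
(forall u, der g u ((x1 u * x2 u + y1 u * y2 u) / g u)) ->
(forall u, k u = (x1 u * y2 u - y1 u * x2 u) / g u ^+ 3) ->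
forall F : R -> R, (forall u, der F u (k u * g u)) ->
let th u := angle_of (x1 0 / g 0) (y1 0 / g 0) + F u - F 0 in
forall u, cos (th u) = x1 u / g u /\ sin (th u) = y1 u / g u.
Proof.
move=> hx hy g0 gE hg kE F hF th u.
have gn v : g v != 0 by rewrite gt_eqF.
have dth v : der th v (k v * g v).
by apply: der_eq (derB (derD (der_cst _ v) (hF v)) (der_cst _ v)) _; ring.
have dX v : der (fun z => x1 z / g z) v (- (k v * y1 v)).
apply: der_eq (derM (hx v) (derV (gn v) (hg v))) _.
rewrite kE; apply: (mulIf (expf_neq0 3 (gn v))); field: (gE v).
by rewrite gn.
have dY v : der (fun z => y1 z / g z) v (k v * x1 v).
apply: der_eq (derM (hy v) (derV (gn v) (hg v))) _.
rewrite kE; apply: (mulIf (expf_neq0 3 (gn v))); field: (gE v).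
by rewrite gn.
pose C z := x1 z / g z * cos (th z) + y1 z / g z * sin (th z).
pose D z := y1 z / g z * cos (th z) - x1 z / g z * sin (th z).
have dC v : der C v 0.
apply: der_eq (derD (derM (dX v) (der_cos (dth v))) (derM (dY v) (der_sin (dth v)))) _.
by field.
have dD v : der D v 0.
apply: der_eq (derB (derM (dY v) (der_cos (dth v))) (derM (dX v) (der_sin (dth v)))) _.
by field.
have n0 : (x1 0 / g 0) ^+ 2 + (y1 0 / g 0) ^+ 2 = 1.
rewrite !expr_div_n -mulrDl -gE divff // expf_neq0 //.
have th0 : th 0 = angle_of (x1 0 / g 0) (y1 0 / g 0) by rewrite /th addrK.
have [ca sa] := angle_ofP n0.
have C1 : C u = 1 by rewrite (der0_cst u 0 dC) /C th0 ca sa -!expr2.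
have D0 : D u = 0 by rewrite (der0_cst u 0 dD) /D th0 ca sa; ring.
have cs := cos2Dsin2 (th u).
move: C1 D0; rewrite /C /D; set X := x1 u / g u; set Y := y1 u / g u.
set co := cos (th u) in cs *; set si := sin (th u) in cs * => C1 D0.
split.
transitivity (co * (X * co + Y * si) - si * (Y * co - X * si)); first by rewrite C1 D0; ring.
by transitivity (X * (co ^+ 2 + si ^+ 2)); [ring|rewrite cs mulr1].
transitivity (si * (X * co + Y * si) + co * (Y * co - X * si)); first by rewrite C1 D0; ring.
by transitivity (Y * (co ^+ 2 + si ^+ 2)); [ring|rewrite cs mulr1].
Qed.

End PlaneCurve.

Local Arguments du : simpl never.
Local Arguments dt : simpl never.

(** * Arc length, curvature, tangent angle and the evolution of the speed *)

Section Flow.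
Context {R : realType}.
Implicit Types (u t p q : R).

Definition speed (x y : R -> R -> R) u t : R := Num.sqrt (du x u t ^+ 2 + du y u t ^+ 2).
(** Signed with respect to the parametrisation: the orientation [eps] is left out because it cancels
    in the flow equation ([flow_eq]). *)
Definition kurv (x y : R -> R -> R) u t : R :=
(du x u t * du (du y) u t - du y u t * du (du x) u t) / speed x y u t ^+ 3.
Definition alen (x y : R -> R -> R) p q t : R :=
prim (speed x y ^~ t) q - prim (speed x y ^~ t) p.
(** The base angle at u = 0 is a principal value and may jump in time. This is harmless: the
    mobility is periodic, and only differences of angles at one time are followed. *)
Definition tangle (x y : R -> R -> R) u t : R :=
angle_of (du x 0 t / speed x y 0 t) (du y 0 t / speed x y 0 t)
+ prim (fun v => kurv x y v t * speed x y v t) u.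

Variables (a : R -> R) (eps : R) (c1 c2 : R -> R) (P : R) (x y : R -> R -> R) (T : R).
Hypothesis heps : eps = 1 \/ eps = -1.
Hypothesis P0 : 0 < P.
Hypothesis da : forall s, derivable a s 1.
Hypothesis H : flow_solution a eps c1 c2 P x y T.

Let hx : smooth_strip x T. Proof. by case: H => _ []. Qed.
Let hy : smooth_strip y T. Proof. by case: H => _ [_ []]. Qed.

Notation g := (speed x y).
Notation k := (kurv x y).
Notation th := (tangle x y).
Notation I_ := [set t : R | 0 <= t < T].

Lemma curvE u t : curv eps x y u t = eps * k u t.
Proof. by rewrite /curv /kurv -mulrA. Qed.

Lemma flow_space n u t : 0 <= t < T ->
der (dun n x ^~ t) u (dun n.+1 x u t) /\ der (dun n y ^~ t) u (dun n.+1 y u t).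
Proof.
move=> ht; have [_ [h1 _]] := hx; have [_ [h2 _]] := hy.
by split; apply: der_derive1; [exact: h1|exact: h2].
Qed.

Lemma flow_space1 u t : 0 <= t < T ->
der (du x ^~ t) u (du (du x) u t) /\ der (du y ^~ t) u (du (du y) u t).
Proof. exact: (@flow_space 1). Qed.

Lemma flow_time n u t : 0 < t < T ->
der (dun n x u) t (dt (dun n x) u t) /\ der (dun n y u) t (dt (dun n y) u t).
Proof.
move=> ht; have [h1 _] := hx; have [h2 _] := hy.
by split; apply: der_derive1; [have [_ []] := h1 0%N n u t ht|have [_ []] := h2 0%N n u t ht].
Qed.

Lemma flow_cont n : cont_on I_ (dun n x) /\ cont_on I_ (dun n y).
Proof.
have [_ [_ h1]] := hx; have [_ [_ h2]] := hy.
by split; apply/cont_onP; [exact: h1|exact: h2].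
Qed.

Lemma flow_time_cont n u t : 0 < t < T ->
(forall e, 0 < e -> exists2 d : R, 0 < d & forall u' t', `|u' - u| < d -> `|t' - t| < d ->
 `|dt (dun n x) u' t' - dt (dun n x) u t| < e) /\
(forall e, 0 < e -> exists2 d : R, 0 < d & forall u' t', `|u' - u| < d -> `|t' - t| < d ->
 `|dt (dun n y) u' t' - dt (dun n y) u t| < e).
Proof.
move=> ht; have [h1 _] := hx; have [h2 _] := hy.
by split; apply: cont_for; [have [_ []] := h1 1%N n u t ht|have [_ []] := h2 1%N n u t ht].
Qed.

Lemma flow_per n u t : 0 <= t < T -> dun n x (u + P) t = dun n x u t /\ dun n y (u + P) t = dun n y u t.
Proof.
move=> ht; elim: n u => [|n IH] u.
by have [_ [_ [_ [_ [h _]]]]] := H; exact: h.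
have [h1 h2] := flow_space n (u + P) ht; have [h3 h4] := flow_space n u ht.
have s1 : der (fun z : R => z + P) u 1.
by apply: der_eq (derD (der_id u) (der_cst P u)) _; rewrite addr0.
have e1 := der_comp (g := fun z => z + P) (x := u) h1 s1.
have e2 := der_comp (g := fun z => z + P) (x := u) h2 s1.
rewrite !mulr1 in e1 e2.
have E1 : (fun z => dun n x (z + P) t) = dun n x ^~ t by apply/funext => z; have [] := IH z.
have E2 : (fun z => dun n y (z + P) t) = dun n y ^~ t by apply/funext => z; have [] := IH z.
rewrite E1 in e1; rewrite E2 in e2.
by split; [exact: der_unique e1 h3|exact: der_unique e2 h4].
Qed.

Lemma flow_per1 u t : 0 <= t < T -> du x (u + P) t = du x u t /\ du y (u + P) t = du y u t.
Proof. exact: (@flow_per 1). Qed.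

Lemma flow_per2 u t : 0 <= t < T ->
du (du x) (u + P) t = du (du x) u t /\ du (du y) (u + P) t = du (du y) u t.
Proof. exact: (@flow_per 2). Qed.

Lemma flow_cont1 : cont_on I_ (du x) /\ cont_on I_ (du y).
Proof. exact: (flow_cont 1). Qed.

Lemma flow_cont2 : cont_on I_ (du (du x)) /\ cont_on I_ (du (du y)).
Proof. exact: (flow_cont 2). Qed.

Lemma flow_space2 u t : 0 <= t < T ->
der (du (du x) ^~ t) u (dun 3 x u t) /\ der (du (du y) ^~ t) u (dun 3 y u t).
Proof. exact: (@flow_space 2). Qed.

Lemma speed_gt0 u t : 0 <= t < T -> 0 < g u t.
Proof.
move=> ht; have [_ [_ [_ [_ [_ [h _]]]]]] := H.
by rewrite sqrtr_gt0 lt_neqAle eq_sym h //= addr_ge0 // sqr_ge0.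
Qed.

Lemma speed_neq0 u t : 0 <= t < T -> g u t != 0.
Proof. by move=> /speed_gt0 h; rewrite gt_eqF. Qed.

Lemma speed_sq u t : g u t ^+ 2 = du x u t ^+ 2 + du y u t ^+ 2.
Proof. by rewrite sqr_sqrtr // addr_ge0 // sqr_ge0. Qed.

Lemma speed_space u t : 0 <= t < T ->
der (g ^~ t) u ((du x u t * du (du x) u t + du y u t * du (du y) u t) / g u t).
Proof.
move=> ht; have [h1 h2] := flow_space1 u ht.
have g0 : 0 < du x u t ^+ 2 + du y u t ^+ 2 by rewrite -speed_sq exprn_gt0 // speed_gt0.
apply: der_eq (der_sqrt (f := fun z => du x z t ^+ 2 + du y z t ^+ 2) g0
(derD (derX 2 h1) (derX 2 h2))) _.
have gn := speed_neq0 u ht; move: gn; rewrite /speed /= !expr1.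
move: (Num.sqrt _ : R) => G; move: (du (du x) u t) (du (du y) u t) => X2 Y2.
by move: (du x u t) (du y u t) => X1 Y1 gn; field; rewrite gn.
Qed.

Lemma speed_per u t : 0 <= t < T -> g (u + P) t = g u t.
Proof. by move=> ht; rewrite /speed; have [-> ->] := flow_per1 u ht. Qed.

Lemma kurv_per u t : 0 <= t < T -> k (u + P) t = k u t.
Proof.
move=> ht; have [e1 e2] := flow_per1 u ht; have [e3 e4] := flow_per2 u ht.
by rewrite /kurv (speed_per u ht) e1 e2 e3 e4.
Qed.

Lemma speed_cont : cont_on I_ g.
Proof.
have [h1 h2] := flow_cont1.
exact: (cont_on_sqrt (cont_onD (cont_onX 2 h1) (cont_onX 2 h2))).
Qed.

Lemma kurv_cont : cont_on I_ k.
Proof.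
have [h1 h2] := flow_cont1; have [h3 h4] := flow_cont2.
apply: (cont_onM (cont_onB (cont_onM h1 h4) (cont_onM h2 h3))).
apply: (cont_onV _ (cont_onX 3 speed_cont)) => u t ht.
by rewrite expf_neq0 // (speed_neq0 u ht).
Qed.

Lemma kurv_der u t : 0 <= t < T -> exists l, der (k ^~ t) u l.
Proof.
move=> ht; have [h1 h2] := flow_space1 u ht; have [h3 h4] := flow_space2 u ht.
have g3 : g u t ^+ 3 != 0 by rewrite expf_neq0 // (speed_neq0 u ht).
eexists; exact: (derM (derB (derM h1 h4) (derM h2 h3))
(derV (f := fun z => g z t ^+ 3) g3 (derX 3 (speed_space u ht)))).
Qed.

Lemma arc_der u t : 0 <= t < T -> der (prim (g ^~ t)) u (g u t).
Proof. by move=> ht; apply: prim_der; exact: (cont_on_slice _ speed_cont). Qed.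

Lemma tangle_der u t : 0 <= t < T -> der (th ^~ t) u (k u t * g u t).
Proof.
move=> ht; rewrite -[X in der _ _ X]add0r; apply: derD; first exact: der_cst.
apply: (@prim_der _ (fun v => k v t * g v t)).
by apply: (cont_on_slice _ (cont_onM kurv_cont speed_cont)).
Qed.

Lemma tangleP u t : 0 <= t < T -> cos (th u t) = du x u t / g u t /\ sin (th u t) = du y u t / g u t.
Proof.
move=> ht.
have := @tangent_angle _ (du x ^~ t) (du (du x) ^~ t) (du y ^~ t) (du (du y) ^~ t) (g ^~ t) (k ^~ t)
(fun v => (flow_space1 v ht).1) (fun v => (flow_space1 v ht).2) (fun v => speed_gt0 v ht)
(fun v => speed_sq v t) (fun v => speed_space v ht) (fun v => erefl) (prim (fun v => k v t * g v t)).
rewrite prim0 => /(_ _ u); rewrite subr0; apply => v.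
apply: (@prim_der _ (fun v => k v t * g v t)).
by apply: (cont_on_slice _ (cont_onM kurv_cont speed_cont)).
Qed.

(** The orientation sign enters through the curvature and through the normal, so it squares away. *)
Lemma flow_eq u t : 0 < t < T ->
dt x u t = - (a (th u t) * k u t) * (du y u t / g u t) /\
dt y u t = a (th u t) * k u t * (du x u t / g u t).
Proof.
move=> /andP[t0 tT]; have ht : 0 <= t < T by rewrite ltW.
have [_ [_ [_ [_ [_ [_ [h _]]]]]]] := H.
have [hc hs] := tangleP u ht.
have e2 : eps * eps = 1 by case: heps => ->; ring.
have [|-> ->] := h u t (th u t) _ hc hs; first by rewrite t0.
rewrite curvE -/(speed x y u t); split.
by transitivity (eps * eps * (- (a (th u t) * k u t) * (du y u t / g u t))); [ring|rewrite e2 mul1r].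
by transitivity (eps * eps * (a (th u t) * k u t * (du x u t / g u t))); [ring|rewrite e2 mul1r].
Qed.

Let near_time t : 0 < t < T -> exists2 e : R, 0 < e & forall s, `|s - t| < e -> 0 < s < T.
Proof.
move=> /andP[t0 tT]; exists (Num.min t (T - t)); first by rewrite lt_min t0 subr_gt0.
by move=> s; rewrite lt_min !ltr_norml => /andP[/andP[h1 _] /andP[_ h2]]; apply/andP; split; lra.
Qed.

Lemma eps_continuous (f : R -> R -> R) t :
(forall u e, 0 < e -> exists2 d : R, 0 < d & forall u' t', `|u' - u| < d -> `|t' - t| < d ->
 `|f u' t' - f u t| < e) -> continuous (f ^~ t).
Proof.
move=> hf u; apply/cvgrPdist_lt => e e0; have [d d0 hd] := hf u e e0.
exists d => // u' /= h; rewrite distrC; apply: hd; first by rewrite distrC.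
by rewrite subrr normr0.
Qed.

(* Schwarz: comparing Leibniz' rule for x = int x_u with x itself. *)
Lemma mixed_derivative_gen (f f1 : R -> R -> R) t : 0 < t < T ->
(forall u s, 0 < s < T -> der (f ^~ s) u (f1 u s)) ->
(forall u s, 0 < s < T -> der (f u) s (dt f u s)) ->
(forall u s, 0 < s < T -> der (f1 u) s (dt f1 u s)) ->
(forall u e, 0 < e -> exists2 d : R, 0 < d & forall u' t', `|u' - u| < d -> `|t' - t| < d ->
 `|dt f1 u' t' - dt f1 u t| < e) ->
forall u, der (dt f ^~ t) u (dt f1 u t).
Proof.
move=> ht h1 h2 h3 hc u.
have [e e0 he] := near_time ht.
have dQ := prim_der (eps_continuous hc).
set Q := prim (dt f1 ^~ t) in dQ.
have main b c : b <= c -> dt f c t - dt f b t = Q c - Q b.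
move=> bc; apply: (@der_unique _ (fun s => f c s - f b s) t).
 by apply: derB; exact: h2.
apply: (leibniz (f := f1) (ft := dt f1) (S := f) bc e0).
- by move=> v s _ /he; exact: h1.
- by move=> v s _ /he; exact: h3.
- by move=> v _; exact: dQ.
- by move=> v _; exact: hc.
have E : dt f ^~ t = (fun v => Q v + (dt f 0 t - Q 0)).
apply/funext => v; have [v0|/ltW v0] := leP 0 v.
 by have := main 0 v v0; lra.
by have := main v 0 v0; lra.
rewrite E; apply: der_eq (derD (dQ u) (der_cst _ u)) _; exact: addr0.
Qed.

Lemma mixed_derivative u t : 0 < t < T ->
der (dt x ^~ t) u (dt (du x) u t) /\ der (dt y ^~ t) u (dt (du y) u t).
Proof.
move=> ht; split; apply: (mixed_derivative_gen ht).
- by move=> v s /andP[s0 sT]; apply: (flow_space 0 v _).1; rewrite ltW.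
- by move=> v s hs; apply: (flow_time 0 v hs).1.
- by move=> v s hs; apply: (flow_time 1 v hs).1.
- by move=> v; apply: (flow_time_cont 1 v ht).1.
- by move=> v s /andP[s0 sT]; apply: (flow_space 0 v _).2; rewrite ltW.
- by move=> v s hs; apply: (flow_time 0 v hs).2.
- by move=> v s hs; apply: (flow_time 1 v hs).2.
- by move=> v; apply: (flow_time_cont 1 v ht).2.
Qed.

Lemma speed_time u t : 0 < t < T -> der (g u) t (- (a (th u t) * k u t ^+ 2 * g u t)).
Proof.
move=> ht; have /andP[t0 tT] := ht; have ht' : 0 <= t < T by rewrite ltW.
have gn := speed_neq0 u ht'.
have [t1 t2] : der (du x u) t (dt (du x) u t) /\ der (du y u) t (dt (du y) u t).
exact: (@flow_time 1).
have g0 : 0 < du x u t ^+ 2 + du y u t ^+ 2 by rewrite -speed_sq exprn_gt0 // speed_gt0.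
apply: der_eq (der_sqrt (f := fun s => du x u s ^+ 2 + du y u s ^+ 2) g0
(derD (derX 2 t1) (derX 2 t2))) _.
have [m1 m2] := mixed_derivative u ht.
have [l hl] := kurv_der u ht'.
have dath : der (fun v => a (th v t)) u (derive1 a (th u t) * (k u t * g u t)).
by apply: der_comp (tangle_der u ht'); exact: der_derive1.
have [s1 s2] := flow_space1 u ht'.
have dw := derM (derM dath hl) (derV (f := g ^~ t) gn (speed_space u ht')).
set w1 := (X in der _ _ X) in dw.
(* The velocity is w = a k / g times the rotated vector (x_u, y_u). After differentiation in u, the
   term with the derivative of w is orthogonal to the tangent and drops out of the derivative of the
   speed. *)
have E1 : dt x ^~ t = (fun v => - (a (th v t) * k v t / g v t) * du y v t).
by apply/funext => v; have [-> _] := flow_eq v ht; ring.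
have E2 : dt y ^~ t = (fun v => a (th v t) * k v t / g v t * du x v t).
by apply/funext => v; have [_ ->] := flow_eq v ht; ring.
rewrite E1 in m1; rewrite E2 in m2.
rewrite (der_unique m1 (derM (derN dw) s2)) (der_unique m2 (derM dw s1)).
have kE : k u t * g u t ^+ 3 = du x u t * du (du y) u t - du y u t * du (du x) u t.
by rewrite divfK // expf_neq0.
rewrite /= !expr1 -[Num.sqrt _ : R]/(g u t).
clearbody w1; clear dw dath E1 E2 m1 m2 hl.
move: kE gn; move: (a _) (k u t) (g u t) => A K G.
move: (du (du x) u t) (du (du y) u t) => X2 Y2.
move: (du x u t) (du y u t) => X1 Y1 kE G0; field: kE.
by rewrite G0.
Qed.

End Flow.

#[local] Opaque du dt.

(** * Contact conditions in the frame of the chord *)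

Section ContactGeometry.
Context {R : realType}.

(* In the frame of the chord, [c] and [s] are the cosine and sine of the angle of a tangent. *)
Lemma chord_frame (A B d c x1 y1 g : R) : 0 < d -> 0 < g ->
A ^+ 2 + B ^+ 2 = d ^+ 2 -> x1 ^+ 2 + y1 ^+ 2 = g ^+ 2 ->
A * x1 + B * y1 = d * c * g ->
let s := (A * y1 - B * x1) / (d * g) in
[/\ c ^+ 2 + s ^+ 2 = 1, x1 / g = (A * c - B * s) / d & y1 / g = (B * c + A * s) / d].
Proof.
move=> d0 g0 hd hg hc s.
have dn : d != 0 by rewrite gt_eqF.
have gn : g != 0 by rewrite gt_eqF.
have cE : c = (A * x1 + B * y1) / (d * g) by rewrite hc; field; rewrite dn gn.
split.
- rewrite cE /s !expr_div_n -mulrDl.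
have -> : (A * x1 + B * y1) ^+ 2 + (A * y1 - B * x1) ^+ 2 =
 (A ^+ 2 + B ^+ 2) * (x1 ^+ 2 + y1 ^+ 2) by ring.
by rewrite hd hg -exprMn divff // expf_neq0 // mulf_neq0.
- transitivity ((A ^+ 2 + B ^+ 2) * x1 / (d ^+ 2 * g)).
 by rewrite hd; field; rewrite dn gn.
by rewrite cE /s; field; rewrite dn gn.
- transitivity ((A ^+ 2 + B ^+ 2) * y1 / (d ^+ 2 * g)).
 by rewrite hd; field; rewrite dn gn.
by rewrite cE /s; field; rewrite dn gn.
Qed.

Lemma curve_accel (x1 y1 x2 y2 g k : R) : 0 < g -> x1 ^+ 2 + y1 ^+ 2 = g ^+ 2 ->
k = (x1 * y2 - y1 * x2) / g ^+ 3 ->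
let g1 := (x1 * x2 + y1 * y2) / g in
x2 = g1 / g * x1 - k * g * y1 /\ y2 = g1 / g * y1 + k * g * x1.
Proof.
move=> g0 hg -> g1; have gn : g != 0 by rewrite gt_eqF.
split.
transitivity ((x1 ^+ 2 + y1 ^+ 2) * x2 / g ^+ 2).
 by rewrite hg; field; rewrite gn.
by rewrite /g1; field; rewrite gn.
transitivity ((x1 ^+ 2 + y1 ^+ 2) * y2 / g ^+ 2).
by rewrite hg; field; rewrite gn.
by rewrite /g1; field; rewrite gn.
Qed.

(** Dividing the variations by the speeds passes to arc length. By the first-order conditions the
    tangential accelerations cancel against the derivatives of the speed in the profile term,
    leaving curvatures and angles only. *)
Lemma normalized_contact (A B d c p2 x1p y1p x2p y2p gp kp x1q y1q x2q y2q gq kq : R) :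
0 < d -> 0 < gp -> 0 < gq -> A ^+ 2 + B ^+ 2 = d ^+ 2 ->
x1p ^+ 2 + y1p ^+ 2 = gp ^+ 2 -> x1q ^+ 2 + y1q ^+ 2 = gq ^+ 2 ->
kp = (x1p * y2p - y1p * x2p) / gp ^+ 3 -> kq = (x1q * y2q - y1q * x2q) / gq ^+ 3 ->
A * x1q + B * y1q = d * c * gq -> A * x1p + B * y1p = d * c * gp ->
let sp := (A * y1p - B * x1p) / (d * gp) in
let sq := (A * y1q - B * x1q) / (d * gq) in
(forall xi eta, 0 <= (eta * x1q - xi * x1p) ^+ 2 + (eta * y1q - xi * y1p) ^+ 2
  + A * (eta ^+ 2 * x2q - xi ^+ 2 * x2p) + B * (eta ^+ 2 * y2q - xi ^+ 2 * y2p)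
  - (c ^+ 2 + d * p2) * (eta * gq - xi * gp) ^+ 2
  - d * c * (eta ^+ 2 * ((x1q * x2q + y1q * y2q) / gq)
    - xi ^+ 2 * ((x1p * x2p + y1p * y2p) / gp))) ->
forall xi eta, 0 <= xi ^+ 2 + eta ^+ 2 - 2 * xi * eta * (c ^+ 2 + sp * sq)
 - d * (eta ^+ 2 * kq * sq - xi ^+ 2 * kp * sp) - (c ^+ 2 + d * p2) * (eta - xi) ^+ 2.
Proof.
move=> d0 gp0 gq0 hd hp hq hkp hkq fq fp sp sq H xi eta.
have dn : d != 0 by rewrite gt_eqF.
have gpn : gp != 0 by rewrite gt_eqF.
have gqn : gq != 0 by rewrite gt_eqF.
have [p1 pX pY] := chord_frame d0 gp0 hd hp fp.
have [q1 qX qY] := chord_frame d0 gq0 hd hq fq.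
have [aX aY] := curve_accel gp0 hp hkp.
have [bX bY] := curve_accel gq0 hq hkq.
move: H aX aY bX bY => /=.
move: ((x1q * x2q + y1q * y2q) / gq) ((x1p * x2p + y1p * y2p) / gp) => Gq Gp H aX aY bX bY.
have := H (xi / gp) (eta / gq).
have -> : (eta / gq * x1q - xi / gp * x1p) ^+ 2 + (eta / gq * y1q - xi / gp * y1p) ^+ 2 =
 xi ^+ 2 + eta ^+ 2 - 2 * xi * eta * (c ^+ 2 + sp * sq).
have -> : c ^+ 2 + sp * sq = (x1p / gp) * (x1q / gq) + (y1p / gp) * (y1q / gq).
 rewrite pX qX pY qY -/sp -/sq.
 transitivity ((A ^+ 2 + B ^+ 2) * (c ^+ 2 + sp * sq) / d ^+ 2).
 by rewrite hd; field; rewrite dn.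
 by field; rewrite dn.
transitivity (xi ^+ 2 * (x1p ^+ 2 + y1p ^+ 2) / gp ^+ 2 +
 eta ^+ 2 * (x1q ^+ 2 + y1q ^+ 2) / gq ^+ 2 - 2 * xi * eta *
 ((x1p / gp) * (x1q / gq) + (y1p / gp) * (y1q / gq))).
 by field; rewrite gpn gqn.
by rewrite hp hq !mulfK // expf_neq0.
have Eq : A * x2q + B * y2q = d * c * Gq - kq * gq ^+ 2 * (d * sq).
rewrite bX bY.
transitivity (Gq / gq * (A * x1q + B * y1q) - kq * gq * (A * y1q - B * x1q)); first by ring.
by rewrite fq /sq; field; rewrite dn gqn.
have Ep : A * x2p + B * y2p = d * c * Gp - kp * gp ^+ 2 * (d * sp).
rewrite aX aY.
transitivity (Gp / gp * (A * x1p + B * y1p) - kp * gp * (A * y1p - B * x1p)); first by ring.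
by rewrite fp /sp; field; rewrite dn gpn.
rewrite !divfK //; congr (0 <= _).
have -> : A * ((eta / gq) ^+ 2 * x2q - (xi / gp) ^+ 2 * x2p) =
(eta / gq) ^+ 2 * (A * x2q + B * y2q) - (xi / gp) ^+ 2 * (A * x2p + B * y2p)
- B * ((eta / gq) ^+ 2 * y2q - (xi / gp) ^+ 2 * y2p) by ring.
rewrite Eq Ep; field; by rewrite gpn gqn.
Qed.

End ContactGeometry.

(** * The differential inequality at a first contact of the flow with a profile *)

Section FlowContact.
Context {R : realType}.
Implicit Types (u t p q : R).
Variables (a : R -> R) (eps : R) (c1 c2 : R -> R) (P : R) (x y : R -> R -> R) (T : R).
Hypothesis heps : eps = 1 \/ eps = -1.
Hypothesis P0 : 0 < P.
Hypothesis da : forall s, derivable a s 1.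
Hypothesis a_gt0 : forall s, 0 < a s.
Hypothesis a_per : forall s, a (s + 2 * pi) = a s.
Hypothesis H : flow_solution a eps c1 c2 P x y T.

Notation g := (speed x y).
Notation k := (kurv x y).
Notation th := (tangle x y).
Notation l_ := (alen x y).
Notation I_ := [set t : R | 0 <= t < T].
Notation J_ := [set t : R | 0 < t < T].

Lemma continuous_mul (f h : R -> R) : continuous f -> continuous h ->
continuous (fun v => f v * h v).
Proof. by move=> hf hh v; exact: (cvgM (hf v) (hh v)). Qed.

(** The integral of a k^2 ds over the arc, which is the rate at which its length is lost
    ([arc_time]). *)
Definition dissip (a : R -> R) (x y : R -> R -> R) p q t : R :=
let D := prim (fun v => a (tangle x y v t) * kurv x y v t ^+ 2 * speed x y v t) in D q - D p.

Lemma J_sub_I : J_ `<=` I_.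
Proof. by move=> t /= /andP[t0 tT]; rewrite ltW. Qed.

Lemma near_time t : 0 < t < T -> exists2 e : R, 0 < e & forall s, `|s - t| < e -> 0 < s < T.
Proof.
move=> /andP[t0 tT]; exists (Num.min t (T - t)); first by rewrite lt_min t0 subr_gt0.
by move=> s; rewrite lt_min !ltr_norml => /andP[/andP[h1 _] /andP[_ h2]]; apply/andP; split; lra.
Qed.

Lemma cont_on_open (f : R -> R -> R) u t : 0 < t < T -> cont_on J_ f ->
forall e, 0 < e -> exists2 d : R, 0 < d &
forall u' t', `|u' - u| < d -> `|t' - t| < d -> `|f u' t' - f u t| < e.
Proof.
move=> ht hf e e0; have [r r0 hr] := near_time ht.
have [d d0 hd] := hf u t ht e e0.
exists (Num.min r d); first by rewrite lt_min r0.
move=> u' t'; rewrite !lt_min => /andP[_ h1] /andP[/hr h2 h3]; exact: hd.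
Qed.

Lemma open_cont_on (f : R -> R -> R) :
(forall u t, 0 < t < T -> forall e, 0 < e -> exists2 d : R, 0 < d &
forall u' t', `|u' - u| < d -> `|t' - t| < d -> `|f u' t' - f u t| < e) -> cont_on J_ f.
Proof.
move=> hf u t ht e e0; have [d d0 hd] := hf u t ht e e0; exists d => // u' t' _; exact: hd.
Qed.

Lemma a_tangle_cont t : 0 <= t < T -> continuous (fun v => a (th v t)).
Proof.
move=> ht v; apply: (@der_cvg _ (fun v => a (th v t)) v).
apply: (@der_comp _ a (th ^~ t)); first exact: der_derive1.
exact: (tangle_der H).
Qed.

Lemma dissip_der u t : 0 <= t < T ->
der (prim (fun v => a (th v t) * k v t ^+ 2 * g v t)) u (a (th u t) * k u t ^+ 2 * g u t).
Proof.
move=> ht; apply: (@prim_der _ (fun v => a (th v t) * k v t ^+ 2 * g v t)).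
have h1 := cont_on_slice (ht : I_ t) (kurv_cont H).
have h2 := cont_on_slice (ht : I_ t) (speed_cont H).
apply: (continuous_mul _ h2); apply: (continuous_mul (a_tangle_cont ht)).
by under eq_fun do rewrite expr2; exact: (continuous_mul h1 h1).
Qed.

Lemma arc_time p q t : p <= q -> 0 < t < T -> der (l_ p q) t (- dissip a x y p q t).
Proof.
move=> pq ht; have ht' := J_sub_I ht.
have [e e0 he] := near_time ht.
pose ft u s := (du x u s * dt (du x) u s + du y u s * dt (du y) u s) / g u s.
have dft u s : 0 < s < T -> der (g u) s (ft u s).
move=> hs; have hs' := J_sub_I hs; have gn := speed_neq0 H u hs'.
have [t1 t2] : der (du x u) s (dt (du x) u s) /\ der (du y u) s (dt (du y) u s).
 exact: (@flow_time _ _ _ _ _ _ _ _ _ H 1).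
have g0 : 0 < du x u s ^+ 2 + du y u s ^+ 2.
 by rewrite -speed_sq exprn_gt0 // (speed_gt0 H).
apply: der_eq (der_sqrt (f := fun s => du x u s ^+ 2 + du y u s ^+ 2) g0
 (derD (derX 2 t1) (derX 2 t2))) _.
rewrite /ft /= !expr1 -[Num.sqrt _ : R]/(g u s).
move: (g u s) (du x u s) (du y u s) (dt _ _ _) (dt _ _ _) gn => G X1 Y1 X2 Y2 gn.
by field; rewrite gn.
have cft : cont_on J_ ft.
have [x1c y1c] := flow_cont1 H.
have c1x := open_cont_on (fun u t ht => (@flow_time_cont _ _ _ _ _ _ _ _ _ H 1 u t ht).1).
have c1y := open_cont_on (fun u t ht => (@flow_time_cont _ _ _ _ _ _ _ _ _ H 1 u t ht).2).
apply: (cont_onM (cont_onD (cont_onM (cont_on_sub J_sub_I x1c) c1x)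
       (cont_onM (cont_on_sub J_sub_I y1c) c1y))).
apply: (cont_onV _ (cont_on_sub J_sub_I (speed_cont H))) => u s hs.
exact: (speed_neq0 H u (J_sub_I hs)).
pose D := prim (fun v => a (th v t) * k v t ^+ 2 * g v t).
have -> : - dissip a x y p q t = - D q - - D p by rewrite /dissip -/D; ring.
apply: (leibniz (f := g) (ft := ft) (S := fun u s => prim (g ^~ s) u) (Q := fun u => - D u) pq e0).
- by move=> u s _ /he /J_sub_I; exact: (arc_der H).
- by move=> u s _ /he; exact: dft.
- move=> u _; have -> : ft u t = - (a (th u t) * k u t ^+ 2 * g u t).
 exact: (der_unique (dft u t ht) (speed_time heps da H u ht)).
by apply: derN; exact: dissip_der.
- by move=> u _; exact: (cont_on_open u ht cft).
Qed.

Lemma arc_gt0 p q t : p < q -> 0 <= t < T -> 0 < l_ p q t.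
Proof.
move=> pq ht; rewrite subr_gt0; apply: (der_gt0_lt pq (fun u _ => arc_der H u ht)).
by move=> u _; exact: (speed_gt0 H).
Qed.

Lemma tangle_eq1 p q t : cos (th q t - th p t) = 1 -> a (th q t) = a (th p t).
Proof.
move=> /cos_eq1[j hj].
have -> : th q t = th p t + j%:~R * (2 * pi) by rewrite -hj; ring.
by rewrite (periodic_int a_per).
Qed.

(** Minimality in space gives the second variation, minimality against earlier times the sign of the
    time derivative, and [contact_alg] combines them. Either the tangents are parallel, or they are
    in reflected position, where with c = cos beta the turning has cosine 2 c^2 - 1 = cos (2
    beta). *)
Lemma flow_contact (pf : R -> R -> R) (psi1 psi2 : R -> R) p q t e pt :
0 < t < T -> p < q -> 0 < e ->
(forall s, 0 < s -> der (pf ^~ t) s (psi1 s)) -> (forall s, 0 < s -> der psi1 s (psi2 s)) ->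
let l := l_ p q t in let d := pf l t in let c := psi1 l in
der (fun s => pf (l_ p q s) s) t (c * - dissip a x y p q t + pt) -> 0 < d ->
let F p q s := (x q s - x p s) ^+ 2 + (y q s - y p s) ^+ 2 - pf (l_ p q s) s ^+ 2 in
F p q t = 0 -> (forall p' q', `|p' - p| < e -> `|q' - q| < e -> 0 <= F p' q' t) ->
(forall h, 0 < h < e -> 0 <= F p q (t - h)) ->
let bp := Num.sqrt (a (th p t)) in let bq := Num.sqrt (a (th q t)) in
c ^+ 2 <= 1 /\
((cos (th q t - th p t) = 1 /\ c * dissip a x y p q t <= pt) \/
(cos (th q t - th p t) = 2 * c ^+ 2 - 1 /\
 d * c * dissip a x y p q t - d * pt <=
 (bp - bq) ^+ 2 * (1 - c ^+ 2) - d * psi2 l * (bp + bq) ^+ 2)).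
Proof.
move=> ht pq e0 hpsi hpsi1 l d c dpf d0 F F0 Fsp Ftm bp bq.
have ht' := J_sub_I ht.
have [s1 s2] : (forall u, der (x ^~ t) u (du x u t)) /\ (forall u, der (y ^~ t) u (du y u t)).
by split=> u; have [] := @flow_space _ _ _ _ _ _ _ _ _ H 0 u t ht'.
have [E1 E2 E3] := second_variation s1 (fun u => (flow_space1 H u ht').1) s2
(fun u => (flow_space1 H u ht').2) (fun u => arc_der H u ht') (fun u => speed_space H u ht')
(fun u => speed_gt0 H u ht') hpsi hpsi1 pq e0 F0 Fsp.
rewrite -[prim _ q - prim _ p]/l -/d -/c in E1 E2 E3.
set A := x q t - x p t in E1 E2 E3; set B := y q t - y p t in E1 E2 E3.
have hAB : A ^+ 2 + B ^+ 2 = d ^+ 2 by apply/eqP; rewrite -subr_eq0; apply/eqP.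
have gp0 := speed_gt0 H p ht'; have gq0 := speed_gt0 H q ht'.
have hp := esym (speed_sq x y p t); have hq := esym (speed_sq x y q t).
have H2 := normalized_contact d0 gp0 gq0 hAB hp hq (erefl (k p t)) (erefl (k q t)) E1 E2 E3.
have [Pp Ppx Ppy] := chord_frame d0 gp0 hAB hp E2.
have [Pq Pqx Pqy] := chord_frame d0 gq0 hAB hq E1.
set sp := (A * du y p t - B * du x p t) / (d * g p t) in H2 Pp Ppx Ppy.
set sq := (A * du y q t - B * du x q t) / (d * g q t) in H2 Pq Pqx Pqy.
have dn : d != 0 by rewrite gt_eqF.
have cosT : cos (th q t - th p t) = c ^+ 2 + sp * sq.
rewrite cosB; have [-> ->] := tangleP H q ht'; have [-> ->] := tangleP H p ht'.
rewrite Pqx Pqy Ppx Ppy.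
transitivity ((A ^+ 2 + B ^+ 2) * (c ^+ 2 + sp * sq) / d ^+ 2).
 by field; rewrite dn.
by rewrite hAB; field; rewrite dn.
(* The squared chord changes by the normal speeds b^2 k at its ends, the profile by the loss of arc
   length and by its own time derivative [pt]. *)
have Ht : d * (bp ^+ 2 * k p t * sp - bq ^+ 2 * k q t * sq) + d * c * dissip a x y p q t - d * pt <= 0.
have b2p : bp ^+ 2 = a (th p t) by rewrite sqr_sqrtr // ltW.
have b2q : bq ^+ 2 = a (th q t) by rewrite sqr_sqrtr // ltW.
have [tq1 tq2] : der (x q) t (dt x q t) /\ der (y q) t (dt y q t).
 exact: (@flow_time _ _ _ _ _ _ _ _ _ H 0).
have [tp1 tp2] : der (x p) t (dt x p t) /\ der (y p) t (dt y p t).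
 exact: (@flow_time _ _ _ _ _ _ _ _ _ H 0).
have dF := derB (derD (derX 2 (derB tq1 tp1)) (derX 2 (derB tq2 tp2))) (derX 2 dpf).
have := left_der_le0 e0 (f := F p q) (x := t) _ dF; rewrite F0 => /(_ Ftm).
have [-> ->] := flow_eq heps H q ht; have [-> ->] := flow_eq heps H p ht.
rewrite -/A -/B -/l -/d b2p b2q /= !expr1.
rewrite Pqx Pqy Ppx Ppy.
move: (a _) (a _) (k p t) (k q t) (dissip _ _ _ _ _ _) => ap aq kp kq X.
set V := (V in V <= 0 -> _) => hV.
have : V = 2 * (d * (ap * kp * sp - aq * kq * sq) + d * c * X - d * pt).
 rewrite /V; transitivity (2 * ((A ^+ 2 + B ^+ 2) / d * (ap * kp * sp - aq * kq * sq)
 + d * c * X - d * pt)); first by field; rewrite dn.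
 by rewrite hAB; field; rewrite dn.
by move: hV; clear; lra.
have [[e1 e2]|[e1 e2]] := contact_alg Pp Pq d0 H2 Ht.
split; first by move: Pp (sqr_ge0 sp); clear; lra.
have cT1 : cos (th q t - th p t) = 1 by rewrite cosT e1 -expr2.
by left; split=> //; apply: e2; rewrite /bp /bq (tangle_eq1 cT1).
split; first by move: Pp (sqr_ge0 sp); clear; lra.
by right; rewrite cosT.
Qed.

End FlowContact.

(** * Numerical bounds for sine, cosine and pi *)

Section Trig.
Context {R : realType}.
Implicit Types (u s t d b T : R).

Lemma sin_le t : 0 <= t -> sin t <= t.
Proof.
move=> t0; rewrite -subr_ge0.
have := @der_ge0_le _ (fun z => z - sin z) (fun z => 1 - cos z * 1) 0 t t0
(fun z _ => derB (der_id z) (der_sin (der_id z))).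
rewrite sin0 subrr; apply => z _; rewrite mulr1 subr_ge0; exact: cos_le1.
Qed.

Lemma cos_ge t : 1 - t ^+ 2 / 2 <= cos t.
Proof.
wlog t0 : t / 0 <= t.
move=> h; have [/h//|/ltW t0] := leP 0 t.
by have := h (- t); rewrite cosN sqrrN oppr_ge0; apply.
rewrite -subr_ge0.
have hd (z : R) : der (fun z => cos z - (1 - z ^+ 2 / 2)) z (z - sin z).
apply: der_eq (derB (der_cos (der_id z)) (derB (der_cst 1 z) (derM (derX 2 (der_id z)) (der_cst _ z)))) _.
by rewrite /=; field.
have := der_ge0_le t0 (fun z _ => hd z); rewrite cos0 expr0n /= mul0r subr0 subrr; apply.
by move=> z /andP[z0 _]; rewrite subr_ge0 sin_le.
Qed.

Lemma sin_ge t : 0 <= t -> t - t ^+ 3 / 6 <= sin t.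
Proof.
move=> t0; rewrite -subr_ge0.
have hd (z : R) : der (fun z => sin z - (z - z ^+ 3 / 6)) z (cos z - (1 - z ^+ 2 / 2)).
apply: der_eq (derB (der_sin (der_id z)) (derB (der_id z) (derM (derX 3 (der_id z)) (der_cst _ z)))) _.
by rewrite /=; field.
have := der_ge0_le t0 (fun z _ => hd z); rewrite sin0 expr0n /= mul0r subr0 subrr; apply.
by move=> z _; rewrite subr_ge0 cos_ge.
Qed.

Lemma cos_le t : cos t <= 1 - t ^+ 2 / 2 + t ^+ 4 / 24.
Proof.
wlog t0 : t / 0 <= t.
move=> h; have [/h//|/ltW t0] := leP 0 t.
have := h (- t); rewrite cosN oppr_ge0 => /(_ t0).
have -> : (- t) ^+ 4 = t ^+ 4 by ring.
by rewrite sqrrN.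
rewrite -subr_ge0.
have hd (z : R) : der (fun z => (1 - z ^+ 2 / 2 + z ^+ 4 / 24) - cos z) z (sin z - (z - z ^+ 3 / 6)).
apply: der_eq (derB (derD (derB (der_cst 1 z) (derM (derX 2 (der_id z)) (der_cst _ z)))
 (derM (derX 4 (der_id z)) (der_cst _ z))) (der_cos (der_id z))) _.
by rewrite /=; field.
have := der_ge0_le t0 (fun z _ => hd z); rewrite cos0 !expr0n /= !mul0r subr0 addr0 subrr; apply.
by move=> z /andP[z0 _]; rewrite subr_ge0 sin_ge.
Qed.

Lemma sin_le5 t : 0 <= t -> sin t <= t - t ^+ 3 / 6 + t ^+ 5 / 120.
Proof.
move=> t0; rewrite -subr_ge0.
have hd (z : R) : der (fun z => (z - z ^+ 3 / 6 + z ^+ 5 / 120) - sin z) z (1 - z ^+ 2 / 2 + z ^+ 4 / 24 - cos z).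
apply: der_eq (derB (derD (derB (der_id z) (derM (derX 3 (der_id z)) (der_cst _ z)))
 (derM (derX 5 (der_id z)) (der_cst _ z))) (der_sin (der_id z))) _.
by rewrite /=; field.
have := der_ge0_le t0 (fun z _ => hd z); rewrite sin0 !expr0n /= !mul0r subr0 addr0 subrr; apply.
by move=> z _; rewrite subr_ge0 cos_le.
Qed.

Lemma cos_ge6 t : 0 <= t -> 1 - t ^+ 2 / 2 + t ^+ 4 / 24 - t ^+ 6 / 720 <= cos t.
Proof.
move=> t0; rewrite -subr_ge0.
have hd (z : R) : der (fun z => cos z - (1 - z ^+ 2 / 2 + z ^+ 4 / 24 - z ^+ 6 / 720)) z
(z - z ^+ 3 / 6 + z ^+ 5 / 120 - sin z).
apply: der_eq (derB (der_cos (der_id z)) (derB (derD (derB (der_cst 1 z)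
 (derM (derX 2 (der_id z)) (der_cst _ z)))
 (derM (derX 4 (der_id z)) (der_cst _ z))) (derM (derX 6 (der_id z)) (der_cst _ z)))) _.
by rewrite /=; field.
have := der_ge0_le t0 (fun z _ => hd z); rewrite cos0 !expr0n /= !mul0r !subr0 addr0 subrr; apply.
by move=> z /andP[z0 _]; rewrite subr_ge0 sin_le5.
Qed.

(** Cosine is bounded below by its Taylor polynomial of order six, which is still positive at
    313/200. This precision is what [key_large] consumes. *)
Lemma pihalf_gt : 313 / 200 < pi / 2 :> R.
Proof.
rewrite ltNge; apply/negP => h.
have p0 : 0 < pi / 2 :> R by rewrite divr_gt0 // pi_gt0.
have := cos_ge6 (ltW p0); rewrite cos_pihalf leNgt => /negP; apply.
move: (pi / 2) p0 h => z z0 hz.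
have -> : z ^+ 4 = (z ^+ 2) ^+ 2 by rewrite -exprM.
have -> : z ^+ 6 = (z ^+ 2) ^+ 3 by rewrite -exprM.
(* In w = z^2 the polynomial is a cubic; 49/20 is a rounded upper bound of (313/200)^2 at which it
   is still positive, and it decreases up to there. *)
have z2 : z ^+ 2 <= (313 / 200) ^+ 2 by rewrite ler_sqr ?nnegrE; lra.
have w0 : 0 < z ^+ 2 by rewrite exprn_gt0.
have r2 : (313 / 200 : R) ^+ 2 <= 49 / 20 by lra.
move: (z ^+ 2) (le_trans z2 r2) w0 => w hw w0.
have h1 : 49 / 20 - w >= 0 by lra.
have h2 : 0 <= 1 / 2 - (w + 49 / 20) / 24 + (w ^+ 2 + w * (49 / 20) + (49 / 20) ^+ 2) / 720.
by nra.
have -> : 1 - w / 2 + w ^+ 2 / 24 - w ^+ 3 / 720 =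
(49 / 20 - w) * (1 / 2 - (w + 49 / 20) / 24 + (w ^+ 2 + w * (49 / 20) + (49 / 20) ^+ 2) / 720)
+ (1 - (49 / 20) / 2 + (49 / 20) ^+ 2 / 24 - (49 / 20) ^+ 3 / 720) by field.
apply: ltr_wpDl; first exact: mulr_ge0.
lra.
Qed.

Lemma mul_cos_le_sin t : 0 <= t <= pi -> t * cos t <= sin t.
Proof.
move=> /andP[t0 tpi]; rewrite -subr_ge0.
have hd (z : R) : der (fun z => sin z - z * cos z) z (z * sin z).
apply: der_eq (derB (der_sin (der_id z)) (derM (der_id z) (der_cos (der_id z)))) _.
by ring.
have := der_ge0_le t0 (fun z _ => hd z); rewrite sin0 mul0r subrr; apply.
by move=> z /andP[z0 zt]; rewrite mulr_ge0 // sin_ge0_pi // z0 (le_trans zt).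
Qed.

Lemma cos_eq_cases T b : cos T = cos (2 * b) ->
exists j : int, T = 2 * b + j%:~R * (2 * pi) \/ T = - (2 * b) + j%:~R * (2 * pi).
Proof.
move=> h.
have : sin ((T - 2 * b) / 2) * sin ((T + 2 * b) / 2) = 0.
pose p := (T + 2 * b) / 2; pose m := (T - 2 * b) / 2.
have : cos (p + m) = cos (p - m).
 have -> : p + m = T by rewrite /p /m; field.
 by rewrite h; congr cos; rewrite /p /m; field.
by rewrite cosD cosB -/p -/m; lra.
have key (z : R) : sin (z / 2) = 0 -> exists j : int, z = j%:~R * (2 * pi).
move=> hz; apply: cos_eq1; have -> : z = z / 2 + z / 2 by field.
by rewrite cosD -!expr2 hz expr0n subr0 cos2sin2 hz expr0n subr0.
move=> /eqP; rewrite mulf_eq0 => /orP[/eqP/key[j hj]|/eqP/key[j hj]]; exists j.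
by left; lra.
by right; lra.
Qed.

End Trig.

(** * The limit mobility: bounds, Lipschitz constants and gaps between two angles *)

Section Anisotropy.
Context {R : realType}.
Implicit Types (s t u c b T e : R).

Definition l1dir s : R := `|cos s| + `|sin s|.

Lemma l1dir_sq s : 1 <= l1dir s ^+ 2 <= 2.
Proof.
rewrite /l1dir; have h := cos2Dsin2 s.
have hc : `|cos s| ^+ 2 = cos s ^+ 2 by rewrite real_normK // num_real.
have hs : `|sin s| ^+ 2 = sin s ^+ 2 by rewrite real_normK // num_real.
have c0 : 0 <= `|cos s| by []. have s0 : 0 <= `|sin s| by [].
rewrite -hc -hs in h; move: (`|cos s|) (`|sin s|) c0 s0 h => C S c0 s0 h.
have : 0 <= (C - S) ^+ 2 by exact: sqr_ge0.
have : 0 <= C * S by exact: mulr_ge0.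
by move=> h1 h2; apply/andP; split; nra.
Qed.

Lemma l1dir_ge1 s : 1 <= l1dir s.
Proof.
have /andP[h _] := l1dir_sq s.
have h0 : 0 <= l1dir s by rewrite addr_ge0.
nra.
Qed.

Lemma l1dir_per s : l1dir (s + pi / 2) = l1dir s.
Proof. by rewrite /l1dir cosDpihalf sinDpihalf normrN addrC. Qed.

(** By periodicity s' lies in the first quadrant, where the absolute values open. If t' leaves the
    quadrant, compare with its nearer end, where [l1dir] takes its minimal value 1. *)
Lemma l1dir_lip s t : `|l1dir s - l1dir t| <= `|s - t|.
Proof.
suff main s' t' : l1dir s' - l1dir t' <= `|s' - t'|.
by rewrite ler_norml main andbT lerNl opprB distrC.
have p0 : 0 < pi / 2 :> R by rewrite divr_gt0 // pi_gt0.
wlog h : s' t' / 0 <= s' <= pi / 2.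
move=> H; pose k := Num.floor (s' / (pi / 2)).
have h1 := floor_le (s' / (pi / 2)); rewrite -/k ler_pdivlMr // in h1.
have h2 := floorD1_gt (s' / (pi / 2)); rewrite -/k ltr_pdivrMr // intrD mulrDl mul1r in h2.
have := H (s' + (- k)%:~R * (pi / 2)) (t' + (- k)%:~R * (pi / 2)).
rewrite !(periodic_int l1dir_per) mulrNz mulNr.
have -> : s' - k%:~R * (pi / 2) - (t' - k%:~R * (pi / 2)) = s' - t' by ring.
by apply; lra.
have [s0 sp] := andP h.
pose F (z : R) := cos z + sin z.
have dF (z : R) : der F z (cos z - sin z).
apply: der_eq (derD (der_cos (der_id z)) (der_sin (der_id z))) _; ring.
have bF (z : R) : 0 <= z <= pi / 2 -> `|cos z - sin z| <= 1.
move=> /andP[z0 zp]; have c0 : 0 <= cos z by apply: cos_ge0_pihalf; rewrite zp andbT; lra.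
have s00 : 0 <= sin z by apply: sin_ge0_pi; rewrite z0 /=; lra.
have := cos_le1 z; have := sin_le1 z.
by rewrite ler_norml; lra.
have lF z1 z2 : 0 <= z1 <= pi / 2 -> 0 <= z2 <= pi / 2 -> `|F z1 - F z2| <= `|z1 - z2|.
wlog z12 : z1 z2 / z2 <= z1.
 by move=> H h1 h2; have [/H|/ltW/H] := leP z2 z1; [exact|rewrite distrC (distrC z1); exact].
move=> h1 h2; rewrite (ger0_norm (x := z1 - z2)) ?subr_ge0 // -[X in _ <= X]mul1r.
apply: (der_bound z12 (fun z _ => dF z)) => z hz; apply: bF; move: h1 h2 hz; lra.
have sE : l1dir s' = F s'.
rewrite /l1dir /F !ger0_norm //; first by apply: sin_ge0_pi; rewrite s0 /=; lra.
by apply: cos_ge0_pihalf; rewrite sp andbT; lra.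
have F0 : F 0 = 1 by rewrite /F cos0 sin0 addr0.
have Fp : F (pi / 2) = 1 by rewrite /F cos_pihalf sin_pihalf add0r.
have lt1 := l1dir_ge1 t'.
rewrite sE; have [t0|t0] := leP 0 t'; last first.
have := lF s' 0 h ltac:(lra); rewrite F0 subr0 (ger0_norm s0) ler_norml => /andP[_ hh].
by rewrite ger0_norm; lra.
have [tp|tp] := leP t' (pi / 2); last first.
have := lF s' (pi / 2) h ltac:(lra); rewrite Fp ler_norml => /andP[_ hh].
by rewrite (ler0_norm (x := s' - t')); [move: hh; rewrite ler0_norm; lra|lra].
have := lF s' t' h ltac:(lra); rewrite ler_norml => /andP[_ hh].
apply: le_trans hh; rewrite lerB // /F /l1dir; have := ler_norm (cos t'); have := ler_norm (sin t').
lra.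
Qed.

Lemma anisoE s : aniso s = (2 * l1dir s ^+ 2)^-1. Proof. by []. Qed.

Lemma aniso_bounds s : 1 / 4 <= aniso s <= 1 / 2.
Proof.
rewrite anisoE; have /andP[h1 h2] := l1dir_sq s.
have h0 : 0 < 2 * l1dir s ^+ 2 by lra.
apply/andP; split; first by rewrite -[X in _ <= X]div1r ler_pdivlMr //; lra.
by rewrite -[X in X <= _]div1r ler_pdivrMr //; lra.
Qed.

Lemma aniso_per s : aniso (s + pi / 2) = aniso s.
Proof. by rewrite !anisoE l1dir_per. Qed.

Lemma sqrt_aniso_bounds s : 1 / 2 <= Num.sqrt (aniso s) <= 283 / 400.
Proof.
have /andP[h1 h2] := aniso_bounds s.
have h0 : 0 <= Num.sqrt (aniso s) by exact: sqrtr_ge0.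
have hE : Num.sqrt (aniso s) ^+ 2 = aniso s by rewrite sqr_sqrtr //; lra.
by apply/andP; split; nra.
Qed.

(** The square root is (1 / sqrt 2) / [l1dir], and [l1dir] is 1-Lipschitz and at least 1. *)
Lemma sqrt_aniso_lip s t :
`|Num.sqrt (aniso s) - Num.sqrt (aniso t)| <= Num.sqrt 2^-1 * `|s - t|.
Proof.
have E r : Num.sqrt (aniso r) = Num.sqrt 2^-1 / l1dir r.
have l0 : 0 < l1dir r by apply: lt_le_trans (l1dir_ge1 r).
rewrite anisoE invfM sqrtrM ?invr_ge0 //; congr (_ * _).
by rewrite -exprVn sqrtr_sqr ger0_norm // invr_ge0 ltW.
rewrite !E -mulrBr normrM ger0_norm ?sqrtr_ge0 // ler_wpM2l ?sqrtr_ge0 //.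
have ls := l1dir_ge1 s; have lt := l1dir_ge1 t; apply: le_trans (l1dir_lip s t).
have ln : l1dir s != 0 by rewrite gt_eqF //; lra.
have tn : l1dir t != 0 by rewrite gt_eqF //; lra.
have -> : (l1dir s)^-1 - (l1dir t)^-1 = (l1dir t - l1dir s) / (l1dir s * l1dir t).
by field; rewrite ln tn.
rewrite normrM distrC -[X in _ <= X]mulr1 ler_wpM2l // ger0_norm; last first.
by rewrite invr_ge0 mulr_ge0 //; lra.
by rewrite invf_le1; nra.
Qed.

Lemma sqrt_dist (v w : R) : 0 <= v -> 1 / 4 <= w ->
`|Num.sqrt v - Num.sqrt w| <= 2 * `|v - w|.
Proof.
move=> v0 w0; have hv : Num.sqrt v ^+ 2 = v by rewrite sqr_sqrtr.
have hw : Num.sqrt w ^+ 2 = w by rewrite sqr_sqrtr //; lra.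
have sv : 0 <= Num.sqrt v by exact: sqrtr_ge0.
have sw0 : 0 <= Num.sqrt w by exact: sqrtr_ge0.
have sw : 1 / 2 <= Num.sqrt w by nra.
rewrite -{2}hv -{2}hw subr_sqr normrM mulrCA -[X in X <= _]mulr1 ler_wpM2l //.
by rewrite ger0_norm; lra.
Qed.

(** Equality of the cosines means that T is 2b or -2b modulo 2 pi; since h has period pi, the
    displacement may be read as 2b or as pi - 2b. *)
Lemma periodic_gap (h : R -> R) (K b th T : R) : (forall s, h (s + pi) = h s) ->
(forall s t, `|h s - h t| <= K * `|s - t|) -> 0 <= b <= pi / 2 -> cos T = cos (2 * b) ->
`|h th - h (th + T)| <= K * (2 * b) /\ `|h th - h (th + T)| <= K * (pi - 2 * b).
Proof.
move=> hp hl /andP[b0 bp] /cos_eq_cases[j hj].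
have E s : h (th + (s + j%:~R * (2 * pi))) = h (th + s).
by rewrite addrA; have -> : j%:~R * (2 * pi) = (j * 2)%:~R * pi :> R;
 [rewrite intrM; ring|rewrite (periodic_int hp)].
case: hj => ->; rewrite E.
split; first by apply: le_trans (hl _ _) _; rewrite opprD addNKr normrN ger0_norm //; lra.
have -> : th + 2 * b = (th + (2 * b - pi)) + pi by ring.
rewrite hp; apply: le_trans (hl _ _) _; rewrite opprD addNKr normrN ler0_norm; last lra.
by rewrite opprB.
split; first by apply: le_trans (hl _ _) _; rewrite opprD addNKr normrN normrN ger0_norm //; lra.
have -> : h (th + - (2 * b)) = h (th + (pi - 2 * b)).
by have -> : th + (pi - 2 * b) = (th + - (2 * b)) + pi by ring; rewrite hp.
by apply: le_trans (hl _ _) _; rewrite opprD addNKr normrN ger0_norm //; lra.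
Qed.

Lemma turning_ge b T : 0 <= b <= pi / 2 -> cos T = cos (2 * b) ->
`|T| = 2 * b \/ 2 * pi - 2 * b <= `|T|.
Proof.
move=> /andP[b0 bp] /cos_eq_cases[j hj].
have p0 := pi_gt0 R.
have [j0|j0] := eqVneq j 0.
by rewrite j0 in hj; left; case: hj => ->; rewrite mul0r addr0 ?normrN ger0_norm //; lra.
right; have : 1 <= `|j%:~R : R|.
by rewrite -intr_norm -[1]/(1%:~R) ler_int -gtz0_ge1 normr_gt0.
have nE : `|j%:~R * (2 * pi)| = `|j%:~R| * (2 * pi) :> R by rewrite normrM (ger0_norm (x := 2 * pi)) //; lra.
move=> j1; have j2 : 2 * pi <= `|j%:~R| * (2 * pi) :> R by rewrite ler_peMl //; lra.
rewrite -nE in j2; move: (j%:~R * (2 * pi)) j2 hj => J j2 hj; case: hj => ->.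
have := ler_normD (2 * b + J) (- (2 * b)); have -> : 2 * b + J - 2 * b = J by ring.
rewrite normrN (ger0_norm (x := 2 * b)); lra.
have := ler_normD (- (2 * b) + J) (2 * b); have -> : - (2 * b) + J + 2 * b = J by ring.
rewrite (ger0_norm (x := 2 * b)); lra.
Qed.

End Anisotropy.

Tactic Notation "lraw" ne_hyp_list(hs) := clear - hs; lra.
Tactic Notation "nraw" ne_hyp_list(hs) := clear - hs; nra.

(** * Mobility estimates at a contact: wide angles *)

Section KeyInequalities.
Context {R : realType}.
Implicit Types (a : R -> R) (s t u c b th T xi e K q y : R).

(** What a regularised mobility keeps in the limit: [K] is uniform but possibly large, [e] tends to
    0. An estimate with a numerical constant has to pass through [e] and the limit mobility. *)
Definition admissible a K e := [/\ forall s, 0 < a s, forall s, a (s + pi / 2) = a s,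
forall s t, `|Num.sqrt (a s) - Num.sqrt (a t)| <= K * `|s - t| &
forall s, `|a s - aniso s| <= e].

Lemma admissible_bounds a K e s : admissible a K e -> e <= 1 / 1000 ->
249 / 1000 <= a s <= 501 / 1000.
Proof.
move=> [_ _ _ /(_ s)]; rewrite ler_norml => /andP[h1 h2] he.
by have := aniso_bounds s; lra.
Qed.

Lemma admissible_sqrt a K e s : admissible a K e -> e <= 1 / 1000 ->
[/\ 49 / 100 <= Num.sqrt (a s), Num.sqrt (a s) <= 71 / 100 & Num.sqrt (a s) ^+ 2 = a s].
Proof.
move=> ha he; have /andP[h1 h2] := admissible_bounds s ha he.
have hE : Num.sqrt (a s) ^+ 2 = a s by rewrite sqr_sqrtr //; lra.
have h0 : 0 <= Num.sqrt (a s) by exact: sqrtr_ge0.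
by split => //; nra.
Qed.

(** The bounds with [K] are the Lipschitz hypothesis; the others go through the limit mobility at a
    cost of 2 e for each angle. The last one is the oscillation of the limit root: 83/400 = 283/400
    - 1/2. *)
Lemma admissible_gap a K e b th T : admissible a K e -> 0 <= b <= pi / 2 ->
cos T = cos (2 * b) ->
let D : R := `|Num.sqrt (a th) - Num.sqrt (a (th + T))| in
[/\ D <= K * (2 * b), D <= K * (pi - 2 * b),
 D <= Num.sqrt 2^-1 * (2 * b) + 4 * e, D <= Num.sqrt 2^-1 * (pi - 2 * b) + 4 * e &
 D <= 83 / 400 + 4 * e].
Proof.
move=> [a0 ap al ac] hb hT D.
have pipi (h : R -> R) : (forall s, h (s + pi / 2) = h s) -> forall s, h (s + pi) = h s.
move=> hh s; have -> : s + pi = s + pi / 2 + pi / 2 by field.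
by rewrite !hh.
have pa : forall s, Num.sqrt (a (s + pi)) = Num.sqrt (a s) by move=> s; rewrite (pipi a).
have pn : forall s, Num.sqrt (aniso (s + pi)) = Num.sqrt (aniso s).
by move=> s; rewrite (pipi (@aniso R)) //; exact: aniso_per.
have [h1 h2] := periodic_gap (h := fun s => Num.sqrt (a s)) th pa al hb hT.
have [h3 h4] := periodic_gap (h := fun s => Num.sqrt (aniso s)) th pn (@sqrt_aniso_lip R) hb hT.
have hd s : `|Num.sqrt (a s) - Num.sqrt (aniso s)| <= 2 * e.
have /andP[n1 n2] := aniso_bounds s.
apply: le_trans (sqrt_dist (ltW (a0 s)) n1) _; rewrite ler_wpM2l //; exact: ac.
have hD : D <= `|Num.sqrt (aniso th) - Num.sqrt (aniso (th + T))| + 4 * e.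
rewrite /D; move: (hd th) (hd (th + T)).
move: (Num.sqrt (a th) : R) (Num.sqrt (aniso th) : R) (Num.sqrt (a (th + T)) : R)
 (Num.sqrt (aniso (th + T)) : R) => v1 v2 v3 v4 g1 g2.
have := ler_normD (v1 - v2) (v2 - v4 + (v4 - v3)).
have := ler_normD (v2 - v4) (v4 - v3).
have -> : v1 - v2 + (v2 - v4 + (v4 - v3)) = v1 - v3 by ring.
rewrite (distrC v4) => ? ?; lra.
have h5 : `|Num.sqrt (aniso th) - Num.sqrt (aniso (th + T))| <= 83 / 400.
have := sqrt_aniso_bounds th; have := sqrt_aniso_bounds (th + T).
by rewrite ler_norml; lra.
split; [exact: h1|exact: h2|lra|lra|lra].
Qed.

(** The angle is acos c. The bounds [b * c <= sin b] and [(pi / 2 - b) * sin b <= c] are the same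
    inequality [mul_cos_le_sin], taken at b and at its complement. *)
Lemma beta_exists c : 0 <= c <= 1 -> exists b, [/\ 0 <= b <= pi / 2, cos b = c,
cos (2 * b) = 2 * c ^+ 2 - 1 & [/\ 0 <= sin b, sin b ^+ 2 = 1 - c ^+ 2, b * c <= sin b,
(pi / 2 - b) * sin b <= c & sin b <= b]].
Proof.
move=> /andP[c0 c1]; have hc : -1 <= c <= 1 by lra.
have bc : cos (acos c) = c by exact: acosK.
have b0 : 0 <= acos c by exact: acos_ge0.
have bpi : acos c <= pi by exact: acos_lepi.
have bp : acos c <= pi / 2.
rewrite leNgt; apply/negP => h.
have : cos (acos c) < cos (pi / 2).
 by rewrite ltr_cos // in_itv /=; have := pi_gt0 R; lra.
by rewrite bc cos_pihalf; lra.
have s0 : 0 <= sin (acos c) by apply: sin_ge0_pi; rewrite b0.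
have cs := cos2Dsin2 (acos c); rewrite bc in cs.
exists (acos c); split => //; first by rewrite b0.
have -> : 2 * acos c = acos c + acos c by ring.
by rewrite cosD bc -!expr2; lra.
split => //; first lra.
- by rewrite -{2}bc; apply: mul_cos_le_sin; rewrite b0.
- have h : 0 <= pi / 2 - acos c <= pi by lra.
have := mul_cos_le_sin h.
by rewrite cosB sinB cos_pihalf sin_pihalf mul0r add0r mul1r mul0r subr0 mul1r bc.
- exact: sin_le.
Qed.

(* Wide-angle regime of the chord-arc estimate: tangents at the ends of the chord nearly
antiparallel and nearly orthogonal to it. *)
Lemma key_wide a K e c th T xi : admissible a K e -> 0 <= K -> 0 <= e <= 1 / 1000 ->
0 <= c <= 1 / 100 -> cos T = 2 * c ^+ 2 - 1 ->
let bp : R := Num.sqrt (a th) in let bq : R := Num.sqrt (a (th + T)) in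
[/\ (bp - bq) ^+ 2 <= (3 * K * c) ^+ 2, 200 * e <= c -> (bp - bq) ^+ 2 <= 21 / 10 * c ^+ 2,
 235 / 100 <= a xi * T ^+ 2 & (bp + bq) ^+ 2 <= 3].
Proof.
move=> ha K0 /andP[e0 e1] /andP[c0 c1] hT bp bq.
have [b [hb bc b2 [s0 s2 _ hd _]]] := beta_exists (ltac:(lra) : 0 <= c <= 1).
rewrite -b2 in hT.
have [g1 g2 g3 g4 g5] := admissible_gap th ha hb hT.
rewrite -/bp -/bq in g1 g2 g3 g4 g5.
have [p1 p2 p3] := admissible_sqrt th ha e1.
have [q1 q2 q3] := admissible_sqrt (th + T) ha e1.
rewrite -/bp in p1 p2 p3; rewrite -/bq in q1 q2 q3.
have Dsq : (bp - bq) ^+ 2 = `|bp - bq| ^+ 2 by rewrite real_normK // num_real.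
have D0 : 0 <= `|bp - bq| by [].
have [d dE] : exists d, d = pi / 2 - b by exists (pi / 2 - b).
have sb : 999 / 1000 <= sin b.
by have c2 : c ^+ 2 <= 1 / 10000; [nraw c0 c1|nraw s0 s2 c2].
have d0 : 0 <= d by rewrite dE; case/andP: hb => _; rewrite subr_ge0.
have dc : d <= 1002 / 1000 * c by rewrite -dE in hd; nraw d0 sb hd.
have dE' : pi - 2 * b = 2 * d by rewrite dE; field.
rewrite dE' in g2 g4.
have h2 : Num.sqrt 2^-1 ^+ 2 = 2^-1 :> R by rewrite sqr_sqrtr // invr_ge0.
have h20 : 0 <= Num.sqrt 2^-1 :> R by exact: sqrtr_ge0.
move: (Num.sqrt 2^-1 : R) h2 h20 g3 g4 => r h2 h20 g3 g4.
move: (`|bp - bq|) Dsq D0 g1 g2 g3 g4 g5 => D Dsq D0 g1 g2 g3 g4 g5.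
split.
- rewrite Dsq; apply: lerXn2r; rewrite ?nnegrE //; first by rewrite !mulr_ge0.
have : K * (2 * d) <= K * (3 * c) by rewrite ler_wpM2l //; lraw dc c0.
by move=> h; apply: le_trans g2 _; rewrite mulrAC -mulrA mulrC in h *; lraw h.
- move=> ec; rewrite Dsq.
have s71 : r <= 708 / 1000 by nraw h2 h20.
(* Here d = pi / 2 - b is at most 1.002 c, so the limit Lipschitz constant gives about sqrt 2 times
   c, and 200 e <= c pays for the error 4 e; the square of 1.44 is below 2.1. *)
have D1 : D <= 144 / 100 * c.
 apply: le_trans g4 _.
 have : r * (2 * d) <= 708 / 1000 * (2 * (1002 / 1000 * c)).
 by apply: ler_pM; [exact: h20|rewrite mulr_ge0|exact: s71|rewrite ler_wpM2l].
 by move=> h; lraw h ec c0.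
by nraw D0 D1 c0.
- have b0 : 0 <= b by case/andP: hb.
have T2 : (2 * b) ^+ 2 <= T ^+ 2.
 have -> : T ^+ 2 = `|T| ^+ 2 by rewrite real_normK // num_real.
 have [->//|h] := turning_ge hb hT.
 apply: lerXn2r; rewrite ?nnegrE //; first by rewrite mulr_ge0.
 by apply: le_trans h; case/andP: hb => _ h; lraw h.
have bb : 155 / 100 <= b by have p := @pihalf_gt R; rewrite dE in dc; lraw dc c1 p.
have /andP[x1 x2] := admissible_bounds xi ha e1.
have b2' : 24 / 10 <= b ^+ 2 by nraw bb.
have : 249 / 1000 * (2 * b) ^+ 2 <= a xi * T ^+ 2.
 by apply: ler_pM; [clear; lra|exact: sqr_ge0|exact: x1|exact: T2].
by rewrite exprMn => h; lraw h b2'.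
- by nraw p1 p2 q1 q2.
Qed.

End KeyInequalities.

(** * Mobility estimates at a contact: slopes bounded below *)

Section KeyNarrow.
Context {R : realType}.
Implicit Types (a : R -> R) (s t u c b th T xi e K q y : R).

Lemma sq_le (v w : R) : 0 <= v -> v <= w -> v ^+ 2 <= w ^+ 2.
Proof. by move=> v0 vw; apply: lerXn2r => //; rewrite nnegrE // (le_trans v0). Qed.

Lemma cube_mono (C y b : R) : 0 <= C -> 0 <= y <= b -> 3 * C * b <= 2 ->
y ^+ 2 - C * y ^+ 3 <= b ^+ 2 - C * b ^+ 3.
Proof.
move=> C0 /andP[y0 yb] h; rewrite -subr_ge0.
have -> : b ^+ 2 - C * b ^+ 3 - (y ^+ 2 - C * y ^+ 3) =
(b - y) * (b + y - C * (b ^+ 2 + b * y + y ^+ 2)) by ring.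
apply: mulr_ge0; first lra.
have h1 : b ^+ 2 + b * y + y ^+ 2 <= 3 / 2 * b * (b + y).
have : 0 <= (b - y) * (b + 2 * y) by rewrite mulr_ge0; lra.
by move=> ?; nra.
have : C * (b ^+ 2 + b * y + y ^+ 2) <= C * (3 / 2 * b * (b + y)) by rewrite ler_wpM2l.
have : 0 <= (2 - 3 * C * b) * (b + y) by rewrite mulr_ge0; lra.
move=> h2 h3; nraw h2 h3.
Qed.

Lemma key_small (K C S w D b y c q : R) : 0 <= K -> C = 20 * K + 1 ->
98 / 100 <= S -> S / 2 - 2 * K * b <= w -> 0 <= D <= K * (2 * b) -> 0 < y <= b ->
K * b <= 1 / 100 -> 3 * C * b <= 2 -> 9 / 10 <= c ^+ 2 -> q <= y ^+ 2 - C * y ^+ 3 ->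
D ^+ 2 * y ^+ 2 + S ^+ 2 * q * c ^+ 2 < w ^+ 2 * (2 * b) ^+ 2 * c ^+ 2.
Proof.
move=> K0 CE S0 hw /andP[D0 hD] /andP[y0 yb] Kb Cb c2 hq.
have b0 : 0 < b by exact: lt_le_trans yb.
have C0 : 0 <= C by rewrite CE; lraw K0.
have hq' : q <= b ^+ 2 - C * b ^+ 3.
by apply: le_trans hq (cube_mono C0 _ Cb); rewrite ltW.
have h1 : D ^+ 2 <= 4 * K ^+ 2 * b ^+ 2.
have -> : 4 * K ^+ 2 * b ^+ 2 = (K * (2 * b)) ^+ 2 by ring.
by apply: lerXn2r; rewrite ?nnegrE // !mulr_ge0 // ltW.
have h2 : y ^+ 2 <= b ^+ 2 by apply: lerXn2r; rewrite ?nnegrE // ltW.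
have h3 : D ^+ 2 * y ^+ 2 <= 4 * K ^+ 2 * b ^+ 4.
have -> : 4 * K ^+ 2 * b ^+ 4 = 4 * K ^+ 2 * b ^+ 2 * b ^+ 2 by ring.
by apply: ler_pM => //; exact: sqr_ge0.
have h4 : (S / 2 - 2 * K * b) ^+ 2 <= w ^+ 2.
have z0 : 0 <= S / 2 - 2 * K * b by lraw S0 Kb.
by apply: lerXn2r; rewrite ?nnegrE //; exact: le_trans hw.
have h5 : (S - 4 * K * b) ^+ 2 * b ^+ 2 <= w ^+ 2 * (2 * b) ^+ 2.
have -> : (S - 4 * K * b) ^+ 2 * b ^+ 2 = (S / 2 - 2 * K * b) ^+ 2 * (2 * b) ^+ 2 by field.
by rewrite ler_wpM2r // sqr_ge0.
have h6 : S ^+ 2 * q <= S ^+ 2 * (b ^+ 2 - C * b ^+ 3) by rewrite ler_wpM2l // sqr_ge0.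
have h7 : 0 < S * b ^+ 3 by rewrite mulr_gt0 // ?exprn_gt0 //; lraw S0.
have h8 : 8 * K + 1 / 2 <= S * C.
rewrite CE; have : 98 / 100 * (20 * K + 1) <= S * (20 * K + 1).
 by rewrite ler_wpM2r // -CE.
by move=> h; lraw h K0.
have h9 : 8 * K * (S * b ^+ 3) < S * C * (S * b ^+ 3).
by rewrite ltr_pM2r //; lraw h8.
have Kb4 : 0 <= K ^+ 2 * b ^+ 4 by rewrite mulr_ge0 // ?sqr_ge0 // exprn_ge0 // ltW.
have h10 : 5 * (K ^+ 2 * b ^+ 4) + S ^+ 2 * q < w ^+ 2 * (2 * b) ^+ 2.
apply: lt_le_trans h5.
have -> : (S - 4 * K * b) ^+ 2 * b ^+ 2 = S ^+ 2 * b ^+ 2 - 8 * K * (S * b ^+ 3) + 16 * (K ^+ 2 * b ^+ 4) by ring.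
move: h6; have -> : S ^+ 2 * (b ^+ 2 - C * b ^+ 3) = S ^+ 2 * b ^+ 2 - S * C * (S * b ^+ 3) by ring.
by move=> h6; lraw h6 h9 Kb4.
have c20 : 0 < c ^+ 2 by lraw c2.
have : (5 * (K ^+ 2 * b ^+ 4) + S ^+ 2 * q) * c ^+ 2 < w ^+ 2 * (2 * b) ^+ 2 * c ^+ 2 by rewrite ltr_pM2r.
have : 4 * K ^+ 2 * b ^+ 4 <= 5 * (K ^+ 2 * b ^+ 4) * c ^+ 2.
have : 9 / 10 * (5 * (K ^+ 2 * b ^+ 4)) <= c ^+ 2 * (5 * (K ^+ 2 * b ^+ 4)).
 by rewrite ler_wpM2r // mulr_ge0.
by move=> h; lraw h Kb4.
move=> g1 g2; move: g2; rewrite mulrDl => g2; lraw g1 g2 h3.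
Qed.

(** Here q is negligible and D^2 y^2 < b^2 c^2, up to errors of order e, must come from the limit
    mobility; the use is with d = pi / 2 - b. For d <= 0.15, D <= sqrt 2 d and d y <= c reduce it to
    b > sqrt 2, and b >= 1.415. For b <= 0.15, D is at most 0.22. In between, D <= 0.2085 is beaten
    by b d >= 0.212. The first and the last comparison rest on b + d > 1.565. *)
Lemma key_large (nu e r D b d y c q A y0 : R) :
0 < nu <= 1 -> 0 <= e <= nu / 100 / 1000 -> 0 <= r -> r ^+ 2 = 2^-1 -> 0 <= D ->
D <= r * (2 * b) + 4 * e -> D <= r * (2 * d) + 4 * e -> D <= 83 / 400 + 4 * e ->
0 <= b -> 0 <= d -> 313 / 200 < b + d <= 2 -> d * y <= c -> 0 <= y <= b -> y <= 1 -> nu <= c <= 1 ->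
1 - b ^+ 2 / 2 <= c -> 0 < y0 <= y -> y0 <= 1 / 20 -> 0 <= q <= y0 ^+ 2 / 100 ->
(1 - 4 * e) * b ^+ 2 <= A ->
D ^+ 2 * y ^+ 2 + 3 * q * c ^+ 2 < A * c ^+ 2.
Proof.
move=> /andP[n0 n1] /andP[e0 e1] r0 r2 D0 D1 D2 D3 b0 d0 /andP[bd bd2] dy /andP[yy yb] y1 /andP[c0 c1] cb
/andP[z0 zy] z1 /andP[q0 q1] hA.
have e1' : e <= 1 / 100 / 100 by lraw e1 n1.
have cp : 0 < c by exact: lt_le_trans c0.
have c2 : 0 < c ^+ 2 by rewrite exprn_gt0.
have r1 : 2 * r <= 99 / 70 by nraw r0 r2.
have q2 : q <= 1 / 200 / 200 by nraw q1 z0 z1.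
suff : D ^+ 2 * y ^+ 2 < (A - 3 * q) * c ^+ 2 by rewrite mulrBl; lra.
have [hd|hd] := leP d (15 / 100).
have h1 : D * y <= c * (99 / 70 + 1 / 5000).
 have g1 : D * y <= (r * (2 * d) + 4 * e) * y by rewrite ler_wpM2r.
 have g2 : 2 * r * (d * y) <= 2 * r * c by rewrite ler_wpM2l // mulr_ge0.
 have g3 : 4 * e * y <= 4 * e by rewrite ler_piMr // mulr_ge0.
 have g4 : 2 * r * c <= 99 / 70 * c by rewrite ler_wpM2r // ltW.
 have g5 : e <= c / 100 / 1000 by lraw e1 c0.
 move: g1; have -> : (r * (2 * d) + 4 * e) * y = 2 * r * (d * y) + 4 * e * y by ring.
 by move=> g1; lraw g1 g2 g3 g4 g5 cp.
have h2 : (D * y) ^+ 2 <= (c * (99 / 70 + 1 / 5000)) ^+ 2.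
 by apply: sq_le h1; rewrite mulr_ge0.
have hb : 283 / 200 <= b by lraw bd hd.
have b2 : (283 / 200) ^+ 2 <= b ^+ 2 by apply: sq_le hb; clear; lra.
have A1 : 2001 / 1000 <= A by apply: le_trans hA; nraw b2 e0 e1'.
move: h2; rewrite !exprMn => h2; apply: le_lt_trans h2 _.
by rewrite mulrC (ltr_pM2r c2); lraw A1 q2.
have d15 : 0 < d by lraw hd.
have [hb|hb] := leP b (15 / 100).
have D4 : D <= 22 / 100 by nraw D1 r1 hb b0 r0 e1'.
have b2 : b ^+ 2 <= 23 / 1000 by nraw hb b0.
have c9 : 98 / 100 <= c by lraw cb b2.
have c99 : 96 / 100 <= c ^+ 2 by nraw c9.
have y2 : y ^+ 2 <= b ^+ 2 by apply: lerXn2r; rewrite ?nnegrE.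
have D44 : D ^+ 2 <= 5 / 100 by nraw D4 D0.
have h1 : D ^+ 2 * y ^+ 2 <= 5 / 100 * b ^+ 2.
 by apply: ler_pM; [exact: sqr_ge0|exact: sqr_ge0|exact: D44|exact: y2].
have yz : y0 ^+ 2 <= b ^+ 2.
 by apply: lerXn2r; rewrite ?nnegrE //; [exact: ltW|exact: le_trans yb].
have q3 : q <= b ^+ 2 / 100 by lraw yz q1.
have b20 : 0 < b ^+ 2 by apply: lt_le_trans yz; rewrite exprn_gt0.
have A1 : 9 / 10 * b ^+ 2 <= A by apply: le_trans hA; nraw b20 e0 e1'.
have A2 : 8 / 10 * b ^+ 2 <= A - 3 * q by lraw A1 q3 b20.
have A3 : 8 / 10 * b ^+ 2 * (96 / 100) <= (A - 3 * q) * c ^+ 2.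
 by apply: ler_pM; [lraw b20|clear; lra|exact: A2|exact: c99].
by lraw h1 A3 b20.
have D4 : D <= 417 / 2000 by lraw D3 e1'.
have bd3 : 212 / 1000 <= b * d.
have : 0 <= (b - 15 / 100) * (d - 15 / 100) by rewrite mulr_ge0 // subr_ge0 ltW.
by rewrite mulrBl !mulrBr => h; lraw h bd.
have bd4 : 44 / 1000 <= b ^+ 2 * d ^+ 2 by rewrite -exprMn; nraw bd3.
have A1 : (44 / 1000) * (999 / 1000) <= A * d ^+ 2.
have : (1 - 4 * e) * b ^+ 2 * d ^+ 2 <= A * d ^+ 2 by rewrite ler_wpM2r // sqr_ge0.
by move=> h; apply: le_trans h; rewrite -mulrA; nraw bd4 e0 e1'.
have d20 : 0 < d ^+ 2 by rewrite exprn_gt0.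
have d24 : d ^+ 2 <= 4 by nraw bd2 b0 d0.
rewrite -(ltr_pM2r d20).
have h1 : (d * y) ^+ 2 <= c ^+ 2.
by apply: lerXn2r; rewrite ?nnegrE //; [rewrite mulr_ge0|exact: ltW].
have h2 : D ^+ 2 * y ^+ 2 * d ^+ 2 <= (417 / 2000) ^+ 2 * c ^+ 2.
rewrite -mulrA -exprMn [y * d]mulrC; apply: ler_pM; [exact: sqr_ge0|exact: sqr_ge0|exact: sq_le|exact: h1].
apply: le_lt_trans h2 _; rewrite [X in _ < X]mulrAC (ltr_pM2r c2) mulrBl.
have : 3 * q * d ^+ 2 <= 3 * (1 / 200 / 200) * 4.
by apply: ler_pM; [lraw q0|exact: ltW|lraw q2|exact: d24].
by move=> h; lraw h A1.
Qed.

End KeyNarrow.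

Section KeyAll.
Context {R : realType}.
Implicit Types (a : R -> R) (s t u c b th T xi e K q y : R).

(** Here y = sin beta. Small y is the regime of [K] and of the cubic reserve, larger y that of the
    limit mobility. The constants C2, y0 and kap depend on [K] alone, and only the tolerance e0
    depends on [nu]. *)
Lemma key_all K nu : 0 <= K -> 0 < nu <= 1 ->
exists C2 y0 kap e0 : R, [/\ 0 <= C2, 0 < y0, y0 * (10 * (C2 + 1)) <= 1, 0 < kap &
0 < e0 <= 1 / 1000 /\
forall a e, admissible a K e -> 0 <= e <= e0 -> forall c y th T xi q,
 nu <= c < 1 -> 0 <= y -> y ^+ 2 = 1 - c ^+ 2 -> cos T = 2 * c ^+ 2 - 1 ->
 `|xi - th| <= `|T| -> `|xi - (th + T)| <= `|T| -> 0 <= q ->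
 (y < y0 -> q <= y ^+ 2 - C2 * y ^+ 3) -> (y0 <= y -> q <= kap) ->
 forall D S : R, D = Num.sqrt (a th) - Num.sqrt (a (th + T)) ->
 S = Num.sqrt (a th) + Num.sqrt (a (th + T)) ->
 D ^+ 2 * y ^+ 2 + S ^+ 2 * q * c ^+ 2 < a xi * T ^+ 2 * c ^+ 2].
Proof.
move=> K0 /andP[nu0 nu1].
have [C2 C2E] : exists C2, C2 = 20 * K + 1 by exists (20 * K + 1).
have C0 : 1 <= C2 by lraw C2E K0.
have [y0 y0E] : exists y0, y0 = (10 * (C2 + 1))^-1 by exists (10 * (C2 + 1))^-1.
have C1 : 0 < 10 * (C2 + 1) by lraw C0.
have y00 : 0 < y0 by rewrite y0E invr_gt0.
have y0C : y0 * (10 * (C2 + 1)) = 1 by rewrite y0E mulVf // gt_eqF.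
exists C2, y0, (y0 ^+ 2 / 100), (nu / 100 / 1000).
split; [lraw C0|by []|by rewrite y0C|by rewrite divr_gt0 // exprn_gt0|].
split; first lraw nu0 nu1.
move=> a e ha /andP[e0 e1] c y th T xi q /andP[c0 c1] hy yE hT hx1 hx2 q0 hq1 hq2 D S DE SE.
have e1' : e <= 1 / 1000 by lraw e1 nu1.
have cp : 0 < c by exact: lt_le_trans c0.
have c01 : 0 <= c <= 1 by rewrite !ltW.
have [b [hb bc b2 [s0 s2 bcs dbs sb]]] := beta_exists c01.
have sy : sin b = y.
apply/eqP; rewrite -(eqrXn2 (n := 2)) // s2 yE //.
rewrite sy in bcs dbs sb; rewrite -b2 in hT.
have /andP[b0 bp] := hb.
have [g1 g2 g3 g4 g5] := admissible_gap th ha hb hT; rewrite -DE in g1 g2 g3 g4 g5.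
have [p1 p2 p3] := admissible_sqrt th ha e1'.
have [q1 q2 q3] := admissible_sqrt (th + T) ha e1'.
have [x1 x2 x3] := admissible_sqrt xi ha e1'.
have Dn : D ^+ 2 = `|D| ^+ 2 by rewrite real_normK // num_real.
have yy : 0 < y.
rewrite lt_neqAle hy andbT; apply/eqP => y0'; move: yE; rewrite -y0' expr0n /=.
move=> h; have h' : c ^+ 2 < 1 by rewrite expr_lt1 // ltW.
by lraw h h'.
have T2b : 2 * b <= `|T|.
have [->//|h] := turning_ge hb hT.
by apply: le_trans h; lraw bp.
have TT : T ^+ 2 = `|T| ^+ 2 by rewrite real_normK // num_real.
have /andP[ax1 ax2] := admissible_bounds xi ha e1'.
have bb0 : 0 <= 2 * b by lraw b0.
have T2 : (2 * b) ^+ 2 <= T ^+ 2 by rewrite TT; apply: lerXn2r; rewrite ?nnegrE.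
have [yl|yl] := ltP y y0.
have y20 : y0 <= 1 / 20 by nraw y0C C0 y00.
have y2s : y ^+ 2 <= 1 / 400 by nraw hy yl y20.
have c9 : 99 / 100 <= c ^+ 2 by lraw y2s yE.
have c99 : 99 / 100 <= c by nraw c9 cp c1.
have by2 : b <= 102 / 100 * y by nraw bcs c99 b0.
have hq := hq1 yl.
have [TE|Tbig] := turning_ge hb hT.
 rewrite -x3 TT TE Dn.
 apply: (key_small K0 C2E) => //.
 - by rewrite SE; lraw p1 q1.
 - have k1 : Num.sqrt (a xi) >= Num.sqrt (a th) - K * (2 * b).
  have [_ _ /(_ xi th) al _] := ha; rewrite TE in hx1.
  have : K * `|xi - th| <= K * (2 * b) by rewrite ler_wpM2l.
  by move: al; rewrite ler_norml => /andP[al _] h; lraw al h.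
 have k2 : Num.sqrt (a xi) >= Num.sqrt (a (th + T)) - K * (2 * b).
  have [_ _ /(_ xi (th + T)) al _] := ha; rewrite TE in hx2.
  have : K * `|xi - (th + T)| <= K * (2 * b) by rewrite ler_wpM2l.
  by move: al; rewrite ler_norml => /andP[al _] h; lraw al h.
 by rewrite SE; lraw k1 k2.
 - by rewrite normr_ge0.
 - by rewrite yy.
 - have : K * b <= K * (102 / 100 * y0) by rewrite ler_wpM2l //; lraw by2 yl.
 have : K * y0 <= 1 / 200 by nraw y0C C2E K0 y00.
 by move=> h1 h2; lraw h1 h2.
 - have : C2 * b <= C2 * (102 / 100 * y0) by rewrite ler_wpM2l //; [lraw C0|lraw by2 yl].
 by move=> h; nraw h y0C y00.
 - lraw c9.
(* The tangent makes an extra turn, |T| >= 2 pi - 2 b >= pi, so rough bounds on D and S suffice. *)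
have T3 : 3 <= `|T|.
 by have p := @pihalf_gt R; apply: le_trans Tbig; lraw p bp.
have T9 : 9 <= T ^+ 2 by rewrite TT; nraw T3.
have R1 : 249 / 1000 * 9 <= a xi * T ^+ 2 by apply: ler_pM; [clear; lra|clear; lra|exact: ax1|exact: T9].
have R2 : 249 / 1000 * 9 * (99 / 100) <= a xi * T ^+ 2 * c ^+ 2.
 by apply: ler_pM; [clear; lra|clear; lra|exact: R1|exact: c9].
have y3 : 0 <= C2 * y ^+ 3 by rewrite mulr_ge0 //; [lraw C0|rewrite exprn_ge0].
have q4 : q <= 1 / 400 by lraw hq y3 y2s.
have D5 : D ^+ 2 <= 1 by rewrite DE; nraw p1 p2 q1 q2.
have S5 : S ^+ 2 <= 3 by rewrite SE; nraw p1 p2 q1 q2.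
have L1 : D ^+ 2 * y ^+ 2 <= 1 * (1 / 400) by apply: ler_pM; rewrite ?sqr_ge0.
have L2 : S ^+ 2 * q <= 3 * (1 / 400) by apply: ler_pM; rewrite ?sqr_ge0.
have c2 : c ^+ 2 <= 1 by rewrite expr_le1 // ltW.
have L3 : S ^+ 2 * q * c ^+ 2 <= 3 * (1 / 400) * 1.
 by apply: ler_pM; rewrite ?sqr_ge0 // mulr_ge0 // sqr_ge0.
by lraw L1 L3 R2.
have h2 : Num.sqrt 2^-1 ^+ 2 = 2^-1 :> R by rewrite sqr_sqrtr // invr_ge0.
have h20 : 0 <= Num.sqrt 2^-1 :> R by exact: sqrtr_ge0.
have S3 : S ^+ 2 <= 3 by rewrite SE; nraw p1 p2 q1 q2.
have dE : pi - 2 * b = 2 * (pi / 2 - b) by field.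
rewrite dE in g4.
have /andP[ph1 ph2] := @pihalf_02 R.
have q5 := hq2 yl.
have main : `|D| ^+ 2 * y ^+ 2 + 3 * q * c ^+ 2 < a xi * T ^+ 2 * c ^+ 2.
apply: (@key_large _ nu e (Num.sqrt 2^-1) `|D| b (pi / 2 - b) y c q _ y0) => //.
- by rewrite nu0.
- by rewrite e0.
- lraw bp.
- by have p := @pihalf_gt R; apply/andP; split; lraw p ph2.
- by rewrite hy.
- by rewrite -sy sin_le1.
- by rewrite c0 ltW.
- by rewrite -bc cos_ge.
- by rewrite y00.
- by nraw y0C C0 y00.
- by rewrite q0.
- have [_ _ _ /(_ xi)] := ha; rewrite ler_norml => /andP[z1 _].
 have /andP[z2 _] := aniso_bounds xi.
 have : (1 / 4 - e) * (2 * b) ^+ 2 <= a xi * T ^+ 2.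
 by apply: ler_pM; [lraw e1'|exact: sqr_ge0|lraw z1 z2|exact: T2].
 by move=> h; lraw h.
rewrite Dn; apply: le_lt_trans main; rewrite lerD2l.
by rewrite ler_wpM2r ?sqr_ge0 // ler_wpM2r.
Qed.

End KeyAll.

(** * The concave profile and its differential inequality *)

Section Profile.
Context {R : realType}.
Implicit Types (s m x z q y c : R).

Lemma expN_bounds x : 0 <= x ->
[/\ 1 - x <= expR (- x), expR (- x) <= 1, expR (- x) <= 1 - x + x ^+ 2 / 2 &
 1 - x + x ^+ 2 / 2 - x ^+ 3 / 6 <= expR (- x)].
Proof.
move=> x0.
have hN (z : R) : der (fun z => expR (- z)) z (- expR (- z)).
by apply: der_eq (der_exp (derN (der_id z))) _; rewrite mulrN1.
have e1 (z : R) : 0 <= z -> expR (- z) <= 1.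
by move=> z0; rewrite -expR0 ler_expR oppr_le0.
have e2 (z : R) : 0 <= z -> 1 - z <= expR (- z).
move=> z0; rewrite -subr_ge0.
have hd (w : R) : der (fun w => expR (- w) - (1 - w)) w (1 - expR (- w)).
 by apply: der_eq (derB (hN w) (derB (der_cst 1 w) (der_id w))) _; ring.
have := der_ge0_le z0 (fun w _ => hd w); rewrite !oppr0 expR0 addr0 subrr; apply.
by move=> w /andP[w0 _]; rewrite subr_ge0 e1.
have e3 (z : R) : 0 <= z -> expR (- z) <= 1 - z + z ^+ 2 / 2.
move=> z0; rewrite -subr_ge0.
have hd (w : R) : der (fun w => 1 - w + w ^+ 2 / 2 - expR (- w)) w (expR (- w) - (1 - w)).
 apply: der_eq (derB (derD (derB (der_cst 1 w) (der_id w)) (derM (derX 2 (der_id w)) (der_cst _ w))) (hN w)) _.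
 by rewrite /=; field.
have := der_ge0_le z0 (fun w _ => hd w); rewrite !oppr0 expR0 expr0n /= mul0r !addr0 subrr; apply.
by move=> w /andP[w0 _]; rewrite subr_ge0 e2.
split; [exact: e2|exact: e1|exact: e3|].
rewrite -subr_ge0.
have hd (w : R) : der (fun w => expR (- w) - (1 - w + w ^+ 2 / 2 - w ^+ 3 / 6)) w (1 - w + w ^+ 2 / 2 - expR (- w)).
apply: der_eq (derB (hN w) (derB (derD (derB (der_cst 1 w) (der_id w))
 (derM (derX 2 (der_id w)) (der_cst _ w))) (derM (derX 3 (der_id w)) (der_cst _ w)))) _.
by rewrite /=; field.
have := der_ge0_le x0 (fun w _ => hd w); rewrite !oppr0 expR0 !expr0n /= !mul0r !oppr0 !addr0 subrr; apply.
by move=> w /andP[w0 _]; rewrite subr_ge0 e3.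
Qed.

(** The deficits x^2 / 3 and x / 3 below x are the room that [profile_choice] spends. *)
Lemma exp_sat x : 0 <= x -> (x <= 1 -> 1 - expR (- x) <= x * (1 - x / 3)) /\
(1 <= x -> 1 - expR (- x) <= 2 / 3 * x).
Proof.
move=> x0; have [e1 e2 e3 e4] := expN_bounds x0; split=> [x1|x1].
have h : 0 <= x ^+ 2 * (1 - x) / 6 by rewrite divr_ge0 // mulr_ge0 ?sqr_ge0 // subr_ge0.
by nraw e4 h.
have [_ _ f3 f4] := expN_bounds (@ler01 R).
have h1 : expR (- (1 : R)) <= 1 / 2 by lraw f3.
have h2 : 1 / 3 <= expR (- (1 : R)) by lraw f4.
have hd (w : R) : der (fun w => 2 / 3 * w - (1 - expR (- w))) w (2 / 3 - expR (- w)).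
apply: der_eq (derB (derM (der_cst _ w) (der_id w)) (derB (der_cst 1 w) (der_exp (derN (der_id w))))) _.
by ring.
have h := der_ge0_le x1 (fun w _ => hd w).
rewrite -subr_ge0; apply: le_trans (h _); first by lraw h2.
move=> w /andP[w0 _]; have : expR (- w) <= expR (- 1) by rewrite ler_expR lerN2.
by move=> h3; lraw h3 h1.
Qed.

(* [1 + |s|] instead of [1 + s] only makes the profile a total continuous function. *)
Definition lnp s : R := ln (1 + `|s|).
(** The slope of the profile. With x = ln (1 + s), its square is exp (- m^2 x^2) while the relative
    concavity [profq] is m^2 x (1 - exp (- x)): the latter stays below 1 - slope^2 with room of
    cubic order, as [key_all] demands. *)
Definition prof1 m s : R := expR (- (m ^+ 2 / 2 * lnp s ^+ 2)).
Definition prof m : R -> R := prim (prof1 m).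
Definition prof2 m s : R := - (m ^+ 2 * lnp s / (1 + s)) * prof1 m s.
(** This is - s psi'' / psi' for the profile psi ([prof2E]). *)
Definition profq m s : R := m ^+ 2 * lnp s * (s / (1 + s)).

Lemma lnp_ge0 s : 0 <= lnp s.
Proof. by apply: ln_ge0; rewrite lerDl. Qed.

Lemma lnp_der s : 0 < s -> der lnp s (1 + s)^-1.
Proof.
move=> s0.
have h : der (fun z : R => ln (1 + z)) s (1 + s)^-1.
by apply: der_eq (der_ln (f := fun z => 1 + z) _ (derD (der_cst 1 s) (der_id s))) _;
 [lraw s0|rewrite add0r mul1r].
apply: eps_der => e e0; have [d d0 hd] := der_eps h e0.
exists (Num.min d s); first by rewrite lt_min d0.
move=> k; rewrite lt_min => /andP[k1 k2]; have := hd k k1; rewrite /lnp.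
have -> : `|s| = s by exact: gtr0_norm.
have -> // : `|s + k| = s + k.
by rewrite gtr0_norm //; move: k2; rewrite ltr_norml => /andP[k2 _]; lraw k2.
Qed.

Lemma lnp_exp s : 0 <= s -> expR (- lnp s) = (1 + s)^-1.
Proof. by move=> s0; rewrite expRN lnK ?ger0_norm // posrE; lraw s0. Qed.

Lemma prof1_cont m : continuous (prof1 m).
Proof.
move=> s.
have cl : {for s, continuous lnp}.
apply: (@continuous_comp _ _ _ (fun z : R => 1 + `|z|) (@ln R)).
 apply: cvgD; first exact: cvg_cst.
 exact: norm_continuous.
by apply: continuous_ln; rewrite ltr_pwDl.
apply: (@continuous_comp _ _ _ (fun z => - (m ^+ 2 / 2 * lnp z ^+ 2)) (@expR R)); last exact: continuous_expR.
apply: cvgN; apply: cvgM; first exact: cvg_cst.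
by under eq_fun do rewrite expr2; rewrite expr2; exact: cvgM.
Qed.

Lemma prof_der m s : der (prof m) s (prof1 m s).
Proof. by apply: prim_der; exact: prof1_cont. Qed.

Lemma prof_0 m : prof m 0 = 0. Proof. exact: prim0. Qed.

Lemma prof1_der m s : 0 < s -> der (prof1 m) s (prof2 m s).
Proof.
move=> s0; have s1 : 1 + s != 0 by rewrite gt_eqF //; lraw s0.
apply: der_eq (der_exp (derN (derM (der_cst (m ^+ 2 / 2) s) (derX 2 (lnp_der s0))))) _.
by rewrite /prof2 /prof1 /=; move: (expR _) => E; field; rewrite s1.
Qed.

Lemma prof1_gt0 m s : 0 < prof1 m s. Proof. exact: expR_gt0. Qed.

Lemma prof1_le1 m s : prof1 m s <= 1.
Proof. by rewrite -expR0 ler_expR oppr_le0 mulr_ge0 ?sqr_ge0 // divr_ge0 // sqr_ge0. Qed.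

Lemma prof2E m s : 0 < s -> - s * prof2 m s = profq m s * prof1 m s.
Proof. by move=> s0; rewrite /prof2 /profq; ring. Qed.

Lemma prof1_lt1 m s : 0 < m -> 0 < s -> prof1 m s < 1.
Proof.
move=> m0 s0; rewrite -expR0 ltr_expR oppr_lt0 mulr_gt0 ?divr_gt0 ?exprn_gt0 //.
by rewrite ln_gt0 // gtr0_norm // ltrDl.
Qed.

Lemma prof1_mono m s t : 0 <= s <= t -> prof1 m t <= prof1 m s.
Proof.
move=> /andP[s0 st]; rewrite ler_expR lerN2 ler_wpM2l ?divr_ge0 ?sqr_ge0 //.
apply: sq_le; first exact: lnp_ge0.
rewrite /lnp !ger0_norm //; last exact: le_trans st.
by rewrite ler_ln ?posrE; lraw s0 st.
Qed.

Lemma prof_ge m s : 0 <= s -> s * prof1 m s <= prof m s.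
Proof.
move=> s0; rewrite -subr_ge0.
have hd (z : R) : der (fun z => prof m z - z * prof1 m s) z (prof1 m z - prof1 m s).
by apply: der_eq (derB (prof_der m z) (derM (der_id z) (der_cst _ z))) _; ring.
have := der_ge0_le s0 (fun z _ => hd z); rewrite prof_0 mul0r subrr; apply.
by move=> z hz; rewrite subr_ge0 prof1_mono.
Qed.

Lemma prof_le m s : 0 <= s -> prof m s <= s.
Proof.
move=> s0; rewrite -subr_ge0.
have hd (z : R) : der (fun z => z - prof m z) z (1 - prof1 m z) by apply: derB; [exact: der_id|exact: prof_der].
have := der_ge0_le s0 (fun z _ => hd z); rewrite prof_0 subrr; apply.
by move=> z _; rewrite subr_ge0 prof1_le1.
Qed.

Lemma prof_gt0 m s : 0 < s -> 0 < prof m s.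
Proof. by move=> s0; apply: lt_le_trans (prof_ge m (ltW s0)); rewrite mulr_gt0 // prof1_gt0. Qed.

Lemma prof_gt m s : 0 < m -> 0 < s -> s * prof1 m s < prof m s.
Proof.
move=> m0 s0; rewrite -subr_gt0.
have hd (z : R) : der (fun z => prof m z - z * prof1 m s) z (prof1 m z - prof1 m s).
by apply: der_eq (derB (prof_der m z) (derM (der_id z) (der_cst _ z))) _; ring.
have := der_gt0_lt s0 (fun z _ => hd z); rewrite prof_0 mul0r subrr; apply.
move=> z /andP[z0 zs]; rewrite subr_gt0 ltr_expR ltrN2 ltr_pM2l ?divr_gt0 ?exprn_gt0 //.
rewrite ltr_sqr ?nnegrE ?lnp_ge0 // /lnp !gtr0_norm //.
by rewrite ltr_ln ?posrE; lraw s0 zs z0.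
Qed.

Lemma profq_ge0 m s : 0 < s -> 0 <= profq m s.
Proof.
move=> s0; apply: mulr_ge0; first by apply: mulr_ge0; [exact: sqr_ge0|exact: lnp_ge0].
by apply: divr_ge0; [exact: ltW|lraw s0].
Qed.

(** With x = ln (1 + s) and w = m x, q is m w (1 - exp (- x)) and y^2 is 1 - exp (- w^2). For small
    y, the factor 1 - exp (- x) saves more than w^2 / 2 + C2 w as soon as m (C2 + 1) <= 1/10. For
    larger y, c >= nu bounds w^2 by 2 N, and q <= m w is small with m. *)
Lemma profile_choice (C2 y0 kap nu m1 : R) : 0 <= C2 -> 0 < y0 -> y0 * (10 * (C2 + 1)) <= 1 ->
0 < kap -> 0 < nu <= 1 -> 0 < m1 -> exists m : R, [/\ 0 < m, m <= m1 &
forall s y, 0 < s -> 0 <= y -> y ^+ 2 = 1 - prof1 m s ^+ 2 -> nu <= prof1 m s ->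
 (y < y0 -> profq m s <= y ^+ 2 - C2 * y ^+ 3) /\ (y0 <= y -> profq m s <= kap)].
Proof.
move=> C0 y00 hy0 k0 /andP[nu0 nu1] m10.
have [N NE] : exists N, N = - ln nu by exists (- ln nu).
have N0 : 0 <= N by rewrite NE oppr_ge0 ln_le0.
pose M := Num.min m1 (Num.min (1 / (10 * (C2 + 1))) (kap / (1 + 2 * N))).
have C1 : 0 < 10 * (C2 + 1) by lraw C0.
have N1 : 0 < 1 + 2 * N by lraw N0.
exists M.
have m0 : 0 < M by rewrite !lt_min m10 !divr_gt0.
have mm : M <= m1 by rewrite ge_min lexx.
have mC : M * (10 * (C2 + 1)) <= 1 by rewrite -ler_pdivlMr // /M !ge_min lexx !orbT.
have mk : M * (1 + 2 * N) <= kap by rewrite -ler_pdivlMr // /M !ge_min lexx !orbT.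
clearbody M; split=> // s y s0 yy yE hc.
set x := lnp s; have x0 : 0 <= x by exact: lnp_ge0.
have qE : profq M s = M ^+ 2 * x * (1 - expR (- x)).
rewrite /profq -/x lnp_exp ?ltW //; have s1 : 1 + s != 0 by rewrite gt_eqF //; lraw s0.
by field; rewrite s1.
have [z zE] : exists z, z = M ^+ 2 * x ^+ 2 by exists (M ^+ 2 * x ^+ 2).
have z0 : 0 <= z by rewrite zE mulr_ge0 ?sqr_ge0.
have cE : prof1 M s ^+ 2 = expR (- z).
by rewrite /prof1 -expRM_natl mulrC -mulr_natl; congr expR; rewrite zE -/x; field.
have [w wE] : exists w, w = M * x by exists (M * x).
have w0 : 0 <= w by rewrite wE mulr_ge0 // ltW.
have zw : z = w ^+ 2 by rewrite zE wE exprMn.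
have [e1 e2 e3 e4] := expN_bounds z0.
rewrite cE in yE.
have yz : y ^+ 2 <= z by lraw yE e1.
have yw : y <= w by rewrite zw in yz; nraw yz yy w0.
have qle : profq M s <= M * w.
rewrite qE; have -> : M ^+ 2 * x * (1 - expR (- x)) = M * w * (1 - expR (- x)) by rewrite wE; ring.
apply: ler_piMr; first by apply: mulr_ge0; [exact: ltW|exact: w0].
by have := expR_gt0 (- x) => h; lraw h.
split=> [yl|yl]; last first.
apply: le_trans qle _; apply: le_trans mk; rewrite ler_pM2l //.
have : z <= 2 * N.
 have : ln (nu ^+ 2) <= ln (expR (- z)).
 by rewrite ler_ln ?posrE ?exprn_gt0 ?expR_gt0 // -cE; apply: sq_le => //; exact: ltW.
 by rewrite expRK lnXn // mulr2n NE => h; lraw h.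
by rewrite zw => h; nraw h w0.
have y3 : C2 * y ^+ 3 <= C2 * (z * w).
rewrite ler_wpM2l // exprSr; apply: ler_pM => //; exact: sqr_ge0.
have rhs : z * (1 - z / 2 - C2 * w) <= y ^+ 2 - C2 * y ^+ 3 by nraw y3 yE e3.
apply: le_trans rhs.
have [h1 h2] := exp_sat x0.
have qz : forall r, 1 - expR (- x) <= x * r -> profq M s <= z * r.
move=> r hr; rewrite qE zE; have -> : M ^+ 2 * x ^+ 2 * r = M ^+ 2 * x * (x * r) by ring.
by apply: ler_wpM2l hr; apply: mulr_ge0; [exact: sqr_ge0|exact: x0].
have [xl|xl] := leP x 1.
apply: le_trans (qz _ (h1 xl)) _; rewrite ler_wpM2l //.
have Mx : M * (C2 + 1) * x <= 1 / 10 * x by rewrite ler_wpM2r //; lraw mC.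
have M1 : M <= 1 by nraw mC C0 m0.
have w1 : w <= 1 by rewrite wE; nraw M1 xl x0 m0.
have zw1 : z <= w by rewrite zw; nraw w1 w0.
have Mw : C2 * w + w <= 1 / 10 * x by rewrite wE; lraw Mx.
by lraw zw1 Mw w0 x0.
have h2' := h2 (ltW xl); rewrite mulrC in h2'.
apply: le_trans (qz _ h2') _; rewrite ler_wpM2l //.
have y01 : y0 <= 1 / 10 by nraw hy0 y00 C0.
have y2s : y ^+ 2 <= y0 ^+ 2 by apply: sq_le => //; exact: ltW.
have z1 : z <= 1.
rewrite leNgt; apply/negP => z1.
have : expR (- z) <= expR (- 1) by rewrite ler_expR lerN2 ltW.
have [_ _ f3 _] := expN_bounds (@ler01 R).
by move=> h; nraw h f3 yE y2s y01 y00.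
have z2 : z <= 2 * y0 ^+ 2 by nraw e3 yE y2s z1 z0.
have w2 : w <= 2 * y0 by rewrite zw in z2; nraw z2 w0 y00.
have Cw : C2 * w <= C2 * (2 * y0) by rewrite ler_wpM2l.
by nraw Cw z2 hy0 y00 y01.
Qed.

End Profile.

(** * Behaviour of the profile near zero and at infinity *)

Section ProfileAsymptotics.
Context {R : realType}.
Implicit Types (s m x z q y c : R).

Lemma lnp_bounds s : 0 <= s -> [/\ lnp s <= s, s - s ^+ 2 / 2 <= lnp s,
lnp s <= s - s ^+ 2 / 2 + s ^+ 3 / 3 & s / (1 + s) <= lnp s].
Proof.
move=> s0.
have hl (z : R) : 0 <= z -> der (fun w => ln (1 + w)) z (1 + z)^-1.
move=> z0; apply: der_eq (der_ln (f := fun w => 1 + w) _ (derD (der_cst 1 z) (der_id z))) _.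
 by lraw z0.
by rewrite add0r mul1r.
have iz (z : R) : 0 <= z -> [/\ (1 + z)^-1 <= 1, 1 - z <= (1 + z)^-1, (1 + z)^-1 <= 1 - z + z ^+ 2
 & 0 < 1 + z].
move=> z0; have z1 : 0 < 1 + z by lraw z0.
have z3 : 0 <= z ^+ 3 by exact: exprn_ge0.
split => //; first by rewrite invf_le1 //; lraw z0.
 by rewrite -[X in _ <= X]div1r ler_pdivlMr //; nraw z0.
rewrite -[X in X <= _]div1r ler_pdivrMr //.
have -> : (1 - z + z ^+ 2) * (1 + z) = 1 + z ^+ 3 by ring.
by lraw z3.
rewrite /lnp ger0_norm //.
have ge (f f1 : R -> R) : (forall z, 0 <= z <= s -> der f z (f1 z)) ->
(forall z, 0 <= z <= s -> 0 <= f1 z) -> f 0 = 0 -> 0 <= f s.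
by move=> h1 h2 f0; rewrite -f0; exact: (der_ge0_le s0 h1 h2).
split.
- rewrite -subr_ge0; apply: (ge (fun z => z - ln (1 + z)) (fun z => 1 - (1 + z)^-1)).
+ by move=> z /andP[z0 _]; apply: derB; [exact: der_id|exact: hl].
+ by move=> z /andP[/iz[h _ _ _] _]; rewrite subr_ge0.
+ by rewrite addr0 ln1 subrr.
- rewrite -subr_ge0; apply: (ge (fun z => ln (1 + z) - (z - z ^+ 2 / 2)) (fun z => (1 + z)^-1 - (1 - z))).
+ move=> z /andP[z0 _]; apply: derB; first exact: hl.
 by apply: der_eq (derB (der_id z) (derM (derX 2 (der_id z)) (der_cst _ z))) _; rewrite /=; field.
+ by move=> z /andP[/iz[_ h _ _] _]; rewrite subr_ge0.
+ by rewrite addr0 ln1 expr0n /= mul0r !subrr.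
- rewrite -subr_ge0; apply: (ge (fun z => (z - z ^+ 2 / 2 + z ^+ 3 / 3) - ln (1 + z)) (fun z => 1 - z + z ^+ 2 - (1 + z)^-1)).
+ move=> z /andP[z0 _]; apply: derB; last exact: hl.
 by apply: der_eq (derD (derB (der_id z) (derM (derX 2 (der_id z)) (der_cst _ z)))
 (derM (derX 3 (der_id z)) (der_cst _ z))) _; rewrite /=; field.
+ by move=> z /andP[/iz[_ _ h _] _]; rewrite subr_ge0.
+ by rewrite addr0 ln1 !expr0n /= !mul0r !subrr addr0 subrr.
- rewrite -subr_ge0; apply: (ge (fun z => ln (1 + z) - z / (1 + z)) (fun z => z / (1 + z) ^+ 2)).
+ move=> z /andP[z0 _]; have [_ _ _ z1] := iz z z0; have zn : 1 + z != 0 by rewrite gt_eqF.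
 apply: der_eq (derB (hl z z0) (derM (der_id z) (derV (f := fun w => 1 + w) zn (derD (der_cst 1 z) (der_id z))))) _.
 by field; rewrite zn.
+ by move=> z /andP[z0 _]; rewrite divr_ge0 // sqr_ge0.
+ by rewrite addr0 ln1 mul0r subrr.
Qed.

(** Take s1 with ln (1 + s1) = 1 / (2 m^2). Up to s1, [profq] is at most 1/2, which keeps 2 s psi'
    above psi. At s1 the slope is at most 8 m^2, so by concavity psi stays below 16 m^2 s from there
    on. *)
Lemma prof_tail m muh : 0 < m -> 16 * m ^+ 2 < muh -> exists s1 : R, [/\ 0 < s1,
forall s, 0 < s <= s1 -> prof m s <= 2 * (s * prof1 m s) &
forall s, s1 <= s -> prof m s < muh * s].
Proof.
move=> m0 hm; have m2 : 0 < m ^+ 2 by rewrite exprn_gt0.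
have [w wE] : exists w, w = (2 * m ^+ 2)^-1 by exists (2 * m ^+ 2)^-1.
have w0 : 0 < w by rewrite wE invr_gt0 mulr_gt0.
have mw : m ^+ 2 * w = 1 / 2 by rewrite wE; field; rewrite gt_eqF.
pose s1 := expR w - 1.
have s10 : 0 < s1 by rewrite subr_gt0 -expR0 ltr_expR.
have lE : lnp s1 = w by rewrite /lnp gtr0_norm // /s1 addrCA subrr addr0 expRK.
have hle s : 0 <= s <= s1 -> prof m s <= 2 * (s * prof1 m s).
move=> /andP[s0 ss1]; rewrite -subr_ge0.
pose f z := 2 * (z * prof1 m z) - prof m z.
have [->|sn] := eqVneq s 0; first by rewrite mul0r mulr0 prof_0 subrr.
have sp : 0 < s by rewrite lt_neqAle eq_sym sn.
have hd z : 0 < z -> der f z (prof1 m z * (1 - 2 * profq m z)).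
 move=> z0; apply: der_eq (derB (derM (der_cst 2 z) (derM (der_id z) (prof1_der m z0))) (prof_der m z)) _.
 have h : z * prof2 m z = - (profq m z * prof1 m z) by rewrite -(prof2E m z0); ring.
 transitivity (prof1 m z + 2 * (z * prof2 m z)); first by ring.
 by rewrite h; ring.
rewrite leNgt; apply/negP => fneg.
have fbig z : 0 < z <= s -> f z <= f s.
 move=> /andP[z0 zs].
 have hd' v : z <= v <= s -> der f v (prof1 m v * (1 - 2 * profq m v)).
 by case/andP=> h _; apply: hd; exact: lt_le_trans h.
 apply: (der_ge0_le zs hd').
 move=> v /andP[v1 v2]; have v0 : 0 < v by exact: lt_le_trans v1.
 apply: mulr_ge0; first exact: ltW (prof1_gt0 m v).
 have lv : lnp v <= w.
 by rewrite -lE /lnp !gtr0_norm // ler_ln ?posrE; lraw v0 v2 ss1 s10.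
 have v11 : v / (1 + v) <= 1 by rewrite ler_pdivrMr; lraw v0.
 have v10 : 0 <= v / (1 + v) by rewrite divr_ge0; lraw v0.
 have : profq m v <= m ^+ 2 * w * 1.
 apply: ler_pM => //; first by rewrite mulr_ge0 ?lnp_ge0 // ltW.
 by rewrite ler_wpM2l // ltW.
 by rewrite mw => h; lraw h.
(* f is continuous at 0 with f 0 = 0, whereas f <= f s < 0 near 0 *)
have f0 z : 0 < z -> - z <= f z.
 move=> z0; rewrite /f; have h1 := prof_le m (ltW z0).
 have h2 : 0 <= z * prof1 m z by rewrite mulr_ge0 // ltW // prof1_gt0.
 by lraw h1 h2.
pose z := Num.min s (- f s / 2).
have z0 : 0 < z by rewrite lt_min sp divr_gt0 // oppr_gt0.
have zs : z <= s by rewrite ge_min lexx.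
have zf : z <= - f s / 2 by rewrite ge_min lexx orbT.
have h1 := f0 z z0; have h2 := fbig z ltac:(by rewrite z0).
have h3 : f s < 0 := fneg.
by clearbody z; lraw h1 h2 zf h3.
exists s1; split => //; first by move=> s /andP[s0 ss]; apply: hle; rewrite ltW.
move=> s ss1; have s0 : 0 < s by exact: lt_le_trans ss1.
have E8 : prof1 m s1 <= 8 * m ^+ 2.
rewrite /prof1 lE.
have zE : m ^+ 2 / 2 * w ^+ 2 = w / 4.
 by transitivity ((m ^+ 2 * w) * w / 2); [field|rewrite mw; field].
rewrite zE expRN -[X in X <= _]div1r ler_pdivrMr ?expR_gt0 //.
have h := expR_ge1Dx (w / 4).
have : 8 * m ^+ 2 * (1 + w / 4) <= 8 * m ^+ 2 * expR (w / 4) by rewrite ler_pM2l // mulr_gt0.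
by move=> h'; apply: le_trans h'; move: mw m2; move: (m ^+ 2) => M mw M0; lraw mw M0.
have h1 := hle s1 ltac:(by rewrite lexx ltW).
have h2 : prof m s - prof m s1 <= prof1 m s1 * (s - s1).
rewrite -subr_ge0.
have hd (z : R) : der (fun z => prof1 m s1 * (z - s1) - (prof m z - prof m s1)) z (prof1 m s1 - prof1 m z).
 apply: der_eq (derB (derM (der_cst _ z) (derB (der_id z) (der_cst s1 z))) (derB (prof_der m z) (der_cst _ z))) _.
 by ring.
have := der_ge0_le ss1 (fun z _ => hd z); rewrite !subrr mulr0 subrr; apply.
by move=> z /andP[z1 _]; rewrite subr_ge0 prof1_mono // z1 ltW.
have h3 : prof1 m s1 * s <= 8 * m ^+ 2 * s by rewrite ler_pM2r.
have h4 : 16 * m ^+ 2 * s < muh * s by rewrite ltr_pM2r.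
have h5 : prof1 m s1 * s1 <= prof1 m s1 * s by rewrite ler_pM2l // prof1_gt0.
by rewrite mulrBr in h2; lraw h1 h2 h3 h4 h5.
Qed.

(** The cubic deficit lets a large scale push the profile below the chords of the initial curve,
    whose deficit is cubic too. *)
Lemma prof_cubic m S : 0 < m -> 0 < S -> exists2 eta : R, 0 < eta &
forall s, 0 <= s <= S -> prof m s <= s - eta * s ^+ 3.
Proof.
move=> m0 S0; pose W := m ^+ 2 / 2 * S ^+ 2.
have W0 : 0 <= W by rewrite mulr_ge0 ?sqr_ge0 // divr_ge0 // sqr_ge0.
have S1 : 0 < 1 + S by lraw S0.
have W1 : 0 < 1 + W by lraw W0.
pose eta := m ^+ 2 / 2 / (1 + S) ^+ 2 / (1 + W) / 3.
have eta0 : 0 < eta by rewrite !divr_gt0 // exprn_gt0.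
exists eta => // s /andP[s0 sS]; rewrite -subr_ge0.
have hd (z : R) : der (fun z => (z - eta * z ^+ 3) - prof m z) z (1 - 3 * eta * z ^+ 2 - prof1 m z).
apply: der_eq (derB (derB (der_id z) (derM (der_cst _ z) (derX 3 (der_id z)))) (prof_der m z)) _.
by rewrite /=; ring.
have := der_ge0_le s0 (fun z _ => hd z); rewrite prof_0 expr0n /= mulr0 !subr0; apply.
move=> z /andP[z0 zs]; rewrite subr_ge0.
have [l1 _ _ l4] := lnp_bounds z0.
have z1 : 0 < 1 + z by lraw z0.
set v := m ^+ 2 / 2 * lnp z ^+ 2.
have m20 : 0 < m ^+ 2 / 2 by rewrite divr_gt0 // exprn_gt0.
have vW : v <= W.
rewrite ler_pM2l //; apply: sq_le; first exact: lnp_ge0.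
by lraw l1 zs sS.
have v0 : 0 <= v by rewrite mulr_ge0 ?sqr_ge0 // ltW.
have lo : m ^+ 2 / 2 / (1 + S) ^+ 2 * z ^+ 2 <= v.
have -> : m ^+ 2 / 2 / (1 + S) ^+ 2 * z ^+ 2 = m ^+ 2 / 2 * (z / (1 + S)) ^+ 2.
 by field; rewrite gt_eqF.
rewrite ler_pM2l //; apply: sq_le; first by rewrite divr_ge0 // ltW.
apply: le_trans l4; rewrite ler_pdivlMr // mulrAC ler_pdivrMr //.
by rewrite ler_wpM2l //; lraw zs sS.
rewrite /prof1 -/v expRN.
have e1 : (expR v)^-1 <= (1 + v)^-1.
by rewrite lef_pV2 ?posrE ?expR_gt0 //; [exact: expR_ge1Dx|lraw v0].
apply: le_trans e1 _.
have v1 : 0 < 1 + v by lraw v0.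
have -> : (1 + v)^-1 = 1 - v / (1 + v) by field; rewrite gt_eqF.
rewrite lerD2l lerN2.
have -> : 3 * eta * z ^+ 2 = m ^+ 2 / 2 / (1 + S) ^+ 2 * z ^+ 2 / (1 + W).
by rewrite /eta; field; rewrite !gt_eqF.
apply: (@le_trans _ _ (v / (1 + W))); first by rewrite ler_pM2r // invr_gt0.
by rewrite ler_wpM2l // lef_pV2 ?posrE // lerD2l.
Qed.

(** The positive quartic term reflects ln (1 + s) < s; [kurv_strict] turns it into a strict
    inequality. *)
Lemma prof_low m s : 0 <= s <= 1 / 4 ->
s - m ^+ 2 / 6 * s ^+ 3 + m ^+ 2 / 16 * s ^+ 4 <= prof m s.
Proof.
move=> /andP[s0 s1]; rewrite -subr_ge0.
have hd (z : R) : der (fun z => prof m z - (z - m ^+ 2 / 6 * z ^+ 3 + m ^+ 2 / 16 * z ^+ 4)) z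
(prof1 m z - (1 - m ^+ 2 / 2 * (z ^+ 2 - z ^+ 3 / 2))).
apply: der_eq (derB (prof_der m z) (derD (derB (der_id z) (derM (der_cst _ z) (derX 3 (der_id z))))
 (derM (der_cst _ z) (derX 4 (der_id z))))) _.
by rewrite /=; field.
have := der_ge0_le s0 (fun z _ => hd z).
rewrite prof_0 !expr0n /= !mulr0 !subr0 addr0 subrr; apply.
move=> z /andP[z0 zs]; rewrite subr_ge0.
have [_ _ l3 _] := lnp_bounds z0.
have v0 : 0 <= m ^+ 2 / 2 * lnp z ^+ 2 by rewrite mulr_ge0 ?sqr_ge0 // divr_ge0 // sqr_ge0.
have [e1 _ _ _] := expN_bounds v0.
apply: le_trans e1; rewrite lerD2l lerN2 ler_wpM2l // ?divr_ge0 ?sqr_ge0 //.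
have zz : z <= 1 / 4 by lraw zs s1.
have h1 : lnp z ^+ 2 <= (z - z ^+ 2 / 2 + z ^+ 3 / 3) ^+ 2.
by apply: sq_le => //; exact: lnp_ge0.
apply: le_trans h1 _.
have -> : (z - z ^+ 2 / 2 + z ^+ 3 / 3) ^+ 2 = z ^+ 2 * (1 - z / 2 + z ^+ 2 / 3) ^+ 2 by field.
have -> : z ^+ 2 - z ^+ 3 / 2 = z ^+ 2 * (1 - z / 2) by field.
rewrite ler_wpM2l ?sqr_ge0 //.
have h : 0 <= z * (1 / 4 - z) by rewrite mulr_ge0 // subr_ge0.
have h3 : 0 <= z ^+ 2 * (1 / 4 - z) by rewrite mulr_ge0 ?sqr_ge0 // subr_ge0.
have h4 : 0 <= z ^+ 3 * (1 / 4 - z) by rewrite mulr_ge0 ?exprn_ge0 // subr_ge0.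
have -> : (1 - z / 2 + z ^+ 2 / 3) ^+ 2 = 1 - z + (11 / 12) * z ^+ 2 - z ^+ 3 / 3 + z ^+ 4 / 9 by field.
have z3 : 0 <= z ^+ 3 by exact: exprn_ge0.
have E1 : z * (1 / 4 - z) = z / 4 - z ^+ 2 by field.
have E4 : z ^+ 3 * (1 / 4 - z) = z ^+ 3 / 4 - z ^+ 4 by field.
rewrite E1 in h; rewrite E4 in h4.
by lraw h h4 z3 z0.
Qed.

Lemma prof_up m s : 0 <= m <= 1 -> 0 <= s <= 1 ->
prof m s <= s - m ^+ 2 / 6 * s ^+ 3 + m ^+ 2 * s ^+ 4.
Proof.
move=> /andP[m0 m1] /andP[s0 s1]; rewrite -subr_ge0.
have hd (z : R) : der (fun z => (z - m ^+ 2 / 6 * z ^+ 3 + m ^+ 2 * z ^+ 4) - prof m z) z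
((1 - m ^+ 2 / 2 * z ^+ 2 + 4 * m ^+ 2 * z ^+ 3) - prof1 m z).
apply: der_eq (derB (derD (derB (der_id z) (derM (der_cst _ z) (derX 3 (der_id z))))
 (derM (der_cst _ z) (derX 4 (der_id z)))) (prof_der m z)) _.
by rewrite /=; field.
have := der_ge0_le s0 (fun z _ => hd z).
rewrite prof_0 !expr0n /= !mulr0 !subr0 addr0; apply.
move=> z /andP[z0 zs]; rewrite subr_ge0.
have [l1 l2 _ _] := lnp_bounds z0.
have v0 : 0 <= m ^+ 2 / 2 * lnp z ^+ 2 by rewrite mulr_ge0 ?sqr_ge0 // divr_ge0 // sqr_ge0.
have [_ _ e3 _] := expN_bounds v0.
apply: le_trans e3 _.
have z1 : z <= 1 by lraw zs s1.
have m2 : 0 <= m ^+ 2 by exact: sqr_ge0.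
have m21 : m ^+ 2 <= 1 by rewrite expr_le1.
have x2 : z ^+ 2 - z ^+ 3 <= lnp z ^+ 2.
have h : (z - z ^+ 2 / 2) ^+ 2 <= lnp z ^+ 2.
 by apply: sq_le => //; nraw z0 z1.
have z4 : 0 <= z ^+ 4 by exact: exprn_ge0.
apply: le_trans h.
have -> : (z - z ^+ 2 / 2) ^+ 2 = z ^+ 2 - z ^+ 3 + z ^+ 4 / 4 by field.
by lraw z4.
have x3 : lnp z ^+ 2 <= z ^+ 2 by apply: sq_le => //; exact: lnp_ge0.
have x4 : (lnp z ^+ 2) ^+ 2 <= (z ^+ 2) ^+ 2 by apply: sq_le => //; exact: sqr_ge0.
have z43 : (z ^+ 2) ^+ 2 <= z ^+ 3.
have -> : (z ^+ 2) ^+ 2 = z ^+ 3 * z by ring.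
by rewrite ler_piMr // exprn_ge0.
move: (lnp z ^+ 2) x2 x3 x4 => X x2 x3 x4.
have E : (m ^+ 2 / 2 * X) ^+ 2 / 2 <= m ^+ 2 * z ^+ 3.
have -> : (m ^+ 2 / 2 * X) ^+ 2 / 2 = m ^+ 2 * (m ^+ 2 * X ^+ 2 / 8) by field.
rewrite ler_wpM2l //.
have : m ^+ 2 * X ^+ 2 <= 1 * (z ^+ 2) ^+ 2 by apply: ler_pM => //; exact: sqr_ge0.
have z30 : 0 <= z ^+ 3 by exact: exprn_ge0.
by move=> h; lraw h z43 z30.
have F : m ^+ 2 * (z ^+ 2 - z ^+ 3) <= m ^+ 2 * X by rewrite ler_wpM2l.
have G : 0 <= m ^+ 2 * z ^+ 3 by rewrite mulr_ge0 // exprn_ge0.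
by rewrite mulrBr in F; lraw E F G.
Qed.

End ProfileAsymptotics.

(* Unlike [lraw], keeps the section variables, which [lra] needs. *)
Tactic Notation "lras" hyp_list(hs) :=
revert hs; repeat match goal with H : is_true _ |- _ => clear H end; intros; lra.

(** * Chord against arc: Taylor expansion at the diagonal *)

Section ChordExpansion.
Context {R : realType}.
Implicit Types (u m p q r h c : R).

Lemma ivt (f : R -> R) a b v : a <= b -> (forall u, a <= u <= b -> {for u, continuous f}) ->
f a <= v <= f b -> exists2 u : R, a <= u <= b & f u = v.
Proof.
move=> ab cf /andP[av vb].
have [||u] := @IVT _ f a b v ab.
- by apply: continuous_in_subspaceT => u; rewrite inE /= in_itv /=; exact: cf.
- by rewrite ge_min av /= le_max vb orbT.
- by rewrite in_itv /= => hu <-; exists u.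
Qed.

(** Integration in arc length to either side of m, dropping the factor 1 / (n + 1); the sign e
    treats the upper and the lower bound at once. *)
Lemma growth (f f1 S g : R -> R) m r c n : 0 <= c ->
(forall u, `|u - m| <= r -> der f u (f1 u * g u)) ->
(forall u, der S u (g u)) -> (forall u, 0 < g u) -> f m = 0 ->
(forall u, `|u - m| <= r -> `|f1 u| <= c * `|S u - S m| ^+ n) ->
forall u, `|u - m| <= r -> `|f u| <= c * `|S u - S m| ^+ n.+1.
Proof.
move=> c0 hf hS g0 fm hb u hu.
have Smono v w : v <= w -> S v <= S w.
by move=> vw; apply: (der_ge0_le vw (fun z _ => hS z)) => z _; exact: ltW.
have [mu|/ltW um] := leP m u.
have sub v : m <= v <= u -> `|v - m| <= r.
 move=> /andP[h1 h2]; apply: le_trans hu; rewrite !ger0_norm ?subr_ge0 //; lraw h2.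
have E v : m <= v -> `|S v - S m| = S v - S m.
 by move=> mv; rewrite ger0_norm // subr_ge0 Smono.
have main (e : R) : (e = 1 \/ e = -1) -> 0 <= c * (S u - S m) ^+ n.+1 - e * f u.
 move=> he; pose F v := c * (S v - S m) ^+ n.+1 - e * f v.
 have dF v : m <= v <= u -> der F v ((c * n.+1%:R * (S v - S m) ^+ n - e * f1 v) * g v).
 move=> hv; apply: der_eq (derB (derM (der_cst c v) (derX n.+1 (derB (hS v) (der_cst (S m) v))))
  (derM (der_cst e v) (hf v (sub v hv)))) _.
 by rewrite /= subr0; ring.
 have F0 : F m = 0 by rewrite /F subrr expr0n /= fm !mulr0 subrr.
 rewrite -F0; apply: (der_ge0_le mu dF) => v hv; apply: mulr_ge0; last exact: ltW.
 have /andP[mv vu] := hv.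
 have := hb v (sub v hv); rewrite E // ler_norml => /andP[h1 h2].
 have s0 : 0 <= c * (S v - S m) ^+ n by rewrite mulr_ge0 // exprn_ge0 // subr_ge0 Smono.
 have : c * (S v - S m) ^+ n <= c * n.+1%:R * (S v - S m) ^+ n.
 rewrite mulrAC -[X in X <= _]mulr1 ler_wpM2l // -[X in X <= _]/(1%:R) ler_nat //.
 case: he => ->; move: (c * n.+1%:R * _) (c * _) h1 h2 => A B h1 h2 h3; lraw h1 h2 h3.
rewrite E //; have := main 1 (or_introl erefl); have := main (-1) (or_intror erefl).
by rewrite ler_norml; move: (c * _) => A h1 h2; lraw h1 h2.
have sub v : u <= v <= m -> `|v - m| <= r.
move=> /andP[h1 h2]; apply: le_trans hu; rewrite !ler0_norm ?subr_le0 //; lraw h1.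
have E v : v <= m -> `|S v - S m| = S m - S v.
by move=> mv; rewrite ler0_norm ?opprB // subr_le0 Smono.
have main (e : R) : (e = 1 \/ e = -1) -> 0 <= c * (S m - S u) ^+ n.+1 - e * f u.
move=> he; pose F v := - (c * (S m - S v) ^+ n.+1 - e * f v).
have dF v : u <= v <= m -> der F v ((c * n.+1%:R * (S m - S v) ^+ n + e * f1 v) * g v).
 move=> hv; apply: der_eq (derN (derB (derM (der_cst c v) (derX n.+1 (derB (der_cst (S m) v) (hS v))))
 (derM (der_cst e v) (hf v (sub v hv))))) _.
 by rewrite /= sub0r; ring.
have F0 : F m = 0 by rewrite /F subrr expr0n /= fm !mulr0 subrr oppr0.
rewrite -oppr_le0 -F0; apply: (der_ge0_le um dF) => v hv; apply: mulr_ge0; last exact: ltW.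
have /andP[uv vm] := hv.
have := hb v (sub v hv); rewrite E // ler_norml => /andP[h1 h2].
have s0 : 0 <= c * (S m - S v) ^+ n by rewrite mulr_ge0 // exprn_ge0 // subr_ge0 Smono.
have : c * (S m - S v) ^+ n <= c * n.+1%:R * (S m - S v) ^+ n.
 rewrite mulrAC -[X in X <= _]mulr1 ler_wpM2l // -[X in X <= _]/(1%:R) ler_nat //.
case: he => ->; move: (c * n.+1%:R * _) (c * _) h1 h2 => A B h1 h2 h3; lraw h1 h2 h3.
rewrite E //; have := main 1 (or_introl erefl); have := main (-1) (or_intror erefl).
by rewrite ler_norml; move: (c * _) => A h1 h2; lraw h1 h2.
Qed.

Variables (x y th S g k : R -> R).
Hypothesis dx : forall u, der x u (cos (th u) * g u).
Hypothesis dy : forall u, der y u (sin (th u) * g u).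
Hypothesis dS : forall u, der S u (g u).
Hypothesis dth : forall u, der th u (k u * g u).
Hypothesis g0 : forall u, 0 < g u.

Let Smono v w : v <= w -> S v <= S w.
Proof. by move=> vw; apply: (der_ge0_le vw (fun z _ => dS z)) => z _; exact: ltW. Qed.

Lemma along_der m u : der (fun u => (x u - x m) * cos (th m) + (y u - y m) * sin (th m)) u
(cos (th u - th m) * g u).
Proof.
apply: der_eq (derD (derM (derB (dx u) (der_cst _ u)) (der_cst _ u))
(derM (derB (dy u) (der_cst _ u)) (der_cst _ u))) _.
by rewrite cosB; ring.
Qed.

Lemma across_der m u : der (fun u => (y u - y m) * cos (th m) - (x u - x m) * sin (th m)) u
(sin (th u - th m) * g u).
Proof.
apply: der_eq (derB (derM (derB (dy u) (der_cst _ u)) (der_cst _ u))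
(derM (derB (dx u) (der_cst _ u)) (der_cst _ u))) _.
by rewrite sinB; ring.
Qed.

(** Project the chord on the tangent at the arc midpoint. The angle to it is at most kap |s|, and
    integrating 1 - kap^2 s^2 / 2 over [-l/2, l/2] produces the constant 1/24. *)
Lemma chord_lower kap p q : (forall u, `|k u| <= kap) -> p < q ->
forall l, l = S q - S p ->
l - kap ^+ 2 * l ^+ 3 / 24 <= Num.sqrt ((x q - x p) ^+ 2 + (y q - y p) ^+ 2).
Proof.
move=> hk pq l lE.
have kap0 : 0 <= kap by apply: le_trans (hk 0).
have [m /andP[pm mq] Sm] : exists2 m : R, p <= m <= q & S m = (S p + S q) / 2.
apply: ivt; first exact: ltW.
 by move=> u _; exact: der_cvg (dS u).
by have := Smono (ltW pq); lra.
pose f u := (x u - x m) * cos (th m) + (y u - y m) * sin (th m)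
- ((S u - S m) - kap ^+ 2 * (S u - S m) ^+ 3 / 6).
have df u : der f u ((cos (th u - th m) - (1 - kap ^+ 2 * (S u - S m) ^+ 2 / 2)) * g u).
have dSm := derB (dS u) (der_cst (S m) u).
apply: der_eq (derB (along_der m u) (derB dSm (derM (derM (der_cst _ u) (derX 3 dSm)) (der_cst _ u)))) _.
by rewrite /=; field.
have df0 u : 0 <= (cos (th u - th m) - (1 - kap ^+ 2 * (S u - S m) ^+ 2 / 2)) * g u.
apply: mulr_ge0; last exact: ltW.
have dalpha v : der (fun v => th v - th m) v (k v * g v).
 by apply: der_eq (derB (dth v) (der_cst _ v)) _; rewrite subr0.
have ha : `|th u - th m| <= kap * `|S u - S m| ^+ 1.
 apply: (@growth (fun v => th v - th m) k S g m `|u - m| kap 0 kap0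
 (fun v _ => dalpha v) dS g0 (subrr _) _ u (lexx _)) => v _.
 by rewrite expr0 mulr1; exact: hk.
rewrite expr1 in ha.
have c := cos_ge (th u - th m).
have : (th u - th m) ^+ 2 <= kap ^+ 2 * (S u - S m) ^+ 2.
 rewrite -exprMn -[X in X <= _]real_normK ?num_real // -[X in _ <= X]real_normK ?num_real //.
 by apply: sq_le => //; rewrite normrM (ger0_norm kap0).
by rewrite subr_ge0 => h; lra.
have f0 : f m = 0 by rewrite /f !subrr !mul0r expr0n /= mulr0 mul0r subr0 addr0 subrr.
have fq : 0 <= f q by rewrite -f0; apply: (der_ge0_le mq (fun u _ => df u)) => u _; exact: df0.
have fp : f p <= 0 by rewrite -f0; apply: (der_ge0_le pm (fun u _ => df u)) => u _; exact: df0.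
have Sq : S q - S m = l / 2 by rewrite Sm lE; field.
have Sp : S p - S m = - (l / 2) by rewrite Sm lE; field.
set A := x q - x p; set B := y q - y p.
have h1 : l - kap ^+ 2 * l ^+ 3 / 24 <= A * cos (th m) + B * sin (th m).
move: fq fp; rewrite /f Sq Sp => fq fp.
have -> : l - kap ^+ 2 * l ^+ 3 / 24 = (l / 2 - kap ^+ 2 * (l / 2) ^+ 3 / 6)
 - (- (l / 2) - kap ^+ 2 * (- (l / 2)) ^+ 3 / 6) by field.
by rewrite /A /B; lra.
apply: le_trans h1 _.
apply: le_trans (ler_norm _) _; rewrite -sqrtr_sqr ler_sqrt; last by rewrite addr_ge0 // sqr_ge0.
have cs := cos2Dsin2 (th m).
have : 0 <= (A * sin (th m) - B * cos (th m)) ^+ 2 by exact: sqr_ge0.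
have -> : A ^+ 2 + B ^+ 2 = (A ^+ 2 + B ^+ 2) * (cos (th m) ^+ 2 + sin (th m) ^+ 2) by rewrite cs mulr1.
by move=> h; nra.
Qed.

Section Landau.
Variables (m r : R).
Hypothesis s_le1 : forall u, `|u - m| <= r -> `|S u - S m| <= 1.

(** Orders are counted in the arc length from m, which is at most 1 on the range considered, so that
    orders may be lowered. *)
Definition bigOh n (f : R -> R) :=
exists2 c : R, 0 <= c & forall u, `|u - m| <= r -> `|f u| <= c * `|S u - S m| ^+ n.

Lemma bigOh_eq n (f h : R -> R) : f =1 h -> bigOh n f -> bigOh n h.
Proof. by move=> e [c c0 H]; exists c => // u hu; rewrite -e; exact: H. Qed.

Lemma bigOhD n (f h : R -> R) : bigOh n f -> bigOh n h -> bigOh n (fun u => f u + h u).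
Proof.
move=> [c c0 H] [d d0 G]; exists (c + d) => [|u hu]; first exact: addr_ge0.
by rewrite mulrDl; apply: le_trans (ler_normD _ _) _; apply: lerD; [exact: H|exact: G].
Qed.

Lemma bigOhM i j (f h : R -> R) : bigOh i f -> bigOh j h -> bigOh (i + j) (fun u => f u * h u).
Proof.
move=> [c c0 H] [d d0 G]; exists (c * d) => [|u hu]; first exact: mulr_ge0.
by rewrite exprD mulrACA normrM; apply: ler_pM => //; [exact: H|exact: G].
Qed.

Lemma bigOhW i j f : (i <= j)%N -> bigOh j f -> bigOh i f.
Proof.
move=> ij [c c0 H]; exists c => // u hu; apply: le_trans (H u hu) _.
apply: ler_wpM2l => //; apply: ler_wiXn2l => //; exact: s_le1.
Qed.

Lemma bigOh_cst (c : R) : bigOh 0 (fun=> c).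
Proof. by exists `|c| => // u _; rewrite expr0 mulr1. Qed.

Lemma bigOh_s n : bigOh n (fun u => (S u - S m) ^+ n).
Proof. by exists 1 => // u _; rewrite mul1r normrX. Qed.

Lemma bigOhZ n c f : bigOh n f -> bigOh n (fun u => c * f u).
Proof. by move=> H; have := bigOhM (bigOh_cst c) H. Qed.

Lemma bigOh_prim n f f1 : (forall u, der f u (f1 u * g u)) -> f m = 0 -> bigOh n f1 -> bigOh n.+1 f.
Proof.
by move=> df fm [c c0 H]; exists c => // u hu; apply: (growth c0 _ dS g0 fm H hu) => v _; exact: df.
Qed.

Lemma bigOh_le n (f h : R -> R) : (forall u, `|f u| <= `|h u|) -> bigOh n h -> bigOh n f.
Proof. by move=> le [c c0 H]; exists c => // u hu; apply: le_trans (le u) (H u hu). Qed.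

Variables (k1 k2 : R -> R) (B : R).
Hypothesis dk : forall u, der k u (k1 u * g u).
Hypothesis dk1 : forall u, der k1 u (k2 u * g u).
Hypothesis k2B : forall u, `|u - m| <= r -> `|k2 u| <= B.

Let sg u := S u - S m.
Let dsg u : der sg u (g u).
Proof. by apply: der_eq (derB (dS u) (der_cst _ u)) _; rewrite subr0. Qed.
Let sgm : sg m = 0. Proof. exact: subrr. Qed.

Lemma angle_expansion :
bigOh 3 (fun u => th u - th m - k m * (S u - S m) - k1 m * (S u - S m) ^+ 2 / 2).
Proof.
have O1 : bigOh 1 (fun u => k1 u - k1 m).
apply: (@bigOh_prim 0 _ k2) => [u||]; last by exists `|B| => // u hu; rewrite expr0 mulr1; apply: le_trans (k2B hu) (ler_norm _).
 by apply: der_eq (derB (dk1 u) (der_cst _ u)) _; rewrite subr0.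
by rewrite subrr.
have O2 : bigOh 2 (fun u => k u - k m - k1 m * sg u).
apply: (bigOh_prim _ _ O1) => [u|]; last by rewrite sgm subrr mulr0 subrr.
by apply: der_eq (derB (derB (dk u) (der_cst _ u)) (derM (der_cst _ u) (dsg u))) _; ring.
apply: (bigOh_prim _ _ O2) => [u|]; last by rewrite !subrr expr0n /= !mulr0 mul0r !subr0.
apply: der_eq (derB (derB (derB (dth u) (der_cst _ u)) (derM (der_cst _ u) (dsg u)))
(derM (derM (der_cst _ u) (derX 2 (dsg u))) (der_cst _ u))) _.
by rewrite /sg /=; field.
Qed.

(** Order 5 is required because [chord_upper] multiplies this error by 4 h and has to end at order
    6. *)
Lemma along_expansion : bigOh 5 (fun u => (x u - x m) * cos (th m) + (y u - y m) * sin (th m)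
- ((S u - S m) - k m ^+ 2 * (S u - S m) ^+ 3 / 6 - k m * k1 m * (S u - S m) ^+ 4 / 8)).
Proof.
have O3 := angle_expansion; set ro := (X in bigOh 3 X) in O3.
have s1 := bigOh_s 1; have s2 := bigOh_s 2.
have Oa : bigOh 1 (fun u => th u - th m).
apply: (@bigOh_eq _ (fun u => k m * (S u - S m) ^+ 1 + (k1 m / 2 * (S u - S m) ^+ 2 + ro u))).
 by move=> u; rewrite /ro; field.
apply: bigOhD; first exact: bigOhZ.
by apply: bigOhD; [apply: bigOhW (bigOhZ _ s2)|apply: bigOhW O3].
have Oc : bigOh 4 (fun u => cos (th u - th m) - 1 + (th u - th m) ^+ 2 / 2).
apply: (@bigOh_le _ _ (fun u => (th u - th m) ^+ 4 / 24)); last first.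
 apply: bigOh_eq (bigOhZ (24^-1) (bigOhM (bigOhM Oa Oa) (bigOhM Oa Oa))) => u /=.
 by field.
move=> u; have h1 := cos_ge (th u - th m); have h2 := cos_le (th u - th m).
rewrite ger0_norm; last by lras h1.
by apply: le_trans _ (ler_norm _); lras h2.
apply: (@bigOh_prim _ _ (fun u => cos (th u - th m)
 - (1 - k m ^+ 2 * (S u - S m) ^+ 2 / 2 - k m * k1 m * (S u - S m) ^+ 3 / 2))) => [u||].
- apply: der_eq (derB (along_der m u) (derB (derB (dsg u) (derM (derM (der_cst _ u) (derX 3 (dsg u))) (der_cst _ u)))
 (derM (derM (der_cst _ u) (derX 4 (dsg u))) (der_cst _ u)))) _.
by rewrite /sg /=; field.
- by rewrite !subrr !expr0n /= !mul0r !mulr0 !mul0r !subr0 addr0.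
- apply: (@bigOh_eq _ (fun u => (cos (th u - th m) - 1 + (th u - th m) ^+ 2 / 2)
 + (- (k1 m ^+ 2 / 8) * (S u - S m) ^+ 4 + (- (k m) * ((S u - S m) ^+ 1 * ro u)
 + (- (k1 m / 2) * ((S u - S m) ^+ 2 * ro u) + - (1 / 2) * (ro u * ro u)))))).
 by move=> u; rewrite /ro; field.
apply: bigOhD => //; apply: bigOhD; first exact: bigOhZ (bigOh_s 4).
apply: bigOhD; first exact: bigOhZ (bigOhM s1 O3).
apply: bigOhD; first by apply: bigOhW (bigOhZ _ (bigOhM s2 O3)).
by apply: bigOhW (bigOhZ _ (bigOhM O3 O3)).
Qed.

Lemma across_expansion : bigOh 3 (fun u => (y u - y m) * cos (th m) - (x u - x m) * sin (th m)
- k m * (S u - S m) ^+ 2 / 2).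
Proof.
have O3 := angle_expansion; set ro := (X in bigOh 3 X) in O3.
have s1 := bigOh_s 1; have s2 := bigOh_s 2.
have Oa : bigOh 1 (fun u => th u - th m).
apply: (@bigOh_eq _ (fun u => k m * (S u - S m) ^+ 1 + (k1 m / 2 * (S u - S m) ^+ 2 + ro u))).
 by move=> u; rewrite /ro; field.
apply: bigOhD; first exact: bigOhZ.
by apply: bigOhD; [apply: bigOhW (bigOhZ _ s2)|apply: bigOhW O3].
have Os : bigOh 3 (fun u => sin (th u - th m) - (th u - th m)).
apply: (@bigOh_le _ _ (fun u => (th u - th m) ^+ 3)); last first.
 by apply: bigOh_eq (bigOhM (bigOhM Oa Oa) Oa) => u /=; ring.
move=> u; set v := th u - th m.
have [v0|v0] := leP 0 v.
 have h1 := sin_ge v0; have h2 := sin_le v0.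
 rewrite ler0_norm; last by lras h2.
 apply: le_trans _ (ler_norm _); have : 0 <= v ^+ 3 by rewrite exprn_ge0.
 by move=> h3; lras h1 h2 h3.
have v0' : 0 <= - v by lras v0.
have h1 := sin_ge v0'; have h2 := sin_le v0'; rewrite sinN in h1 h2.
have e : (- v) ^+ 3 = - v ^+ 3 by ring.
rewrite e in h1.
rewrite ger0_norm; last by lras h2.
rewrite -normrN; apply: le_trans _ (ler_norm _).
have : 0 <= (- v) ^+ 3 by rewrite exprn_ge0.
by rewrite e => h3; lras h1 h2 h3.
apply: (@bigOh_prim _ _ (fun u => sin (th u - th m) - k m * (S u - S m))) => [u||].
- apply: der_eq (derB (across_der m u) (derM (derM (der_cst _ u) (derX 2 (dsg u))) (der_cst _ u))) _.
by rewrite /sg /=; field.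
- by rewrite !subrr !expr0n /= !mul0r !mulr0 !mul0r !subr0.
- apply: (@bigOh_eq _ (fun u => (sin (th u - th m) - (th u - th m)) + (k1 m / 2 * (S u - S m) ^+ 2 + ro u))).
 by move=> u; rewrite /ro; field.
by apply: bigOhD; [apply: bigOhW Os|apply: bigOhD; [exact: bigOhZ|apply: bigOhW O3]].
Qed.

(** For points at equal arc distance h on both sides of m, the even terms, quartic along the tangent
    and quadratic across it, cancel in the difference; the first uncontrolled term is h^6. *)
Lemma chord_upper : exists2 M : R, 0 <= M & forall p q h, `|p - m| <= r -> `|q - m| <= r -> 0 <= h ->
S q - S m = h -> S p - S m = - h ->
(x q - x p) ^+ 2 + (y q - y p) ^+ 2 <= 4 * h ^+ 2 - 4 / 3 * k m ^+ 2 * h ^+ 4 + M * h ^+ 6.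
Proof.
have [c c0 Hc] := along_expansion; have [d d0 Hd] := across_expansion.
exists (k m ^+ 4 / 9 + 8 * c + 2 * c * k m ^+ 2 + 4 * c ^+ 2 + 4 * d ^+ 2) => [|p q h hp hq h0 Sq Sp].
have := sqr_ge0 (k m); have := sqr_ge0 (k m ^+ 2); have := sqr_ge0 c; have := sqr_ge0 d.
rewrite -exprM; move=> h1 h2 h3 h4; have := mulr_ge0 c0 h4; move: (c * _) => w hw.
by rewrite -mulrA; have := mulr_ge0 c0 h4; move=> h5; lra.
have h1 : h <= 1 by have := s_le1 hq; rewrite Sq ger0_norm.
have := Hc q hq; have := Hc p hp; have := Hd q hq; have := Hd p hp.
rewrite Sq Sp normrN (ger0_norm h0).
set Aq := (x q - x m) * _ + _; set Ap := (x p - x m) * _ + _.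
set Bq := (y q - y m) * _ - _; set Bp := (y p - y m) * _ - _.
have E : (x q - x p) ^+ 2 + (y q - y p) ^+ 2 = (Aq - Ap) ^+ 2 + (Bq - Bp) ^+ 2.
rewrite /Aq /Ap /Bq /Bp; have cs := cos2Dsin2 (th m).
rewrite -[LHS]mulr1 -cs; ring.
rewrite E => b1 b2 a1 a2.
have bb : `|Bq - Bp| <= 2 * d * h ^+ 3.
have -> : Bq - Bp = (Bq - k m * h ^+ 2 / 2) - (Bp - k m * (- h) ^+ 2 / 2) by ring.
apply: le_trans (ler_normB _ _) _; lras b1 b2.
pose e := Aq - Ap - (2 * h - k m ^+ 2 * h ^+ 3 / 3).
have ee : `|e| <= 2 * c * h ^+ 5.
have -> : e = (Aq - (h - k m ^+ 2 * h ^+ 3 / 6 - k m * k1 m * h ^+ 4 / 8))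
 - (Ap - (- h - k m ^+ 2 * (- h) ^+ 3 / 6 - k m * k1 m * (- h) ^+ 4 / 8)) by rewrite /e; field.
apply: le_trans (ler_normB _ _) _; lras a1 a2.
have -> : Aq - Ap = 2 * h - k m ^+ 2 * h ^+ 3 / 3 + e by rewrite /e; ring.
have b2' : (Bq - Bp) ^+ 2 <= 4 * d ^+ 2 * h ^+ 6.
rewrite -[X in X <= _]real_normK ?num_real //.
have -> : 4 * d ^+ 2 * h ^+ 6 = (2 * d * h ^+ 3) ^+ 2 by ring.
exact: sq_le.
have e2 : e ^+ 2 <= 4 * c ^+ 2 * h ^+ 6.
rewrite -[X in X <= _]real_normK ?num_real //.
apply: le_trans (_ : (2 * c * h ^+ 5) ^+ 2 <= _); first exact: sq_le.
have -> : (2 * c * h ^+ 5) ^+ 2 = 4 * c ^+ 2 * h ^+ 10 by ring.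
apply: ler_wpM2l; first by have := sqr_ge0 c => h2; lras h2.
by apply: ler_wiXn2l.
have e1 : e * (4 * h) <= 8 * c * h ^+ 6.
apply: le_trans (_ : (2 * c * h ^+ 5) * (4 * h) <= _).
 apply: ler_wpM2r; first by lras h0.
 exact: le_trans (ler_norm _) ee.
by have -> : 8 * c * h ^+ 6 = (2 * c * h ^+ 5) * (4 * h) by ring.
have e3 : - e * (2 / 3 * k m ^+ 2 * h ^+ 3) <= 2 * c * k m ^+ 2 * h ^+ 6.
have k0 : 0 <= 2 / 3 * k m ^+ 2 * h ^+ 3.
 apply: mulr_ge0; last exact: exprn_ge0.
 by apply: mulr_ge0 (sqr_ge0 _); lra.
apply: le_trans (_ : (2 * c * h ^+ 5) * (2 / 3 * k m ^+ 2 * h ^+ 3) <= _).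
 apply: ler_wpM2r => //; apply: le_trans (ler_norm _) _; by rewrite normrN.
have h86 : h ^+ 8 <= h ^+ 6 by apply: ler_wiXn2l.
have h8 : 0 <= h ^+ 8 by rewrite exprn_ge0.
have ck : 0 <= c * k m ^+ 2 by rewrite mulr_ge0 // sqr_ge0.
have := ler_wpM2l ck h86; have := mulr_ge0 ck h8.
have -> : 2 * c * h ^+ 5 * (2 / 3 * k m ^+ 2 * h ^+ 3) = 4 / 3 * (c * k m ^+ 2 * h ^+ 8) by ring.
have -> : 2 * c * k m ^+ 2 * h ^+ 6 = 2 * (c * k m ^+ 2 * h ^+ 6) by ring.
move: (c * _ * h ^+ 8) (c * _ * h ^+ 6) => w1 w2 g1 g2; lras g1 g2.
have -> : (2 * h - k m ^+ 2 * h ^+ 3 / 3 + e) ^+ 2 = 4 * h ^+ 2 - 4 / 3 * k m ^+ 2 * h ^+ 4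
+ k m ^+ 4 / 9 * h ^+ 6 + e * (4 * h) + - e * (2 / 3 * k m ^+ 2 * h ^+ 3) + e ^+ 2 by field.
have -> : (k m ^+ 4 / 9 + 8 * c + 2 * c * k m ^+ 2 + 4 * c ^+ 2 + 4 * d ^+ 2) * h ^+ 6 = k m ^+ 4 / 9 * h ^+ 6 + 8 * c * h ^+ 6 + 2 * c * k m ^+ 2 * h ^+ 6 + 4 * c ^+ 2 * h ^+ 6 + 4 * d ^+ 2 * h ^+ 6 by ring.
lras b2' e2 e1 e3.
Qed.

End Landau.

(** At arc length 2h the squared profile is at least 4 h^2 - 16/3 mm^2 b^2 h^4 + 4 mm^2 b^3 h^5.
    Against [chord_upper] the term in h^5 beats the error in h^6, so even equality k^2 = 4 mm^2 b^2
    is excluded; the strictness is what lets the inequality survive for a short time. *)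
Lemma kurv_strict (k1 k2 : R -> R) (b mm h0 m : R) : (forall u, der k u (k1 u * g u)) ->
(forall u, der k1 u (k2 u * g u)) -> {for m, continuous k2} ->
0 < b -> 0 < mm -> 0 < h0 ->
(forall p q, p < q -> S q - S p < h0 ->
 (prof mm (b * (S q - S p)) / b) ^+ 2 <= (x q - x p) ^+ 2 + (y q - y p) ^+ 2) ->
k m ^+ 2 < 4 * mm ^+ 2 * b ^+ 2.
Proof.
move=> dk dk1 ck2 b0 mm0 hh0 H.
have cS (v : R) : {for v, continuous S} by exact: der_cvg (dS v).
have [r r0 hr] : exists2 r : R, 0 < r & forall u, `|u - m| <= r ->
 `|S u - S m| <= 1 /\ `|k2 u| <= `|k2 m| + 1.
have /cvgrPdist_lt/(_ 1 ltr01)[d1 /= d10 H1] := cS m.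
have /cvgrPdist_lt/(_ 1 ltr01)[d2 /= d20 H2] := ck2.
exists (Num.min d1 d2 / 2) => [|u hu]; first by rewrite divr_gt0 // lt_min d10 d20.
have m0 : 0 < Num.min d1 d2 by rewrite lt_min d10 d20.
have hu' : `|m - u| < Num.min d1 d2 by rewrite distrC; lras hu m0.
move: hu'; rewrite lt_min => /andP[/H1 g1 /H2 g2].
split; first by rewrite distrC; exact: ltW.
have := lerB_dist (k2 u) (k2 m); rewrite (distrC (k2 u)) => g3; lras g2 g3.
have [M M0 HM] := @chord_upper m r (fun u hu => (hr u hu).1) k1 k2 _ dk dk1 (fun u hu => (hr u hu).2).
have Slt u v : u < v -> S u < S v.
by move=> uv; apply: (der_gt0_lt uv (fun z _ => dS z)) => z _; exact: g0.
have M1 : 0 < M + 1 by lras M0.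
have w0 : 0 < mm ^+ 2 * b ^+ 3 by rewrite mulr_gt0 ?exprn_gt0.
(* In turn: both points stay within r of m, the pair is closer than h0, the quartic expansion of the
   profile applies, and h (M + 1) stays below a quarter of the fifth-order coefficient. *)
have [h hp [hh1a hh1b hh2 hh3 hh4]] : exists2 h : R, 0 < h & [/\ h <= S (m + r) - S m,
 h <= S m - S (m - r), h <= h0 / 4, h <= 1 / (8 * b) & h <= mm ^+ 2 * b ^+ 3 / (M + 1)].
have e1 : 0 < S (m + r) - S m by rewrite subr_gt0 Slt //; lras r0.
have e2 : 0 < S m - S (m - r) by rewrite subr_gt0 Slt //; lras r0.
have e3 : 0 < h0 / 4 by rewrite divr_gt0.
have e4 : 0 < 1 / (8 * b) by rewrite divr_gt0 // mulr_gt0.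
have e5 : 0 < mm ^+ 2 * b ^+ 3 / (M + 1) by rewrite divr_gt0.
exists (Num.min (S (m + r) - S m) (Num.min (S m - S (m - r)) (Num.min (h0 / 4)
 (Num.min (1 / (8 * b)) (mm ^+ 2 * b ^+ 3 / (M + 1)))))).
 by rewrite !lt_min e1 e2 e3 e4 e5.
by split; rewrite !ge_min lexx ?orbT.
have [q /andP[mq qr] Sq] : exists2 q : R, m <= q <= m + r & S q = S m + h.
apply: ivt => [|u _|]; [by lras r0|exact: cS|by lras hp hh1a].
have [p /andP[pr pm] Sp] : exists2 p : R, m - r <= p <= m & S p = S m - h.
apply: ivt => [|u _|]; [by lras r0|exact: cS|by lras hp hh1b].
have hpr : `|p - m| <= r by rewrite ler_norml; lras pr pm r0.
have hqr : `|q - m| <= r by rewrite ler_norml; lras qr mq r0.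
have Sqm : S q - S m = h by rewrite Sq; ring.
have Spm : S p - S m = - h by rewrite Sp; ring.
have lE : S q - S p = 2 * h by rewrite Sq Sp; ring.
have pq : p < q.
rewrite ltNge; apply/negP => /Smono; rewrite Sq Sp => hb; lras hb hp.
have up := HM p q h hpr hqr (ltW hp) Sqm Spm.
have lo := H p q pq; rewrite lE in lo.
have {}lo := lo (_ : 2 * h < h0); have {}lo := lo ltac:(lras hh2 hp hh0).
have s14 : 0 <= b * (2 * h) <= 1 / 4.
have : h * (8 * b) <= 1 by rewrite -ler_pdivlMr // mulr_gt0.
have := mulr_gt0 b0 hp => g1 g2; lras g1 g2.
have pl := prof_low mm s14.
set s := b * (2 * h) in pl s14 lo.
have /andP[s0 s1] := s14.
have pf0 : 0 <= prof mm s by apply: le_trans (prof_ge mm s0); rewrite mulr_ge0 // ltW // prof1_gt0.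
pose w := - (mm ^+ 2 / 6) * s ^+ 3 + mm ^+ 2 / 16 * s ^+ 4.
(* Squaring the lower bound s + w is legitimate only if it is nonnegative; otherwise s + 2 w is
   negative and the claim is trivial. *)
have pl2 : s * (s + 2 * w) <= prof mm s ^+ 2.
have pw : s + w <= prof mm s by rewrite /w; lras pl.
have [h1|h1] := leP 0 (s + w).
 apply: le_trans (_ : (s + w) ^+ 2 <= _); last exact: sq_le.
 have := sqr_ge0 w => h2; nra.
apply: le_trans (_ : 0 <= _); last exact: sqr_ge0.
rewrite mulr_ge0_le0 //; lras h1 s0.
have bp : 0 < b ^+ 2 by rewrite exprn_gt0.
have main : s * (s + 2 * w) <= (4 * h ^+ 2 - 4 / 3 * k m ^+ 2 * h ^+ 4 + M * h ^+ 6) * b ^+ 2.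
apply: le_trans pl2 _; rewrite -ler_pdivrMr //.
by apply: le_trans up; move: lo; rewrite exprMn exprVn.
have e1 : s * (s + 2 * w) = (4 * h ^+ 2 - 16 / 3 * mm ^+ 2 * b ^+ 2 * h ^+ 4
+ 4 * mm ^+ 2 * b ^+ 3 * h ^+ 5) * b ^+ 2 by rewrite /w /s; field.
rewrite e1 ler_pM2r // in main.
have h4 : 0 < h ^+ 4 by rewrite exprn_gt0.
have hM : h * (M + 1) <= mm ^+ 2 * b ^+ 3 by rewrite -ler_pdivlMr.
have main2 : (4 / 3 * k m ^+ 2) * h ^+ 4
 <= (16 / 3 * mm ^+ 2 * b ^+ 2 - 4 * (mm ^+ 2 * b ^+ 3) * h + M * h ^+ 2) * h ^+ 4.
apply: le_trans (_ : 4 * h ^+ 2 + M * h ^+ 6 - (4 * h ^+ 2 - 16 / 3 * mm ^+ 2 * b ^+ 2 * h ^+ 4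
+ 4 * mm ^+ 2 * b ^+ 3 * h ^+ 5) <= _); first by lras main.
by rewrite le_eqVlt; apply/orP; left; apply/eqP; ring.
rewrite ler_pM2r // in main2.
have t1 : M * h ^+ 2 <= (mm ^+ 2 * b ^+ 3) * h.
rewrite expr2 mulrA ler_pM2r //; lras hM hp.
have t2 := mulr_gt0 w0 hp.
lras main2 t1 t2.
Qed.

End ChordExpansion.

(** * Length along the flow, and Cauchy-Schwarz for the turning *)

Section MeanValue.
Context {R : realType}.
Implicit Types (f df : R -> R) (a b t e d : R).

Lemma within_eps f a b : (forall t, a <= t <= b -> forall e, 0 < e -> exists2 d : R, 0 < d &
 forall t', a <= t' <= b -> `|t' - t| < d -> `|f t' - f t| < e) ->
{within `[a, b], continuous f}.
Proof.
move=> H; apply/subspace_continuousP => t; rewrite /= in_itv /= => ht.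
apply/cvgrPdist_lt => e e0; have [d d0 Hd] := H t ht e e0.
rewrite /= /within /=; exists d => //= t' /= h1; rewrite in_itv /= => h2.
by rewrite distrC; apply: Hd => //; rewrite distrC.
Qed.

(** The flow equation holds at positive times only, so at the initial time continuity replaces
    differentiability. *)
Lemma mvt_open f df a b : a < b -> (forall t, a < t < b -> der f t (df t)) ->
(forall t, a <= t <= b -> forall e, 0 < e -> exists2 d : R, 0 < d &
 forall t', a <= t' <= b -> `|t' - t| < d -> `|f t' - f t| < e) ->
exists2 c : R, a < c < b & f b - f a = df c * (b - a).
Proof.
move=> ab H /within_eps W.
have [|c hc E] := MVT ab _ W (df := df); first by move=> t; rewrite in_itv /= => /H.
by exists c => //; move: hc; rewrite in_itv.
Qed.

End MeanValue.

Section FlowBundle.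
Context {R : realType}.
Implicit Types (u t p q : R).

Definition flowing (a : R -> R) eps (c1 c2 : R -> R) (P : R) x y T : Prop :=
(eps = 1 \/ eps = -1) /\ 0 < P /\ (forall s, derivable a s 1) /\ (forall s, 0 < a s) /\
(forall s, a (s + 2 * pi) = a s) /\ flow_solution a eps c1 c2 P x y T.

Variables (a : R -> R) (eps : R) (c1 c2 : R -> R) (P : R) (x y : R -> R -> R) (T : R).
Hypothesis F : flowing a eps c1 c2 P x y T.
Notation g := (speed x y).
Notation k := (kurv x y).
Notation th := (tangle x y).
Notation l_ := (alen x y).
Notation I_ := [set t : R | 0 <= t < T].

Lemma flowing_eps : eps = 1 \/ eps = -1. Proof. by case: F. Qed.
Lemma flowing_P : 0 < P. Proof. by case: F => _ []. Qed.
Lemma flowing_da s : derivable a s 1. Proof. by case: F => _ [_ [h _]]; exact: h. Qed.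
Lemma flowing_a0 s : 0 < a s. Proof. by case: F => _ [_ [_ [h _]]]; exact: h. Qed.
Lemma flowing_aper s : a (s + 2 * pi) = a s. Proof. by case: F => _ [_ [_ [_ [h _]]]]; exact: h. Qed.
Lemma flowing_sol : flow_solution a eps c1 c2 P x y T. Proof. by case: F => _ [_ [_ [_ []]]]. Qed.

Let H := flowing_sol.

Lemma flow_space0 u t : 0 <= t < T -> der (x ^~ t) u (du x u t) /\ der (y ^~ t) u (du y u t).
Proof. exact: (flow_space H 0). Qed.

Lemma alen_cat p q r t : l_ p q t + l_ q r t = l_ p r t.
Proof. by rewrite /alen addrC addrA subrK. Qed.

Lemma alen_shift p q t : 0 <= t < T -> l_ (p + P) (q + P) t = l_ p q t.
Proof.
move=> ht.
have d1 v : der (fun v => prim (g ^~ t) (v + P)) v (g v t).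
have dP : der (fun z : R => z + P) v (1 + 0) by exact: derD (der_id v) (der_cst P v).
apply: der_eq (@der_comp _ (prim (g ^~ t)) (fun z => z + P) v _ _ (arc_der H (v + P) ht) dP) _.
by rewrite addr0 mulr1 (speed_per H).
exact: (der_uniq_prim d1 (fun v => arc_der H v ht)).
Qed.

Lemma alen_period p t : 0 <= t < T -> l_ p (p + P) t = l_ 0 P t.
Proof.
move=> ht.
have := alen_shift 0 p ht; rewrite add0r => E.
by rewrite -(alen_cat 0 P P t) -(alen_cat p 0 (p + P)) -[l_ 0 (p + P) t](alen_cat 0 P) E /alen; ring.
Qed.

Lemma alen_ge0 p q t : p <= q -> 0 <= t < T -> 0 <= l_ p q t.
Proof.
move=> pq ht; rewrite /alen subr_ge0.
apply: (der_ge0_le pq (fun v _ => arc_der H v ht)) => v _; exact: ltW (speed_gt0 H v ht).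
Qed.

Lemma cont_prim2 (f : R -> R -> R) (A : set R) p q t : A t -> cont_on A f ->
forall e, 0 < e -> exists2 d : R, 0 < d & forall p' q' t', A t' ->
`|p' - p| < d -> `|q' - q| < d -> `|t' - t| < d -> `|f q' t' - f p' t' - (f q t - f p t)| < e.
Proof.
move=> At cf e e0; have e2 : 0 < e / 2 by rewrite divr_gt0.
have [d1 d10 H1] := cf p t At _ e2; have [d2 d20 H2] := cf q t At _ e2.
exists (Num.min d1 d2) => [|p' q' t' At']; first by rewrite lt_min d10 d20.
rewrite !lt_min => /andP[hp _] /andP[_ hq] /andP[ht1 ht2].
have {}H1 := H1 p' t' At' hp ht1; have {}H2 := H2 q' t' At' hq ht2.
have -> : f q' t' - f p' t' - (f q t - f p t) = (f q' t' - f q t) - (f p' t' - f p t) by ring.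
apply: le_lt_trans (ler_normB _ _) _.
by rewrite [e]splitr; apply: ltrD.
Qed.

Lemma alen_cont p q t : 0 <= t < T -> forall e, 0 < e -> exists2 d : R, 0 < d &
forall p' q' t', 0 <= t' < T -> `|p' - p| < d -> `|q' - q| < d -> `|t' - t| < d ->
`|l_ p' q' t' - l_ p q t| < e.
Proof. by move=> ht; apply: (@cont_prim2 _ I_ _ _ _ ht); apply: cont_prim; exact: speed_cont H. Qed.

Lemma periodic_bound (f : R -> R -> R) t1 : cont_on I_ f -> 0 <= t1 < T ->
(forall u t, 0 <= t < T -> f (u + P) t = f u t) ->
exists2 M : R, 0 < M & forall u t, 0 <= t <= t1 -> `|f u t| <= M.
Proof.
move=> cf /andP[t10 t1T] fper; apply: contrapT => no.
have sub t : 0 <= t <= t1 -> 0 <= t < T by move=> /andP[-> h] /=; exact: le_lt_trans h t1T.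
have P0 := flowing_P.
have red (n : nat) : exists ut : R * R, [/\ 0 <= ut.1 <= P, 0 <= ut.2 <= t1 & n%:R < `|f ut.1 ut.2|].
apply: contrapT => hno; apply: no; exists n.+1%:R => // u t ht; rewrite leNgt; apply/negP => hb.
apply: hno.
have [j [v [hv uE]]] : exists (j : int) v, 0 <= v <= P /\ u = v + j%:~R * P.
 exists (Num.floor (u / P)), (u - (Num.floor (u / P))%:~R * P); split; last by rewrite subrK.
 have /andP[h1 h2] := mem_rg1_floor (u / P).
 rewrite subr_ge0 -ler_pdivlMr // h1 /= lerBlDr -{1}[P]mul1r -mulrDl -ler_pdivrMr // addrC ltW //.
exists (v, t); split => //=.
have pf s : f (s + P) t = f s t by apply: fper; exact: sub.
have := periodic_int pf j v; rewrite -uE => <-.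
by apply: lt_trans hb; rewrite ltr_nat.
have [z hz] := choice red.
have [|u [t [w [hu ht _ HH]]]] := @bolzano_weierstrass3 _ (fun n => (z n).1) (fun n => (z n).2) (fun=> 0) 0 (P + t1).
move=> n; have [/andP[h1 h2] /andP[h3 h4] _] := hz n.
by split; apply/andP; split; rewrite ?addr_ge0 // ?(ltW P0) //; [apply: le_trans h2 _; rewrite lerDl|apply: le_trans h4 _; rewrite lerDr ltW].
have ht1 : 0 <= t <= t1.
have /andP[-> _] := ht; rewrite /= leNgt; apply/negP => hb.
have hb' : 0 < t - t1 by rewrite subr_gt0.
have [n [_ _ hn _]] := HH (t - t1) 0%N hb'.
have [_ /andP[_ h4] _] := hz n; move: hn; rewrite distrC ger0_norm ?subr_ge0.
 by rewrite ltrD2l ltrN2 ltNge h4.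
exact: le_trans h4 (ltW hb).
have [d d0 Hd] := cf u t (sub t ht1) 1 ltr01.
have [N hN] : exists N : nat, `|f u t| + 1 < N%:R.
by exists (Num.Def.archi_bound (`|f u t| + 1)); apply: archi_boundP; rewrite addr_ge0.
have [n [Nn h1 h2 _]] := HH d N d0.
have [_ hn3 hn] := hz n.
have := Hd (z n).1 (z n).2 (sub _ hn3) h1 h2.
have := lerB_dist (f (z n).1 (z n).2) (f u t).
have : N%:R <= n%:R :> R by rewrite ler_nat.
move: hN hn => g1 g2 g3 g4 g5; lras g1 g2 g3 g4 g5.
Qed.

(** With b the root of a and B a primitive of b, B of the tangent angle changes along the arc by the
    integral of b k ds. Cauchy-Schwarz bounds its square by dissipation times length, and the mean
    value theorem writes the change as b (xi) times the turning: this is the origin of the angle xi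
    in the key inequalities. *)
Lemma cauchy_schwarz p q t : 0 <= t < T -> p < q ->
exists2 xi : R, `|xi - th p t| <= `|th q t - th p t| /\ `|xi - th q t| <= `|th q t - th p t| &
a xi * (th q t - th p t) ^+ 2 <= dissip a x y p q t * l_ p q t.
Proof.
move=> ht pq.
pose b s := Num.sqrt (a s) : R.
have ca (s : R) : {for s, continuous a} := der_cvg (der_derive1 (@flowing_da s)).
have cb : continuous b.
move=> s; apply: (@continuous_comp _ _ _ a (@Num.sqrt R)); first exact: ca.
exact: (@sqrt_continuous R).
have bsq s : b s ^+ 2 = a s by rewrite /b sqr_sqrtr // ltW // flowing_a0.
set B := prim b; have dB s : der B s (b s) := prim_der cb s.
pose D := prim (fun v => a (th v t) * k v t ^+ 2 * g v t).
have dD (v : R) : der D v (a (th v t) * k v t ^+ 2 * g v t).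
by rewrite /D; exact: (dissip_der (fun s => @flowing_da s) H v ht).
have l0 : 0 < l_ p q t by exact: (arc_gt0 H pq ht).
set dB' := B (th q t) - B (th p t).
have main : dB' ^+ 2 <= dissip a x y p q t * l_ p q t.
(* Cauchy-Schwarz by integrating (b k - lam)^2 >= 0 with the optimal lam. *)
pose lam := dB' / l_ p q t.
pose Phi v := D v - 2 * lam * B (th v t) + lam ^+ 2 * prim (g ^~ t) v.
have dPhi v : der Phi v ((b (th v t) * k v t - lam) ^+ 2 * g v t).
 apply: der_eq (derD (derB (dD v) (derM (der_cst _ v) (der_comp (f := B) (dB _) (tangle_der H v ht))))
 (derM (der_cst _ v) (arc_der H v ht))) _.
 by rewrite -bsq; ring.
have : Phi p <= Phi q.
 apply: (der_ge0_le (ltW pq) (fun v _ => dPhi v)) => v _.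
 by apply: mulr_ge0 (sqr_ge0 _) (ltW (speed_gt0 H v ht)).
have e1 : dissip a x y p q t = D q - D p by [].
have e2 : l_ p q t = prim (g ^~ t) q - prim (g ^~ t) p by [].
rewrite -subr_ge0.
have -> : Phi q - Phi p = dissip a x y p q t - 2 * lam * dB' + lam ^+ 2 * l_ p q t.
 by rewrite e1 e2 /Phi /dB'; ring.
have -> : dissip a x y p q t - 2 * lam * dB' + lam ^+ 2 * l_ p q t
 = (dissip a x y p q t * l_ p q t - dB' ^+ 2) / l_ p q t.
 by rewrite /lam; field; exact: lt0r_neq0.
by rewrite pmulr_lge0 ?invr_gt0 // subr_ge0.
have mv (u v : R) : exists2 xi : R, `|xi - u| <= `|v - u| /\ `|xi - v| <= `|v - u| & B v - B u = b xi * (v - u).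
case: (ltgtP u v) => [uv|vu|->].
- have [c /andP[h1 h2] E] := mvt uv (fun z _ => dB z); exists c => //.
 have hs : 0 <= v - u by rewrite subr_ge0 ltW.
 by rewrite (ger0_norm hs); split; rewrite ler_norml; apply/andP; split; lras h1 h2.
- have [c /andP[h1 h2] E] := mvt vu (fun z _ => dB z); exists c.
 have hs : v - u <= 0 by rewrite subr_le0 ltW.
 by rewrite (ler0_norm hs); split; rewrite ler_norml; apply/andP; split; lras h1 h2.
 by rewrite -[LHS]opprB E; ring.
- by exists v; rewrite ?subrr ?mulr0.
have [xi hxi E] := mv (th p t) (th q t); exists xi => //.
by rewrite -bsq -exprMn -E; exact: main.
Qed.

Lemma dissip_ge0 p q t : 0 <= t < T -> p <= q -> 0 <= dissip a x y p q t.
Proof.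
move=> ht pq; rewrite /dissip /= subr_ge0.
apply: (der_ge0_le pq (fun v _ => dissip_der (fun s => @flowing_da s) H v ht)) => v _.
apply: mulr_ge0 (ltW (speed_gt0 H v ht)); apply: mulr_ge0 (sqr_ge0 _); exact: ltW (flowing_a0 _).
Qed.

Lemma length_noninc t1 t2 : 0 <= t1 -> t1 <= t2 -> t2 < T -> l_ 0 P t2 <= l_ 0 P t1.
Proof.
move=> h0 + h2; rewrite le_eqVlt => /orP[/eqP->//|h12].
have P0 := flowing_P.
have [||c /andP[hc1 hc2] E] := @mvt_open _ (l_ 0 P) (fun t => - dissip a x y 0 P t) t1 t2 h12.
- move=> t /andP[g1 g2]; apply: (arc_time flowing_eps (fun s => @flowing_da s) H (ltW P0)).
by rewrite (le_lt_trans h0 g1) (lt_trans g2 h2).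
- move=> t /andP[g1 g2] e e0.
have ht : 0 <= t < T by rewrite (le_trans h0 g1) (le_lt_trans g2 h2).
have [d d0 Hd] := alen_cont 0 P ht e0; exists d => // t' /andP[g3 g4] htt.
by apply: Hd => //; rewrite ?subrr ?normr0 // (le_trans h0 g3) (le_lt_trans g4 h2).
rewrite -subr_le0 E mulNr oppr_le0; apply: mulr_ge0; last by rewrite subr_ge0 ltW.
apply: dissip_ge0; last exact: ltW.
by rewrite (le_trans h0 (ltW hc1)) (lt_trans hc2 h2).
Qed.

End FlowBundle.

(** * The crude chord-arc estimate *)

Section ChordArc.
Context {R : realType}.
Implicit Types (u t p q : R).

(** The flow is controlled on [0, t1] only, so F is extended by 0 to meet the periodicity at all
    times asked by [first_contact]. *)
Lemma first_contact_on (F : R -> R -> R -> R) (P t1 : R) : 0 < P -> 0 <= t1 ->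
(forall p q t, 0 <= t <= t1 -> F (p + P) (q + P) t = F p q t) ->
(forall p q t, 0 <= t <= t1 -> forall e, 0 < e -> exists2 d : R, 0 < d &
 forall p' q' t', 0 <= t' <= t1 -> `|p' - p| < d -> `|q' - q| < d -> `|t' - t| < d ->
 `|F p' q' t' - F p q t| < e) ->
(forall p q, p <= q <= p + P -> 0 <= F p q 0) ->
(forall t, 0 <= t < t1 ->
 (forall s p q, 0 <= s <= t -> p <= q <= p + P -> 0 <= F p q s) ->
 exists2 d : R, 0 < d & forall s p q, t <= s <= t + d -> s <= t1 ->
 p <= q <= p + P -> q - p < d \/ p + P - q < d -> 0 <= F p q s) ->
(forall t p q, 0 <= t < t1 ->
 (forall s p q, 0 <= s <= t -> p <= q <= p + P -> 0 <= F p q s) ->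
 p < q < p + P -> F p q t = 0 -> False) ->
forall t p q, 0 <= t <= t1 -> p <= q <= p + P -> 0 <= F p q t.
Proof.
move=> P0 t10 per cont h0 hdiag hcon.
pose G p q t := if 0 <= t <= t1 then F p q t else 0.
have GE p q t : 0 <= t <= t1 -> G p q t = F p q t by rewrite /G => ->.
have good t : 0 <= t < t1 -> (forall s p q, 0 <= s <= t -> p <= q <= p + P -> 0 <= G p q s) ->
 forall s p q, 0 <= s <= t -> p <= q <= p + P -> 0 <= F p q s.
move=> /andP[g1 g2] HG s p q hs hpq; rewrite -GE ?HG //.
by have /andP[-> h] := hs; rewrite /= (le_trans h (ltW g2)).
move=> t p q ht hpq; rewrite -(GE p q t ht); move: t p q ht hpq.
apply: (@first_contact _ G P t1 P0 t10).
- by move=> p q t; rewrite /G; case: ifP => // ht; exact: per.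
- move=> p q t ht e e0; have [d d0 Hd] := cont p q t ht e e0.
by exists d => // p' q' t' ht' h1 h2 h3; rewrite !GE //; exact: Hd.
- by move=> p q hpq; rewrite GE ?lexx //; exact: h0.
- move=> t ht /(good t ht) HG; have [d d0 Hd] := hdiag t ht HG.
exists d => // s p q hs hs1 hpq hor; rewrite GE; first exact: (Hd s p q hs hs1 hpq hor).
by have /andP[g1 _] := ht; have /andP[g2 _] := hs; rewrite (le_trans g1 g2) hs1.
- move=> t p q ht /(good t ht) HG hpq; rewrite GE; first exact: (hcon t p q ht HG hpq).
by have /andP[-> h] := ht; rewrite (ltW h).
Qed.

(** Let z = l / L. For z <= 1/100 the slope c is nearly mu and 2.35 wins against 2.1, the Lipschitz
    gap of the limit mobility. Otherwise d >= mu eL / 200, and C0 is chosen so that C0 d^2 exceeds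
    all errors, which are at most (9 K^2 + 4) mu^2. *)
Lemma chord_arc_alg (mu l L c d X pt C0 K aT eL Db2 S2 e : R) :
0 < mu <= 1 / 100 -> 0 < l <= L / 2 -> 0 < eL <= L ->
c = mu * (1 - 2 * l / L) -> d = mu * (l * (1 - l / L)) -> aT <= X * l -> 235 / 100 <= aT ->
pt <= - C0 * d -> 0 <= Db2 -> Db2 <= (3 * K * c) ^+ 2 -> (200 * e <= c -> Db2 <= 21 / 10 * c ^+ 2) ->
0 <= S2 <= 3 -> 250 * e <= mu -> C0 = 400 * 100 * (9 * K ^+ 2 + 4) / eL ^+ 2 ->
d * c * X - d * pt <= Db2 * (1 - c ^+ 2) + d * (2 * mu / L) * S2 -> False.
Proof.
move=> /andP[mu0 mu1] /andP[l0 lL] /andP[eL0 eLL] cE dE haT haT1 hpt D0 D1 D2 /andP[S0 S3] he C0E main.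
have L0 : 0 < L by lraw eL0 eLL.
pose z := l / L.
have lz : l = z * L by rewrite /z divfK // lt0r_neq0.
have z0 : 0 < z by rewrite divr_gt0.
have z1 : z <= 1 / 2 by rewrite /z ler_pdivrMr //; lraw lL.
have cz : c = mu * (1 - 2 * z) by rewrite cE /z; ring.
have dz : d = mu * (1 - z) * l by rewrite dE -/z; ring.
have d0 : 0 < d by rewrite dz; apply: mulr_gt0 => //; apply: mulr_gt0 => //; lraw z1.
have c0 : 0 <= c by rewrite cz; apply: mulr_ge0; [exact: ltW|lraw z1].
have cmu : c <= mu by rewrite cz; have := mulr_gt0 mu0 z0 => h; lraw h.
have C00 : 0 <= C0.
rewrite C0E; apply: divr_ge0; last exact: sqr_ge0.
have := sqr_ge0 K => h; lraw h.
have X0 : 0 < X by rewrite -(pmulr_lgt0 _ l0); lraw haT haT1.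
have r1 : Db2 * (1 - c ^+ 2) <= Db2.
have := mulr_ge0 D0 (sqr_ge0 c) => h; lraw h.
have r2 : d * (2 * mu / L) * S2 <= 6 * mu ^+ 2 * (z * (1 - z)).
have -> : 6 * mu ^+ 2 * (z * (1 - z)) = d * (2 * mu / L) * 3.
 by rewrite dz /z; field; exact: lt0r_neq0.
apply: ler_wpM2l => //; apply: mulr_ge0; first exact: ltW.
by apply: divr_ge0; [lraw mu0|exact: ltW].
have r3 : C0 * d ^+ 2 <= - d * pt.
have := ler_wpM2l (ltW d0) hpt => h; lraw h.
have z2 : 0 <= z ^+ 2 by exact: sqr_ge0.
have mu2 : 0 < mu ^+ 2 by rewrite exprn_gt0.
have r4 : c * (mu * (1 - z) * (235 / 100)) <= d * c * X.
have -> : d * c * X = c * (mu * (1 - z) * (X * l)) by rewrite dz; ring.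
apply: ler_wpM2l => //; apply: ler_wpM2l; last by lraw haT haT1.
by apply: mulr_ge0; [exact: ltW|lraw z1].
have [zs|zs] := leP z (1 / 100).
have c98 : 98 / 100 * mu <= c.
 rewrite cz; have := ler_wpM2l (ltW mu0) zs => h; lraw h.
have D3 : Db2 <= 21 / 10 * c ^+ 2 by apply: D2; lraw he c98 mu0.
have C0d : 0 <= C0 * d ^+ 2 by rewrite mulr_ge0 // sqr_ge0.
have q1 : 6 * mu ^+ 2 * (z * (1 - z)) <= 6 / 100 * mu ^+ 2.
 have h1 : z * (1 - z) <= 1 / 100 by lraw zs z2.
 have := ler_wpM2l (ltW mu2) h1 => h; lraw h.
have q2 : c * (mu * (99 / 100) * (235 / 100)) <= c * (mu * (1 - z) * (235 / 100)).
 apply: ler_wpM2l => //; have h1 : 99 / 100 <= 1 - z by lraw zs.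
 have := ler_wpM2l (ltW mu0) h1 => h; lraw h.
have q3 : c ^+ 2 <= c * mu by rewrite expr2 ler_wpM2l.
have q4 : 98 / 100 * mu ^+ 2 <= c * mu.
 have := ler_wpM2r (ltW mu0) c98 => h; lraw h.
have q5 : c * (mu * (99 / 100) * (235 / 100)) = 23265 / 100 / 100 * (c * mu).
 by field.
rewrite q5 in q2.
lraw main r1 r2 r3 r4 C0d q1 q2 q3 q4 D3 mu2.
have w1 : 0 <= c * (mu * (1 - z) * (235 / 100)).
apply: mulr_ge0 => //; apply: mulr_ge0; last by lra.
by apply: mulr_ge0; [exact: ltW|lraw z1].
have w2 : 6 * mu ^+ 2 * (z * (1 - z)) <= 3 / 2 * mu ^+ 2.
have h1 : z * (1 - z) <= 1 / 4 by have := sqr_ge0 (z - 1 / 2) => h; lraw h.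
have := ler_wpM2l (ltW mu2) h1 => h; lraw h.
have w3 : (3 * K * c) ^+ 2 <= 9 * K ^+ 2 * mu ^+ 2.
rewrite exprMn; have -> : (3 * K) ^+ 2 = 9 * K ^+ 2 by ring.
apply: ler_wpM2l; first by have := sqr_ge0 K => h; lraw h.
exact: sq_le.
have w4 : mu * eL / 200 <= d.
rewrite dz; have -> : mu * eL / 200 = mu * (1 / 2) * (eL / 100) by field.
apply: ler_pM.
- by apply: mulr_ge0; [exact: ltW|lra].
- by lraw eL0.
- by apply: ler_wpM2l; [exact: ltW|lraw z1].
- rewrite lz; have := ler_wpM2r (ltW L0) (ltW zs) => h; lraw h eLL.
have w5 : (9 * K ^+ 2 + 4) * mu ^+ 2 <= C0 * d ^+ 2.
have -> : (9 * K ^+ 2 + 4) * mu ^+ 2 = C0 * (mu * eL / 200) ^+ 2.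
 by rewrite C0E; field; exact: lt0r_neq0.
apply: ler_wpM2l => //; apply: sq_le => //.
by apply: divr_ge0; [apply: mulr_ge0; exact: ltW|lra].
have w6 : (9 * K ^+ 2 + 4) * mu ^+ 2 = 9 * K ^+ 2 * mu ^+ 2 + 4 * mu ^+ 2 by ring.
rewrite w6 in w5; move: (9 * K ^+ 2 * mu ^+ 2) w3 w5 => W w3 w5.
lraw main r1 r2 r3 r4 w1 w2 w3 w5 D1 mu2.
Qed.

Definition chord2 (x y : R -> R -> R) p q t : R := (x q t - x p t) ^+ 2 + (y q t - y p t) ^+ 2.

Variables (a : R -> R) (eps : R) (c1 c2 : R -> R) (P : R) (x y : R -> R -> R) (T : R).
Hypothesis F : flowing a eps c1 c2 P x y T.
Notation g := (speed x y).
Notation k := (kurv x y).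
Notation th := (tangle x y).
Notation l_ := (alen x y).
Notation I_ := [set t : R | 0 <= t < T].
Let H := flowing_sol F.
Notation L := (l_ 0 P).
Notation ch := (chord2 x y).

Lemma flow_periodic u t : 0 <= t < T -> x (u + P) t = x u t /\ y (u + P) t = y u t.
Proof. exact: (flow_per H 0). Qed.

Lemma chord2_shift p q t : 0 <= t < T -> ch (p + P) (q + P) t = ch p q t.
Proof. by move=> ht; rewrite /chord2 !(flow_periodic _ ht).1 !(flow_periodic _ ht).2. Qed.

Lemma chord2_swap p q t : 0 <= t < T -> ch q (p + P) t = ch p q t.
Proof. by move=> ht; rewrite /chord2 (flow_periodic p ht).1 (flow_periodic p ht).2; ring. Qed.

Lemma alen_swap p q t : 0 <= t < T -> l_ q (p + P) t = L t - l_ p q t.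
Proof. by move=> ht; rewrite -(alen_period F p ht) -(alen_cat x y p q); ring. Qed.

Lemma chord2_ge0 p q t : 0 <= ch p q t.
Proof. by rewrite addr_ge0 // sqr_ge0. Qed.

Definition cont3 (Q : set R) (f : R -> R -> R -> R) := forall p q t, Q t -> forall e, 0 < e ->
exists2 d : R, 0 < d & forall p' q' t', Q t' -> `|p' - p| < d -> `|q' - q| < d -> `|t' - t| < d ->
`|f p' q' t' - f p q t| < e.

Lemma cont3_comp2 Q f h (G : R -> R -> R) : cont3 Q f -> cont3 Q h ->
(forall v w : R, {for (v, w), continuous (fun z : R * R => G z.1 z.2)}) ->
cont3 Q (fun p q t => G (f p q t) (h p q t)).
Proof.
move=> cf ch cG p q t Qt e e0.
have [d d0 Hd] := cont_for (cG (f p q t) (h p q t)) e0.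
have [d1 d10 H1] := cf p q t Qt d d0; have [d2 d20 H2] := ch p q t Qt d d0.
exists (Num.min d1 d2) => [|p' q' t' Qt']; first by rewrite lt_min d10 d20.
rewrite !lt_min => /andP[a1 a2] /andP[b1 b2] /andP[e1 e2].
by apply: Hd; [apply: H1|apply: H2].
Qed.

Lemma cont3B Q f h : cont3 Q f -> cont3 Q h -> cont3 Q (fun p q t => f p q t - h p q t).
Proof.
move=> cf ch; apply: (@cont3_comp2 Q f h (fun v w => v - w) cf ch) => v w.
by apply: (@continuousB _ R); [exact: cvg_fst|exact: cvg_snd].
Qed.

Lemma cont3D Q f h : cont3 Q f -> cont3 Q h -> cont3 Q (fun p q t => f p q t + h p q t).
Proof.
move=> cf ch; apply: (@cont3_comp2 Q f h (fun v w => v + w) cf ch) => v w.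
by apply: (@continuousD _ R); [exact: cvg_fst|exact: cvg_snd].
Qed.

Lemma cont3M Q f h : cont3 Q f -> cont3 Q h -> cont3 Q (fun p q t => f p q t * h p q t).
Proof.
move=> cf ch; apply: (@cont3_comp2 Q f h (fun v w => v * w) cf ch) => v w.
by apply: (@continuousM R); [exact: cvg_fst|exact: cvg_snd].
Qed.

Lemma cont3_comp Q f (G : R -> R) : cont3 Q f -> (forall p q t, Q t -> {for f p q t, continuous G}) ->
cont3 Q (fun p q t => G (f p q t)).
Proof.
move=> cf cG p q t Qt e e0.
have /cvgrPdist_lt/(_ e e0)[d /= d0 Hd] := cG p q t Qt.
have [d1 d10 H1] := cf p q t Qt d d0; exists d1 => // p' q' t' Qt' h1 h2 h3.
by rewrite distrC; apply: Hd; rewrite /= distrC; exact: H1.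
Qed.

Lemma cont3_cst Q (c : R) : cont3 Q (fun _ _ _ => c).
Proof. by move=> p q t _ e e0; exists 1 => // p' q' t' _ _ _ _; rewrite subrr normr0. Qed.

Lemma cont3_t Q (f : R -> R) : continuous f -> cont3 Q (fun _ _ t => f t).
Proof.
move=> cf p q t _ e e0; have /cvgrPdist_lt/(_ e e0)[d /= d0 Hd] := cf t.
by exists d => // p' q' t' _ _ _ h3; rewrite distrC; apply: Hd; rewrite /= distrC.
Qed.

Lemma cont3_sub Q Q' f : Q' `<=` Q -> cont3 Q f -> cont3 Q' f.
Proof.
move=> s cf p q t Qt e e0; have [d d0 Hd] := cf p q t (s _ Qt) e e0.
by exists d => // p' q' t' /s Qt'; exact: Hd.
Qed.

Lemma alen_cont3 : cont3 I_ l_.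
Proof. by move=> p q t ht e e0; exact: (alen_cont F p q ht e0). Qed.

Lemma length_cont3 : cont3 I_ (fun _ _ t => L t).
Proof.
move=> p q t ht e e0; have [d d0 Hd] := alen_cont F 0 P ht e0.
by exists d => // p' q' t' ht' _ _ h; apply: Hd => //; rewrite subrr normr0.
Qed.

Lemma chord2_cont3 : cont3 I_ ch.
Proof.
have cx : cont3 I_ (fun p q t => x q t - x p t).
by move=> p q t ht; apply: (@cont_prim2 _ x I_ p q t ht (flow_cont H 0).1).
have cy : cont3 I_ (fun p q t => y q t - y p t).
by move=> p q t ht; apply: (@cont_prim2 _ y I_ p q t ht (flow_cont H 0).2).
exact: cont3D (cont3M cx cx) (cont3M cy cy).
Qed.

Lemma chord_lower_flow kap p q t : 0 <= t < T -> (forall u, `|k u t| <= kap) -> p < q ->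
l_ p q t - kap ^+ 2 * l_ p q t ^+ 3 / 24 <= Num.sqrt (ch p q t).
Proof.
move=> ht hk pq.
apply: (@chord_lower _ (x ^~ t) (y ^~ t) (th ^~ t) (prim (g ^~ t)) (g ^~ t) (k ^~ t)) => //.
- move=> u; apply: der_eq (flow_space0 F u ht).1 _.
by rewrite (tangleP H u ht).1 divfK // (speed_neq0 H u ht).
- move=> u; apply: der_eq (flow_space0 F u ht).2 _.
by rewrite (tangleP H u ht).2 divfK // (speed_neq0 H u ht).
- by move=> u; exact: (arc_der H u ht).
- by move=> u; exact: (tangle_der H u ht).
- by move=> u; exact: (speed_gt0 H u ht).
Qed.

End ChordArc.

Section ChordArcFlow.
Context {R : realType}.
Implicit Types (u t p q : R).
Variables (a : R -> R) (eps : R) (c1 c2 : R -> R) (P : R) (x y : R -> R -> R) (T : R).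
Hypothesis F : flowing a eps c1 c2 P x y T.
Notation th := (tangle x y).
Notation l_ := (alen x y).
Let H := flowing_sol F.
Notation L := (l_ 0 P).
Notation ch := (chord2 x y).

Lemma alen_small t1 r : 0 <= t1 < T -> 0 < r -> exists2 d : R, 0 < d & forall p q t, 0 <= t <= t1 ->
p <= q -> q - p < d -> l_ p q t < r.
Proof.
move=> ht1 r0.
have [M M0 HM] := periodic_bound F (speed_cont H) ht1 (fun u t => speed_per H u (t := t)).
exists (r / M) => [|p q t /andP[h0 h1] pq hd]; first by rewrite divr_gt0.
have ht : 0 <= t < T by rewrite h0 (le_lt_trans h1 _) //; case/andP: ht1.
apply: le_lt_trans (_ : M * (q - p) < _); last by rewrite mulrC -ltr_pdivlMr.
apply: le_trans (ler_norm _) _.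
by apply: (der_bound pq (fun v _ => arc_der H v ht)) => v _; apply: HM; rewrite h0 h1.
Qed.

Variables (K e eL mu0 C0 t1 : R).

(** The bound 1/100 on mu0 puts the slope of the profile into the range of [key_wide]; 250 e must
    stay below the smallest value that mu reaches before t1. *)
Definition chordarc_hyp : Prop :=
[/\ admissible a K e, 0 <= K, 0 <= e <= 1 / 1000, 0 < mu0 <= 1 / 100 & 0 < eL] /\
[/\ C0 = 400 * 100 * (9 * K ^+ 2 + 4) / eL ^+ 2, 250 * e <= mu0 * expR (- (C0 * t1)),
 0 <= t1 < T & forall t, 0 <= t <= t1 -> eL <= L t].

Hypothesis Hy : chordarc_hyp.

Notation mu := (fun t : R => mu0 * expR (- (C0 * t))).
(** The factor 1 - s / L makes the profile symmetric under s -> L - s, as the chord is. *)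
Let pf s t : R := mu t * (s * (1 - s / L t)).

Let L_gt0 t : 0 <= t < T -> 0 < L t.
Proof. by move=> ht; exact: (arc_gt0 H (flowing_P F) ht). Qed.

Let inI t : 0 <= t <= t1 -> 0 <= t < T.
Proof. by case: Hy => _ [_ _ /andP[_ h] _] /andP[-> h1] /=; exact: le_lt_trans h1 h. Qed.

Let C0_ge0 : unit -> 0 <= C0.
Proof.
move=> _; case: Hy => _ [-> _ _ _]; apply: divr_ge0; last exact: sqr_ge0.
by have := sqr_ge0 K => h; lras h.
Qed.

Let mu_bounds t : 0 <= t <= t1 -> [/\ 0 < mu t, mu t <= 1 / 100 & 250 * e <= mu t].
Proof.
move=> /andP[h0 h1]; have c0 := C0_ge0 tt.
case: Hy => -[_ _ _ /andP[m0 m1] _] [_ he _ _].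
have b1 : expR (- (C0 * t)) <= 1 by rewrite -expR0 ler_expR oppr_le0 mulr_ge0.
have b2 : expR (- (C0 * t1)) <= expR (- (C0 * t)) by rewrite ler_expR lerN2 ler_wpM2l.
split; first by rewrite mulr_gt0 // expR_gt0.
- have := ler_wpM2l (ltW m0) b1 => h; lras h m1.
- have := ler_wpM2l (ltW m0) b2 => h; lras h he.
Qed.

Let pf_swap p q t : 0 <= t < T -> pf (l_ q (p + P) t) t = pf (l_ p q t) t.
Proof.
move=> ht; rewrite /pf (alen_swap F) //.
by have := L_gt0 ht => /lt0r_neq0 h; field.
Qed.

Let pf_der s t : 0 <= t < T -> der (pf ^~ t) s (mu t * (1 - 2 * s / L t)).
Proof.
move=> ht.
apply: der_eq (derM (der_cst _ s) (derM (der_id s) (derB (der_cst _ s) (derM (der_id s) (der_cst _ s))))) _.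
by have := L_gt0 ht => /lt0r_neq0 h; field.
Qed.

Let pf1_der s t : 0 <= t < T -> der (fun s => mu t * (1 - 2 * s / L t)) s (- (2 * mu t / L t)).
Proof.
move=> ht.
apply: der_eq (derM (der_cst _ s) (derB (der_cst _ s) (derM (derM (der_cst _ s) (der_id s)) (der_cst _ s)))) _.
by have := L_gt0 ht => /lt0r_neq0 h; field.
Qed.

Let mu_der t : der (fun t : R => mu0 * expR (- (C0 * t))) t (- C0 * mu t).
Proof.
apply: der_eq (derM (der_cst _ t) (der_exp (derN (derM (der_cst _ t) (der_id t))))) _.
by ring.
Qed.

Let pf_time p q t : p <= q -> 0 < t < T ->
der (fun s => pf (l_ p q s) s) t
(mu t * (1 - 2 * l_ p q t / L t) * - dissip a x y p q t
 + (- C0 * pf (l_ p q t) t - mu t * l_ p q t ^+ 2 * dissip a x y 0 P t / L t ^+ 2)).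
Proof.
move=> pq /andP[h0 h1]; have ht : 0 < t < T by rewrite h0.
have hd s := @flowing_da _ _ _ _ _ _ _ _ _ F s.
have dl := arc_time (flowing_eps F) hd H pq ht.
have dL := arc_time (flowing_eps F) hd H (ltW (flowing_P F)) ht.
have L0 : 0 < L t by apply: L_gt0; rewrite (ltW h0).
have L0' := lt0r_neq0 L0.
apply: der_eq (derM (mu_der t) (derM dl (derB (der_cst _ t) (derM dl (derV (f := L) L0' dL))))) _.
by rewrite /pf; field.
Qed.

Let FF p q t := ch p q t - pf (l_ p q t) t ^+ 2.

Let FF_swap p q t : 0 <= t < T -> FF q (p + P) t = FF p q t.
Proof. by move=> ht; rewrite /FF (chord2_swap F) // pf_swap. Qed.

Let pf_bounds l t : 0 <= t <= t1 -> 0 <= l <= L t -> 0 <= pf l t <= l / 100.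
Proof.
move=> ht /andP[l0 lL]; have [m0 m1 _] := mu_bounds ht.
have L0 := L_gt0 (inI ht).
have r1 : l / L t <= 1 by rewrite ler_pdivrMr // mul1r.
have r0 : 0 <= l / L t by rewrite divr_ge0 // ltW.
rewrite /pf; set z := l / L t in r0 r1 *; set m := mu t in m0 m1 *.
have h1 : 0 <= m * l by rewrite mulr_ge0 // ltW.
have h2 := mulr_ge0 h1 r0.
have h3 : m * l <= 1 / 100 * l by rewrite ler_wpM2r.
have h4 : 0 <= m * l * (1 - z) by rewrite mulr_ge0 // subr_ge0.
by apply/andP; split; rewrite mulrA //; lras h2 h3.
Qed.

(** At a contact the tangents are nearly orthogonal to the chord, with cosine at most 1/100.
    Parallel tangents are impossible because the profile decreases in time; the reflected position
    is excluded by [key_wide] and [chord_arc_alg]. *)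
Lemma chord_arc_contact t p q : 0 < t <= t1 -> p < q < p + P -> l_ p q t <= L t / 2 ->
(forall s p q, 0 <= s <= t -> p <= q <= p + P -> 0 <= FF p q s) -> FF p q t = 0 -> False.
Proof.
move=> /andP[t0 tt1] /andP[pq qp] lL good F0.
have ht1 : 0 <= t <= t1 by rewrite (ltW t0).
have ht : 0 <= t < T := inI ht1.
have /andP[_ tT] := ht; have htT : 0 < t < T by rewrite t0.
have l0 : 0 < l_ p q t := arc_gt0 H pq ht.
have [m0 m1 me] := mu_bounds ht1.
have L0 := L_gt0 ht.
pose ee := Num.min (Num.min ((q - p) / 2) ((p + P - q) / 2)) t.
have ee0 : 0 < ee by rewrite !lt_min t0 !divr_gt0 ?subr_gt0.
have d0 : 0 < pf (l_ p q t) t.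
rewrite /pf; apply: mulr_gt0 => //; apply: mulr_gt0 => //.
rewrite subr_gt0 ltr_pdivrMr // mul1r; lras lL L0.
have a0 := flowing_a0 F; have aper := flowing_aper F.
have := @flow_contact _ a eps c1 c2 P x y T (flowing_eps F) a0 aper H
pf (fun s => mu t * (1 - 2 * s / L t)) (fun _ => - (2 * mu t / L t)) p q t ee _
htT pq ee0 (fun s _ => pf_der s ht) (fun s _ => pf1_der s ht)
(pf_time (ltW pq) htT) d0 F0.
case=> [p' q' hp hq|h /andP[h0 h1]|cc].
- apply: good; first by rewrite (ltW t0) lexx.
move: hp hq; rewrite !lt_min !ltr_norml => /andP[/andP[/andP[a1 a2] /andP[a3 a4]] _] /andP[/andP[/andP[b1 b2] /andP[b3 b4]] _].
by apply/andP; split; lras a1 a2 a3 a4 b1 b2 b3 b4.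
- apply: good; last by rewrite (ltW pq) (ltW qp).
move: h1; rewrite !lt_min => /andP[_ h1].
by apply/andP; split; lras h0 h1.
have X0 : 0 <= dissip a x y p q t by apply: (dissip_ge0 F ht (ltW pq)).
have Y0 : 0 <= dissip a x y 0 P t by apply: (dissip_ge0 F ht (ltW (flowing_P F))).
set pt := - C0 * _ - _.
have pt_le : pt <= - C0 * pf (l_ p q t) t.
rewrite /pt lerBlDr lerDl; apply: divr_ge0; last exact: sqr_ge0.
by apply: mulr_ge0 Y0; apply: mulr_ge0 (sqr_ge0 _); exact: ltW.
have c0 : 0 <= mu t * (1 - 2 * l_ p q t / L t).
apply: mulr_ge0; first exact: ltW.
by rewrite subr_ge0 ler_pdivrMr // mul1r; lras lL.
case: Hy => -[adm K0 he /andP[mu00 mu01] eL0] [C0E _ _ hL].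
have C0gt : 0 < C0.
rewrite C0E; apply: divr_gt0; last by rewrite exprn_gt0.
by have := sqr_ge0 K => h; lras h.
case=> [[_ hX]|[hcos hX]].
have := mulr_ge0 c0 X0; have := mulr_gt0 C0gt d0 => h1 h2; lras h1 h2 hX pt_le.
have [xi [hx1 hx2] hxi] := cauchy_schwarz F ht pq.
set TT := th q t - th p t in hcos hxi.
have c100 : 0 <= mu t * (1 - 2 * l_ p q t / L t) <= 1 / 100.
rewrite c0 /=; have h1 : 0 <= l_ p q t / L t by rewrite divr_ge0 // ltW.
have := mulr_ge0 (ltW m0) h1 => h2.
have -> : mu t * (1 - 2 * l_ p q t / L t) = mu t - 2 * (mu t * (l_ p q t / L t)) by ring.
by lras h2 m1.
have [k1 k2 k3 k4] := @key_wide _ a K e _ (th p t) TT xi adm K0 he c100 hcos.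
have tq : th p t + TT = th q t by rewrite /TT addrC subrK.
rewrite tq in k1 k2 k4.
apply: (@chord_arc_alg _ (mu t) (l_ p q t) (L t) _ (pf (l_ p q t) t) (dissip a x y p q t) pt C0 K
(a xi * TT ^+ 2) eL ((Num.sqrt (a (th p t)) - Num.sqrt (a (th q t))) ^+ 2)
((Num.sqrt (a (th p t)) + Num.sqrt (a (th q t))) ^+ 2) e _ _ _ erefl erefl hxi k3 pt_le
(sqr_ge0 _) k1 k2).
- by rewrite m0 m1.
- by rewrite l0 lL.
- by rewrite eL0 hL.
- by rewrite sqr_ge0 k4.
- exact: me.
- exact: C0E.
- apply: le_trans hX _; rewrite le_eqVlt; apply/orP; left; apply/eqP; ring.
Qed.

Lemma chord_arc_flow :
(forall p q, p < q < p + P -> (mu0 * (l_ p q 0 * (1 - l_ p q 0 / L 0))) ^+ 2 < ch p q 0) ->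
forall t p q, 0 <= t <= t1 -> p <= q <= p + P ->
(mu0 * expR (- (C0 * t)) * (l_ p q t * (1 - l_ p q t / L t))) ^+ 2 <= ch p q t.
Proof.
move=> init t p q ht hpq; rewrite -subr_ge0 -/(pf (l_ p q t) t) -/(FF p q t).
have [_ [_ _ ht1 _]] := Hy.
have P0 := flowing_P F.
have t10 : 0 <= t1 by case/andP: ht1.
have FFdiag u s : FF u u s = 0.
by rewrite /FF /chord2 /pf /alen !subrr mul0r mulr0 !expr0n /= addr0 subrr.
have lbounds v w s : 0 <= s < T -> v <= w <= v + P -> 0 <= l_ v w s <= L s.
move=> hs /andP[h1 h2]; rewrite (alen_ge0 F h1 hs) /= -subr_ge0 -(alen_swap F) //.
by apply: (alen_ge0 F _ hs).
move: t p q ht hpq; apply: (@first_contact_on _ FF P t1 P0 t10).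
- move=> p q t /inI ht; rewrite /FF (chord2_shift F) // (alen_shift F) //.
- have cl : cont3 [set t | 0 <= t <= t1] l_ by apply: cont3_sub (alen_cont3 F) => t /=; exact: inI.
have cL : cont3 [set t | 0 <= t <= t1] (fun _ _ t => L t).
 by apply: cont3_sub (length_cont3 F) => t /=; exact: inI.
have cc : cont3 [set t | 0 <= t <= t1] ch by apply: cont3_sub (chord2_cont3 F) => t /=; exact: inI.
have cmu : cont3 [set t | 0 <= t <= t1] (fun _ _ t => mu t).
 by apply: cont3_t => t; exact: der_cvg (mu_der t).
have cpf : cont3 [set t | 0 <= t <= t1] (fun p q t => pf (l_ p q t) t).
 have cV : cont3 [set t | 0 <= t <= t1] (fun _ _ t => (L t)^-1).
 apply: (cont3_comp (G := GRing.inv) cL) => p q t /inI ht.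
 by apply: inv_continuous; exact: lt0r_neq0 (L_gt0 ht).
 exact: (cont3M cmu (cont3M cl (cont3B (cont3_cst 1) (cont3M cl cV)))).
by move=> p q t ht; apply: (cont3B cc (cont3M cpf cpf)).
- move=> p q /andP[]; rewrite le_eqVlt => /orP[/eqP <-|pq]; first by rewrite FFdiag.
have h0 : 0 <= (0 : R) <= t1 by rewrite lexx.
rewrite le_eqVlt => /orP[/eqP ->|qp]; first by rewrite (FF_swap _ _ (inI h0)) FFdiag.
have := init p q; rewrite pq qp => /(_ isT) hi.
by rewrite /FF /pf mulr0 oppr0 expR0 mulr1 subr_ge0; exact: ltW.
- move=> t ht good.
have [kap kap0 Hk] := periodic_bound F (kurv_cont H) ht1 (fun u t => kurv_per H u (t := t)).
have kv0 : 0 < 1 / kap by rewrite divr_gt0.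
have [d d0 Hd] := alen_small ht1 kv0.
(* The profile has slope at most 1/100, and an arc shorter than 1 / kap has a chord of at least
   23/24 of its length. *)
have near s p q : 0 <= s <= t1 -> p <= q <= p + P -> q - p < d -> 0 <= FF p q s.
 move=> hs /andP[]; rewrite le_eqVlt => /orP[/eqP <-|pq]; first by rewrite FFdiag.
 move=> qp hd; have hs' := inI hs.
 have lk := Hd p q s hs (ltW pq) hd.
 have l0 := arc_gt0 H pq hs'.
 have cl := chord_lower_flow F hs' (fun u => Hk u s hs) pq.
 have lb := lbounds p q s hs' (_ : p <= q <= p + P).
 have {}lb := lb ltac:(by rewrite (ltW pq) qp).
 have /andP[pf0 pf1] := pf_bounds hs lb.
 have lk1 : l_ p q s * kap <= 1 by rewrite -ler_pdivlMr // ltW.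
 have lk2 : kap ^+ 2 * l_ p q s ^+ 3 <= l_ p q s.
 have -> : kap ^+ 2 * l_ p q s ^+ 3 = (l_ p q s * kap) ^+ 2 * l_ p q s by ring.
 rewrite -[X in _ <= X]mul1r ler_pM2r // -[X in _ <= X](expr1n _ 2); apply: sq_le => //.
 by rewrite mulr_ge0 // ltW.
 have pfs : pf (l_ p q s) s <= Num.sqrt (ch p q s) by lras cl lk2 pf1 l0.
 rewrite /FF subr_ge0 -[X in _ <= X](sqr_sqrtr (chord2_ge0 x y p q s)).
 exact: sq_le.
exists d => // s p q /andP[ts _] st1 /andP[pq qp] hor.
have hs : 0 <= s <= t1 by case/andP: ht => h _; rewrite (le_trans h ts).
case: hor => hor; first by apply: near => //; rewrite pq qp.
rewrite -(FF_swap _ _ (inI hs)); apply: near => //.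
by rewrite qp lerD2r.
- move=> t p q /andP[]; rewrite le_eqVlt => /orP[/eqP <-|t0] tt1 good hpq F0.
 have := init p q hpq; move: F0; rewrite /FF /pf mulr0 oppr0 expR0 mulr1 => /eqP.
 by rewrite subr_eq0 => /eqP ->; rewrite ltxx.
have ht1' : 0 < t <= t1 by rewrite t0 (ltW tt1).
have hT : 0 <= t < T by apply: inI; rewrite (ltW t0) (ltW tt1).
(* The complementary arc from q to p + P has the same chord and the same profile value, so the
   shorter arc may be taken. *)
have [lL|Ll] := leP (l_ p q t) (L t / 2).
 exact: (chord_arc_contact ht1' hpq lL good F0).
apply: (@chord_arc_contact t q (p + P) ht1') => //.
+ by case/andP: hpq => h1 h2; rewrite h2 ltrD2r.
+ by rewrite (alen_swap F) //; lras Ll.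
+ by rewrite FF_swap.
Qed.

End ChordArcFlow.

(** * Functions with n continuous derivatives *)

Section Regularity.
Context {R : realType}.
Implicit Types (f h : R -> R) (u : R).

Fixpoint Cn n f : Prop := match n with
| 0%N => continuous f
| n'.+1 => exists2 f', (forall u, der f u (f' u)) & Cn n' f' end.

Lemma Cn_ext n f h : f =1 h -> Cn n f -> Cn n h.
Proof. by move=> /funext ->. Qed.

Lemma CnW n f : Cn n.+1 f -> Cn n f.
Proof.
elim: n f => [|n IH] f [f' df cf']; first by move=> u; exact: der_cvg (df u).
by exists f' => //; exact: IH.
Qed.

Lemma CnD n f h : Cn n f -> Cn n h -> Cn n (fun u => f u + h u).
Proof.
elim: n f h => [|n IH] f h; first by move=> cf ch u; apply: continuousD; [exact: cf|exact: ch].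
move=> [f' df cf] [h' dh ch]; exists (fun u => f' u + h' u); last exact: IH.
by move=> u; exact: derD.
Qed.

Lemma CnN n f : Cn n f -> Cn n (fun u => - f u).
Proof.
elim: n f => [|n IH] f; first by move=> cf u; apply: continuousN; exact: cf.
move=> [f' df cf]; exists (fun u => - f' u); last exact: IH.
by move=> u; exact: derN.
Qed.

Lemma CnM n f h : Cn n f -> Cn n h -> Cn n (fun u => f u * h u).
Proof.
elim: n f h => [|n IH] f h; first by move=> cf ch u; apply: continuousM; [exact: cf|exact: ch].
move=> cf ch; have f0 := CnW cf; have h0 := CnW ch.
case: cf ch => [f' df cf] [h' dh ch]; exists (fun u => f' u * h u + f u * h' u).
by move=> u; exact: derM.
by apply: CnD; exact: IH.
Qed.

Lemma CnV n f : (forall u, f u != 0) -> Cn n f -> Cn n (fun u => (f u)^-1).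
Proof.
move=> f0; elim: n => [|n IH]; first by move=> cf u; apply: continuousV; [exact: f0|exact: cf].
move=> cf; have {}IH := IH (CnW cf); case: cf => [f' df cf].
exists (fun u => - (f' u * ((f u)^-1 * (f u)^-1))); last by apply: CnN; apply: CnM => //; exact: CnM.
move=> u; apply: der_eq (derV (f0 u) (df u)) _.
by rewrite mulNr expr2 invfM.
Qed.

(** With h the speed, this converts a derivative in the parameter into one in arc length. *)
Lemma Cn_rescale n f h : (forall u, h u != 0) -> Cn n.+1 f -> Cn n h ->
exists2 f1, (forall u, der f u (f1 u * h u)) & Cn n f1.
Proof.
move=> h0 [f' df cf] ch; exists (fun u => f' u * (h u)^-1); last exact: CnM cf (CnV h0 ch).
by move=> u; apply: der_eq (df u) _; rewrite divfK.
Qed.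

End Regularity.

(** * The sharp chord-arc profile and the curvature bound *)

Section ProfileFlow.
Context {R : realType}.
Implicit Types (u t p q : R).

Lemma quarter_arith (l l' L L' eL : R) : 0 < eL -> eL <= L -> l < L / 4 ->
l' - l < eL / 16 -> - (eL / 16) < L' - L -> l' <= L' / 2.
Proof. move=> h1 h2 h3 h4 h5; lra. Qed.

Lemma periodic_red (P : R) u : 0 < P -> exists (j : int) (v : R), 0 <= v <= P /\ u = v + j%:~R * P.
Proof.
move=> P0; exists (Num.floor (u / P)), (u - (Num.floor (u / P))%:~R * P); split; last by rewrite subrK.
have /andP[h1 h2] := mem_rg1_floor (u / P).
rewrite subr_ge0 -ler_pdivlMr // h1 /= lerBlDr -{1}[P]mul1r -mulrDl -ler_pdivrMr // addrC ltW //.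
Qed.

Variables (a : R -> R) (eps : R) (c1 c2 : R -> R) (P : R) (x y : R -> R -> R) (T : R).
Hypothesis F : flowing a eps c1 c2 P x y T.
Notation g := (speed x y).
Notation k := (kurv x y).
Notation th := (tangle x y).
Notation l_ := (alen x y).
Let H := flowing_sol F.
Notation L := (l_ 0 P).
Notation ch := (chord2 x y).

Lemma flow_Cn n j t : 0 <= t < T -> Cn n (dun j x ^~ t) /\ Cn n (dun j y ^~ t).
Proof.
move=> ht; elim: n j => [|n IH] j.
by split=> u; [exact: der_cvg (flow_space H j u ht).1|exact: der_cvg (flow_space H j u ht).2].
by split; [exists (dun j.+1 x ^~ t)|exists (dun j.+1 y ^~ t)] => //;
[move=> u; exact: (flow_space H j u ht).1|exact: (IH _).1|move=> u; exact: (flow_space H j u ht).2|exact: (IH _).2].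
Qed.

Lemma speed_Cn n t : 0 <= t < T -> Cn n (g ^~ t).
Proof.
move=> ht; have g0 u := speed_neq0 H u ht.
elim: n => [|n IH]; first by move=> u; exact: der_cvg (speed_space H u ht).
exists (fun u => (du x u t * du (du x) u t + du y u t * du (du y) u t) / g u t).
by move=> u; exact: (speed_space H u ht).
apply: CnM (CnV g0 IH); apply: CnD; apply: CnM.
- exact: (flow_Cn n 1 ht).1.
- exact: (flow_Cn n 2 ht).1.
- exact: (flow_Cn n 1 ht).2.
- exact: (flow_Cn n 2 ht).2.
Qed.

Lemma kurv_Cn n t : 0 <= t < T -> Cn n (k ^~ t).
Proof.
move=> ht; have g0 u : g u t ^+ 3 != 0 by rewrite expf_neq0 // (speed_neq0 H u ht).
apply: CnM (CnV g0 _).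
apply: CnD; last apply: CnN; apply: CnM.
- exact: (flow_Cn n 1 ht).1.
- exact: (flow_Cn n 2 ht).2.
- exact: (flow_Cn n 1 ht).2.
- exact: (flow_Cn n 2 ht).1.
have gg := speed_Cn n ht.
by apply: Cn_ext (CnM gg (CnM gg gg)) => u /=; rewrite exprS expr2.
Qed.

Variables (K mu1 nu eL t1 m b0 s1 : R).

Notation b := (fun t : R => b0 * expR t).
(** Rescaling by b keeps the slope 1 at zero. The growth of b makes the profile decrease strictly in
    time: its time derivative at fixed length is l psi' - psi < 0, by concavity. *)
Let pf s t : R := prof m (b t * s) / b t.

Definition profile_hyp : Prop :=
[/\ 0 < m <= 1, 0 < b0, 0 < s1, 4 * s1 <= b0 * eL & 0 < eL] /\
[/\ 0 < mu1, nu = mu1 / 4, 0 <= t1 < T & forall t, 0 <= t <= t1 -> eL <= L t] /\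
[/\ forall s, 0 < s <= s1 -> prof m s <= 2 * (s * prof1 m s),
 forall s, s1 <= s -> prof m s < mu1 / 2 * s,
 (forall t p q, 0 <= t <= t1 -> p <= q <= p + P ->
  (mu1 * (l_ p q t * (1 - l_ p q t / L t))) ^+ 2 <= ch p q t),
 (forall p q, p < q < p + P -> l_ p q 0 <= L 0 / 2 -> pf (l_ p q 0) 0 ^+ 2 < ch p q 0) &
 (forall s h TT xi, 0 < s -> nu <= prof1 m s -> cos TT = 2 * prof1 m s ^+ 2 - 1 ->
  `|xi - h| <= `|TT| -> `|xi - (h + TT)| <= `|TT| ->
  (Num.sqrt (a h) - Num.sqrt (a (h + TT))) ^+ 2 * (1 - prof1 m s ^+ 2)
  + (Num.sqrt (a h) + Num.sqrt (a (h + TT))) ^+ 2 * profq m s * prof1 m s ^+ 2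
  < a xi * TT ^+ 2 * prof1 m s ^+ 2)].

Hypothesis Hy : profile_hyp.

Let b_gt0 t : 0 < b t.
Proof. by case: Hy => -[_ h _ _ _] _; rewrite mulr_gt0 // expR_gt0. Qed.

Let b_mono s t : s <= t -> b s <= b t.
Proof. by case: Hy => -[_ h _ _ _] _ st; rewrite ler_pM2l // ler_expR. Qed.

Let L_gt0 t : 0 <= t < T -> 0 < L t.
Proof. by move=> ht; exact: (arc_gt0 H (flowing_P F) ht). Qed.

Let inI t : 0 <= t <= t1 -> 0 <= t < T.
Proof. by case: Hy => _ [[_ _ /andP[_ h] _] _] /andP[-> h1] /=; exact: le_lt_trans h1 h. Qed.

Let pf_der s t : der (pf ^~ t) s (prof1 m (b t * s)).
Proof.
have ds : der (fun s => b t * s) s (b t).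
by apply: der_eq (derM (der_cst (b t) s) (der_id s)) _; rewrite mul0r add0r mulr1.
apply: der_eq (derM (@der_comp _ (prof m) (fun s => b t * s) s _ _ (prof_der m _) ds) (der_cst (b t)^-1 s)) _.
by rewrite mulr0 addr0 mulfK // lt0r_neq0.
Qed.

Let pf1_der s t : 0 < s -> der (fun s => prof1 m (b t * s)) s (b t * prof2 m (b t * s)).
Proof.
move=> s0; have ds : der (fun s => b t * s) s (b t).
by apply: der_eq (derM (der_cst (b t) s) (der_id s)) _; rewrite mul0r add0r mulr1.
have bs : 0 < b t * s by rewrite mulr_gt0.
by apply: der_eq (@der_comp _ (prof1 m) (fun s => b t * s) s _ _ (prof1_der m bs) ds) _; rewrite mulrC.
Qed.

Let b_der t : der (fun t : R => b0 * expR t) t (b t).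
Proof. by apply: der_eq (derM (der_cst b0 t) (der_exp (der_id t))) _; rewrite mul0r add0r mulr1. Qed.

Let pf_time p q t : p <= q -> 0 < t < T -> der (fun s => pf (l_ p q s) s) t
(prof1 m (b t * l_ p q t) * - dissip a x y p q t
+ (l_ p q t * prof1 m (b t * l_ p q t) - pf (l_ p q t) t)).
Proof.
move=> pq ht; have hd s := @flowing_da _ _ _ _ _ _ _ _ _ F s.
have dl := arc_time (flowing_eps F) hd H pq ht.
have bn := lt0r_neq0 (b_gt0 t).
apply: der_eq (derM (@der_comp _ (prof m) (fun s => b s * l_ p q s) t _ _ (prof_der m _) (derM (b_der t) dl))
(derV (f := fun t => b t) bn (b_der t))) _.
rewrite /pf; move: (b0 * expR t) bn => B bn.
by field.
Qed.

(** The shorter of the two arcs. The minimum is not smooth where they are equal, but contacts occur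
    only on arcs shorter than L / 4. *)
Let M p q t := Num.min (l_ p q t) (L t - l_ p q t).
Let FF p q t := ch p q t - pf (M p q t) t ^+ 2.

Let M_swap p q t : 0 <= t < T -> M q (p + P) t = M p q t.
Proof. by move=> ht; rewrite /M (alen_swap F) // minC; congr Num.min; ring. Qed.

Let FF_swap p q t : 0 <= t < T -> FF q (p + P) t = FF p q t.
Proof. by move=> ht; rewrite /FF (chord2_swap F) // M_swap. Qed.

Let M_small p q t : l_ p q t <= L t / 2 -> M p q t = l_ p q t.
Proof. by move=> h; rewrite /M min_l //; lras h. Qed.

Let FF_small p q t : l_ p q t <= L t / 2 -> FF p q t = ch p q t - pf (l_ p q t) t ^+ 2.
Proof. by move=> h; rewrite /FF M_small. Qed.

Let pf_ge0 l t : 0 <= l -> 0 <= pf l t.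
Proof.
move=> l0; apply: divr_ge0; last exact: ltW.
have s0 : 0 <= b t * l by rewrite mulr_ge0 // ltW.
by apply: le_trans (prof_ge m s0); rewrite mulr_ge0 // ltW // prof1_gt0.
Qed.

(** The crude estimate forces pf >= mu1 / 2 * l at a contact; by the tail of the profile this means
    b l < s1 and c >= nu. Since 4 s1 <= b0 eL, the arc is then shorter than L / 4, the minimum of
    the two arcs is locally smooth, and [flow_contact] contradicts the key inequality. *)
Lemma profile_contact t p q : 0 < t <= t1 -> p < q < p + P -> l_ p q t <= L t / 2 ->
(forall s p q, 0 <= s <= t -> p <= q <= p + P -> 0 <= FF p q s) -> FF p q t = 0 -> False.
Proof.
move=> /andP[t0 tt1] /andP[pq qp] lL good F0.
have [[/andP[m0 m1] b00 s10 hs1 eL0] [[mu0 nuE _ hL] [tl1 tl2 hca _ hkey]]] := Hy.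
have ht1 : 0 <= t <= t1 by rewrite (ltW t0).
have ht : 0 <= t < T := inI ht1.
have /andP[_ tT] := ht; have htT : 0 < t < T by rewrite t0.
have l0 : 0 < l_ p q t := arc_gt0 H pq ht.
have L0 := L_gt0 ht; have bt0 := b_gt0 t; have Le := hL t ht1.
have F1 := F0; rewrite (FF_small lL) in F1.
set l := l_ p q t in l0 lL F1 *.
have s0 : 0 < b t * l by rewrite mulr_gt0.
have d0 : 0 < pf l t by rewrite /pf divr_gt0 // prof_gt0.
(* The crude bound, with 1 - l / L >= 1/2 on the shorter arc. *)
have hh : mu1 / 2 * l <= pf l t.
have h1 : (mu1 * (l * (1 - l / L t))) ^+ 2 <= pf l t ^+ 2.
 apply: le_trans (hca t p q ht1 _) _; first by rewrite (ltW pq) (ltW qp).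
 by move/eqP: F1; rewrite subr_eq0 => /eqP ->.
have z1 : l / L t <= 1 / 2 by rewrite ler_pdivrMr //; lras lL.
have h2 : mu1 * (l * (1 - l / L t)) <= pf l t.
 rewrite -(ler_pXn2r (n := 2)) // nnegrE; last exact: ltW.
 by apply: mulr_ge0; [exact: ltW|apply: mulr_ge0; [exact: ltW|lras z1]].
apply: le_trans h2; rewrite -mulrA ler_pM2l // mulrC.
by rewrite ler_pM2l //; lras z1.
have eml : mu1 / 2 * l * b t = mu1 / 2 * (b t * l) by ring.
have bls : b t * l < s1.
rewrite ltNge; apply/negP => /tl2 hb.
have : pf l t < mu1 / 2 * l by rewrite /pf ltr_pdivrMr // eml.
by rewrite ltNge hh.
have nuc : nu <= prof1 m (b t * l).
have h1 : prof m (b t * l) <= 2 * (b t * l * prof1 m (b t * l)) by apply: tl1; rewrite s0 ltW.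
have h2 : mu1 / 2 * (b t * l) <= prof m (b t * l).
 by move: hh; rewrite /pf ler_pdivlMr // eml.
have h3 : mu1 / 2 * (b t * l) <= 2 * prof1 m (b t * l) * (b t * l).
 by move: h1 h2; move: (prof m _) => w h1 h2; lras h1 h2.
rewrite ler_pM2r // in h3; rewrite nuE; lras h3.
have l4 : l < L t / 4.
have bb : b0 <= b t by rewrite -[X in X <= _]mulr1 -expR0; apply: b_mono; exact: ltW.
have g1 : b0 * l <= b t * l by rewrite ler_wpM2r // ltW.
have g2 : b0 * l < b0 * (eL / 4) by lras g1 bls hs1.
rewrite ltr_pM2l // in g2; lras g2 Le.
have e16 : 0 < eL / 16 by rewrite divr_gt0.
have [dl dl0 Hdl] := alen_cont F p q ht e16.
have [dL dL0 HdL] := alen_cont F 0 P ht e16.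
pose ee := Num.min (Num.min (Num.min ((q - p) / 2) ((p + P - q) / 2)) t) (Num.min dl dL).
have ee0 : 0 < ee by rewrite !lt_min t0 dl0 dL0 !divr_gt0 ?subr_gt0.
have z0 (v : R) : `|v - v| < dL by rewrite subrr normr0.
(* Near the contact the shorter arc is still the one from p' to q', so [FF] agrees with the smooth
   function of [flow_contact]. *)
have loc p' q' t' : 0 <= t' < T -> `|p' - p| < dl -> `|q' - q| < dl -> `|t' - t| < Num.min dl dL ->
 FF p' q' t' = ch p' q' t' - pf (l_ p' q' t') t' ^+ 2.
move=> ht' hp hq; rewrite lt_min => /andP[ha hb].
have := Hdl p' q' t' ht' hp hq ha.
have := HdL 0 P t' ht' (z0 0) (z0 P) hb.
rewrite !ltr_norml => /andP[g1 g2] /andP[g3 g4].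
apply: FF_small; exact: (quarter_arith eL0 Le l4 g4 g1).
have a0 := flowing_a0 F; have aper := flowing_aper F.
have := @flow_contact _ a eps c1 c2 P x y T (flowing_eps F) a0 aper H
pf (fun s => prof1 m (b t * s)) (fun s => b t * prof2 m (b t * s)) p q t ee _
htT pq ee0 (fun s _ => pf_der s t) (fun s hs => pf1_der t hs)
(pf_time (ltW pq) htT) d0 F1.
case=> [p' q'|h /andP[h0]|cc].
- rewrite !lt_min => /andP[/andP[/andP[a1 a2] a3] /andP[a4 a5]] /andP[/andP[/andP[b1 b2] b3] /andP[b4 b5]].
have dd : `|t - t| < Num.min dl dL by rewrite subrr normr0 lt_min dl0 dL0.
rewrite -(loc p' q' t ht a4 b4 dd); apply: good; first by rewrite (ltW t0) lexx.
move: a1 a2 b1 b2; rewrite !ltr_norml => /andP[a1 a1'] /andP[a2 a2'] /andP[b1 b1'] /andP[b2 b2'].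
by apply/andP; split; lras a1 a1' a2 a2' b1 b1' b2 b2'.
- rewrite !lt_min => /andP[/andP[_ ht0] /andP[h1 h2]].
have hth : 0 <= t - h <= t by apply/andP; split; lras h0 ht0.
have hthT : 0 <= t - h < T by case/andP: hth => -> h3; rewrite /= (le_lt_trans h3 tT).
have z1 (v : R) : `|v - v| < dl by rewrite subrr normr0.
rewrite -(loc p q (t - h) hthT (z1 p) (z1 q)).
 by apply: good => //; rewrite (ltW pq) (ltW qp).
have -> : t - h - t = - h by ring.
by rewrite normrN gtr0_norm // lt_min h1 h2.
rewrite -/l in cc *.
have X0 : 0 <= dissip a x y p q t by apply: (dissip_ge0 F ht (ltW pq)).
set c := prof1 m (b t * l) in nuc cc *.
have c0 : 0 < c by exact: prof1_gt0.
have cd : l * c < pf l t.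
rewrite /pf ltr_pdivlMr //; have := prof_gt m0 s0; rewrite -/c => h.
by move: (prof m _) h => w h; lras h.
case=> [[_ hX]|[hcos hX]].
have := mulr_ge0 (ltW c0) X0 => h2; lras h2 hX cd.
have [xi [hx1 hx2] hxi] := cauchy_schwarz F ht pq.
set TT := th q t - th p t in hcos hxi hx1 hx2.
have tq : th p t + TT = th q t by rewrite /TT addrC subrK.
have := hkey (b t * l) (th p t) TT xi s0 nuc hcos hx1.
rewrite tq => /(_ hx2); rewrite -/c.
have qE := prof2E m s0; rewrite -/c in qE.
set Db := (_ - _) ^+ 2 in hX *; set Sb := (_ + _) ^+ 2 in hX *.
set qq := profq m (b t * l) in qE *.
move=> key.
have Db0 : 0 <= Db by exact: sqr_ge0.
have y0 : 0 <= 1 - c ^+ 2.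
rewrite subr_ge0 -[X in _ <= X](expr1n _ 2); apply: sq_le; [exact: ltW|exact: prof1_le1].
(* multiplying the contact inequality by [l] *)
have hX2 : pf l t * c * (a xi * TT ^+ 2) <= Db * (1 - c ^+ 2) * l + pf l t * Sb * qq * c.
have h1 : pf l t * c * (a xi * TT ^+ 2) <= pf l t * c * (dissip a x y p q t * l).
 by apply: ler_wpM2l => //; apply: mulr_ge0; exact: ltW.
apply: le_trans h1 _.
have h2 : pf l t * c * dissip a x y p q t * l - pf l t * (l * c - pf l t) * l <=
 Db * (1 - c ^+ 2) * l - pf l t * (b t * prof2 m (b t * l)) * Sb * l.
 by rewrite -(mulrBl l (_ * _)) -[X in _ <= X]mulrBl; exact: (ler_wpM2r (ltW l0) hX).
have e1 : pf l t * (b t * prof2 m (b t * l)) * Sb * l = - (pf l t * Sb * qq * c).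
 have -> : pf l t * (b t * prof2 m (b t * l)) * Sb * l = - (pf l t * Sb * (- (b t * l) * prof2 m (b t * l))) by ring.
 by rewrite qE; ring.
have e2 : 0 <= - (pf l t * (l * c - pf l t) * l).
 rewrite -mulNr -mulrN; apply: mulr_ge0; last exact: ltW.
 by apply: mulr_ge0; [exact: ltW|rewrite oppr_ge0 subr_le0 ltW].
rewrite e1 in h2.
have e3 : pf l t * c * dissip a x y p q t * l = pf l t * c * (dissip a x y p q t * l) by ring.
rewrite e3 in h2; move: (pf l t * c * (_ * l)) (pf l t * Sb * qq * c) h2 e2 => w1 w2 h2 e2.
by lras h2 e2.
have fac : Db * (1 - c ^+ 2) < c ^+ 2 * (a xi * TT ^+ 2 - Sb * qq) by lras key.
have fac0 : 0 < a xi * TT ^+ 2 - Sb * qq.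
have h1 : 0 < c ^+ 2 * (a xi * TT ^+ 2 - Sb * qq) by apply: le_lt_trans fac; exact: mulr_ge0.
by move: h1; rewrite pmulr_rgt0 // exprn_gt0.
have h3 : pf l t * c * (a xi * TT ^+ 2 - Sb * qq) <= Db * (1 - c ^+ 2) * l by lras hX2.
have h4 : l * c * c * (a xi * TT ^+ 2 - Sb * qq) < pf l t * c * (a xi * TT ^+ 2 - Sb * qq).
by rewrite ltr_pM2r // ltr_pM2r.
have h5 : Db * (1 - c ^+ 2) * l < c ^+ 2 * (a xi * TT ^+ 2 - Sb * qq) * l by rewrite ltr_pM2r.
have e4 : l * c * c * (a xi * TT ^+ 2 - Sb * qq) = c ^+ 2 * (a xi * TT ^+ 2 - Sb * qq) * l by ring.
rewrite e4 in h4; lras h3 h4 h5.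
Qed.

Lemma profile_kurv t : 0 <= t <= t1 -> (forall p q, p <= q <= p + P -> 0 <= FF p q t) ->
forall u, k u t ^+ 2 < 4 * m ^+ 2 * b t ^+ 2.
Proof.
move=> ht1 good u; have ht := inI ht1.
have [[/andP[m0 m1] _ _ _ _] _] := Hy.
have g0 v := speed_neq0 H v ht.
have [k1 dk1 ck1] := Cn_rescale g0 (kurv_Cn 2 ht) (speed_Cn 1 ht).
have [k2 dk2 ck2] := Cn_rescale g0 ck1 (speed_Cn 0 ht).
have L0 := L_gt0 ht; have L2 : 0 < L t / 2 by rewrite divr_gt0.
apply: (@kurv_strict _ (x ^~ t) (y ^~ t) (th ^~ t) (prim (g ^~ t)) (g ^~ t) (k ^~ t)
_ _ _ _ _ k1 k2 (b t) m (L t / 2) u) => //.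
- move=> v; apply: der_eq (flow_space0 F v ht).1 _.
by rewrite (tangleP H v ht).1 divfK.
- move=> v; apply: der_eq (flow_space0 F v ht).2 _.
by rewrite (tangleP H v ht).2 divfK.
- by move=> v; exact: (arc_der H v ht).
- by move=> v; exact: (tangle_der H v ht).
- by move=> v; exact: (speed_gt0 H v ht).
- exact: ck2.
move=> p q pq hl.
have qp : q <= p + P.
rewrite leNgt; apply/negP => hb.
have h1 := arc_gt0 H hb ht; have h2 := alen_cat x y p (p + P) q t.
rewrite (alen_period F p ht) in h2.
have hl' : l_ p q t < L t / 2 by exact: hl.
by move: (l_ p q t) (l_ (p + P) q t) (L t) L0 h1 h2 hl' => w1 w2 w3 h0 h1 h2 h3; lras h0 h1 h2 h3.
have := good p q; rewrite (ltW pq) qp => /(_ isT).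
by rewrite (FF_small (ltW hl)) subr_ge0.
Qed.

Let cmp_arith (l kk w B d : R) : 0 < l -> 0 <= w -> kk + d <= 4 * w * B ^+ 2 -> 0 <= B ->
w * B ^+ 3 * l <= d / 24 -> l - w * B ^+ 2 / 6 * l ^+ 3 + w * B ^+ 3 * l ^+ 4 <= l - kk * l ^+ 3 / 24.
Proof.
move=> l0 w0 h1 B0 h2.
have l3 : 0 <= l ^+ 3 by rewrite exprn_ge0 // ltW.
have h : w * B ^+ 3 * l <= w * B ^+ 2 / 6 - kk / 24 by lras h1 h2.
have := ler_wpM2r l3 h.
have -> : w * B ^+ 3 * l * l ^+ 3 = w * B ^+ 3 * l ^+ 4 by ring.
have -> : (w * B ^+ 2 / 6 - kk / 24) * l ^+ 3 = w * B ^+ 2 / 6 * l ^+ 3 - kk * l ^+ 3 / 24 by ring.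
by move=> h3; lras h3.
Qed.

(** At time t the curvature is strictly below 2 m b, hence by compactness below it with room, and
    the room persists for a short time. Then the cubic coefficients of chord and profile are
    strictly ordered, which on short arcs absorbs the quartic term of the profile. *)
Lemma profile_near_diagonal t : 0 <= t < t1 ->
(forall s p q, 0 <= s <= t -> p <= q <= p + P -> 0 <= FF p q s) ->
exists2 d : R, 0 < d & forall s p q, t <= s <= t + d -> s <= t1 ->
 p <= q <= p + P -> q - p < d \/ p + P - q < d -> 0 <= FF p q s.
Proof.
move=> /andP[t0 tt1] good.
have [[/andP[m0 m1] b00 s10 hs1 eL0] [[mu0 nuE hT1 hL] _]] := Hy.
have ht1 : 0 <= t <= t1 by rewrite t0 ltW.
have ht := inI ht1; have P0 := flowing_P F.
have goodt p q : p <= q <= p + P -> 0 <= FF p q t by apply: good; rewrite t0 lexx.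
have strict := profile_kurv ht1 goodt.
have ck : cont_on [set t : R | 0 <= t < T] (fun u t => k u t ^+ 2) by apply: cont_onX; exact: (kurv_cont H).
have [v hv Hv] : exists2 v : R, 0 <= v <= P & forall u, 0 <= u <= P -> k u t ^+ 2 <= k v t ^+ 2.
have [|v hv Hv] := @EVT_max R (fun u => k u t ^+ 2) 0 P (ltW P0).
 by apply: continuous_subspaceT; exact: (cont_on_slice ht ck).
exists v; first by move: hv; rewrite in_itv.
by move=> u hu; apply: Hv; rewrite in_itv.
(* Half of the room is spent on continuity in time, the other half on the quartic term. *)
pose dlt := (4 * m ^+ 2 * b t ^+ 2 - k v t ^+ 2) / 2.
have dlt0 : 0 < dlt by rewrite divr_gt0 // subr_gt0; exact: strict.
have [d1 d10 Hd1] := @slice_uniform _ [set t : R | 0 <= t < T] (fun u t => k u t ^+ 2) 0 P t dlt ht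
(fun u _ => ck u t ht) dlt0.
pose kk := k v t ^+ 2 + dlt.
have kk0 : 0 <= kk by rewrite addr_ge0 ?sqr_ge0 // ltW.
have kb s : t <= s <= t1 -> s - t < d1 -> forall u, `|k u s| <= Num.sqrt kk.
move=> /andP[ts st1] sd u; have hs : 0 <= s < T by apply: inI; rewrite (le_trans t0 ts).
have [j [w [hw ->]]] := periodic_red u P0.
have per z : k (z + P) s = k z s by exact: (kurv_per H z hs).
rewrite (periodic_int per j w) -sqrtr_sqr ler_sqrt //.
have hd : `|s - t| < d1 by rewrite ger0_norm // subr_ge0.
have := Hd1 w s hs hw hd; rewrite ltr_norml => /andP[_ h2].
apply: le_trans (_ : k w t ^+ 2 + dlt <= _); first by rewrite -lerBlDl ltW.
by rewrite lerD2r; exact: Hv.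
pose B := b t1; have B0 : 0 < B by exact: b_gt0.
have mB : 0 < m ^+ 2 * B ^+ 3 by rewrite mulr_gt0 ?exprn_gt0.
(* Arcs below r are short enough for [prof_up], their quartic term costs at most dlt / 24, and they
   are the shorter ones. *)
pose r := Num.min (Num.min (1 / B) (dlt / 24 / (m ^+ 2 * B ^+ 3))) (eL / 2).
have r0 : 0 < r.
have e1 : 0 < 1 / B by exact: divr_gt0.
have e2 : 0 < dlt / 24 / (m ^+ 2 * B ^+ 3) by apply: divr_gt0 mB; exact: divr_gt0.
have e3 : 0 < eL / 2 by exact: divr_gt0.
by rewrite !lt_min e1 e2 e3.
have [d2 d20 Hd2] := alen_small F hT1 r0.
have near s p q : t <= s <= t1 -> s - t < d1 -> p <= q <= p + P -> q - p < d2 -> 0 <= FF p q s.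
move=> hs sd hpq qd; have /andP[ts st1] := hs.
have hs1' : 0 <= s <= t1 by rewrite (le_trans t0 ts).
have hsT := inI hs1'.
have /andP[] := hpq; rewrite le_eqVlt => /orP[/eqP <-|pq] qp.
 have l0 : l_ p p s = 0 by rewrite /alen subrr.
 rewrite FF_small l0; last by apply: divr_ge0 => //; exact: ltW (L_gt0 hsT).
 by rewrite /pf mulr0 prof_0 mul0r expr0n /= subr0; exact: chord2_ge0.
have := Hd2 p q s hs1' (ltW pq) qd; rewrite !lt_min => /andP[/andP[l1 l2] l3].
have l0 := arc_gt0 H pq hsT.
have lL : l_ p q s <= L s / 2.
 by have Ls := hL s hs1'; move: (l_ p q s) (L s) l3 Ls => w1 w2 l3 Ls; lras l3 Ls.
rewrite (FF_small lL) subr_ge0 -[X in _ <= X](sqr_sqrtr (chord2_ge0 x y p q s)).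
apply: sq_le; first exact: pf_ge0 (ltW l0).
apply: le_trans _ (chord_lower_flow F hsT (kb s hs sd) pq).
rewrite (sqr_sqrtr kk0).
set l := l_ p q s in l0 l1 l2 *.
have bs0 := b_gt0 s; have bsB : b s <= B by exact: b_mono.
have bts : b t <= b s by exact: b_mono.
have m01 : 0 <= m <= 1 by rewrite (ltW m0).
have s01 : 0 <= b s * l <= 1.
 rewrite mulr_ge0 ?(ltW l0) ?(ltW bs0) //=.
 apply: le_trans (_ : B * l <= 1); first by rewrite ler_wpM2r // ltW.
 by rewrite mulrC -ler_pdivlMr // ltW.
have up := prof_up m01 s01.
have up2 : pf l s <= l - m ^+ 2 * b s ^+ 2 / 6 * l ^+ 3 + m ^+ 2 * b s ^+ 3 * l ^+ 4.
 rewrite /pf ler_pdivrMr //; apply: le_trans up _.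
 by rewrite le_eqVlt; apply/orP; left; apply/eqP; ring.
apply: le_trans up2 _; apply: (@cmp_arith l kk (m ^+ 2) (b s) dlt) => //.
- exact: sqr_ge0.
- have h1 : b t ^+ 2 <= b s ^+ 2 by apply: sq_le => //; exact: ltW.
 have -> : kk + dlt = 4 * (m ^+ 2 * b t ^+ 2) by rewrite /kk /dlt; field.
 by rewrite -mulrA ler_pM2l //; exact: (ler_wpM2l (sqr_ge0 m) h1).
- exact: ltW.
- apply: le_trans (_ : m ^+ 2 * B ^+ 3 * l <= _).
 rewrite ler_wpM2r ?(ltW l0) // ler_wpM2l ?sqr_ge0 //.
 by apply: lerXn2r => //; rewrite nnegrE ltW.
 by rewrite mulrC -ler_pdivlMr // ltW.
exists (Num.min (d1 / 2) d2) => [|s p q /andP[ts sd] st1 hpq hor]; first by rewrite lt_min d20 divr_gt0.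
have hs : t <= s <= t1 by rewrite ts.
have sd1 : s - t < d1.
have : s - t <= d1 / 2.
 by apply: le_trans (_ : Num.min (d1 / 2) d2 <= _); [rewrite lerBlDl|rewrite ge_min lexx].
by move=> h; lras h d10.
case: hor => [h|h].
by apply: near => //; apply: lt_le_trans h _; rewrite ge_min lexx orbT.
have hsT : 0 <= s < T by apply: inI; rewrite (le_trans t0 ts).
rewrite -(FF_swap _ _ hsT); apply: near => //.
by have /andP[h1 h2] := hpq; rewrite h2 lerD2r.
by apply: lt_le_trans h _; rewrite ge_min lexx orbT.
Qed.

Lemma profile_flow t p q : 0 <= t <= t1 -> p <= q <= p + P -> 0 <= FF p q t.
Proof.
have [[_ b00 _ _ eL0] [[_ _ hT1 hL] [_ _ _ init _]]] := Hy.
have t10 : 0 <= t1 by case/andP: hT1.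
have z0 : 0 <= (0 : R) <= t1 by rewrite lexx.
have FFdiag u s : 0 <= s < T -> FF u u s = 0.
move=> hs; have l0 : l_ u u s = 0 by rewrite /alen subrr.
rewrite FF_small l0; last by apply: divr_ge0 => //; exact: ltW (L_gt0 hs).
by rewrite /pf mulr0 prof_0 mul0r /chord2 !subrr !expr0n /= addr0 subrr.
have init' v w : v < w < v + P -> 0 < FF v w 0.
move=> hvw; have [h|h] := leP (l_ v w 0) (L 0 / 2).
 by rewrite (FF_small h) subr_gt0; exact: init.
have h' : l_ w (v + P) 0 <= L 0 / 2.
 rewrite (alen_swap F) ?inI //.
 by move: (l_ v w 0) (L 0) h => w1 w2 h; lras h.
rewrite -(FF_swap _ _ (inI z0)) (FF_small h') subr_gt0; apply: init => //.
by have /andP[h1 h2] := hvw; rewrite h2 ltrD2r.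
move: t p q; apply: (@first_contact_on _ FF P t1 (flowing_P F) t10).
- move=> p q t /inI ht; rewrite /FF /M (chord2_shift F) // (alen_shift F) //.
- have cl : cont3 [set t | 0 <= t <= t1] l_ by apply: cont3_sub (alen_cont3 F) => t /=; exact: inI.
have cL : cont3 [set t | 0 <= t <= t1] (fun _ _ t => L t).
 by apply: cont3_sub (length_cont3 F) => t /=; exact: inI.
have cc : cont3 [set t | 0 <= t <= t1] ch by apply: cont3_sub (chord2_cont3 F) => t /=; exact: inI.
have cb : cont3 [set t | 0 <= t <= t1] (fun _ _ t => b t).
 by apply: cont3_t => t; exact: der_cvg (b_der t).
have cM : cont3 [set t | 0 <= t <= t1] M.
 apply: (cont3_comp2 (G := Num.min) cl (cont3B cL cl)) => v w.
 by apply: continuous_min; [exact: cvg_fst|exact: cvg_snd].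
have cV : cont3 [set t | 0 <= t <= t1] (fun _ _ t => (b t)^-1).
 apply: (cont3_comp (G := GRing.inv) cb) => p q t _.
 by apply: inv_continuous; exact: lt0r_neq0.
have cp : cont3 [set t | 0 <= t <= t1] (fun p q t => prof m (b t * M p q t)).
 apply: (cont3_comp (G := prof m) (cont3M cb cM)) => p q t _.
 exact: der_cvg (prof_der m _).
have cpf := cont3M cp cV.
by move=> p q t ht; apply: (cont3B cc (cont3M cpf cpf)).
- move=> p q /andP[]; rewrite le_eqVlt => /orP[/eqP <-|pq]; first by rewrite FFdiag ?inI.
rewrite le_eqVlt => /orP[/eqP ->|qp]; first by rewrite (FF_swap _ _ (inI z0)) FFdiag ?inI.
by apply/ltW/init'; rewrite pq.
- exact: profile_near_diagonal.
- move=> t p q /andP[]; rewrite le_eqVlt => /orP[/eqP <-|t0] tt1 good hpq F0.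
 by have := init' p q hpq; rewrite F0 ltxx.
have ht1' : 0 < t <= t1 by rewrite t0 (ltW tt1).
have hT : 0 <= t < T by apply: inI; rewrite (ltW t0) (ltW tt1).
have [lL|Ll] := leP (l_ p q t) (L t / 2).
 exact: (profile_contact ht1' hpq lL good F0).
apply: (@profile_contact t q (p + P) ht1') => //.
+ by case/andP: hpq => h1 h2; rewrite h2 ltrD2r.
+ by rewrite (alen_swap F) //; move: (l_ p q t) (L t) Ll => w1 w2 Ll; lras Ll.
+ by rewrite FF_swap.
Qed.

Lemma profile_curvature u t : 0 <= t <= t1 -> `|k u t| <= 2 * m * (b0 * expR t1).
Proof.
move=> ht; have [[/andP[m0 _] _ _ _ _] _] := Hy.
have h1 := profile_kurv ht (fun p q => profile_flow ht (q := q)) u.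
have /andP[_ tt1] := ht.
apply: le_trans (_ : 2 * m * b t <= _); last by apply: ler_wpM2l (b_mono tt1); rewrite mulr_ge0 // ltW.
have m2 : 0 <= 2 * m * b t by rewrite mulr_ge0 ?(ltW (b_gt0 t)) // mulr_ge0 // ltW.
rewrite -[X in _ <= X](ger0_norm m2) -!sqrtr_sqr ler_sqrt ?sqr_ge0 //.
by apply: ltW; have -> : (2 * m * b t) ^+ 2 = 4 * m ^+ 2 * b t ^+ 2 by ring.
Qed.

End ProfileFlow.

(** * Chord-arc constant of the initial curve *)

Section InitialCurve.
Context {R : realType}.
Implicit Types (p q s u : R).
Variables (c1 c2 : R -> R) (P : R).
Hypothesis J : arclength_jordan c1 c2 P.

Lemma jordan_P : 0 < P. Proof. by case: J. Qed.

Lemma jordan_der n s : der (derive1n n c1) s (derive1n n.+1 c1 s) /\ der (derive1n n c2) s (derive1n n.+1 c2 s).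
Proof.
by case: J => _ [h1 [h2 _]]; rewrite !derive1nS; split; apply: der_derive1; [exact: h1|exact: h2].
Qed.

Notation x1 := (derive1 c1).
Notation y1 := (derive1 c2).
Notation x2 := (derive1n 2 c1).
Notation y2 := (derive1n 2 c2).

Lemma jordan_der0 s : der c1 s (x1 s) /\ der c2 s (y1 s).
Proof. exact: (jordan_der 0). Qed.

Lemma jordan_der1 s : der x1 s (x2 s) /\ der y1 s (y2 s).
Proof. exact: (jordan_der 1). Qed.

Lemma jordan_per s : c1 (s + P) = c1 s /\ c2 (s + P) = c2 s.
Proof. by case: J => _ [_ [_ [h _]]]. Qed.

Lemma jordan_unit s : x1 s ^+ 2 + y1 s ^+ 2 = 1.
Proof. by case: J => _ [_ [_ [_ [h _]]]]. Qed.

Definition kurv0 s : R := x1 s * y2 s - y1 s * x2 s.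

Lemma kurv0_cont : continuous kurv0.
Proof.
have c n : Cn 0 (derive1n n c1) /\ Cn 0 (derive1n n c2).
by split=> s; [exact: der_cvg (jordan_der n s).1|exact: der_cvg (jordan_der n s).2].
have h := CnD (CnM (c 1%N).1 (c 2%N).2) (CnN (CnM (c 1%N).2 (c 2%N).1)).
exact: h.
Qed.

Definition tangle0 s : R := angle_of (x1 0) (y1 0) + prim kurv0 s.

Lemma tangle0_der s : der tangle0 s (kurv0 s).
Proof. by apply: der_eq (derD (der_cst _ s) (prim_der kurv0_cont s)) _; rewrite add0r. Qed.

Lemma tangle0P s : cos (tangle0 s) = x1 s /\ sin (tangle0 s) = y1 s.
Proof.
have h1 u : (1 : R) ^+ 2 = x1 u ^+ 2 + y1 u ^+ 2 by rewrite expr1n jordan_unit.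
have h2 u : der (fun=> 1 : R) u ((x1 u * x2 u + y1 u * y2 u) / 1).
apply: der_eq (der_cst _ u) _; rewrite divr1.
have d : der (fun u => x1 u ^+ 2 + y1 u ^+ 2) u (2 * (x1 u * x2 u + y1 u * y2 u)).
 have alg (A B C D : R) : 2%:R * A ^+ 2.-1 * C + 2%:R * B ^+ 2.-1 * D = 2 * (A * C + B * D).
 by rewrite /=; ring.
 exact: der_eq (derD (derX 2 (jordan_der1 u).1) (derX 2 (jordan_der1 u).2)) (alg _ _ _ _).
have E : (fun u => x1 u ^+ 2 + y1 u ^+ 2) = fun=> 1 by apply/funext => v; exact: jordan_unit.
rewrite E in d; have := der_unique d (der_cst 1 u) => /eqP.
by rewrite mulf_eq0 pnatr_eq0 /= => /eqP ->.
have h3 u : kurv0 u = (x1 u * y2 u - y1 u * x2 u) / 1 ^+ 3 by rewrite expr1n divr1.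
have h4 u : der (prim kurv0) u (kurv0 u * 1) by rewrite mulr1; exact: prim_der kurv0_cont u.
have [e1 e2] := tangent_angle (fun u => (jordan_der1 u).1) (fun u => (jordan_der1 u).2)
(fun _ => ltr01) h1 h2 h3 h4 s.
rewrite prim0 subr0 !divr1 in e1 e2.
by split; [exact: e1|exact: e2].
Qed.

Lemma periodic_derive (f : R -> R) s l : (forall s, f (s + P) = f s) -> der f s l -> der f (s + P) l.
Proof.
move=> per df.
have E : (fun z => f (z - P)) = f by apply/funext => z; rewrite -[in RHS](subrK P z) per.
have dz : der (fun z : R => z - P) (s + P) 1.
by apply: der_eq (derB (der_id _) (der_cst P _)) _; rewrite subr0.
have df' : der f (s + P - P) l by rewrite addrK.
by have := @der_comp _ f (fun z => z - P) (s + P) l 1 df' dz; rewrite E mulr1.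
Qed.

Lemma jordan_per_n n s : derive1n n c1 (s + P) = derive1n n c1 s /\ derive1n n c2 (s + P) = derive1n n c2 s.
Proof.
elim: n s => [|n IH] s; first exact: jordan_per.
have [d1 d2] := jordan_der n s; have [d1' d2'] := jordan_der n (s + P).
split.
exact: (der_unique d1' (periodic_derive (fun v => (IH v).1) d1)).
exact: (der_unique d2' (periodic_derive (fun v => (IH v).2) d2)).
Qed.

Lemma kurv0_per s : kurv0 (s + P) = kurv0 s.
Proof.
have h1 := jordan_per_n 1 s; have h2 := jordan_per_n 2 s.
have e1 : x1 (s + P) = x1 s by exact: h1.1.
have e2 : y1 (s + P) = y1 s by exact: h1.2.
by rewrite /kurv0 h2.1 h2.2 e1 e2.
Qed.

Lemma kurv0_bound : exists2 kap : R, 0 < kap & forall s, `|kurv0 s| <= kap.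
Proof.
have P0 := jordan_P.
have [|v hv Hv] := @EVT_max R (fun u => `|kurv0 u|) 0 P (ltW P0).
apply: continuous_subspaceT => u; apply: (@continuous_comp _ _ _ kurv0 (fun z => `|z|)).
 exact: kurv0_cont.
exact: norm_continuous.
exists (`|kurv0 v| + 1) => [|s]; first by rewrite ltr_wpDl.
have [j [w [hw ->]]] := periodic_red s P0.
rewrite (periodic_int kurv0_per j w); apply: le_trans (Hv w _) _; first by rewrite in_itv.
by rewrite lerDl.
Qed.

Definition chord0 p q : R := (c1 q - c1 p) ^+ 2 + (c2 q - c2 p) ^+ 2.

Lemma chord0_swap p q : chord0 q (p + P) = chord0 p q.
Proof. by rewrite /chord0 (jordan_per p).1 (jordan_per p).2; ring. Qed.

Lemma chord0_lower kap p q : (forall s, `|kurv0 s| <= kap) -> p < q ->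
(q - p) - kap ^+ 2 * (q - p) ^+ 3 / 24 <= Num.sqrt (chord0 p q).
Proof.
move=> hk pq.
apply: (@chord_lower _ c1 c2 tangle0 (fun z => z) (fun=> 1) kurv0 _ _ _ _ _ kap p q hk pq _ erefl).
- by move=> u; rewrite mulr1 (tangle0P u).1; exact: (jordan_der0 u).1.
- by move=> u; rewrite mulr1 (tangle0P u).2; exact: (jordan_der0 u).2.
- by move=> u; exact: der_id.
- by move=> u; rewrite mulr1; exact: tangle0_der.
- by move=> u; exact: ltr01.
Qed.

Lemma jordan_inj p q : p < q < p + P -> c1 p = c1 q -> c2 p = c2 q -> False.
Proof.
move=> /andP[pq qp] e1 e2; have P0 := jordan_P.
have red u : exists (j : int) (v : R), 0 <= v < P /\ u = v + j%:~R * P.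
exists (Num.floor (u / P)), (u - (Num.floor (u / P))%:~R * P); split; last by rewrite subrK.
have /andP[h1 h2] := mem_rg1_floor (u / P).
by rewrite subr_ge0 -ler_pdivlMr // h1 /= ltrBlDr -{1}[P]mul1r -mulrDl -ltr_pdivrMr // addrC.
have [i [v [hv pE]]] := red p; have [j [w [hw qE]]] := red q.
have per1 s : c1 (s + P) = c1 s by exact: (jordan_per s).1.
have per2 s : c2 (s + P) = c2 s by exact: (jordan_per s).2.
case: J => _ [_ [_ [_ [_ inj]]]].
have vw : v = w.
apply: inj => //.
 by move: e1; rewrite pE qE (periodic_int per1 i v) (periodic_int per1 j w).
by move: e2; rewrite pE qE (periodic_int per2 i v) (periodic_int per2 j w).
have d1 : 0 < (j - i)%:~R * P.
have -> : (j - i)%:~R * P = q - p by rewrite pE qE vw intrB; ring.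
by rewrite subr_gt0.
have d2 : (j - i)%:~R * P < 1%:~R * P.
have -> : (j - i)%:~R * P = q - p by rewrite pE qE vw intrB; ring.
by rewrite mul1r; lras qp.
rewrite pmulr_lgt0 // ltr0z in d1; rewrite ltr_pM2r // ltr_int in d2.
by move: d1 d2; case: (j - i) => // n; rewrite ltz_nat => h1; rewrite ltz_nat; case: n h1.
Qed.

Lemma chord0_gap d : 0 < d -> exists2 eta : R, 0 < eta & forall p q, d <= q - p <= P - d ->
eta <= chord0 p q.
Proof.
move=> d0; apply: contrapT => no; have P0 := jordan_P.
have red (n : nat) : exists pq : R * R, [/\ 0 <= pq.1 <= P, d <= pq.2 - pq.1 <= P - d & chord0 pq.1 pq.2 < n.+1%:R^-1].
apply: contrapT => hno; apply: no; exists n.+1%:R^-1; first by rewrite invr_gt0.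
move=> p q hpq; rewrite leNgt; apply/negP => hb; apply: hno.
have [j [v [hv pE]]] := periodic_red p P0.
exists (v, q - j%:~R * P); split => //=.
 by have -> : q - j%:~R * P - v = q - p by rewrite pE; ring.
have per1 s : c1 (s + P) = c1 s by exact: (jordan_per s).1.
have per2 s : c2 (s + P) = c2 s by exact: (jordan_per s).2.
have := periodic_int per1 j v; have := periodic_int per2 j v; rewrite -pE => e1 e2.
have := periodic_int per1 j (q - j%:~R * P); have := periodic_int per2 j (q - j%:~R * P).
by rewrite subrK => e3 e4; rewrite /chord0 -e1 -e2 -e3 -e4.
have [z hz] := choice red.
have [|p [q [zz [_ _ _ HH]]]] := @bolzano_weierstrass3 _ (fun n => (z n).1) (fun n => (z n).2) (fun=> 0) 0 (2 * P + d).
move=> n; have [/andP[h1 h2] /andP[h3 h4] _] := hz n.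
move: (z n).1 (z n).2 h1 h2 h3 h4 => v w h1 h2 h3 h4.
by split; apply/andP; split; lras h1 h2 h3 h4 P0 d0.
have hpq : d <= q - p <= P - d.
have cl (s : R) : 0 < s -> d - s <= q - p <= P - d + s.
 move=> s0; have s2 : 0 < s / 2 by rewrite divr_gt0.
 have [n [_ h1 h2 _]] := HH (s / 2) 0%N s2; have [_ /andP[h3 h4] _] := hz n.
 move: h1 h2; rewrite !ltr_norml; move: (z n).1 (z n).2 h3 h4 => v w h3 h4 /andP[a1 a2] /andP[b1 b2].
 by apply/andP; split; lras h3 h4 a1 a2 b1 b2.
apply/andP; split; rewrite leNgt; apply/negP => hb.
 have s0 : 0 < (d - (q - p)) / 2 by lras hb.
 by have /andP[h _] := cl _ s0; lras h hb.
have s0 : 0 < (q - p - (P - d)) / 2 by lras hb.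
by have /andP[_ h] := cl _ s0; lras h hb.
have ch0 : 0 < chord0 p q.
have pq : p < q < p + P by have /andP[h1 h2] := hpq; apply/andP; split; lras h1 h2 d0.
rewrite lt_neqAle eq_sym addr_ge0 ?sqr_ge0 // andbT /chord0.
rewrite paddr_eq0 ?sqr_ge0 // !expf_eq0 /= !subr_eq0; apply/negP => /andP[/eqP h1 /eqP h2].
exact: (jordan_inj pq (esym h1) (esym h2)).
have cc : cont_on setT (fun p q => chord0 p q).
have cD f1 : (forall s, {for s, continuous f1}) -> cont_on setT (fun p q : R => f1 q - f1 p).
 move=> cf u t _ e e0; have e2 : 0 < e / 2 by rewrite divr_gt0.
 have /cvgrPdist_lt/(_ _ e2)[a1 /= a10 Ha] := cf u.
 have /cvgrPdist_lt/(_ _ e2)[b1 /= b10 Hb] := cf t.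
 exists (Num.min a1 b1) => [|u' t' _]; first by rewrite lt_min a10 b10.
 rewrite !lt_min => /andP[g1 _] /andP[_ g2].
 have := Ha u'; rewrite /= distrC => /(_ g1); have := Hb t'; rewrite /= distrC => /(_ g2).
 rewrite (distrC (f1 t)) (distrC (f1 u)) => k1 k2.
 have -> : f1 t' - f1 u' - (f1 t - f1 u) = (f1 t' - f1 t) - (f1 u' - f1 u) by ring.
 by apply: le_lt_trans (ler_normB _ _) _; rewrite [e]splitr; apply: ltrD.
apply: cont_onD; apply: cont_onX; apply: cD => s.
 exact: der_cvg (jordan_der0 s).1.
exact: der_cvg (jordan_der0 s).2.
have ch2 : 0 < chord0 p q / 2 by rewrite divr_gt0.
have [dd dd0 Hdd] := cc p q I _ ch2.
have [N hN] := inv_nat_small ch2.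
have [n [Nn h1 h2 _]] := HH dd N dd0.
have [_ _ h3] := hz n.
have h4 := hN n Nn.
have := Hdd _ _ I h1 h2; rewrite ltr_norml => /andP[h5 _].
move: (chord0 (z n).1 (z n).2) (chord0 p q) (n.+1%:R^-1) h3 h4 h5 => w1 w2 w3 h3 h4 h5.
lras h3 h4 h5.
Qed.

(** If one of the two arcs is shorter than 1 / kap, the curvature bound makes the chord at least
    half of it. For the remaining pairs, compactness and injectivity give a positive lower bound of
    the chord. *)
Lemma chord_arc0 : exists2 mu : R, 0 < mu <= 1 / 100 & forall p q, p < q < p + P ->
(mu * ((q - p) * (1 - (q - p) / P))) ^+ 2 < chord0 p q.
Proof.
have P0 := jordan_P; have [kap kap0 Hk] := kurv0_bound.
pose d := 1 / kap; have d0 : 0 < d by rewrite divr_gt0.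
have small p q : p < q -> q - p <= d -> ((q - p) / 2) ^+ 2 <= chord0 p q.
move=> pq hd; have h1 := chord0_lower Hk pq.
have c0 : 0 <= chord0 p q by rewrite addr_ge0 // sqr_ge0.
rewrite -[X in _ <= X](sqr_sqrtr c0); set l := q - p in hd h1 *.
have l0 : 0 < l by rewrite subr_gt0.
apply: sq_le; first by rewrite divr_ge0 // ltW.
apply: le_trans h1.
have lk : (l * kap) ^+ 2 <= 1.
 rewrite -[X in _ <= X](expr1n _ 2); apply: sq_le; first by rewrite mulr_ge0 // ltW.
 by rewrite -ler_pdivlMr.
have := ler_wpM2r (ltW l0) lk; have -> : (l * kap) ^+ 2 * l = kap ^+ 2 * l ^+ 3 by ring.
by rewrite mul1r; move: (kap ^+ 2 * _) => w h; lras h l0.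
have [eta eta0 Heta] := chord0_gap d0.
have se : 0 < Num.sqrt eta by rewrite sqrtr_gt0.
pose mu := Num.min (1 / 100) (Num.sqrt eta / (2 * P)).
have mu0 : 0 < mu by rewrite lt_min !divr_gt0 // mulr_gt0.
have mu1 : mu <= 1 / 100 by rewrite ge_min lexx.
have mu2 : mu * P <= Num.sqrt eta / 2.
have : mu <= Num.sqrt eta / (2 * P) by rewrite ge_min lexx orbT.
rewrite ler_pdivlMr ?mulr_gt0 // => h; move: (mu) h => z h; lras h.
exists mu => [|p q /andP[pq qp]]; first by rewrite mu0.
have key l l' : 0 < l -> 0 < l' -> l + l' = P -> (mu * (l * (1 - l / P))) = mu * l * (l' / P).
by move=> l0 l0' e; rewrite -e; field; rewrite e lt0r_neq0.
have l0 : 0 < q - p by rewrite subr_gt0.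
have l0' : 0 < p + P - q by rewrite subr_gt0.
have lP : q - p + (p + P - q) = P by ring.
rewrite (key _ _ l0 l0' lP).
have r1 : 0 < (p + P - q) / P <= 1.
by rewrite divr_gt0 //= ler_pdivrMr // mul1r; lras pq.
have r2 : 0 < (q - p) / P <= 1.
by rewrite divr_gt0 //= ler_pdivrMr // mul1r; lras qp.
have nn : 0 <= mu * (q - p) * ((p + P - q) / P).
by have /andP[h1 _] := r1; apply: mulr_ge0 (ltW h1); apply: mulr_ge0; exact: ltW.
have lt_sq (v w : R) : 0 <= v -> v < w -> v ^+ 2 < w ^+ 2.
by move=> v0 vw; rewrite ltr_pXn2r // nnegrE // (le_trans v0) // ltW.
have [hs|hs] := leP (q - p) d.
apply: lt_le_trans (small p q pq hs); apply: lt_sq.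
 exact: nn.
apply: le_lt_trans (_ : mu * (q - p) * 1 < _).
 have /andP[_ h1] := r1; by apply: ler_wpM2l => //; apply: mulr_ge0; exact: ltW.
have := ler_wpM2r (ltW l0) mu1; rewrite mulr1; move: (mu * (q - p)) => w h; lras h l0.
have [hs'|hs'] := leP (p + P - q) d.
rewrite -chord0_swap; apply: lt_le_trans (small q (p + P) qp hs'); apply: lt_sq.
 exact: nn.
have -> : mu * (q - p) * ((p + P - q) / P) = mu * (p + P - q) * ((q - p) / P) by ring.
apply: le_lt_trans (_ : mu * (p + P - q) * 1 < _).
 have /andP[_ h1] := r2; by apply: ler_wpM2l => //; apply: mulr_ge0; exact: ltW.
have := ler_wpM2r (ltW l0') mu1; rewrite mulr1; move: (mu * (p + P - q)) => w h; lras h l0'.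
apply: lt_le_trans (Heta p q _); last by apply/andP; split; lras hs hs'.
rewrite -[X in _ < X](sqr_sqrtr (ltW eta0)); apply: lt_sq.
exact: nn.
apply: le_lt_trans (_ : mu * P * 1 < _); last by rewrite mulr1; lras mu2 se.
have /andP[_ h1] := r1; have /andP[h0 _] := r1.
apply: ler_pM => //; [by apply: mulr_ge0; exact: ltW|exact: ltW|].
by rewrite ler_wpM2l // ?(ltW mu0) //; lras qp.
Qed.

End InitialCurve.

(** * Uniform curvature bound while the length stays positive *)

Section CurvatureBound.
Context {R : realType}.
Implicit Types (p q s u t : R).

Section Initial.
Variables (a : R -> R) (eps : R) (c1 c2 : R -> R) (P : R) (x y : R -> R -> R) (T : R).
Hypothesis J : arclength_jordan c1 c2 P.
Hypothesis F : flowing a eps c1 c2 P x y T.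
Let H := flowing_sol F.

Lemma flow_T0 : 0 <= (0 : R) < T. Proof. by case: H => h _; rewrite lexx. Qed.

Lemma flow_init u : x u 0 = c1 u /\ y u 0 = c2 u.
Proof. by case: H => _ [_ [_ [h _]]]. Qed.

Lemma flow_init1 u : du x u 0 = derive1 c1 u /\ du y u 0 = derive1 c2 u.
Proof.
have ex : x ^~ 0 = c1 by apply/funext => v; exact: (flow_init v).1.
have ey : y ^~ 0 = c2 by apply/funext => v; exact: (flow_init v).2.
have [dx dy] := flow_space0 F u flow_T0; rewrite ex in dx; rewrite ey in dy.
split; first exact: (der_unique dx (jordan_der0 J u).1).
exact: (der_unique dy (jordan_der0 J u).2).
Qed.

Lemma speed_init u : speed x y u 0 = 1.
Proof. by rewrite /speed (flow_init1 u).1 (flow_init1 u).2 (jordan_unit J) sqrtr1. Qed.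

Lemma alen_init p q : alen x y p q 0 = q - p.
Proof.
apply: (der_uniq_prim (df := fun=> 1)) => u; last exact: der_id.
by apply: der_eq (arc_der H u flow_T0) (speed_init u).
Qed.

Lemma chord2_init p q : chord2 x y p q 0 = chord0 c1 c2 p q.
Proof. by rewrite /chord2 /chord0 !(flow_init _).1 !(flow_init _).2. Qed.

End Initial.

(** The bound depends on the initial curve, [K], [eL] and [Tm] only, hence is uniform in the
    regularisation. The slope mu1 that the crude profile retains at time Tm fixes nu, then m, then
    s1, then b0. *)
Lemma curvature_bound (c1 c2 : R -> R) (P K eL Tm : R) : arclength_jordan c1 c2 P ->
0 <= K -> 0 < eL -> 0 <= Tm ->
exists e0 K0 : R, 0 < e0 /\ forall a eps x y T t1 e, flowing a eps c1 c2 P x y T ->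
 admissible a K e -> 0 <= e <= e0 -> 0 <= t1 < T -> t1 <= Tm ->
 (forall t, 0 <= t <= t1 -> eL <= alen x y 0 P t) ->
 forall u t, 0 <= t <= t1 -> `|kurv x y u t| <= K0.
Proof.
move=> J K0 eL0 Tm0; have P0 := jordan_P J.
have [mu0 /andP[mu00 mu01] Hmu] := chord_arc0 J.
have [kap kap0 Hkap] := kurv0_bound J.
pose C0 : R := 400 * 100 * (9 * K ^+ 2 + 4) / eL ^+ 2.
have C00 : 0 <= C0.
apply: divr_ge0; last exact: sqr_ge0.
by have := sqr_ge0 K => h; lraw h.
pose mu1 := mu0 * expR (- (C0 * Tm)).
have mu10 : 0 < mu1 by rewrite mulr_gt0 // expR_gt0.
have mu1m : mu1 <= mu0.
rewrite -[X in _ <= X]mulr1; apply: ler_wpM2l; first exact: ltW.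
by rewrite -expR0 ler_expR oppr_le0 mulr_ge0.
have nu01 : 0 < mu1 / 4 <= 1 by rewrite divr_gt0 //=; lraw mu1m mu01.
have [C2 [y0 [kp [e0 [C20 y00 hy0 kp0 [/andP[e00 e01] hkey]]]]]] := key_all K0 nu01.
have m10 : 0 < mu1 / 64 by rewrite divr_gt0.
have [m [m0 mm1 hm]] := profile_choice C20 y00 hy0 kp0 nu01 m10.
have m1 : m <= 1 by lraw mm1 mu1m mu01.
have m16 : 16 * m ^+ 2 < mu1 / 2.
have : m ^+ 2 <= m by rewrite expr2 -[X in _ <= X]mulr1 ler_wpM2l // ltW.
move=> h; lraw h mm1 mu10.
have [s1 [s10 tl1 tl2]] := prof_tail m0 m16.
have [eta eta0 Heta] := prof_cubic m0 s10.
have kq : 0 <= kap ^+ 2 / 24 / eta by rewrite divr_ge0 ?ltW // divr_gt0 // exprn_gt0.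
have sq : 0 <= 4 * s1 / eL by rewrite divr_ge0 // ?ltW // mulr_gt0.
(* The first term gives 4 s1 <= b0 eL. The second, together with b0 >= 1, makes the cubic deficit
   eta b0^2 of the profile exceed kap^2 / 24, that of the initial chords. *)
pose b0 := 4 * s1 / eL + kap ^+ 2 / 24 / eta + 1.
have b01 : 1 <= b0 by rewrite /b0 lerDr addr_ge0.
have b00 : 0 < b0 by apply: lt_le_trans b01.
have b0s : 4 * s1 <= b0 * eL.
rewrite -ler_pdivrMr // /b0 -addrA lerDl; lraw kq.
have b0k : kap ^+ 2 / 24 < eta * b0 ^+ 2.
rewrite (mulrC eta) -ltr_pdivrMr //; apply: lt_le_trans (_ : b0 <= _).
 by rewrite /b0; move: (kap ^+ 2 / 24 / eta) (4 * s1 / eL) kq sq => w1 w2 kq sq; lraw kq sq.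
by rewrite expr2 ler_peMl // ltW.
exists (Num.min e0 (mu1 / 250)), (2 * m * (b0 * expR Tm)).
split; first by rewrite lt_min e00 divr_gt0.
move=> a eps x y T t1 e F adm /andP[he0]; rewrite le_min => /andP[he1 he2] /andP[t10 t1T] t1m HL u t ht.
have h0T := flow_T0 F.
have L0E : alen x y 0 P 0 = P by rewrite (alen_init J F) subr0.
have he250 : 250 * e <= mu0 * expR (- (C0 * t1)).
apply: le_trans (_ : mu1 <= _); first by lraw he2.
by rewrite /mu1 ler_pM2l // ler_expR lerN2 ler_wpM2l.
have hca : chordarc_hyp a P x y T K e eL mu0 C0 t1.
split; split => //; [by rewrite he0 /=; lraw he1 e01|by rewrite mu00|by rewrite t10].
have ini p q : p < q < p + P ->
 (mu0 * (alen x y p q 0 * (1 - alen x y p q 0 / alen x y 0 P 0))) ^+ 2 < chord2 x y p q 0.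
by move=> hpq; rewrite (chord2_init F) L0E (alen_init J F); exact: Hmu.
have ca := chord_arc_flow F hca ini.
have {}ca : forall t p q, 0 <= t <= t1 -> p <= q <= p + P ->
 (mu1 * (alen x y p q t * (1 - alen x y p q t / alen x y 0 P t))) ^+ 2 <= chord2 x y p q t.
move=> s p q hs hpq; have /andP[hs0 hs1] := hs.
have hsT : 0 <= s < T by rewrite hs0 (le_lt_trans hs1 t1T).
apply: le_trans (ca s p q hs hpq).
have Ls := arc_gt0 (flowing_sol F) P0 hsT.
have /andP[hpq1 hpq2] := hpq.
have l0 := alen_ge0 F hpq1 hsT.
have lL : alen x y p q s <= alen x y 0 P s.
 by rewrite -subr_ge0 -(alen_swap F) // (alen_ge0 F).
have w0 : 0 <= alen x y p q s * (1 - alen x y p q s / alen x y 0 P s).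
 by rewrite mulr_ge0 // subr_ge0 ler_pdivrMr // mul1r.
apply: sq_le; first by rewrite mulr_ge0 // ltW.
apply: ler_wpM2r => //; rewrite /mu1 ler_pM2l // ler_expR lerN2 ler_wpM2l //.
exact: le_trans hs1 t1m.
have hp : profile_hyp a P x y T mu1 (mu1 / 4) eL t1 m b0 s1.
split; [by split => //; rewrite m0|split; split => //; first by rewrite t10].
- move=> p q hpq; rewrite (chord2_init F) (alen_init J F) L0E expR0 mulr1 => lP.
 have /andP[pq qp] := hpq.
 have l0 : 0 < q - p by rewrite subr_gt0.
 set l := q - p in lP l0 *.
 have bl0 : 0 < b0 * l by rewrite mulr_gt0.
 have pr0 : 0 <= prof m (b0 * l) / b0 by rewrite divr_ge0 // ltW // prof_gt0.
 (* On long arcs the tail of the profile lies below the initial chord-arc bound; on short ones the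
    cubic deficits are compared. *)
 have [hs|hs] := leP s1 (b0 * l).
 apply: le_lt_trans (Hmu p q hpq); apply: sq_le => //; rewrite -/l.
 apply: le_trans (_ : mu1 / 2 * l <= _).
  rewrite ler_pdivrMr //; have := tl2 _ hs => /ltW h; apply: le_trans h _.
  by rewrite le_eqVlt; apply/orP; left; apply/eqP; ring.
 have z1 : l / P <= 1 / 2 by rewrite ler_pdivrMr //; lraw lP.
 have -> : mu1 / 2 * l = mu1 * (l * (1 / 2)) by ring.
 apply: ler_pM => //; [exact: ltW|by rewrite mulr_ge0 // ltW|].
 by apply: ler_wpM2l; [exact: ltW|lraw z1].
 have sb : 0 <= b0 * l <= s1 by rewrite !ltW.
 have hc := Heta _ sb.
 have lo := chord0_lower J Hkap pq; rewrite -/l in lo.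
 have c0 : 0 <= chord0 c1 c2 p q by rewrite addr_ge0 // sqr_ge0.
 rewrite -[X in _ < X](sqr_sqrtr c0) ltr_pXn2r // ?nnegrE ?sqrtr_ge0 //.
 apply: lt_le_trans lo; apply: le_lt_trans (_ : l - eta * b0 ^+ 2 * l ^+ 3 < _).
 rewrite ler_pdivrMr //; apply: le_trans hc _.
 by rewrite le_eqVlt; apply/orP; left; apply/eqP; ring.
 rewrite ltrD2l ltrN2; have l3 : 0 < l ^+ 3 by rewrite exprn_gt0.
 have -> : kap ^+ 2 * l ^+ 3 / 24 = kap ^+ 2 / 24 * l ^+ 3 by ring.
 by rewrite ltr_pM2r.
- move=> s h TT xi s0 nus hcos hx1 hx2.
 have yy : 0 <= 1 - prof1 m s ^+ 2.
 rewrite subr_ge0 -[X in _ <= X](expr1n _ 2); apply: sq_le; [exact: ltW (prof1_gt0 _ _)|exact: prof1_le1].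
 have ysq := sqr_sqrtr yy.
 have [g1 g2] := hm s _ s0 (sqrtr_ge0 _) ysq nus.
 rewrite -{1}ysq; have he : 0 <= e <= e0 by rewrite he0.
 apply: (hkey a e adm he (prof1 m s) _ h TT xi (profq m s) _ (sqrtr_ge0 _) ysq hcos hx1 hx2
 (profq_ge0 m s0) g1 g2) => //.
 by rewrite nus prof1_lt1.
apply: le_trans (profile_curvature F hp u ht) _.
apply: ler_wpM2l; first by rewrite mulr_ge0 // ltW.
by rewrite ler_wpM2l ?(ltW b00) // ler_expR.
Qed.

End CurvatureBound.

(** * Signed area and total turning under the flow *)

Section DiscreteValues.
Context {R : realType}.
Implicit Types (f : R -> R) (a b c s v : R).

Lemma ivt_within f a b v : a <= b -> {within `[a, b], continuous f} ->
f a <= v <= f b \/ f b <= v <= f a -> exists2 s : R, a <= s <= b & f s = v.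
Proof.
move=> ab cf hv; have [|s] := @IVT _ f a b v ab cf.
by case: hv => /andP[h1 h2]; rewrite ge_min le_max h1 h2 ?orbT.
by rewrite in_itv /= => hs <-; exists s.
Qed.

(** Between two different multiples of c, the intermediate value theorem would produce a value half
    a step off the lattice. *)
Lemma discrete_const f a b c : a <= b -> {within `[a, b], continuous f} -> 0 < c ->
(forall s, a <= s <= b -> exists j : int, f s = j%:~R * c) -> f a = f b.
Proof.
move=> ab cf c0 hf.
have [ja Ea] : exists j : int, f a = j%:~R * c by apply: hf; rewrite lexx.
have [jb Eb] : exists j : int, f b = j%:~R * c by apply: hf; rewrite lexx ab.
have mid (j : int) (z : R) : j%:~R * c = ja%:~R * c + z * (c / 2) -> (2 * (j - ja))%:~R = z.
move=> h; rewrite intrM intrB.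
have : (2 * (j%:~R - ja%:~R)) * (c / 2) = z * (c / 2) :> R by lraw h.
by move/(mulIf (lt0r_neq0 (divr_gt0 c0 (ltr0n R 2)))).
case: (ltgtP ja jb) => [lt|gt|eq]; last by rewrite Ea Eb eq.
- have [|s hs Es] := @ivt_within f a b (f a + 1 * (c / 2)) ab cf.
 left; rewrite Ea Eb; have : (ja + 1)%:~R <= jb%:~R :> R by rewrite ler_int; lia.
 rewrite intrD => h; have := ler_wpM2r (ltW c0) h => h2; apply/andP; split; lraw h2 c0.
have [j Ej] := hf s hs; have /eqP := mid j 1 ltac:(by rewrite -Ej Es Ea).
by rewrite -[1]/(1%:~R) eqr_int => /eqP; lia.
- have [|s hs Es] := @ivt_within f a b (f a + -1 * (c / 2)) ab cf.
 right; rewrite Ea Eb; have : (jb + 1)%:~R <= ja%:~R :> R by rewrite ler_int; lia.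
 rewrite intrD => h; have := ler_wpM2r (ltW c0) h => h2; apply/andP; split; lraw h2 c0.
have [j Ej] := hf s hs; have /eqP := mid j (-1) ltac:(by rewrite -Ej Es Ea).
by rewrite -[-1]/((-1)%:~R) eqr_int => /eqP; lia.
Qed.

End DiscreteValues.

Section AreaEvolution.
Context {R : realType}.
Implicit Types (p q s u t : R).
Variables (a : R -> R) (eps : R) (c1 c2 : R -> R) (P : R) (x y : R -> R -> R) (T : R).
Hypothesis J : arclength_jordan c1 c2 P.
Hypothesis F : flowing a eps c1 c2 P x y T.
Let H := flowing_sol F.
Notation g := (speed x y).
Notation k := (kurv x y).
Notation th := (tangle x y).
Notation L := (alen x y 0 P).

Definition sarea t : R :=
let S := prim (fun u => x u t * du y u t - y u t * du x u t) in (S P - S 0) / 2.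

Let cx : cont_on [set t : R | 0 <= t < T] x. Proof. exact: (flow_cont H 0).1. Qed.
Let cy : cont_on [set t : R | 0 <= t < T] y. Proof. exact: (flow_cont H 0).2. Qed.

Let ci : cont_on [set t : R | 0 <= t < T] (fun u t => x u t * du y u t - y u t * du x u t).
Proof. by apply: cont_onB; apply: cont_onM; [exact: cx|exact: (flow_cont1 H).2|exact: cy|exact: (flow_cont1 H).1]. Qed.

Lemma sarea_der u t : 0 <= t < T -> der (prim (fun u => x u t * du y u t - y u t * du x u t)) u
(x u t * du y u t - y u t * du x u t).
Proof. by move=> ht; apply: prim_der; exact: (cont_on_slice (t := t) ht ci). Qed.

Lemma sarea_shift p1 p2 t : 0 <= t < T -> exists2 S, sarea t = (S P - S 0) / 2 &
forall u, der S u ((x u t - p1) * du y u t - (y u t - p2) * du x u t).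
Proof.
move=> ht; pose S0 := prim (fun u => x u t * du y u t - y u t * du x u t).
exists (fun u => S0 u - p1 * y u t + p2 * x u t) => [|u].
have [e1 e2] := flow_periodic F 0 ht; rewrite add0r in e1 e2.
by rewrite /sarea -/S0 /= e1 e2; congr (_ / _); ring.
have [dx dy] := flow_space0 F u ht.
apply: der_eq (derD (derB (sarea_der u ht) (derM (der_cst p1 u) dy)) (derM (der_cst p2 u) dx)) _.
ring.
Qed.

Lemma sarea_le_dist p1 p2 r t : 0 <= t < T -> (forall u, `|x u t - p1| <= r /\ `|y u t - p2| <= r) ->
`|sarea t| <= r * L t.
Proof.
move=> ht hr; have [S -> dS] := sarea_shift p1 p2 ht.
have r0 : 0 <= r by apply: le_trans (hr 0).1.
have P0 := flowing_P F.
have bd u : `|(x u t - p1) * du y u t - (y u t - p2) * du x u t| <= 2 * r * g u t.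
have gx : `|du x u t| <= g u t by rewrite -sqrtr_sqr ler_wsqrtr // lerDl sqr_ge0.
have gy : `|du y u t| <= g u t by rewrite -sqrtr_sqr ler_wsqrtr // lerDr sqr_ge0.
apply: le_trans (ler_normB _ _) _; rewrite !normrM.
have -> : 2 * r * g u t = r * g u t + r * g u t by ring.
by apply: lerD; apply: ler_pM => //; [exact: (hr u).1|exact: (hr u).2].
have main (e : R) : `|e| = 1 -> e * (S P - S 0) <= 2 * r * L t.
move=> e1; rewrite -subr_ge0 /alen.
have -> : 2 * r * (prim (g ^~ t) P - prim (g ^~ t) 0) - e * (S P - S 0)
 = (2 * r * prim (g ^~ t) P - e * S P) - (2 * r * prim (g ^~ t) 0 - e * S 0) by ring.
rewrite subr_ge0.
have dd u : der (fun u => 2 * r * prim (g ^~ t) u - e * S u) u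
 (2 * r * g u t - e * ((x u t - p1) * du y u t - (y u t - p2) * du x u t)).
 by apply: der_eq (derB (derM (der_cst _ u) (arc_der H u ht)) (derM (der_cst e u) (dS u))) _; ring.
apply: (der_ge0_le (ltW P0) (fun u _ => dd u)) => u _.
rewrite subr_ge0; apply: le_trans (ler_norm _) _.
by rewrite normrM e1 mul1r; exact: bd.
have m1 := main 1 (normr1 _); have m2 := main (-1) (normrN1 _).
rewrite ler_norml; move: (S P - S 0) (L t) m1 m2 => A B m1 m2.
by apply/andP; split; lras m1 m2.
Qed.

Lemma dist_le_alen p q t : 0 <= t < T -> p <= q ->
`|x q t - x p t| <= alen x y p q t /\ `|y q t - y p t| <= alen x y p q t.
Proof.
move=> ht pq.
have gx u : `|du x u t| <= g u t by rewrite -sqrtr_sqr ler_wsqrtr // lerDl sqr_ge0.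
have gy u : `|du y u t| <= g u t by rewrite -sqrtr_sqr ler_wsqrtr // lerDr sqr_ge0.
have main (f f' : R -> R) : (forall u, der f u (f' u)) -> (forall u, `|f' u| <= g u t) ->
 `|f q - f p| <= alen x y p q t.
move=> df hf; rewrite /alen ler_norml; apply/andP; split.
 rewrite -subr_ge0.
 have -> : f q - f p - - (prim (g ^~ t) q - prim (g ^~ t) p)
 = (f q + prim (g ^~ t) q) - (f p + prim (g ^~ t) p) by ring.
 rewrite subr_ge0; apply: (der_ge0_le pq (fun u _ => derD (df u) (arc_der H u ht))) => u _.
 by have := hf u; rewrite ler_norml => /andP[h _]; rewrite -lerBlDr sub0r.
rewrite -subr_ge0.
have -> : prim (g ^~ t) q - prim (g ^~ t) p - (f q - f p)
 = (prim (g ^~ t) q - f q) - (prim (g ^~ t) p - f p) by ring.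
rewrite subr_ge0; apply: (der_ge0_le pq (fun u _ => derB (arc_der H u ht) (df u))) => u _.
by rewrite subr_ge0; apply: le_trans (ler_norm _) (hf u).
split; first by apply: (main (x ^~ t) (du x ^~ t)) => // u; exact: (flow_space0 F u ht).1.
by apply: (main (y ^~ t) (du y ^~ t)) => // u; exact: (flow_space0 F u ht).2.
Qed.

Lemma dist_le_length p q t : 0 <= t < T -> `|x q t - x p t| <= L t /\ `|y q t - y p t| <= L t.
Proof.
move=> ht; have P0 := flowing_P F.
have [j [v [/andP[v0 vP] E]]] := periodic_red (q - p) P0.
have -> : q = p + v + j%:~R * P by rewrite -addrA -E addrC subrK.
have per1 s : x (s + P) t = x s t by exact: (flow_periodic F s ht).1.
have per2 s : y (s + P) t = y s t by exact: (flow_periodic F s ht).2.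
rewrite (periodic_int per1 j (p + v)) (periodic_int per2 j (p + v)).
have pv : p <= p + v by rewrite lerDl.
have [h1 h2] := dist_le_alen ht pv.
have lL : alen x y p (p + v) t <= L t.
rewrite -(alen_period F p ht) -(alen_cat x y p (p + v) (p + P)) lerDl.
by apply: (alen_ge0 F _ ht); rewrite lerD2l.
by split; [exact: le_trans h1 lL|exact: le_trans h2 lL].
Qed.

Lemma sarea_le_length t : 0 <= t < T -> `|sarea t| <= L t ^+ 2.
Proof.
by move=> ht; rewrite expr2; apply: (sarea_le_dist (p1 := x 0 t) (p2 := y 0 t) ht) => u; exact: dist_le_length.
Qed.

Lemma turning_int t : 0 <= t < T -> exists j : int, th P t - th 0 t = j%:~R * (2 * pi).
Proof.
move=> hs; apply: cos_eq1; rewrite cosB.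
have [e1 e2] := tangleP H P hs; have [e3 e4] := tangleP H 0 hs.
have [p1 p2] := flow_per1 H 0 hs; have p3 := speed_per H 0 hs; rewrite add0r in p1 p2 p3.
rewrite e1 e2 p1 p2 p3 -e3 -e4 -!expr2; exact: cos2Dsin2.
Qed.

(** The total turning is continuous in time and always a multiple of 2 pi, hence equal to the
    initial one. *)
Lemma turning_const t : 0 <= t < T -> th P t - th 0 t = tangle0 c1 c2 P - tangle0 c1 c2 0.
Proof.
move=> ht; have P0 := flowing_P F.
have h0 := flow_T0 F.
have ck : cont_on [set t : R | 0 <= t < T] (fun v t => k v t * g v t).
by apply: cont_onM; [exact: (kurv_cont H)|exact: (speed_cont H)].
have ct : cont_on [set t : R | 0 <= t < T] (fun u t => prim (fun v => k v t * g v t) u) by exact: cont_prim.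
pose W s := th P s - th 0 s.
have WE s : W s = prim (fun v => k v s * g v s) P by rewrite /W /tangle prim0; ring.
have W0 : W 0 = tangle0 c1 c2 P - tangle0 c1 c2 0.
have d1 u : der (th ^~ 0) u (kurv0 c1 c2 u).
 apply: der_eq (tangle_der H u h0) _.
 rewrite (speed_init J F) mulr1 /kurv (speed_init J F) expr1n divr1 /kurv0.
 have ex : du x ^~ 0 = derive1 c1 by apply/funext => v; exact: (flow_init1 J F v).1.
 have ey : du y ^~ 0 = derive1 c2 by apply/funext => v; exact: (flow_init1 J F v).2.
 have [dx dy] := flow_space1 H u h0; rewrite ex in dx; rewrite ey in dy.
 have [dx' dy'] := jordan_der1 J u.
 by rewrite (der_unique dx dx') (der_unique dy dy') (flow_init1 J F u).1 (flow_init1 J F u).2.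
exact: (der_uniq_prim d1 (tangle0_der J)).
rewrite -W0 -/(W t).
have /andP[t0 tT] := ht.
have pi0 : 0 < 2 * pi :> R by rewrite mulr_gt0 // pi_gt0.
apply/esym; apply: (@discrete_const _ W 0 t (2 * pi) t0 _ pi0) => [|s /andP[s0 st]]; last first.
by apply: turning_int; rewrite s0 (le_lt_trans st tT).
apply: within_eps => s /andP[s0 st] e e0.
have hs : 0 <= s < T by rewrite s0 (le_lt_trans st tT).
have [d d0 Hd] := ct P s hs e e0; exists d => // s' /andP[s0' st'] hd.
by rewrite !WE; apply: Hd; rewrite ?subrr ?normr0 //= s0' (le_lt_trans st' tT).
Qed.

Let area_alg (X Y x0 y0 A B gg aa kk Xt Yt Gv : R) : gg != 0 -> gg ^+ 2 = A ^+ 2 + B ^+ 2 ->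
Xt = - (aa * kk) * (B / gg) -> Yt = aa * kk * (A / gg) ->
A * Yt + x0 * Y - (B * Xt + y0 * X) - (0 * Gv + 2 * (aa * (kk * gg)))
= Xt * B + x0 * Y - (Yt * A + y0 * X).
Proof.
move=> g0 gs -> ->.
have -> : kk * gg = kk * ((A ^+ 2 + B ^+ 2) / gg) by rewrite -gs expr2 mulfK.
by field.
Qed.

Section Primitive.
Variables (G : R -> R).
Hypothesis dG : forall s, der G s (a s).

Lemma primitive_period (n : int) s : G (s + n%:~R * (2 * pi)) - G s = n%:~R * (G (2 * pi) - G 0).
Proof.
have per z : G (z + 2 * pi) - G z = G (2 * pi) - G 0.
have d0 v : der (fun v => G (v + 2 * pi) - G v) v 0.
 have dv : der (fun v : R => v + 2 * pi) v 1.
 by apply: der_eq (derD (der_id v) (der_cst _ v)) _; rewrite addr0.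
 apply: der_eq (derB (@der_comp _ G (fun v => v + 2 * pi) v _ _ (dG _) dv) (dG v)) _.
 by rewrite (flowing_aper F) mulr1 subrr.
by have := der0_cst z 0 d0; rewrite add0r.
have peri (m : nat) z : G (z + m%:R * (2 * pi)) - G z = m%:R * (G (2 * pi) - G 0).
elim: m => [|m IH]; first by rewrite !mul0r addr0 subrr.
have := per (z + m%:R * (2 * pi)).
have -> : z + m.+1%:R * (2 * pi) = z + m%:R * (2 * pi) + 2 * pi by rewrite -natr1; ring.
by move: IH; rewrite -natr1; move: (G _) (G (_ + 2 * pi)) (G z) => A B C IH h; lra.
case: n => m; first exact: peri.
rewrite NegzE mulrNz; have := peri m.+1 (s - m.+1%:R * (2 * pi)).
rewrite subrK => h.
have -> : s + - m.+1%:~R * (2 * pi) = s - m.+1%:R * (2 * pi) by rewrite mulNr.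
by rewrite mulNr -h opprB.
Qed.

(** Leibniz' rule with an explicit primitive [Q] of the time derivative of x y_u - y x_u: by the
    flow equation it is x y_t - y x_t - 2 G (theta). The periodic part disappears over a period and
    the mobility is integrated against the turning. *)
Lemma sarea_time t : 0 < t < T -> der sarea t (- (G (th P t) - G (th 0 t))).
Proof.
move=> ht; have /andP[t0 tT] := ht; have ht' : 0 <= t < T by rewrite ltW.
have [e e0 He] := near_time ht; have P0 := flowing_P F.
pose f u t := x u t * du y u t - y u t * du x u t.
pose ft u t := dt x u t * du y u t + x u t * dt (du y) u t - (dt y u t * du x u t + y u t * dt (du x) u t).
have He' s : `|s - t| < e -> 0 <= s < T by move=> /He /andP[h1 h2]; rewrite ltW.
pose Q u := x u t * dt y u t - y u t * dt x u t - 2 * G (th u t).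
have L1 u s : 0 <= u <= P -> `|s - t| < e -> der (prim (f ^~ s)) u (f u s).
by move=> _ hs; exact: (sarea_der u (He' s hs)).
have L2 u s : 0 <= u <= P -> `|s - t| < e -> der (f u) s (ft u s).
move=> _ /He hs.
have [dx dy] := flow_time H 0 u hs; have [dx1 dy1] := flow_time H 1 u hs.
exact: (derB (derM dx dy1) (derM dy dx1)).
have L3 u : 0 <= u <= P -> der Q u (ft u t).
move=> _; have [dx dy] := flow_space0 F u ht'.
have [dxt dyt] := mixed_derivative H u ht.
have [ex ey] := flow_eq (flowing_eps F) H u ht.
apply: der_eq (derB (derB (derM dx dyt) (derM dy dxt)) (derM (der_cst 2 u)
 (@der_comp _ G (th ^~ t) u _ _ (dG _) (tangle_der H u ht')))) _.
exact: (area_alg _ _ _ _ _ (speed_neq0 H u ht') (speed_sq x y u t) ex ey).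
have L4 : cont_on [set t : R | 0 < t < T] ft.
have s1 : [set t : R | 0 < t < T] `<=` [set t : R | 0 <= t < T] by move=> s /= /andP[h ->]; rewrite ltW.
have ct n := open_cont_on (fun u s hs => (flow_time_cont H n u hs).1).
have ct' n := open_cont_on (fun u s hs => (flow_time_cont H n u hs).2).
have c0 := cont_on_sub s1 cx; have c0' := cont_on_sub s1 cy.
have c1x := cont_on_sub s1 (flow_cont1 H).1; have c1y := cont_on_sub s1 (flow_cont1 H).2.
exact: (cont_onB (cont_onD (cont_onM (ct 0%N) c1y) (cont_onM c0 (ct' 1%N)))
 (cont_onD (cont_onM (ct' 0%N) c1x) (cont_onM c0' (ct 1%N)))).
have := @leibniz _ f ft (fun u s => prim (f ^~ s) u) Q 0 P t e (ltW P0) e0 L1 L2 L3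
(fun u _ => cont_on_open u ht L4) => dS.
apply: der_eq (derM dS (der_cst (2^-1) t)) _.
have QP : Q P - Q 0 = - 2 * (G (th P t) - G (th 0 t)).
have [p1 p2] := flow_per1 H 0 ht'; have p3 := speed_per H 0 ht'; have p4 := kurv_per H 0 ht'.
have [q1 q2] := flow_periodic F 0 ht'.
have [exP eyP] := flow_eq (flowing_eps F) H P ht; have [ex0 ey0] := flow_eq (flowing_eps F) H 0 ht.
rewrite add0r in p1 p2 p3 p4 q1 q2.
have aE : a (th P t) = a (th 0 t).
 have [j E] := turning_int ht'.
 have -> : th P t = th 0 t + j%:~R * (2 * pi) by rewrite -E addrC subrK.
 exact: (periodic_int (flowing_aper F)).
have exE : dt x P t = dt x 0 t by rewrite exP ex0 p2 p3 p4 aE.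
have eyE : dt y P t = dt y 0 t by rewrite eyP ey0 p1 p3 p4 aE.
by rewrite /Q exE eyE q1 q2; ring.
by rewrite QP; field.
Qed.

End Primitive.
End AreaEvolution.

(** * Extinction time and blow-up of the curvature *)

Section Extinction.
Context {R : realType}.
Implicit Types (p q s u t : R).

(** On the first quadrant sin / (2 (cos + sin)) is a primitive of the limit mobility, so each of the
    four quadrants contributes 1/2. *)
Lemma aniso_integral (G : R -> R) : (forall s, der G s (aniso s)) -> G (2 * pi) - G 0 = 2.
Proof.
move=> dG; have pi0 := pi_gt0 R.
have quarter : G (pi / 2) - G 0 = 1 / 2.
pose S (s : R) := sin s / (2 * (cos s + sin s)).
have hp : 0 <= pi / 2 :> R by rewrite divr_ge0 // ltW.
have cs s : 0 <= s <= pi / 2 -> [/\ 0 <= cos s, 0 <= sin s & cos s + sin s != 0].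
 move=> /andP[s0 s1]; have c0 : 0 <= cos s by apply: cos_ge0_pihalf; rewrite s1 andbT; lraw s0 pi0.
 have n0 : 0 <= sin s by apply: sin_ge0_pi; rewrite s0; lraw s1 pi0.
 split=> //; apply/eqP => h; have := cos2Dsin2 s.
 have -> : cos s = 0 by lraw h c0 n0.
 have -> : sin s = 0 by lraw h c0 n0.
 by rewrite !expr0n /= addr0 => /esym/eqP; rewrite oner_eq0.
have dS s : 0 <= s <= pi / 2 -> der S s (aniso s).
 move=> hs; have [c0 n0 ne] := cs s hs.
 have d1 := der_sin (der_id s); have d2 := der_cos (der_id s).
 have ne2 : 2 * (cos s + sin s) != 0 by rewrite mulf_neq0.
 apply: der_eq (derM d1 (derV (f := fun s => 2 * (cos s + sin s)) ne2 (derM (der_cst 2 s) (derD d2 d1)))) _.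
 rewrite /aniso (ger0_norm c0) (ger0_norm n0).
 have e : cos s ^+ 2 = 1 - sin s ^+ 2 by rewrite -(cos2Dsin2 s) addrK.
 have -> : (2 * (cos s + sin s) ^+ 2)^-1 = (cos s ^+ 2 + sin s ^+ 2) / (2 * (cos s + sin s) ^+ 2).
 by rewrite cos2Dsin2 mul1r.
 by field.
have h : `|G (pi / 2) - S (pi / 2) - (G 0 - S 0)| <= 0 * (pi / 2 - 0).
 apply: (@der_bound _ (fun s => G s - S s) (fun=> 0) _ _ _ hp) => [s hs|s _]; last by rewrite normr0.
 by apply: der_eq (derB (dG s) (dS s hs)) _; rewrite subrr.
move: h; rewrite mul0r normr_le0 subr_eq0 => /eqP.
rewrite /S sin_pihalf cos_pihalf sin0 cos0 mul0r add0r mulr1 => e.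
by lraw e.
have per s : G (s + pi / 2) - G s = 1 / 2.
have d0 v : der (fun v => G (v + pi / 2) - G v) v 0.
 have dv : der (fun v : R => v + pi / 2) v 1.
 by apply: der_eq (derD (der_id v) (der_cst _ v)) _; rewrite addr0.
 apply: der_eq (derB (@der_comp _ G (fun v => v + pi / 2) v _ _ (dG _) dv) (dG v)) _.
 by rewrite aniso_per mulr1 subrr.
by have := der0_cst s 0 d0; rewrite add0r quarter.
have h0 := per 0; have h1 := per (pi / 2); have h2 := per (pi / 2 + pi / 2).
have h3 := per (pi / 2 + pi / 2 + pi / 2); rewrite add0r in h0.
have -> : 2 * pi = pi / 2 + pi / 2 + pi / 2 + pi / 2 :> R by field.
by lraw h0 h1 h2 h3.
Qed.

Lemma aniso_cont : continuous (@aniso R).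
Proof.
have l0 s : 2 * l1dir s ^+ 2 != 0 :> R.
by rewrite mulf_neq0 // expf_neq0 // gt_eqF // (lt_le_trans ltr01) // l1dir_ge1.
have cl : Cn 0 (@l1dir R).
move=> s; apply/cvgrPdist_lt => e e0; exists e => //= v hv.
by apply: le_lt_trans (l1dir_lip _ _) hv.
have c2 : Cn 0 (fun=> 2 : R) by move=> s; exact: cvg_cst.
have c := CnV (n := 0) l0 (CnM c2 (CnM cl cl)).
by move=> s; have := c s; rewrite /aniso.
Qed.

Lemma admissible_integral a K e (G : R -> R) : admissible a K e -> (forall s, der G s (a s)) ->
`|G (2 * pi) - G 0 - 2| <= e * (2 * pi).
Proof.
move=> [_ _ _ h] dG; have dA := prim_der aniso_cont.
have E := aniso_integral dA.
have -> : G (2 * pi) - G 0 - 2 = (G (2 * pi) - prim (@aniso R) (2 * pi)) - (G 0 - prim (@aniso R) 0).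
by move: (G _) (G 0) (prim _ _) (prim _ 0) E => A B C D E; lraw E.
have p0 : 0 <= 2 * pi :> R by rewrite mulr_ge0 // ltW // pi_gt0.
have := @der_bound _ (fun s => G s - prim (@aniso R) s) (fun s => a s - aniso s) 0 (2 * pi) e p0.
by rewrite subr0; apply => s _; [exact: derB|exact: h].
Qed.

Variables (a : R -> R) (eps : R) (c1 c2 : R -> R) (P : R) (x y : R -> R -> R) (T : R).
Hypothesis J : arclength_jordan c1 c2 P.
Hypothesis F : flowing a eps c1 c2 P x y T.
Let H := flowing_sol F.
Notation g := (speed x y).
Notation k := (kurv x y).
Notation th := (tangle x y).
Notation L := (alen x y 0 P).
Notation A_ := (sarea P x y).

Definition area0 (c1 c2 : R -> R) P : R :=
let S := prim (fun u => c1 u * derive1 c2 u - c2 u * derive1 c1 u) in (S P - S 0) / 2.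

Lemma sarea_init : A_ 0 = area0 c1 c2 P.
Proof.
rewrite /sarea /area0; set f := (X in prim X); set h := (X in _ = (prim X P - _) / _).
have -> : f = h; last by [].
by apply/funext => u; rewrite /f /h (flow_init1 J F u).1 (flow_init1 J F u).2 (flow_init F u).1 (flow_init F u).2.
Qed.

Lemma sarea_cont t : 0 <= t < T -> forall e, 0 < e -> exists2 d : R, 0 < d &
forall t', 0 <= t' < T -> `|t' - t| < d -> `|A_ t' - A_ t| < e.
Proof.
move=> ht e e0.
have ci : cont_on [set t : R | 0 <= t < T] (fun u t => x u t * du y u t - y u t * du x u t).
apply: cont_onB; apply: cont_onM; [exact: (flow_cont H 0).1|exact: (flow_cont1 H).2|
 exact: (flow_cont H 0).2|exact: (flow_cont1 H).1].
have e2 : 0 < 2 * e by rewrite mulr_gt0.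
have [d d0 Hd] := cont_prim2 0 P ht (cont_prim ci) e2.
have z0 (v : R) : `|v - v| < d by rewrite subrr normr0.
exists d => // t' ht' htt; have := Hd 0 P t' ht' (z0 0) (z0 P) htt.
rewrite /sarea -mulrBl normrM (_ : `|2^-1| = 2^-1 :> R); last by rewrite ger0_norm.
by move=> h; rewrite ltr_pdivrMr // mulrC.
Qed.

Lemma sarea_linear (n : int) (G : R -> R) t : (forall s, der G s (a s)) ->
tangle0 c1 c2 P - tangle0 c1 c2 0 = n%:~R * (2 * pi) -> 0 <= t < T ->
A_ t = area0 c1 c2 P - n%:~R * (G (2 * pi) - G 0) * t.
Proof.
move=> dG hn /andP[]; rewrite le_eqVlt => /orP[/eqP <-|t0] tT; first by rewrite mulr0 subr0 sarea_init.
have [||s /andP[s0 st] E] := @mvt_open _ A_ (fun _ => - (n%:~R * (G (2 * pi) - G 0))) 0 t t0.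
- move=> s /andP[s0 st]; have hs : 0 < s < T by rewrite s0 (lt_trans st tT).
have hs' : 0 <= s < T by case/andP: hs => h ->; rewrite ltW.
apply: der_eq (sarea_time F dG hs) _; congr (- _).
rewrite -(primitive_period F dG n (th 0 s)) -hn -(turning_const J F hs').
by congr (G _ - _); ring.
- move=> s /andP[s0 st] e e0; have hs : 0 <= s < T by rewrite s0 (le_lt_trans st tT).
have [d d0 Hd] := sarea_cont hs e0; exists d => // s' /andP[s0' st'] hd.
by apply: Hd => //; rewrite s0' (le_lt_trans st' tT).
rewrite -sarea_init; move: (A_ t) (A_ 0) (n%:~R * _) E => w0 w1 w2; rewrite subr0 => E.
by rewrite -[w0](subrK w1) E; ring.
Qed.

Lemma flow_shrinks : exists p1 p2 : R, forall e, 0 < e -> exists2 d : R, 0 < d &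
forall u t, T - d < t < T -> `|x u t - p1| < e /\ `|y u t - p2| < e.
Proof.
case: H => _ [_ [_ [_ [_ [_ [_ [[p1 p2] hp]]]]]]].
exists p1, p2 => e e0; have [d d0 Hd] := hp e e0; exists d => // u t ht.
by have [h1 h2] := Hd u t ht; split; rewrite distrC; [exact: h1|exact: h2].
Qed.

(** The area is linear in time, and it tends to 0 at T because the curve comes close to a point
    while its length stays bounded. *)
Lemma extinction_time (n : int) (G : R -> R) : (forall s, der G s (a s)) ->
tangle0 c1 c2 P - tangle0 c1 c2 0 = n%:~R * (2 * pi) ->
area0 c1 c2 P = n%:~R * (G (2 * pi) - G 0) * T.
Proof.
move=> dG hn; have lin := sarea_linear dG hn.
set c := n%:~R * _ in lin *; have P0 := flowing_P F.
have T0 : 0 < T by case/andP: (flow_T0 F).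
apply/eqP; rewrite -subr_eq0 -normr_le0 leNgt; apply/negP => hv.
set v := `|_| in hv.
have [p1 [p2 hp]] := flow_shrinks.
have e0 : 0 < v / (4 * P) by rewrite divr_gt0 // mulr_gt0.
have [d d0 Hd] := hp _ e0.
have c1p : 0 < `|c| + 1 by rewrite ltr_wpDl.
pose h := Num.min (Num.min (d / 2) (T / 2)) (v / (4 * (`|c| + 1))).
have h0 : 0 < h.
have q1 : 0 < d / 2 by rewrite divr_gt0.
have q2 : 0 < T / 2 by rewrite divr_gt0.
have q3 : 0 < v / (4 * (`|c| + 1)) by rewrite divr_gt0 // mulr_gt0.
by rewrite !lt_min q1 q2 q3.
have hd : h <= d / 2 by rewrite !ge_min lexx.
have hT : h <= T / 2 by rewrite !ge_min lexx orbT.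
have hc : h <= v / (4 * (`|c| + 1)) by rewrite !ge_min lexx orbT.
have ht : 0 <= T - h < T by apply/andP; split; lras h0 hT T0.
have htd : T - d < T - h < T by apply/andP; split; lras h0 hd d0.
have b1 : `|A_ (T - h)| <= v / (4 * P) * L (T - h).
by apply: (sarea_le_dist (p1 := p1) (p2 := p2) F ht) => u; have [h1 h2] := Hd u _ htd; rewrite !ltW.
have b2 : v / (4 * P) * L (T - h) <= v / 4.
have LP : L (T - h) <= P.
 have := length_noninc F (lexx 0) (_ : 0 <= T - h) (_ : T - h < T).
 rewrite (alen_init J F) subr0; apply; by case/andP: ht.
have := ler_wpM2l (ltW e0) LP.
by have -> : v / (4 * P) * P = v / 4 by field; exact: lt0r_neq0.
have b3 : `|c| * h <= v / 4.
rewrite ler_pdivlMr ?mulr_gt0 // in hc; have := normr_ge0 c => hn0.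
have : 0 <= h by exact: ltW. move=> hh; move: (`|c|) (v) hc hn0 => C V hc hn0; lras hc hh.
have : v <= `|A_ (T - h)| + `|c| * h.
rewrite /v (lin _ ht).
have -> : area0 c1 c2 P - c * T = (area0 c1 c2 P - c * (T - h)) - c * h by ring.
apply: le_trans (ler_normB _ _) _; rewrite lerD2l normrM.
by rewrite (ger0_norm (ltW h0)).
move: (`|c| * h) (`|A_ (T - h)|) (L (T - h)) b1 b2 b3 => w1 w2 w3 b1 b2 b3 b4.
have : 0 < v by exact: hv.
by move: (v) (v / (4 * P) * w3) b1 b2 b3 b4 => V W b1 b2 b3 b4 b5; lras b1 b2 b3 b4 b5.
Qed.

(** Once the curve is within e of a point with e K <= 1/4, the scalar product of the position
    relative to that point with the unit tangent grows at least by half the arc length; but it is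
    periodic. *)
Lemma bounded_no_shrink K : (forall u t, 0 <= t < T -> `|k u t| <= K) -> False.
Proof.
move=> hK; have P0 := flowing_P F.
have T0 : 0 < T by case/andP: (flow_T0 F).
have K0 : 0 <= K by apply: le_trans (hK 0 0 (flow_T0 F)).
have [p1 [p2 hp]] := flow_shrinks.
pose e := 1 / (4 * (K + 1)).
have K1 : 0 < K + 1 by lras K0.
have e0 : 0 < e by rewrite divr_gt0 // mulr_gt0.
have eK : e * K <= 1 / 4.
have : e * (K + 1) = 1 / 4 by rewrite /e; field; exact: lt0r_neq0.
by move=> h; lras h e0.
have [d d0 Hd] := hp _ e0.
pose t := T - Num.min (d / 2) (T / 2).
have hm : 0 < Num.min (d / 2) (T / 2) by rewrite lt_min !divr_gt0.
have m1 : Num.min (d / 2) (T / 2) <= d / 2 by rewrite ge_min lexx.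
have m2 : Num.min (d / 2) (T / 2) <= T / 2 by rewrite ge_min lexx orbT.
have ht : 0 <= t < T by rewrite /t; move: (Num.min _ _) hm m1 m2 => z hm m1 m2; apply/andP; split; lras hm m2 T0.
have htd : T - d < t < T by rewrite /t; move: (Num.min _ _) hm m1 m2 => z hm m1 m2; apply/andP; split; lras hm m1 d0.
pose f u := (x u t - p1) * cos (th u t) + (y u t - p2) * sin (th u t).
have df u : der f u (g u t + ((y u t - p2) * cos (th u t) - (x u t - p1) * sin (th u t)) * (k u t * g u t)).
have [dx dy] := flow_space0 F u ht; have dth := tangle_der H u ht.
have [e1 e2] := tangleP H u ht.
have ex : du x u t = cos (th u t) * g u t by rewrite e1 divfK // (speed_neq0 H u ht).
have ey : du y u t = sin (th u t) * g u t by rewrite e2 divfK // (speed_neq0 H u ht).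
rewrite ex in dx; rewrite ey in dy.
apply: der_eq (derD (derM (derB dx (der_cst p1 u)) (der_cos dth)) (derM (derB dy (der_cst p2 u)) (der_sin dth))) _.
have cs := cos2Dsin2 (th u t); rewrite -[g u t in X in _ = X + _]mul1r -{1}cs; ring.
have fP : f P = f 0.
have [q1 q2] := flow_periodic F 0 ht; rewrite add0r in q1 q2.
have [e1 e2] := tangleP H P ht; have [e3 e4] := tangleP H 0 ht.
have [r1 r2] := flow_per1 H 0 ht; have r3 := speed_per H 0 ht; rewrite add0r in r1 r2 r3.
by rewrite /f q1 q2 e1 e2 r1 r2 r3 -e3 -e4.
have inc : f 0 - 1 / 2 * prim (g ^~ t) 0 <= f P - 1 / 2 * prim (g ^~ t) P.
have dd u := derB (df u) (derM (der_cst (1 / 2) u) (arc_der H u ht)).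
apply: (der_ge0_le (ltW P0) (fun u _ => dd u)) => u _.
have g0 := speed_gt0 H u ht.
set w := (y u t - p2) * cos (th u t) - (x u t - p1) * sin (th u t).
have wb : `|w| <= 2 * e.
 have [h1 h2] := Hd u t htd.
 have c1' : `|cos (th u t)| <= 1 by rewrite ler_norml cos_geN1 cos_le1.
 have s1' : `|sin (th u t)| <= 1 by rewrite ler_norml sin_geN1 sin_le1.
 apply: le_trans (ler_normB _ _) _; rewrite !normrM.
 have m1' : `|y u t - p2| * `|cos (th u t)| <= e * 1 by apply: ler_pM => //; exact: ltW.
 have m2' : `|x u t - p1| * `|sin (th u t)| <= e * 1 by apply: ler_pM => //; exact: ltW.
 by move: (_ * _) m1' (`|x u t - p1| * _) m2' => z1 m1' z2 m2'; lras m1' m2'.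
have wk : `|w * k u t| <= 1 / 2.
 rewrite normrM; apply: le_trans (_ : 2 * e * K <= _); last by lras eK.
 by apply: ler_pM => //; exact: hK.
have wk2 : 0 <= 1 / 2 + w * k u t by move: wk; rewrite ler_norml => /andP[h _]; lras h.
have -> : g u t + w * (k u t * g u t) - (0 * prim (g ^~ t) u + 1 / 2 * g u t)
 = (1 / 2 + w * k u t) * g u t by field.
by apply: mulr_ge0 => //; exact: ltW.
have L0 := arc_gt0 H P0 ht; rewrite /alen in L0.
by move: inc; rewrite fP; move: (prim _ P) (prim _ 0) L0 => z1 z2 L0 inc; lras L0 inc.
Qed.

End Extinction.

(** * Continuity and lifts of directions *)

Section AngleLifts.
Context {R : realType}.
Implicit Types (a b s t u r : R).

Lemma cos_ltE s t : 0 <= s <= pi -> 0 <= t <= pi -> (cos s < cos t) = (t < s).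
Proof. by move=> hs ht; apply: ltr_cos; rewrite in_itv. Qed.

Lemma cos_near1 r : `|r| <= pi -> 31 / 32 <= cos r -> `|r| <= 3 / 10.
Proof.
move=> rp hc; rewrite leNgt; apply/negP => hr.
have e : cos `|r| = cos r by case: (leP 0 r) => h; [rewrite ger0_norm|rewrite ltr0_norm // cosN].
have p3 : 3 / 10 < pi :> R by have := @pihalf_gt R => h; lraw h.
have : cos `|r| < cos (3 / 10).
rewrite cos_ltE // ?normr_ge0 //.
by apply/andP; split; [lra|exact: ltW].
by have := @cos_le R (3 / 10); rewrite e => h1 h2; lraw h1 h2 hc.
Qed.

Lemma angle_red t : exists j : int, `|t - j%:~R * (2 * pi)| <= pi.
Proof.
have p2 : 0 < 2 * pi :> R by rewrite mulr_gt0 // pi_gt0.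
exists (Num.floor ((t + pi) / (2 * pi))).
have /andP[h1 h2] := mem_rg1_floor ((t + pi) / (2 * pi)).
rewrite ler_pdivlMr // in h1; rewrite ltr_pdivrMr // in h2.
rewrite ler_norml; move: (_%:~R) h1 h2 => z h1 h2; apply/andP; split; lraw h1 h2.
Qed.

(** The bound 31/32 = 1 - (1/4)^2 / 2 is what an angle of at most 1/4 guarantees. To leave the
    vicinity of its multiple of 2 pi, D would have to pass at distance pi from it, where the cosine
    is -1. *)
Lemma lift_stay (D : R -> R) a b : a <= b -> {within `[a, b], continuous D} ->
(forall s, a <= s <= b -> 31 / 32 <= cos (D s)) -> `|D b - D a| <= 6 / 10.
Proof.
move=> ab cD hD; have [j hj] := angle_red (D a).
have p3 : 3 / 10 < pi :> R by have := @pihalf_gt R => h; lraw h.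
have per s : cos (D s - j%:~R * (2 * pi)) = cos (D s).
by rewrite -(periodic_int (@cos_2pi R) j (D s - _)) subrK.
have near s : a <= s <= b -> `|D s - j%:~R * (2 * pi)| <= pi -> `|D s - j%:~R * (2 * pi)| <= 3 / 10.
by move=> hs hp; apply: cos_near1 => //; rewrite per; exact: hD.
have hab : a <= b <= b by rewrite ab lexx.
have haa : a <= a <= b by rewrite ab lexx.
have na := near a haa hj; set z := j%:~R * (2 * pi) in na near.
have nb : `|D b - z| <= 3 / 10.
rewrite leNgt; apply/negP => hb.
have {}hb : pi < `|D b - z|.
 by rewrite ltNge; apply/negP => h; have := near b hab h; rewrite leNgt hb.
have [s hs Es] : exists2 s, a <= s <= b & D s = z + (if 0 <= D b - z then pi else - pi).
 apply: ivt_within => //; move: hb na; rewrite ler_norml => + /andP[h1 h2].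
 case: ifP => [h|/negbT]; first by rewrite ger0_norm // => hb; left; apply/andP; split; lraw h1 h2 hb p3.
 by rewrite -ltNge => h; rewrite ltr0_norm // => hb; right; apply/andP; split; lraw h1 h2 hb p3.
have pp : 0 <= pi :> R by exact: ltW (pi_gt0 R).
have Ez : `|D s - z| = pi.
 rewrite Es; case: ifP => _; first by rewrite addrC addKr ger0_norm.
 by rewrite addrC addKr normrN ger0_norm.
have := near s hs; rewrite Ez lexx => /(_ isT) h; lraw h p3.
have -> : D b - D a = (D b - z) - (D a - z) by ring.
apply: le_trans (ler_normB _ _) _; lraw na nb.
Qed.

(** On [0, pi] an angle depends continuously on its cosine and sine: closeness is read off from cos
    (al t - al s). *)
Lemma angle_dist_cont (al : R -> R) a b :
(forall s, a <= s <= b -> 0 <= al s <= pi) ->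
(forall s, a <= s <= b -> forall e, 0 < e -> exists2 d : R, 0 < d & forall t, a <= t <= b ->
 `|t - s| < d -> `|cos (al t) - cos (al s)| < e /\ `|sin (al t) - sin (al s)| < e) ->
forall s, a <= s <= b -> forall e, 0 < e -> exists2 d : R, 0 < d & forall t, a <= t <= b ->
 `|t - s| < d -> `|al t - al s| < e.
Proof.
move=> rg H s hs e e0.
pose e' := Num.min e (pi / 2).
have p0 := pi_gt0 R; have p2 : 0 < pi / 2 :> R by rewrite divr_gt0.
have e'0 : 0 < e' by rewrite lt_min e0 p2.
have e'p : e' <= pi / 2 by rewrite ge_min lexx orbT.
have ce : cos e' < 1.
rewrite -cos0 cos_ltE // ?lexx ?(ltW p0) //.
by rewrite (ltW e'0) /=; lraw e'p p0.
have h2 : 0 < (1 - cos e') / 2 by rewrite divr_gt0 // subr_gt0.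
have [d d0 Hd] := H s hs _ h2; exists d => // t ht htd.
have [g1 g2] := Hd t ht htd.
have cc : cos e' < cos (al t - al s).
rewrite cosB; have := cos2Dsin2 (al s).
have c1 : `|cos (al s)| <= 1 by rewrite ler_norml cos_geN1 cos_le1.
have s1 : `|sin (al s)| <= 1 by rewrite ler_norml sin_geN1 sin_le1.
have m1 : `|(cos (al t) - cos (al s)) * cos (al s)| < (1 - cos e') / 2.
 by rewrite normrM; apply: le_lt_trans g1; rewrite -[X in _ <= X]mulr1 ler_wpM2l.
have m2 : `|(sin (al t) - sin (al s)) * sin (al s)| < (1 - cos e') / 2.
 by rewrite normrM; apply: le_lt_trans g2; rewrite -[X in _ <= X]mulr1 ler_wpM2l.
move: m1 m2; rewrite !ltr_norml => /andP[m1 _] /andP[m2 _] cs.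
have -> : cos (al t) * cos (al s) + sin (al t) * sin (al s) =
 (cos (al t) - cos (al s)) * cos (al s) + (sin (al t) - sin (al s)) * sin (al s)
 + (cos (al s) ^+ 2 + sin (al s) ^+ 2) by ring.
by rewrite cs; move: (_ * cos _) (_ * sin _) m1 m2 => z1 z2 m1 m2; lraw m1 m2.
apply: lt_le_trans (_ : e' <= _); last by rewrite ge_min lexx.
rewrite ltNge; apply/negP => hb.
have /andP[a1 a2] := rg s hs; have /andP[b1 b2] := rg t ht.
have hp : `|al t - al s| <= pi by rewrite ler_norml; apply/andP; split; lraw a1 a2 b1 b2.
have : cos `|al t - al s| <= cos e'.
rewrite leNgt cos_ltE ?normr_ge0 // -?leNgt //.
by rewrite (ltW e'0) /=; lraw e'p p0.
have -> : cos `|al t - al s| = cos (al t - al s).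
by case: (leP 0 (al t - al s)) => h; [rewrite ger0_norm|rewrite ltr0_norm // cosN].
by rewrite leNgt cc.
Qed.

(** [tangent_angle] with (X, Y) in place of the velocity vector, shifted to pass through the
    prescribed angle [al] at u0. *)
Lemma direction_lift (X Y X1 Y1 : R -> R) al u0 : (forall u, der X u (X1 u)) -> (forall u, der Y u (Y1 u)) ->
continuous X1 -> continuous Y1 -> (forall u, 0 < X u ^+ 2 + Y u ^+ 2) ->
let rho u : R := Num.sqrt (X u ^+ 2 + Y u ^+ 2) in
cos al = X u0 / rho u0 -> sin al = Y u0 / rho u0 ->
let f u := (X u * Y1 u - Y u * X1 u) / (X u ^+ 2 + Y u ^+ 2) in
forall u, cos (al + (prim f u - prim f u0)) = X u / rho u /\ sin (al + (prim f u - prim f u0)) = Y u / rho u.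
Proof.
move=> dX dY cX1 cY1 pos rho ca sa f.
have r0 u : 0 < rho u by rewrite sqrtr_gt0.
have rs u : rho u ^+ 2 = X u ^+ 2 + Y u ^+ 2 by rewrite sqr_sqrtr // ltW.
have cf : continuous f.
have cX : Cn 0 X by move=> u; exact: der_cvg (dX u).
have cY : Cn 0 Y by move=> u; exact: der_cvg (dY u).
have n0 u : X u ^+ 2 + Y u ^+ 2 != 0 by exact: lt0r_neq0.
exact: (CnM (CnD (CnM cX (cY1 : Cn 0 Y1)) (CnN (CnM cY (cX1 : Cn 0 X1)))) (CnV (n := 0) n0 (CnD (CnM cX cX) (CnM cY cY)))).
have dr u : der rho u ((X u * X1 u + Y u * Y1 u) / rho u).
apply: der_eq (der_sqrt (f := fun u => X u ^+ 2 + Y u ^+ 2) (pos u) (derD (derX 2 (dX u)) (derX 2 (dY u)))) _.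
rewrite /=; have h := lt0r_neq0 (r0 u); rewrite /rho in h *; move: (Num.sqrt _) h => w h.
by field.
have dF u : der (prim f) u ((X u * Y1 u - Y u * X1 u) / rho u ^+ 3 * rho u).
apply: der_eq (prim_der cf u) _; rewrite /f -rs.
by have h := lt0r_neq0 (r0 u); move: (rho u) h => w h; field.
have base := tangent_angle dX dY r0 rs dr (fun u => erefl) dF.
set be := angle_of _ _ in base.
have [b1 b2] := base u0.
move=> u; have [b3 b4] := base u.
rewrite -ca in b1; rewrite -sa in b2.
have -> : al + (prim f u - prim f u0) = al - (be + prim f u0 - prim f 0) + (be + prim f u - prim f 0) by ring.
have cd : cos (al - (be + prim f u0 - prim f 0)) = 1 by rewrite cosB b1 b2 -!expr2 cos2Dsin2.
have sd : sin (al - (be + prim f u0 - prim f 0)) = 0 by rewrite sinB b1 b2 mulrC subrr.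
move: (al - _) (be + prim f u - prim f 0) cd sd b3 b4 => w z cd sd b3 b4.
by rewrite cosD sinD cd sd !mul0r !mul1r subr0 add0r b3 b4.
Qed.

End AngleLifts.

(** * Hopf's Umlaufsatz *)

Section Umlaufsatz.
Context {R : realType}.
Implicit Types (p q s l u t h : R).
Variables (c1 c2 : R -> R) (P : R).
Hypothesis J : arclength_jordan c1 c2 P.
Notation x1 := (derive1 c1).
Notation y1 := (derive1 c2).
Notation th := (tangle0 c1 c2).
Let X p l := c1 (p + l) - c1 p.
Let Y p l := c2 (p + l) - c2 p.
Let X1 p l := x1 (p + l) - x1 p.
Let Y1 p l := y1 (p + l) - y1 p.
Let rho p l : R := Num.sqrt (X p l ^+ 2 + Y p l ^+ 2).
Let f p l := (X p l * Y1 p l - Y p l * X1 p l) / (X p l ^+ 2 + Y p l ^+ 2).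

Lemma chord0_pos p l : 0 < l < P -> 0 < (c1 (p + l) - c1 p) ^+ 2 + (c2 (p + l) - c2 p) ^+ 2.
Proof.
move=> /andP[l0 lP]; rewrite lt_neqAle eq_sym addr_ge0 ?sqr_ge0 // andbT.
rewrite paddr_eq0 ?sqr_ge0 // !expf_eq0 /= !subr_eq0; apply/negP => /andP[/eqP h1 /eqP h2].
apply: (jordan_inj J (p := p) (q := p + l) _ (esym h1) (esym h2)).
by rewrite ltrDl l0 ltrD2l.
Qed.

Let cauchy2 (A B C D : R) : (A * C + B * D) ^+ 2 <= (A ^+ 2 + B ^+ 2) * (C ^+ 2 + D ^+ 2).
Proof.
rewrite -subr_ge0; have -> : (A ^+ 2 + B ^+ 2) * (C ^+ 2 + D ^+ 2) - (A * C + B * D) ^+ 2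
= (A * D - B * C) ^+ 2 by ring.
exact: sqr_ge0.
Qed.

Lemma chord0_le p l : 0 < l -> Num.sqrt ((c1 (p + l) - c1 p) ^+ 2 + (c2 (p + l) - c2 p) ^+ 2) <= l.
Proof.
move=> l0; set U := c1 (p + l) - c1 p; set V := c2 (p + l) - c2 p; set r := Num.sqrt _.
have r2 : r ^+ 2 = U ^+ 2 + V ^+ 2 by rewrite sqr_sqrtr // addr_ge0 // sqr_ge0.
have r0 : 0 <= r by exact: sqrtr_ge0.
pose ph q := (q - p) * r - ((c1 q - c1 p) * U + (c2 q - c2 p) * V).
have dph q : der ph q (r - (x1 q * U + y1 q * V)).
have [d1 d2] := jordan_der0 J q.
apply: der_eq (derB (derM (derB (der_id q) (der_cst p q)) (der_cst r q))
 (derD (derM (derB d1 (der_cst _ q)) (der_cst U q)) (derM (derB d2 (der_cst _ q)) (der_cst V q)))) _.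
by rewrite !mulr0 !subr0 !addr0 mul1r.
have pl : p <= p + l by rewrite lerDl ltW.
have : ph p <= ph (p + l).
apply: (der_ge0_le pl (fun q _ => dph q)) => q _; rewrite subr_ge0.
have un := jordan_unit J q.
apply: le_trans (ler_norm _) _; rewrite -sqrtr_sqr ler_sqrt ?addr_ge0 ?sqr_ge0 //.
by rewrite -[X in _ <= X]mul1r -un; exact: cauchy2.
have -> : ph p = 0 by rewrite /ph !subrr !mul0r addr0 subrr.
have -> : ph (p + l) = l * r - r ^+ 2.
by rewrite /ph r2 -/U -/V (_ : p + l - p = l) ?expr2 //; ring.
rewrite subr_ge0 => m; rewrite leNgt; apply/negP => lr.
by move: m; rewrite expr2 ler_pM2r ?(lt_trans l0 lr) // leNgt lr.
Qed.

Variables (kap h : R).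
Hypothesis hk : forall s, `|kurv0 c1 c2 s| <= kap.
Hypothesis hh : [/\ 0 < h, kap * h <= 1 / 4 & h < P / 2].

Lemma angle_drift p q : `|th q - th p| <= kap * `|q - p|.
Proof. by apply: (der_bound_sym _ _ (tangle0_der J)) => s; exact: hk. Qed.

Lemma near_tangent p q : `|q - p| <= h -> 31 / 32 <= cos (th q - th p).
Proof.
case: hh => h0 kh _ hq; have d := angle_drift p q.
have k0 : 0 <= kap by apply: le_trans (hk 0).
have d4 : `|th q - th p| <= 1 / 4 by apply: le_trans d _; apply: le_trans kh; exact: ler_wpM2l.
have := cos_ge (th q - th p).
have : (th q - th p) ^+ 2 <= (1 / 4) ^+ 2.
by rewrite -[X in X <= _]real_normK ?num_real //; exact: sq_le.
by move=> g1 g2; lras g1 g2.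
Qed.

(** Integrate the cosine bound of [near_tangent] to both sides of p; by periodicity the chord over P
    - h is the short backward chord, hence the minus sign. *)
Lemma chord_tangent p : 31 / 32 * h <= X p h * cos (th p) + Y p h * sin (th p) /\
31 / 32 * h <= - (X p (P - h) * cos (th p) + Y p (P - h) * sin (th p)).
Proof.
case: (hh) => h0 kh _.
pose F q := (c1 q - c1 p) * cos (th p) + (c2 q - c2 p) * sin (th p) - 31 / 32 * (q - p).
have dF q : der F q (cos (th q - th p) - 31 / 32).
have [d1 d2] := jordan_der0 J q; have [e1 e2] := tangle0P J q; rewrite -e1 in d1; rewrite -e2 in d2.
apply: der_eq (derB (derD (derM (derB d1 (der_cst _ q)) (der_cst _ q)) (derM (derB d2 (der_cst _ q)) (der_cst _ q)))
 (derM (der_cst _ q) (derB (der_id q) (der_cst p q)))) _.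
by rewrite cosB; ring.
have Fp : F p = 0 by rewrite /F !subrr !mul0r mulr0 addr0 subrr.
have pl : p <= p + h by rewrite lerDl ltW.
have pl' : p - h <= p by rewrite gerBl ltW.
have F1 : F p <= F (p + h).
apply: (der_ge0_le pl (fun q _ => dF q)) => q /andP[q1 q2]; rewrite subr_ge0; apply: near_tangent.
by rewrite ger0_norm ?subr_ge0 //; lras q2.
have F2 : F (p - h) <= F p.
apply: (der_ge0_le pl' (fun q _ => dF q)) => q /andP[q1 q2]; rewrite subr_ge0; apply: near_tangent.
by rewrite ler0_norm ?subr_le0 //; lras q1.
have E : p + (P - h) = (p - h) + P by ring.
have e1 : p + h - p = h by ring.
have e2 : p - h - p = - h by ring.
split; first by move: F1; rewrite Fp /F e1 subr_ge0.
rewrite /X /Y E (jordan_per J _).1 (jordan_per J _).2.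
move: F2; rewrite Fp /F e2; set w := (c1 (p - h) - c1 p) * _ + _ => F2; clearbody w; lras F2.
Qed.

Variable s0 : R.
Hypothesis low : forall s, c2 s0 <= c2 s.

Let inl l : h <= l <= P - h -> 0 < l < P.
Proof. by case: hh => h0 _ _ /andP[h1 h2]; apply/andP; split; lras h1 h2 h0. Qed.

Let r_gt0 p l : h <= l <= P - h -> 0 < rho p l.
Proof. by move=> /inl hl; rewrite sqrtr_gt0; exact: chord0_pos. Qed.

Let r_unit p l : h <= l <= P - h -> (X p l / rho p l) ^+ 2 + (Y p l / rho p l) ^+ 2 = 1.
Proof.
move=> hl; have r0 := lt0r_neq0 (r_gt0 p hl).
have rs : rho p l ^+ 2 = X p l ^+ 2 + Y p l ^+ 2 by rewrite sqr_sqrtr // addr_ge0 // sqr_ge0.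
by rewrite !exprMn -mulrDl -rs exprVn mulfV // expf_neq0.
Qed.

(** Since s0 is a lowest point, chords from it point into the upper half plane: this principal
    argument stays in [0, pi] and is continuous in l. *)
Let A l : R := angle_of (X s0 l / rho s0 l) (Y s0 l / rho s0 l).
Let Th p l : R := A l + (prim (f ^~ l) p - prim (f ^~ l) s0).

Let AP l : h <= l <= P - h -> [/\ cos (A l) = X s0 l / rho s0 l, sin (A l) = Y s0 l / rho s0 l & 0 <= A l <= pi].
Proof.
move=> hl; have u1 := r_unit s0 hl; have [e1 e2] := angle_ofP u1; split=> //.
have y0 : 0 <= Y s0 l / rho s0 l by rewrite divr_ge0 ?subr_ge0 ?low // ltW // r_gt0.
rewrite /A /angle_of y0.
have b : -1 <= X s0 l / rho s0 l <= 1.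
rewrite -ler_norml -sqrtr_sqr -[X in _ <= X]sqrtr1 ler_sqrt //.
by rewrite -u1 lerDl sqr_ge0.
by have [] := acos_def b.
Qed.

Let ThP p l : h <= l <= P - h -> cos (Th p l) = X p l / rho p l /\ sin (Th p l) = Y p l / rho p l.
Proof.
move=> hl; have [e1 e2 _] := AP hl.
have dd (c c' : R -> R) (dc : forall s, der c s (c' s)) q : der (fun p => c (p + l) - c p) q (c' (q + l) - c' q).
have dz : der (fun p : R => p + l) q 1.
 by apply: der_eq (derD (der_id q) (der_cst l q)) _; rewrite addr0.
by apply: der_eq (derB (@der_comp _ c (fun p => p + l) q _ _ (dc _) dz) (dc q)) _; rewrite mulr1.
have cc (c c' : R -> R) : (forall s, der c s (c' s)) -> continuous (fun p => c (p + l) - c p).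
by move=> dc q; exact: der_cvg (dd c c' dc q).
apply: (@direction_lift _ (X ^~ l) (Y ^~ l) (X1 ^~ l) (Y1 ^~ l) (A l) s0) => //.
- by move=> u; exact: (dd c1 x1 (fun s => (jordan_der0 J s).1)).
- by move=> u; exact: (dd c2 y1 (fun s => (jordan_der0 J s).2)).
- exact: (cc x1 _ (fun s => (jordan_der1 J s).1)).
- exact: (cc y1 _ (fun s => (jordan_der1 J s).2)).
- by move=> u; exact: (chord0_pos u (inl hl)).
Qed.

Let I_ := [set l : R | h <= l <= P - h].

Let cshift (c : R -> R) (Q : set R) : (forall s, {for s, continuous c}) -> cont_on Q (fun p l => c (p + l) - c p).
Proof.
move=> cc; apply: cont_onB.
apply: cont_on_comp => [u t _|]; first exact: cc.
move=> u t _ e e0; exists (e / 2) => [|u' t' _ g1 g2]; first by rewrite divr_gt0.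
have -> : u' + t' - (u + t) = (u' - u) + (t' - t) by ring.
by apply: le_lt_trans (ler_normD _ _) _; rewrite [e]splitr; apply: ltrD.
apply: cont_on_comp => [u t _|]; first exact: cc.
by move=> u t _ e e0; exists e.
Qed.

Let c0 s : {for s, continuous c1} /\ {for s, continuous c2}.
Proof. by split; [exact: der_cvg (jordan_der0 J s).1|exact: der_cvg (jordan_der0 J s).2]. Qed.
Let c1' s : {for s, continuous x1} /\ {for s, continuous y1}.
Proof. by split; [exact: der_cvg (jordan_der1 J s).1|exact: der_cvg (jordan_der1 J s).2]. Qed.

Let cX : cont_on I_ X. Proof. by apply: cshift => s; exact: (c0 s).1. Qed.
Let cY : cont_on I_ Y. Proof. by apply: cshift => s; exact: (c0 s).2. Qed.
Let cR : cont_on I_ (fun p l => X p l ^+ 2 + Y p l ^+ 2).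
Proof. by apply: cont_onD; apply: cont_onX; [exact: cX|exact: cY]. Qed.

Let cF : cont_on I_ (fun p l => prim (f ^~ l) p).
Proof.
apply: cont_prim; apply: cont_onM; last apply: cont_onV.
- apply: cont_onB; apply: cont_onM; [exact: cX| |exact: cY|].
 by apply: cshift => s; exact: (c1' s).2.
by apply: cshift => s; exact: (c1' s).1.
- by move=> u l hl; exact: lt0r_neq0 (chord0_pos u (inl hl)).
- exact: cR.
Qed.

Let cA l : h <= l <= P - h -> forall e, 0 < e -> exists2 d : R, 0 < d & forall t, h <= t <= P - h ->
 `|t - l| < d -> `|A t - A l| < e.
Proof.
move: l; apply: angle_dist_cont => [l hl|l hl e e0]; first by have [] := AP hl.
have cV : cont_on I_ (fun p l => (rho p l)^-1).
apply: cont_onV => [u t ht|]; first exact: lt0r_neq0 (r_gt0 u ht).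
exact: cont_on_sqrt cR.
have [d1 d10 H1] := cont_onM cX cV s0 hl e0; have [d2 d20 H2] := cont_onM cY cV s0 hl e0.
exists (Num.min d1 d2) => [|t ht]; first by rewrite lt_min d10 d20.
rewrite lt_min => /andP[g1 g2].
have [-> -> _] := AP hl; have [-> -> _] := AP ht.
have z0 (d : R) : 0 < d -> `|s0 - s0| < d by rewrite subrr normr0.
by split; [apply: (H1 s0 t ht (z0 _ d10) g1)|apply: (H2 s0 t ht (z0 _ d20) g2)].
Qed.

(** The error budget: 6/10 for each of the two edges of short chords, twice 6/10 for the edges
    through s0, and two tangent drifts of 1/4, in total 2.9. *)
Let umlauf_arith (tau A1 A2 B1 B2 t0 t1 t2 t3 kh : R) :
`|B2 - t3 - 0 - (A1 - t0 - 0)| <= 6 / 10 -> `|B1 - t2 - pi - (A2 - t0 - pi)| <= 6 / 10 ->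
B1 - A1 - pi = B2 - A2 - pi -> `|A2 - A1 - tau * pi| <= 6 / 10 -> `|t2 - t0| <= kh ->
`|t1 - t3| <= kh -> kh <= 1 / 4 -> `|t1 - t0 - 2 * tau * pi| <= 29 / 10.
Proof.
rewrite !ler_norml => /andP[a1 a2] /andP[b1 b2] e /andP[d1 d2] /andP[f1 f2] /andP[g1 g2] k.
by rewrite -!mulrA; move: (tau * pi) d1 d2 => w d1 d2; apply/andP; split; lras a1 a2 b1 b2 e d1 d2 f1 f2 g1 g2 k.
Qed.

(** Hopf's triangle of chords with its corners cut at arc length h. On edges of short chords the
    secant angle [Th] follows the tangent up to a bounded error; each of the two edges of chords
    through s0 turns by about tau pi, with tau the direction of the horizontal tangent at s0. The
    total error 2.9 is below 2 pi, enough to identify an integer. *)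
Lemma umlauf_estimate : exists2 tau : R, tau = 1 \/ tau = -1 &
`|th (s0 + P) - th s0 - 2 * tau * pi| <= 29 / 10.
Proof.
case: (hh) => h0 kh hP.
have hl1 : h <= h <= P - h by apply/andP; split; lras hP.
have hl2 : h <= P - h <= P - h by apply/andP; split; lras hP.
have y0 : y1 s0 = 0.
by apply: (@min_der0 _ c2 s0 _ 1 ltr01 _ (jordan_der0 J s0).2) => v _; exact: low.
have un := jordan_unit J s0; rewrite y0 expr0n /= addr0 in un.
exists (x1 s0).
by move/eqP: un; rewrite -subr_eq0 subr_sqr_1 mulf_eq0 subr_eq0 addr_eq0 => /orP[] /eqP ->; [left|right].
have [tc ts] := tangle0P J s0; rewrite y0 in ts.
have dirc p : 31 / 32 <= cos (Th p h - th p).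
have [e1 e2] := ThP p hl1; have [g1 _] := chord_tangent p.
have r0 := r_gt0 p hl1; have rh : rho p h <= h := chord0_le p h0.
rewrite cosB e1 e2 -!mulrA ![(rho p h)^-1 * _]mulrC !mulrA -mulrDl ler_pdivlMr //.
apply: le_trans g1; rewrite ler_wpM2l //; lra.
have dirb p : 31 / 32 <= cos (Th p (P - h) - th p - pi).
have [e1 e2] := ThP p hl2; have [_ g1] := chord_tangent p.
have r0 := r_gt0 p hl2.
have rh : rho p (P - h) <= h.
 have := chord0_le (p - h) h0.
 rewrite subrK /rho /X /Y (_ : p + (P - h) = p - h + P); last by ring.
 rewrite (jordan_per J _).1 (jordan_per J _).2 -[(c1 (p - h) - c1 p) ^+ 2]sqrrN opprB.
 by rewrite -[(c2 (p - h) - c2 p) ^+ 2]sqrrN opprB.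
rewrite cosB cospi sinpi mulr0 addr0 mulrN1.
rewrite cosB e1 e2 -!mulrA ![(rho p _)^-1 * _]mulrC !mulrA -mulrDl -mulNr ler_pdivlMr //.
apply: le_trans g1; rewrite ler_wpM2l //; lra.
have cTh l a b (c : R) : h <= l <= P - h -> {within `[a, b], continuous (fun p => Th p l - th p - c)}.
move=> hl; apply: continuous_subspaceT => p.
have cc z : Cn 0 (fun _ : R => z) by move=> s; exact: cvg_cst.
have ct : Cn 0 th by move=> s; exact: der_cvg (tangle0_der J s).
have cf : Cn 0 (fun p => prim (f ^~ l) p) by exact: (cont_on_slice hl cF).
exact: (CnD (CnD (CnD (cc (A l)) (CnD cf (CnN (cc _)))) (CnN ct)) (CnN (cc c))).
have sP : s0 <= s0 + (P - h) by rewrite lerDl; lras hP h0.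
have sh : s0 <= s0 + h by rewrite lerDl ltW.
(* bottom edge *)
have E1 : `|(Th (s0 + (P - h)) h - th (s0 + (P - h)) - 0) - (Th s0 h - th s0 - 0)| <= 6 / 10.
by apply: lift_stay (cTh h _ _ 0 hl1) _ => // s _; rewrite subr0; exact: dirc.
(* cut corner *)
have E2 : `|(Th (s0 + h) (P - h) - th (s0 + h) - pi) - (Th s0 (P - h) - th s0 - pi)| <= 6 / 10.
by apply: lift_stay (cTh _ _ _ pi hl2) _ => // s _; exact: dirb.
(* top edge: the reversed chords of the left edge *)
have E3 : Th (s0 + h) (P - h) - A h - pi = Th (s0 + (P - h)) h - A (P - h) - pi.
pose E p := Th p (s0 + P - p) - A (p - s0) - pi.
have EE : E (s0 + h) = E (s0 + (P - h)).
 have hle : s0 + h <= s0 + (P - h) by lras hP.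
 have p20 : 0 < 2 * pi :> R by rewrite mulr_gt0 // pi_gt0.
 have inl1 p : s0 + h <= p <= s0 + (P - h) -> h <= s0 + P - p <= P - h.
 by move=> /andP[g1 g2]; apply/andP; split; lras g1 g2.
 have inl2 p : s0 + h <= p <= s0 + (P - h) -> h <= p - s0 <= P - h.
 by move=> /andP[g1 g2]; apply/andP; split; lras g1 g2.
 apply: (@discrete_const _ E _ _ (2 * pi) hle _ p20) => [|p hp].
 apply: within_eps => p hp e e0.
 have e4 : 0 < e / 4 by rewrite divr_gt0.
 have l1 := inl1 p hp; have l2 := inl2 p hp.
 have [d1 d10 H1] := cA l1 e4; have [d2 d20 H2] := cA l2 e4.
 have [d3 d30 H3] := cF p l1 e4; have [d4 d40 H4] := cF s0 l1 e4.
 exists (Num.min (Num.min d1 d2) (Num.min d3 d4)) => [|p' hp']; first by rewrite !lt_min d10 d20 d30 d40.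
 rewrite !lt_min => /andP[/andP[g1 g2] /andP[g3 g4]].
 have l1' := inl1 p' hp'; have l2' := inl2 p' hp'.
 have n1 : `|s0 + P - p' - (s0 + P - p)| = `|p' - p|.
  by rewrite -normrN; congr `|_|; ring.
 have n2 : `|p' - s0 - (p - s0)| = `|p' - p| by congr `|_|; ring.
 have := H1 _ l1'; rewrite n1 => /(_ g1) k1.
 have := H2 _ l2'; rewrite n2 => /(_ g2) k2.
 have := H3 p' _ l1' g3; rewrite n1 => /(_ g3) k3.
 have := H4 s0 _ l1'; rewrite n1 subrr normr0 => /(_ d40 g4) k4.
 rewrite /E /Th.
 move: (A _) (A _) (A _) (A _) (prim _ _) (prim _ _) (prim _ _) (prim _ _) k1 k2 k3 k4.
 move=> a1 a2 a3 a4 b1 b2 b3 b4; rewrite !ltr_norml => /andP[q1 q2] /andP[q3 q4] /andP[q5 q6] /andP[q7 q8].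
 by apply/andP; split; lras q1 q2 q3 q4 q5 q6 q7 q8.
 have l1 := inl1 p hp; have l2 := inl2 p hp.
 apply: cos_eq1; rewrite /E.
 have [e1 e2] := ThP p l1; have [e3 e4 _] := AP l2.
 have r0 := lt0r_neq0 (r_gt0 s0 l2).
 have X' : X p (s0 + P - p) = - X s0 (p - s0).
 rewrite /X (_ : p + (s0 + P - p) = s0 + P); last by ring.
 by rewrite (jordan_per J _).1 (_ : s0 + (p - s0) = p) ?opprB //; ring.
 have Y' : Y p (s0 + P - p) = - Y s0 (p - s0).
 rewrite /Y (_ : p + (s0 + P - p) = s0 + P); last by ring.
 by rewrite (jordan_per J _).2 (_ : s0 + (p - s0) = p) ?opprB //; ring.
 have rr : rho p (s0 + P - p) = rho s0 (p - s0) by rewrite /rho X' Y' !sqrrN.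
 rewrite cosB cospi sinpi mulr0 addr0 mulrN1 cosB e1 e2 X' Y' rr e3 e4.
 have := r_unit s0 l2; rewrite !mulNr; move: (X _ _ / _) (Y _ _ / _) => z1 z2 zz.
 by rewrite opprD !opprK -!expr2.
have q1 : s0 + P - (s0 + h) = P - h by ring.
have q2 : s0 + P - (s0 + (P - h)) = h by ring.
have q3 : s0 + h - s0 = h by ring.
have q4 : s0 + (P - h) - s0 = P - h by ring.
by rewrite /E q1 q2 q3 q4 in EE.
have A1 : Th s0 h = A h by rewrite /Th subrr addr0.
have A2 : Th s0 (P - h) = A (P - h) by rewrite /Th subrr addr0.
have drift1 := angle_drift s0 (s0 + h).
have drift2 := angle_drift (s0 + (P - h)) (s0 + P).
have w1 : s0 + h - s0 = h by ring.
have w2 : s0 + P - (s0 + (P - h)) = h by ring.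
rewrite w1 in drift1; rewrite w2 in drift2.
rewrite (ger0_norm (ltW h0)) in drift1 drift2.
(* endpoints of the left edge *)
have [_ _ /andP[a1 a2]] := AP hl1; have [_ _ /andP[b1 b2]] := AP hl2.
have LE : `|A (P - h) - A h - x1 s0 * pi| <= 6 / 10.
have g1 := dirc s0; have g2 := dirb s0; rewrite A1 in g1; rewrite A2 in g2.
rewrite cosB tc ts mulr0 addr0 in g1.
rewrite cosB cospi sinpi mulr0 addr0 mulrN1 cosB tc ts mulr0 addr0 in g2.
have p0 := pi_gt0 R.
move/eqP: un; rewrite -subr_eq0 subr_sqr_1 mulf_eq0 subr_eq0 addr_eq0 => /orP[] /eqP E.
 rewrite E mulr1 in g1; rewrite E mulr1 in g2.
 have k1 : `|A h| <= 3 / 10 by apply: cos_near1 => //; rewrite ger0_norm.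
 have k2 : `|pi - A (P - h)| <= 3 / 10.
 apply: cos_near1; last by rewrite cosB cospi sinpi mul0r addr0 mulN1r.
 by rewrite ger0_norm ?subr_ge0 //; lras b1.
 rewrite E mul1r; move: (A h) (A (P - h)) k1 k2 => z1 z2; rewrite !ler_norml => /andP[q1 q2] /andP[q3 q4].
 by apply/andP; split; lras q1 q2 q3 q4.
rewrite E mulrN1 in g1; rewrite E mulrN1 opprK in g2.
have k1 : `|A (P - h)| <= 3 / 10 by apply: cos_near1 => //; rewrite ger0_norm.
have k2 : `|pi - A h| <= 3 / 10.
 apply: cos_near1; last by rewrite cosB cospi sinpi mul0r addr0 mulN1r.
 by rewrite ger0_norm ?subr_ge0 //; lras a1.
rewrite E mulN1r; move: (A h) (A (P - h)) k1 k2 => z1 z2; rewrite !ler_norml => /andP[q1 q2] /andP[q3 q4].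
by apply/andP; split; lras q1 q2 q3 q4.
rewrite A1 in E1; rewrite A2 in E2.
move: (x1 s0) (A h) (A (P - h)) (Th (s0 + h) (P - h)) (Th (s0 + (P - h)) h) (th s0) (th (s0 + P)) (th (s0 + h)) (th (s0 + (P - h)))
E1 E2 E3 LE drift1 drift2 kh => tau A1' A2' B1 B2 t0 t1 t2 t3.
exact: umlauf_arith.
Qed.

End Umlaufsatz.

Lemma umlaufsatz {R : realType} (c1 c2 : R -> R) (P : R) : arclength_jordan c1 c2 P ->
exists n : int, (n = 1 \/ n = -1) /\ tangle0 c1 c2 P - tangle0 c1 c2 0 = n%:~R * (2 * pi).
Proof.
move=> J; have P0 := jordan_P J; have [kap kap0 hk] := kurv0_bound J.
pose h := Num.min (1 / (4 * kap)) (P / 4).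
have h0 : 0 < h by rewrite lt_min !divr_gt0 // mulr_gt0.
have h1 : h <= 1 / (4 * kap) by rewrite ge_min lexx.
have h2 : h <= P / 4 by rewrite ge_min lexx orbT.
have hh : [/\ 0 < h, kap * h <= 1 / 4 & h < P / 2].
split=> //; last by lraw h2 P0.
by rewrite ler_pdivlMr ?mulr_gt0 // in h1; lraw h1.
have [s0 _ H0] := @EVT_min R c2 0 P (ltW P0) (continuous_subspaceT (fun s => der_cvg (jordan_der0 J s).2)).
have low s : c2 s0 <= c2 s.
have [j [w [hw ->]]] := periodic_red s P0.
have per v : c2 (v + P) = c2 v by exact: (jordan_per J v).2.
by rewrite (periodic_int per j w); apply: H0; rewrite in_itv.
have [tau ht est] := umlauf_estimate J hk hh low.
have shift : tangle0 c1 c2 (s0 + P) - tangle0 c1 c2 s0 = tangle0 c1 c2 P - tangle0 c1 c2 0.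
have d0 v : der (fun v => tangle0 c1 c2 (v + P) - tangle0 c1 c2 v) v 0.
 have dv : der (fun v : R => v + P) v 1.
 by apply: der_eq (derD (der_id v) (der_cst _ v)) _; rewrite addr0.
 apply: der_eq (derB (@der_comp _ (tangle0 c1 c2) (fun v => v + P) v _ _ (tangle0_der J _) dv) (tangle0_der J v)) _.
 by rewrite (kurv0_per J) mulr1 subrr.
by have := der0_cst s0 0 d0; rewrite add0r.
have [n E] : exists j : int, tangle0 c1 c2 P - tangle0 c1 c2 0 = j%:~R * (2 * pi).
apply: cos_eq1; rewrite cosB.
have [e1 e2] := tangle0P J P; have [e3 e4] := tangle0P J 0.
have [p1 p2] := jordan_per_n J 1 0; rewrite add0r in p1 p2.
have p1' : derive1 c1 P = derive1 c1 0 := p1; have p2' : derive1 c2 P = derive1 c2 0 := p2.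
by rewrite e1 e2 p1' p2' -e3 -e4 -!expr2; exact: cos2Dsin2.
exists n; split=> //; rewrite shift E in est.
have p3 := @pihalf_gt R.
have close (z : R) : `|n%:~R * (2 * pi) - 2 * z * pi| <= 29 / 10 -> `|n%:~R - z| < 1.
have -> : n%:~R * (2 * pi) - 2 * z * pi = (n%:~R - z) * (2 * pi) by ring.
rewrite normrM (ger0_norm (_ : 0 <= 2 * pi)); last by lraw p3.
move=> g; rewrite ltNge; apply/negP => g2.
have : 1 * (2 * pi) <= `|n%:~R - z| * (2 * pi) by apply: ler_wpM2r => //; lraw p3.
by move=> g3; lraw g g3 p3.
case: ht => ht; rewrite ht in est; have := close _ est.
rewrite -[1 in X in `|X| < _]/(1%:~R) -intrB -intr_norm -[X in _ < X]/(1%:~R) ltr_int => g; left; lia.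
rewrite -[-1]/((-1)%:~R) -intrB -intr_norm -[X in _ < X]/(1%:~R) ltr_int => g; right; lia.
Qed.

(** * Piecewise linear bumps and their primitives *)

Section Tents.
Context {R : realType}.
Implicit Types (x z w d s t : R).

Definition relu x : R := Num.max x 0.
Definition qrelu x : R := relu x ^+ 2 / 2.
(** The hat function of height 1 supported in [z - d, z + d]; [ramp] is its primitive, rising from 0
    to d. Written as second differences, so that sums over a grid of step d telescope. *)
Definition tent z d x : R := (relu (x - z + d) - 2 * relu (x - z) + relu (x - z - d)) / d.
Definition ramp z d x : R := (qrelu (x - z + d) - 2 * qrelu (x - z) + qrelu (x - z - d)) / d.

Lemma relu_pos x : 0 <= x -> relu x = x. Proof. exact: max_l. Qed.
Lemma relu_neg x : x <= 0 -> relu x = 0. Proof. exact: max_r. Qed.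

Lemma relu_cont : continuous relu.
Proof. by move=> x; apply: continuous_max; [exact: cvg_id|exact: cvg_cst]. Qed.

Lemma qrelu_der x : der qrelu x (relu x).
Proof.
apply: eps_der => e e0.
have [x0|x0|->] := ltgtP x 0.
- exists (- x) => [|h]; first by rewrite oppr_gt0.
rewrite ltr_norml => /andP[_ h2].
have r1 : relu (x + h) = 0 by apply: relu_neg; lraw h2.
have r2 : relu x = 0 by apply: relu_neg; exact: ltW.
by rewrite /qrelu r1 r2 mul0r !subrr normr0 mulr_ge0 // ltW.
- exists (Num.min x e) => [|h]; first by rewrite lt_min x0 e0.
rewrite lt_min => /andP[]; rewrite ltr_norml => /andP[h1 _] h2.
have r1 : relu (x + h) = x + h by apply: relu_pos; lraw h1.
have r2 : relu x = x by apply: relu_pos; exact: ltW.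
rewrite /qrelu r1 r2; have -> : (x + h) ^+ 2 / 2 - x ^+ 2 / 2 - x * h = h / 2 * h by field.
rewrite normrM ler_wpM2r // normrM (ger0_norm (_ : 0 <= 2^-1)) //.
by have := normr_ge0 h => h3; lraw h2 h3.
- exists e => // h hh; rewrite add0r /qrelu (relu_neg (lexx 0)) expr0n /= !mul0r !subr0.
have hr : 0 <= relu h <= `|h|.
 by rewrite /relu le_max lexx orbT /= ge_max ler_norm normr_ge0.
have /andP[r0 r1] := hr.
rewrite ger0_norm; last by rewrite divr_ge0 // sqr_ge0.
have : relu h ^+ 2 <= `|h| ^+ 2 by exact: sq_le.
have : `|h| ^+ 2 <= e * `|h| by rewrite expr2 ler_wpM2r // ltW.
by move: (relu h ^+ 2) (`|h| ^+ 2) (e * `|h|) (sqr_ge0 (relu h)) => w1 w2 w3 g0 g1 g2; lraw g1 g2 g0.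
Qed.

Lemma ramp_der z d x : der (ramp z d) x (tent z d x).
Proof.
have sh c : der (fun x => qrelu (x + c)) x (relu (x + c)).
have dv : der (fun x : R => x + c) x 1 by apply: der_eq (derD (der_id x) (der_cst c x)) _; rewrite addr0.
by apply: der_eq (@der_comp _ qrelu (fun x => x + c) x _ _ (qrelu_der _) dv) _; rewrite mulr1.
have e1 : (fun x => qrelu (x - z + d)) = (fun x => qrelu (x + (- z + d))) by apply/funext => v; rewrite addrA.
have e2 : (fun x => qrelu (x - z - d)) = (fun x => qrelu (x + (- z - d))) by apply/funext => v; rewrite addrA.
have d1 := sh (- z + d); rewrite -e1 addrA in d1; have d2 := sh (- z - d); rewrite -e2 addrA in d2.
apply: der_eq (derM (derD (derB d1 (derM (der_cst 2 x) (sh (- z)))) d2) (der_cst d^-1 x)) _.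
by rewrite /tent mul0r add0r mulr0 addr0.
Qed.

Lemma tent_cont z d : continuous (tent z d).
Proof.
have c0 (k : R) : Cn 0 (fun x => relu (x + k)).
move=> x; apply: (@continuous_comp _ _ _ (fun x : R => x + k) relu); last exact: relu_cont.
by apply: cvgD; [exact: cvg_id|exact: cvg_cst].
have cc (k : R) : Cn 0 (fun _ : R => k) by move=> x; exact: cvg_cst.
have := CnM (CnD (CnD (c0 (- z + d)) (CnN (CnM (cc 2) (c0 (- z))))) (c0 (- z - d))) (cc d^-1).
by apply: (@Cn_ext _ 0) => x; rewrite /tent !addrA.
Qed.

Lemma tent_bounds z d x : 0 < d -> 0 <= tent z d x <= 1.
Proof.
move=> d0; rewrite /tent; set w := x - z.
rewrite divr_ge0 ?ler_pdivrMr ?mul1r //; last exact: ltW.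
case: (leP (w + d) 0) => h1; last case: (leP w 0) => h2; last case: (leP (w - d) 0) => h3.
- have -> : relu (w + d) = 0 by exact: relu_neg. have -> : relu w = 0 by apply: relu_neg; lraw h1 d0.
 have -> : relu (w - d) = 0 by apply: relu_neg; lraw h1 d0. by rewrite mulr0 subrr addr0 ltW.
- have -> : relu (w + d) = w + d by apply: relu_pos; exact: ltW. have -> : relu w = 0 by exact: relu_neg.
 have -> : relu (w - d) = 0 by apply: relu_neg; lraw h2 d0. lraw h2.
- have -> : relu (w + d) = w + d by apply: relu_pos; exact: ltW. have -> : relu w = w by apply: relu_pos; exact: ltW.
 have -> : relu (w - d) = 0 by exact: relu_neg. lraw h2 d0.
- have -> : relu (w + d) = w + d by apply: relu_pos; exact: ltW. have -> : relu w = w by apply: relu_pos; exact: ltW.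
 have -> : relu (w - d) = w - d by apply: relu_pos; exact: ltW. lraw d0.
case: (leP (w + d) 0) => h1; last case: (leP w 0) => h2; last case: (leP (w - d) 0) => h3.
- have -> : relu (w + d) = 0 by exact: relu_neg. have -> : relu w = 0 by apply: relu_neg; lraw h1 d0.
have -> : relu (w - d) = 0 by apply: relu_neg; lraw h1 d0. by rewrite mulr0 subrr addr0.
- have -> : relu (w + d) = w + d by apply: relu_pos; exact: ltW. have -> : relu w = 0 by exact: relu_neg.
have -> : relu (w - d) = 0 by apply: relu_neg; lraw h2 d0. lraw h1.
- have -> : relu (w + d) = w + d by apply: relu_pos; exact: ltW. have -> : relu w = w by apply: relu_pos; exact: ltW.
have -> : relu (w - d) = 0 by exact: relu_neg. lraw h3.
- have -> : relu (w + d) = w + d by apply: relu_pos; exact: ltW. have -> : relu w = w by apply: relu_pos; exact: ltW.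
have -> : relu (w - d) = w - d by apply: relu_pos; exact: ltW. by rewrite le_eqVlt; apply/orP; left; apply/eqP; ring.
Qed.

Lemma tent_out z d x : 0 < d -> d <= `|x - z| -> tent z d x = 0.
Proof.
move=> d0; rewrite /tent; move: (x - z) => w; case: (leP 0 w) => w0.
rewrite (ger0_norm w0) => h.
have -> : relu (w + d) = w + d by apply: relu_pos; lraw w0 d0.
have -> : relu w = w by exact: relu_pos.
have -> : relu (w - d) = w - d by apply: relu_pos; lraw h.
have -> : w + d - 2 * w + (w - d) = 0 by ring.
by rewrite mul0r.
rewrite (ltr0_norm w0) => h.
have -> : relu (w + d) = 0 by apply: relu_neg; lraw h.
have -> : relu w = 0 by apply: relu_neg; exact: ltW.
have -> : relu (w - d) = 0 by apply: relu_neg; lraw h d0.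
by rewrite mulr0 subrr addr0 mul0r.
Qed.

Lemma ramp_left z d x : 0 < d -> x <= z - d -> ramp z d x = 0.
Proof.
move=> d0 h; rewrite /ramp /qrelu.
have -> : relu (x - z + d) = 0 by apply: relu_neg; lraw h.
have -> : relu (x - z) = 0 by apply: relu_neg; lraw h d0.
have -> : relu (x - z - d) = 0 by apply: relu_neg; lraw h d0.
by rewrite expr0n /= mul0r mulr0 subrr addr0 mul0r.
Qed.

Lemma ramp_right z d x : 0 < d -> z + d <= x -> ramp z d x = d.
Proof.
move=> d0 h; rewrite /ramp /qrelu.
have -> : relu (x - z + d) = x - z + d by apply: relu_pos; lraw h d0.
have -> : relu (x - z) = x - z by apply: relu_pos; lraw h d0.
have -> : relu (x - z - d) = x - z - d by apply: relu_pos; lraw h.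
by have := lt0r_neq0 d0 => d1; field.
Qed.

Lemma ramp_bounds z d x : 0 < d -> 0 <= ramp z d x <= d.
Proof.
move=> d0.
have mono v w : v <= w -> ramp z d v <= ramp z d w.
move=> vw; apply: (der_ge0_le vw (fun s _ => ramp_der z d s)) => s _.
by have /andP[] := tent_bounds z s d0.
apply/andP; split.
have [h|h] := leP x (z - d); first by rewrite ramp_left.
by rewrite -(ramp_left d0 (lexx (z - d))); apply: mono; exact: ltW.
have [h|h] := leP (z + d) x; first by rewrite ramp_right.
by rewrite -[X in _ <= X](ramp_right d0 (lexx (z + d))); apply: mono; exact: ltW.
Qed.

Lemma sum_tent (z0 d x : R) n : 0 < d -> z0 <= x <= z0 + n%:R * d ->
\sum_(i < n.+1) tent (z0 + i%:R * d) d x = 1.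
Proof.
move=> d0 /andP[h1 h2].
have -> : \sum_(i < n.+1) tent (z0 + i%:R * d) d x =
(relu (x - z0 + d) - relu (x - z0)) / d - (relu (x - z0 - n%:R * d) - relu (x - z0 - n.+1%:R * d)) / d.
elim: n {h2} => [|n IH]; last rewrite big_ord_recr /= IH /tent.
 by rewrite big_ord1 /tent !mul0r !addr0 !subr0 mul1r; ring.
have -> : x - (z0 + n.+1%:R * d) + d = x - z0 - n%:R * d by rewrite -natr1; ring.
have -> : x - (z0 + n.+1%:R * d) = x - z0 - n.+1%:R * d by ring.
have -> : x - z0 - n.+1%:R * d - d = x - z0 - n.+2%:R * d by rewrite -[n.+2%:R]natr1; ring.
by ring.
have -> : relu (x - z0 + d) = x - z0 + d by apply: relu_pos; lraw h1 d0.
have -> : relu (x - z0) = x - z0 by apply: relu_pos; lraw h1.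
have -> : relu (x - z0 - n%:R * d) = 0 by apply: relu_neg; move: (n%:R * d) h2 => w h2; lraw h2.
have -> : relu (x - z0 - n.+1%:R * d) = 0.
by apply: relu_neg; rewrite -natr1 mulrDl mul1r; move: (n%:R * d) h2 => w h2; lraw h2 d0.
by have := lt0r_neq0 d0 => d1; field.
Qed.

Lemma sum_ramp (z0 d x : R) n : 0 < d -> z0 <= x <= z0 + n%:R * d ->
\sum_(i < n.+1) ramp (z0 + i%:R * d) d x = x - z0 + d / 2.
Proof.
move=> d0 /andP[h1 h2].
have -> : \sum_(i < n.+1) ramp (z0 + i%:R * d) d x =
(qrelu (x - z0 + d) - qrelu (x - z0)) / d - (qrelu (x - z0 - n%:R * d) - qrelu (x - z0 - n.+1%:R * d)) / d.
elim: n {h2} => [|n IH]; last rewrite big_ord_recr /= IH /ramp.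
 by rewrite big_ord1 /ramp !mul0r !addr0 !subr0 mul1r; ring.
have -> : x - (z0 + n.+1%:R * d) + d = x - z0 - n%:R * d by rewrite -natr1; ring.
have -> : x - (z0 + n.+1%:R * d) = x - z0 - n.+1%:R * d by ring.
have -> : x - z0 - n.+1%:R * d - d = x - z0 - n.+2%:R * d by rewrite -[n.+2%:R]natr1; ring.
by ring.
rewrite /qrelu.
have -> : relu (x - z0 + d) = x - z0 + d by apply: relu_pos; lraw h1 d0.
have -> : relu (x - z0) = x - z0 by apply: relu_pos; lraw h1.
have -> : relu (x - z0 - n%:R * d) = 0 by apply: relu_neg; move: (n%:R * d) h2 => w h2; lraw h2.
have -> : relu (x - z0 - n.+1%:R * d) = 0.
by apply: relu_neg; rewrite -natr1 mulrDl mul1r; move: (n%:R * d) h2 => w h2; lraw h2 d0.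
by rewrite expr0n /=; have := lt0r_neq0 d0 => d1; field.
Qed.

End Tents.

(** * Integrals over a period *)

Section ClosedIntegral.
Context {R : realType}.
Implicit Types (f g F : R -> R) (P s : R).

Definition cint P f : R := prim f P - prim f 0.

Lemma cint_eq P f F : (forall s, der F s (f s)) -> continuous f -> cint P f = F P - F 0.
Proof. by move=> dF cf; apply: (der_uniq_prim (prim_der cf) dF). Qed.

Lemma cintD P f g : continuous f -> continuous g -> cint P (fun s => f s + g s) = cint P f + cint P g.
Proof.
move=> cf cg; rewrite (@cint_eq P _ (fun s => prim f s + prim g s)).
- by rewrite /cint; ring.
- by move=> s; apply: derD; exact: prim_der.
- exact: (CnD (n := 0) cf cg).
Qed.

Lemma cintZ P (k : R) f : continuous f -> cint P (fun s => k * f s) = k * cint P f.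
Proof.
move=> cf; rewrite (@cint_eq P _ (fun s => k * prim f s)).
- by rewrite /cint; ring.
- by move=> s; apply: der_eq (derM (der_cst k s) (prim_der cf s)) _; rewrite mul0r add0r.
- have ck : Cn 0 (fun _ : R => k) by move=> s; exact: cvg_cst.
exact: (CnM (n := 0) ck cf).
Qed.

Lemma cint_sum P n (f : 'I_n -> R -> R) : (forall i, continuous (f i)) ->
cint P (fun s => \sum_(i < n) f i s) = \sum_(i < n) cint P (f i) /\ continuous (fun s => \sum_(i < n) f i s).
Proof.
elim: n f => [|n IH] f cf.
have -> : (fun s => \sum_(i < 0) f i s) = fun=> 0 by apply/funext => s; rewrite big_ord0.
have c0 : continuous (fun _ : R => 0 : R) by move=> s; exact: cvg_cst.
by rewrite big_ord0; split=> //; rewrite (@cint_eq P _ (fun=> 0)) ?subrr // => s; exact: der_cst.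
have [e c] := IH (fun i => f (widen_ord (leqnSn n) i)) (fun i => cf _).
have -> : (fun s => \sum_(i < n.+1) f i s) = fun s => \sum_(i < n) f (widen_ord (leqnSn n) i) s + f ord_max s.
by apply/funext => s; rewrite big_ord_recr.
split; last exact: (CnD (n := 0) c (cf _)).
by rewrite cintD // e [RHS]big_ord_recr.
Qed.

Lemma cint_shift P f s : continuous f -> (forall s, f (s + P) = f s) -> prim f (s + P) - prim f s = cint P f.
Proof.
move=> cf per.
have d0 v : der (fun v => prim f (v + P) - prim f v) v 0.
have dv : der (fun v : R => v + P) v 1 by apply: der_eq (derD (der_id v) (der_cst _ v)) _; rewrite addr0.
apply: der_eq (derB (@der_comp _ (prim f) (fun v => v + P) v _ _ (prim_der cf _) dv) (prim_der cf v)) _.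
by rewrite per mulr1 subrr.
by have := der0_cst s 0 d0; rewrite add0r.
Qed.

Lemma cint_bound P f M rho s1 : 0 < P -> continuous f -> (forall s, f (s + P) = f s) -> (forall s, `|f s| <= M) ->
0 <= rho -> (forall s, rho <= `|s - s1| <= P / 2 -> f s = 0) -> `|cint P f| <= M * (2 * rho).
Proof.
move=> P0 cf per hM r0 hz.
have M0 : 0 <= M by apply: le_trans (hM 0).
have dp := prim_der cf.
have := cint_shift (s1 - P / 2) cf per; have -> : s1 - P / 2 + P = s1 + P / 2 by field.
move=> <-.
have [h|h] := leP (P / 2) rho.
apply: le_trans (_ : M * (s1 + P / 2 - (s1 - P / 2)) <= _).
 by apply: (der_bound _ (fun s _ => dp s) (fun s _ => hM s)); lraw P0.
by apply: ler_wpM2l => //; lraw h.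
have z1 : prim f (s1 + P / 2) - prim f (s1 + rho) = 0.
apply/eqP; rewrite -normr_le0 -(mul0r (s1 + P / 2 - (s1 + rho))).
apply: (@der_bound _ (prim f) f _ _ 0); [by lraw h|by move=> s _; exact: dp|].
move=> s /andP[g1 g2]; rewrite hz ?normr0 //; rewrite ger0_norm; last by lraw g1 r0.
by apply/andP; split; lraw g1 g2.
have z2 : prim f (s1 - rho) - prim f (s1 - P / 2) = 0.
apply/eqP; rewrite -normr_le0 -(mul0r (s1 - rho - (s1 - P / 2))).
apply: (@der_bound _ (prim f) f _ _ 0); [by lraw h|by move=> s _; exact: dp|].
move=> s /andP[g1 g2]; rewrite hz ?normr0 //; rewrite ler0_norm; last by lraw g2 r0.
by apply/andP; split; lraw g1 g2.
have m : `|prim f (s1 + rho) - prim f (s1 - rho)| <= M * (s1 + rho - (s1 - rho)).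
by apply: (der_bound _ (fun s _ => dp s) (fun s _ => hM s)); lraw r0.
have e : s1 + rho - (s1 - rho) = 2 * rho by ring.
rewrite e in m; apply: le_trans m.
have -> : prim f (s1 + P / 2) - prim f (s1 - P / 2) = (prim f (s1 + P / 2) - prim f (s1 + rho))
+ (prim f (s1 + rho) - prim f (s1 - rho)) + (prim f (s1 - rho) - prim f (s1 - P / 2)) by ring.
by rewrite z1 z2 add0r addr0.
Qed.

End ClosedIntegral.

(** * A mollified winding number *)

Section Winding.
Context {R : realType}.
Implicit Types (z d s r : R).
Variables (c1 c2 : R -> R) (P : R).
Hypothesis J : arclength_jordan c1 c2 P.
Notation x1 := (derive1 c1).
Notation y1 := (derive1 c2).

(** A mollified count of the signed crossings of the vertical half-line above (z1, z2): tent / d is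
    an approximate Dirac mass in the abscissa, ramp / d an approximate Heaviside function in the
    ordinate. *)
Definition wind z1 z2 d : R := cint P (fun s => tent z1 d (c1 s) / d * (ramp z2 d (c2 s) / d) * x1 s).

Let cx : Cn 0 c1. Proof. by move=> s; exact: der_cvg (jordan_der0 J s).1. Qed.
Let cy : Cn 0 c2. Proof. by move=> s; exact: der_cvg (jordan_der0 J s).2. Qed.
Let cx1 : Cn 0 x1. Proof. by move=> s; exact: der_cvg (jordan_der1 J s).1. Qed.
Let cy1 : Cn 0 y1. Proof. by move=> s; exact: der_cvg (jordan_der1 J s).2. Qed.
Let ccst (k : R) : Cn 0 (fun _ : R => k). Proof. by move=> s; exact: cvg_cst. Qed.
Let ccomp (f c : R -> R) : continuous f -> Cn 0 c -> Cn 0 (fun s => f (c s)).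
Proof. by move=> cf cc s; apply: (@continuous_comp _ _ _ c f); [exact: cc|exact: cf]. Qed.
Let cramp z d : continuous (ramp z d). Proof. by move=> s; exact: der_cvg (ramp_der z d s). Qed.

Let perP (f : R -> R -> R -> R -> R) s : f (c1 (s + P)) (c2 (s + P)) (x1 (s + P)) (y1 (s + P)) = f (c1 s) (c2 s) (x1 s) (y1 s).
Proof.
have [p1 p2] := jordan_per J s; have [p3 p4] := jordan_per_n J 1 s.
have p3' : x1 (s + P) = x1 s := p3; have p4' : y1 (s + P) = y1 s := p4.
by rewrite p1 p2 p3' p4'.
Qed.

Let x1_le s : `|x1 s| <= 1.
Proof. by rewrite -sqrtr_sqr -[X in _ <= X]sqrtr1 ler_sqrt // -(jordan_unit J s) lerDl sqr_ge0. Qed.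
Let y1_le s : `|y1 s| <= 1.
Proof. by rewrite -sqrtr_sqr -[X in _ <= X]sqrtr1 ler_sqrt // -(jordan_unit J s) lerDr sqr_ge0. Qed.

Let V z d z' d' (v : R) := ramp z d v / d - ramp z' d' v / d'.
Let A z1 z2 d z1' d' s := V z1 d z1' d' (c1 s) * (tent z2 d (c2 s) / d) * y1 s.
Let B z2 d z1' z2' d' s := tent z1' d' (c1 s) / d' * V z2 d z2' d' (c2 s) * x1 s.

Let cramp0 z d : Cn 0 (ramp z d). Proof. exact: cramp. Qed.
Let cV z d z' d' : Cn 0 (V z d z' d').
Proof. by have h := CnD (CnM (@cramp0 z d) (@ccst d^-1)) (CnN (CnM (@cramp0 z' d') (@ccst d'^-1))). Qed.
Let cA z1 z2 d z1' d' : Cn 0 (A z1 z2 d z1' d').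
Proof.
by have h := CnM (CnM (ccomp (@cV z1 d z1' d') cx) (CnM (ccomp (@tent_cont _ z2 d) cy) (@ccst d^-1))) cy1.
Qed.
Let cB z2 d z1' z2' d' : Cn 0 (B z2 d z1' z2' d').
Proof.
by have h := CnM (CnM (CnM (ccomp (@tent_cont _ z1' d') cx) (@ccst d'^-1)) (ccomp (@cV z2 d z2' d') cy)) cx1.
Qed.
Let cW z1 z2 d : Cn 0 (fun s => tent z1 d (c1 s) / d * (ramp z2 d (c2 s) / d) * x1 s).
Proof.
by have h := CnM (CnM (CnM (ccomp (@tent_cont _ z1 d) cx) (@ccst d^-1)) (CnM (ccomp (@cramp0 z2 d) cy) (@ccst d^-1))) cx1.
Qed.

(* Integration by parts: the total derivative of [V(c1) ramp(c2)] drops out. *)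
Lemma wind_diff z1 z2 d z1' z2' d' : 0 < d -> 0 < d' ->
wind z1 z2 d - wind z1' z2' d' = cint P (B z2 d z1' z2' d') - cint P (A z1 z2 d z1' d').
Proof.
move=> d0 d0'.
pose F s := V z1 d z1' d' (c1 s) * (ramp z2 d (c2 s) / d)
+ prim (fun s => tent z1' d' (c1 s) / d' * (ramp z2' d' (c2 s) / d') * x1 s) s
- prim (A z1 z2 d z1' d') s + prim (B z2 d z1' z2' d') s.
have dF s : der F s (tent z1 d (c1 s) / d * (ramp z2 d (c2 s) / d) * x1 s).
have [dx dy] := jordan_der0 J s.
have r1 z e := derM (@der_comp _ (ramp z e) c1 s _ _ (ramp_der z e _) dx) (der_cst e^-1 s).
have r2 := derM (@der_comp _ (ramp z2 d) c2 s _ _ (ramp_der z2 d _) dy) (der_cst d^-1 s).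
apply: der_eq (derD (derB (derD (derM (derB (r1 z1 d) (r1 z1' d')) r2) (prim_der (@cW z1' z2' d') s))
 (prim_der (@cA z1 z2 d z1' d') s)) (prim_der (@cB z2 d z1' z2' d') s)) _.
rewrite /A /B /V; ring.
rewrite /wind (cint_eq P dF (@cW z1 z2 d)) /F.
have [p1 p2] := jordan_per J 0; rewrite add0r in p1 p2.
have arith (w a b c a0 b0 c0 : R) : (w + a - b + c) - (w + a0 - b0 + c0) - (a - a0) = (c - c0) - (b - b0) by ring.
by rewrite p1 p2; exact: arith.
Qed.

Let V_out z d z' d' a b (v : R) : 0 < d -> 0 < d' -> a <= z - d -> a <= z' - d' -> z + d <= b -> z' + d' <= b ->
~~ (a < v < b) -> V z d z' d' v = 0.
Proof.
move=> d0 d0' h1 h2 h3 h4; rewrite negb_and -!leNgt => /orP[h|h].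
by rewrite /V !ramp_left ?mul0r ?subrr //; [exact: le_trans h h2|exact: le_trans h h1].
rewrite /V !ramp_right //; [|exact: le_trans h4 h|exact: le_trans h3 h].
by rewrite !mulfV ?subrr // lt0r_neq0.
Qed.

Let tent_out2 z d a b (v : R) : 0 < d -> a <= z - d -> z + d <= b -> ~~ (a < v < b) -> tent z d v = 0.
Proof.
move=> d0 h1 h3; rewrite negb_and -!leNgt => h; apply: tent_out => //.
case/orP: h => h; last by rewrite ger0_norm; lras h h3 d0.
by rewrite ler0_norm; lras h h1 d0.
Qed.

(** The chord is at most 2 D, and on arcs up to P / 2 the chord-arc bound makes it larger than mu /
    2 times the arc: closeness in the plane becomes closeness of parameters. *)
Lemma arc_near mu D s s1 : 0 < mu -> (forall p q, p < q < p + P ->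
 (mu * ((q - p) * (1 - (q - p) / P))) ^+ 2 < chord0 c1 c2 p q) -> 0 < D ->
`|c1 s - c1 s1| <= D -> `|c2 s - c2 s1| <= D -> `|s - s1| <= P / 2 -> `|s - s1| < 4 * D / mu.
Proof.
move=> mu0 Hmu D0 q1 q2 g2; rewrite ltNge; apply/negP => g1; have P0 := jordan_P J.
have l0 : 0 < `|s - s1| by apply: lt_le_trans g1; rewrite divr_gt0 // mulr_gt0.
have chs : chord0 c1 c2 s1 s <= (2 * D) ^+ 2.
rewrite /chord0 -[X in X + _ <= _]real_normK ?num_real // -[X in _ + X <= _]real_normK ?num_real //.
have k1 := sq_le (normr_ge0 _) q1; have k2 := sq_le (normr_ge0 _) q2.
have -> : (2 * D) ^+ 2 = 4 * D ^+ 2 by ring.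
by have k3 := sqr_ge0 D; lras k1 k2 k3.
have chl : (mu * (`|s - s1| * (1 - `|s - s1| / P))) ^+ 2 < chord0 c1 c2 s1 s.
case: (ltgtP s1 s) => [lt|gt|eq]; last by rewrite eq subrr normr0 ltxx in l0.
 have n : `|s - s1| = s - s1 by rewrite ger0_norm // subr_ge0 ltW.
 by rewrite n in g2 *; apply: Hmu; rewrite lt /=; lras g2 P0.
have n : `|s - s1| = s1 - s by rewrite distrC ger0_norm // subr_ge0 ltW.
have := Hmu s s1; rewrite n in g2 *; rewrite gt /= => /(_ ltac:(lras g2 P0)).
by rewrite /chord0 -[(c1 s1 - c1 s) ^+ 2]sqrrN opprB -[(c2 s1 - c2 s) ^+ 2]sqrrN opprB.
set l := `|s - s1| in g1 g2 l0 chl.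
have z1l : l / P <= 1 / 2 by rewrite ler_pdivrMr //; lras g2.
have : (mu * (l * (1 - l / P))) ^+ 2 < (2 * D) ^+ 2 by exact: lt_le_trans chl chs.
rewrite ltr_pXn2r ?nnegrE //; first last.
- by rewrite mulr_ge0 // ltW.
- by apply: mulr_ge0; [exact: ltW|apply: mulr_ge0; [exact: ltW|lras z1l]].
apply/negP; rewrite -leNgt.
apply: le_trans (_ : mu * (4 * D / mu * (1 / 2)) <= _).
rewrite le_eqVlt; apply/orP; left; apply/eqP; have := lt0r_neq0 mu0 => m0; by field.
rewrite ler_pM2l //; apply: ler_pM.
- by apply: divr_ge0; [lras D0|exact: ltW].
- lra.
- exact: g1.
- lras z1l.
Qed.

Section TwoKernels.
Variables (z1 z2 d z1' z2' d' a b c e : R).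
Hypothesis hd : 0 < d /\ 0 < d'.
Hypothesis hbox : [/\ a <= z1 - d, a <= z1' - d', z1 + d <= b & z1' + d' <= b] /\
[/\ c <= z2 - d, c <= z2' - d', z2 + d <= e & z2' + d' <= e].

Let zeroA s : ~ (a < c1 s < b /\ c < c2 s < e) -> A z1 z2 d z1' d' s = 0.
Proof.
case: hd hbox => d0 d0' [[h1 h2 h3 h4] [k1 k2 k3 k4]] no; rewrite /A.
case: (boolP (a < c1 s < b)) => i1; last by rewrite (V_out d0 d0' h1 h2 h3 h4 i1) !mul0r.
case: (boolP (c < c2 s < e)) => i2; first by exfalso; apply: no.
by rewrite (tent_out2 d0 k1 k3 i2) mul0r mulr0 mul0r.
Qed.

Let zeroB s : ~ (a < c1 s < b /\ c < c2 s < e) -> B z2 d z1' z2' d' s = 0.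
Proof.
case: hd hbox => d0 d0' [[h1 h2 h3 h4] [k1 k2 k3 k4]] no; rewrite /B.
case: (boolP (a < c1 s < b)) => i1; last by rewrite (tent_out2 d0' h2 h4 i1) !mul0r.
case: (boolP (c < c2 s < e)) => i2; first by exfalso; apply: no.
by rewrite (V_out d0 d0' k1 k2 k3 k4 i2) mulr0 mul0r.
Qed.

(** Both error terms of [wind_diff] live where the curve meets the box. *)
Lemma wind_box : (forall s, ~ (a < c1 s < b /\ c < c2 s < e)) -> wind z1 z2 d = wind z1' z2' d'.
Proof.
case: (hd) => d0 d0' av; apply/eqP; rewrite -subr_eq0 wind_diff //.
have -> : A z1 z2 d z1' d' = fun=> 0 by apply/funext => s; exact: zeroA.
have -> : B z2 d z1' z2' d' = fun=> 0 by apply/funext => s; exact: zeroB.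
by rewrite subrr.
Qed.

(** The error terms of [wind_diff] are bounded by 1 / d and live where the curve meets the box,
    which by [arc_near] is a parameter range of half-length 4 D / mu. *)
Lemma wind_near mu D : 0 < mu -> (forall p q, p < q < p + P ->
 (mu * ((q - p) * (1 - (q - p) / P))) ^+ 2 < chord0 c1 c2 p q) ->
d' = d -> b - a <= D -> e - c <= D -> `|wind z1 z2 d - wind z1' z2' d'| <= 16 * D / (mu * d).
Proof.
move=> mu0 Hmu dd bD eD; case: (hd) => d0 d0'; have P0 := jordan_P J.
have [[s1 [i1 i2]]|no] := pselect (exists s, a < c1 s < b /\ c < c2 s < e); last first.
rewrite wind_box; last by move=> s hs; apply: no; exists s.
have D0 : 0 <= D.
 case: hbox => -[h1 _ h3 _] _; lras h1 h3 d0 bD.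
by rewrite subrr normr0 divr_ge0 // mulr_ge0 // ltW.
have /andP[a1 a2] := i1; have /andP[b1 b2] := i2.
have D0 : 0 < D by lras a1 a2 bD.
have arc s : 4 * D / mu <= `|s - s1| <= P / 2 -> ~ (a < c1 s < b /\ c < c2 s < e).
move=> /andP[g1 g2] [/andP[a3 a4] /andP[b3 b4]].
have q1 : `|c1 s - c1 s1| <= D by rewrite ler_norml; apply/andP; split; lras a1 a2 a3 a4 bD.
have q2 : `|c2 s - c2 s1| <= D by rewrite ler_norml; apply/andP; split; lras b1 b2 b3 b4 eD.
by have := arc_near mu0 Hmu D0 q1 q2 g2; rewrite ltNge g1.
have rho0 : 0 <= 4 * D / mu by apply: divr_ge0; [lras D0|exact: ltW].
have rb z' v : 0 <= ramp z' d v / d <= 1.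
have /andP[r0 r1] := ramp_bounds z' v d0.
by rewrite divr_ge0 ?(ltW d0) //= ler_pdivrMr // mul1r.
have tb z' v : `|tent z' d v / d| <= d^-1.
have /andP[r0 r1] := tent_bounds z' v d0.
by rewrite normrM (ger0_norm r0) ger0_norm ?invr_ge0 ?(ltW d0) // -[X in _ <= X]mul1r ler_wpM2r // invr_ge0 ltW.
have Vb z' z'' v : `|V z' d z'' d v| <= 1.
have /andP[r0 r1] := rb z' v; have /andP[r2 r3] := rb z'' v.
by rewrite ler_norml /V; move: (ramp z' d v / d) (ramp z'' d v / d) r0 r1 r2 r3 => w1 w2 r0 r1 r2 r3; apply/andP; split; lras r0 r1 r2 r3.
have mul3 (u v w K : R) : `|u| <= 1 -> `|v| <= K -> `|w| <= 1 -> `|u * v * w| <= K.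
move=> h1 h2 h3; rewrite !normrM -[X in _ <= X]mulr1 -[X in _ <= X * _]mul1r.
apply: ler_pM => //; exact: ler_pM.
have A1 : `|cint P (A z1 z2 d z1' d')| <= d^-1 * (2 * (4 * D / mu)).
apply: (cint_bound (s1 := s1) P0 (@cA _ _ _ _ _)) => //.
- by move=> s; exact: (perP (fun u v p q => V z1 d z1' d' u * (tent z2 d v / d) * q)).
- by move=> s; rewrite /A dd; apply: mul3.
- by move=> s /arc; exact: zeroA.
have B1 : `|cint P (B z2 d z1' z2' d')| <= d^-1 * (2 * (4 * D / mu)).
apply: (cint_bound (s1 := s1) P0 (@cB _ _ _ _ _)) => //.
- by move=> s; exact: (perP (fun u v p q => tent z1' d' u / d' * V z2 d z2' d' v * p)).
- by move=> s; rewrite /B dd (mulrC (tent _ _ _ / d)); apply: mul3.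
- by move=> s /arc; exact: zeroB.
rewrite wind_diff //; apply: le_trans (ler_normB _ _) _.
have -> : 16 * D / (mu * d) = d^-1 * (2 * (4 * D / mu)) + d^-1 * (2 * (4 * D / mu)).
by have := lt0r_neq0 mu0; have := lt0r_neq0 d0 => g1 g2; field; rewrite g1 g2.
exact: (lerD B1 A1).
Qed.

End TwoKernels.

End Winding.

(** * The two sides of the curve *)

Section Sides.
Context {R : realType}.
Implicit Types (z d s r t : R).
Variables (c1 c2 : R -> R) (P eps : R).
Hypothesis J : arclength_jordan c1 c2 P.
Hypothesis O : inward_orientation c1 c2 eps.
Notation x1 := (derive1 c1).
Notation y1 := (derive1 c2).
Notation C := (curve_image c1 c2).
Notation D := (enclosed C).
Notation wind := (wind c1 c2 P).

Definition offset1 s r : R := c1 s - r * y1 s.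
Definition offset2 s r : R := c2 s + r * x1 s.
Notation E1 := offset1.
Notation E2 := offset2.

(** The open disk of radius |r| about the offset point, tangent to the curve at s1, misses the
    curve; r^2 has been cancelled, so the condition is linear in r and scales. *)
Definition ballc s1 r := forall s, 0 <= (c1 s - c1 s1) ^+ 2 + (c2 s - c2 s1) ^+ 2
- 2 * r * ((c2 s - c2 s1) * x1 s1 - (c1 s - c1 s1) * y1 s1).

Lemma offset_dist s1 r s : ballc s1 r -> r ^+ 2 <= (E1 s1 r - c1 s) ^+ 2 + (E2 s1 r - c2 s) ^+ 2.
Proof.
move=> /(_ s); have := jordan_unit J s1; rewrite /offset1 /offset2.
move: (c1 s) (c1 s1) (c2 s) (c2 s1) (x1 s1) (y1 s1) => a b c d p q u h.
rewrite -subr_ge0; apply: le_trans h _; rewrite le_eqVlt; apply/orP; left; apply/eqP.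
have -> : r ^+ 2 = r ^+ 2 * (p ^+ 2 + q ^+ 2) by rewrite u mulr1.
ring.
Qed.

Lemma ballc_scale s1 r t : 0 <= t <= 1 -> ballc s1 r -> ballc s1 (t * r).
Proof.
move=> /andP[t0 t1] h s; have {h} := h s; have := sqr_ge0 (c1 s - c1 s1); have := sqr_ge0 (c2 s - c2 s1).
move: ((c1 s - c1 s1) ^+ 2) ((c2 s - c2 s1) ^+ 2) (_ * x1 s1 - _) => a b c h1 h2 h3.
have -> : a + b - 2 * (t * r) * c = (1 - t) * (a + b) + t * (a + b - 2 * r * c) by ring.
by apply: addr_ge0; apply: mulr_ge0 => //; [lras t1|exact: addr_ge0].
Qed.

Lemma center_red s1 s : exists s', [/\ `|s' - s1| <= P / 2, c1 s' = c1 s & c2 s' = c2 s].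
Proof.
have P0 := jordan_P J.
have [j [v [/andP[v0 vP] e]]] := periodic_red (s - s1 + P / 2) P0.
exists (s1 - P / 2 + v).
have per1 u : c1 (u + P) = c1 u by exact: (jordan_per J u).1.
have per2 u : c2 (u + P) = c2 u by exact: (jordan_per J u).2.
have -> : s = s1 - P / 2 + v + j%:~R * P.
by rewrite -addrA -e; ring.
rewrite (periodic_int per1 j) (periodic_int per2 j); split => //.
by rewrite ler_norml; apply/andP; split; lras v0 vP.
Qed.

(** A uniform radius of empty tangent disks: the curvature bounds the normal component of a chord by
    kap l^2, and the chord-arc constant bounds l^2 by 4 / mu^2 times the squared chord. *)
Lemma reach : exists2 rho : R, 0 < rho & forall s1 r, `|r| <= rho -> ballc s1 r.
Proof.
have P0 := jordan_P J.
have [mu /andP[mu0 _] Hmu] := chord_arc0 J; have [kap kap0 Hk] := kurv0_bound J.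
pose K := 4 * kap / mu ^+ 2.
have mu2 : 0 < mu ^+ 2 by rewrite exprn_gt0.
have K0 : 0 < K by apply: divr_gt0 => //; rewrite mulr_gt0.
have main s1 s' : `|s' - s1| <= P / 2 -> `|(c2 s' - c2 s1) * x1 s1 - (c1 s' - c1 s1) * y1 s1|
 <= K * ((c1 s' - c1 s1) ^+ 2 + (c2 s' - c2 s1) ^+ 2).
move=> hs; set l := `|s' - s1| in hs.
have l0 : 0 <= l by exact: normr_ge0.
have up : `|(c2 s' - c2 s1) * x1 s1 - (c1 s' - c1 s1) * y1 s1| <= kap * l * l.
 have [tc ts] := tangle0P J s1; rewrite -tc -ts.
 pose f q := (c2 q - c2 s1) * cos (tangle0 c1 c2 s1) - (c1 q - c1 s1) * sin (tangle0 c1 c2 s1).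
 have df q : der f q (sin (tangle0 c1 c2 q - tangle0 c1 c2 s1)).
 have [dx dy] := jordan_der0 J q; have [e1 e2] := tangle0P J q; rewrite -e1 in dx; rewrite -e2 in dy.
 apply: der_eq (derB (derM (derB dy (der_cst _ q)) (der_cst _ q)) (derM (derB dx (der_cst _ q)) (der_cst _ q))) _.
 by rewrite sinB; ring.
 have fs : f s1 = 0 by rewrite /f !subrr !mul0r subrr.
 have bd q : `|q - s1| <= l -> `|sin (tangle0 c1 c2 q - tangle0 c1 c2 s1)| <= kap * l.
 move=> hq; set w := _ - _.
 have hw : `|w| <= kap * `|q - s1| by apply: (der_bound_sym _ _ (tangle0_der J)) => v; exact: Hk.
 apply: le_trans (_ : `|w| <= _); last by apply: le_trans hw _; rewrite ler_pM2l.
 have [w0|w0] := leP 0 w.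
  rewrite (ger0_norm w0); have h1 := sin_le w0.
  have [w1|w1] := leP w pi; last first.
  by apply: le_trans (_ : 1 <= _); [rewrite ler_norml sin_geN1 sin_le1|have := @pihalf_gt R => h; lras h w1].
  by rewrite ger0_norm //; apply: sin_ge0_pi; rewrite w0.
 have w0' : 0 <= - w by rewrite oppr_ge0 ltW.
 rewrite -normrN -sinN (ltr0_norm w0); have h1 := sin_le w0'.
 have [w1|w1] := leP (- w) pi; last first.
  by apply: le_trans (_ : 1 <= _); [rewrite ler_norml sin_geN1 sin_le1|have := @pihalf_gt R => h; lras h w1].
 by rewrite ger0_norm //; apply: sin_ge0_pi; rewrite w0'.
 rewrite -/(f s'); case: (leP s1 s') => [le|/ltW le].
 have lE : l = s' - s1 by rewrite /l ger0_norm // subr_ge0.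
 have hb : `|f s' - f s1| <= kap * l * (s' - s1).
  apply: (der_bound le (fun q _ => df q)) => q /andP[q1 q2].
  by apply: bd; rewrite lE ger0_norm ?subr_ge0 //; lras q2.
 by rewrite fs subr0 -lE in hb.
 have lE : l = s1 - s' by rewrite /l ler0_norm ?subr_le0 // opprB.
 have hb : `|f s1 - f s'| <= kap * l * (s1 - s').
 apply: (der_bound le (fun q _ => df q)) => q /andP[q1 q2].
 by apply: bd; rewrite lE ler0_norm ?subr_le0 //; lras q1.
 by rewrite fs sub0r normrN -lE in hb.
have lo : mu ^+ 2 / 4 * l ^+ 2 <= (c1 s' - c1 s1) ^+ 2 + (c2 s' - c2 s1) ^+ 2.
 have [l00|ln] := eqVneq l 0; first by rewrite l00 expr0n /= mulr0 addr_ge0 // sqr_ge0.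
 have lp : 0 < l by rewrite lt_neqAle eq_sym ln.
 have z1l : l / P <= 1 / 2 by rewrite ler_pdivrMr //; lras hs.
 have hsq : mu ^+ 2 / 4 * l ^+ 2 <= (mu * (l * (1 - l / P))) ^+ 2.
 have -> : mu ^+ 2 / 4 * l ^+ 2 = (mu * (l * (1 / 2))) ^+ 2 by field.
 apply: sq_le; first by rewrite !mulr_ge0 // ?ltW //; lra.
 by rewrite ler_pM2l // ler_pM2l //; lras z1l.
 apply: le_trans hsq _.
 case: (ltgtP s1 s') => [lt|gt|eq]; last by rewrite /l eq subrr normr0 eqxx in ln.
 have lE : l = s' - s1 by rewrite /l ger0_norm // subr_ge0 ltW.
 have := Hmu s1 s'; rewrite -lE lt /= => /(_ ltac:(lras lE hs P0)) /ltW; exact.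
 have lE : l = s1 - s' by rewrite /l ltr0_norm ?subr_lt0 // opprB.
 have := Hmu s' s1; rewrite -lE gt /= => /(_ ltac:(lras lE hs P0)) /ltW.
 by rewrite /chord0 -[(c1 s1 - c1 s') ^+ 2]sqrrN opprB -[(c2 s1 - c2 s') ^+ 2]sqrrN opprB.
apply: le_trans up _.
apply: le_trans (_ : K * (mu ^+ 2 / 4 * l ^+ 2) <= _); last by rewrite ler_pM2l.
by rewrite le_eqVlt; apply/orP; left; apply/eqP; rewrite /K; have := lt0r_neq0 mu0 => m; field.
exists (1 / (2 * K)); first by rewrite divr_gt0 // mulr_gt0.
move=> s1 r hr s; have [s' [hs <- <-]] := center_red s1 s.
have := main s1 s' hs; set w := _ - _; set A := _ + _ => hw.
rewrite subr_ge0; apply: le_trans (ler_norm _) _; rewrite !normrM (ger0_norm (_ : 0 <= 2)) //.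
apply: le_trans (_ : 2 * (1 / (2 * K)) * (K * A) <= _); last first.
by rewrite le_eqVlt; apply/orP; left; apply/eqP; have := lt0r_neq0 K0 => m; field.
by apply: ler_pM => //; rewrite ?mulr_ge0 // ler_pM2l.
Qed.

Let frame_alg (U V p q : R) : p ^+ 2 + q ^+ 2 = 1 -> U * p + V * q = 0 ->
U = - (V * p - U * q) * q /\ V = (V * p - U * q) * p.
Proof.
move=> un or; have h1 : U * p = - (V * q) by apply/eqP; rewrite -addr_eq0 or.
split.
rewrite -[LHS]mulr1 -un; have -> : U * (p ^+ 2 + q ^+ 2) = U * p * p + U * q * q by ring.
by rewrite h1; ring.
rewrite -[LHS]mulr1 -un; have -> : V * (p ^+ 2 + q ^+ 2) = V * p * p + V * q * q by ring.
have -> : V * q = - (U * p) by rewrite h1 opprK.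
by ring.
Qed.

(** Take s1 nearest to z on the curve. Then z lies on the normal at s1, and the disk about z through
    s1 is empty by minimality. *)
Lemma nearest z1 z2 : exists s1 r, [/\ z1 = E1 s1 r, z2 = E2 s1 r & ballc s1 r].
Proof.
have P0 := jordan_P J.
pose f s := (c1 s - z1) ^+ 2 + (c2 s - z2) ^+ 2.
have df s : der f s (2 * ((c1 s - z1) * x1 s + (c2 s - z2) * y1 s)).
have [dx dy] := jordan_der0 J s.
have alg (a b p q : R) : 2%:R * a ^+ 2.-1 * (p - 0) + 2%:R * b ^+ 2.-1 * (q - 0) = 2 * (a * p + b * q).
 by rewrite /=; ring.
exact: der_eq (derD (derX 2 (derB dx (der_cst z1 s))) (derX 2 (derB dy (der_cst z2 s)))) (alg _ _ _ _).
have [|s1 _ H0] := @EVT_min R f 0 P (ltW P0).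
by apply: continuous_subspaceT => s; exact: der_cvg (df s).
have low s : f s1 <= f s.
have [j [w [hw ->]]] := periodic_red s P0.
have per u : f (u + P) = f u by rewrite /f (jordan_per J u).1 (jordan_per J u).2.
by rewrite (periodic_int per j w); apply: H0; rewrite in_itv.
have orth : (c1 s1 - z1) * x1 s1 + (c2 s1 - z2) * y1 s1 = 0.
have := @min_der0 _ f s1 _ 1 ltr01 (fun h _ => low (s1 + h)) (df s1) => /eqP.
by rewrite mulf_eq0 pnatr_eq0 /= => /eqP.
have un := jordan_unit J s1.
pose r := (z2 - c2 s1) * x1 s1 - (z1 - c1 s1) * y1 s1.
exists s1, r.
have [f1 f2] : z1 - c1 s1 = - r * y1 s1 /\ z2 - c2 s1 = r * x1 s1.
apply: (@frame_alg (z1 - c1 s1) (z2 - c2 s1) (x1 s1) (y1 s1)) => //.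
by rewrite -[RHS]oppr0 -orth; ring.
have e1 : z1 = E1 s1 r by rewrite /offset1 -mulNr -f1 addrC subrK.
have e2 : z2 = E2 s1 r by rewrite /offset2 -f2 addrC subrK.
split => // s.
have := low s; rewrite /f -subr_ge0.
have -> : c1 s - z1 = (c1 s - c1 s1) - (z1 - c1 s1) by ring.
have -> : c2 s - z2 = (c2 s - c2 s1) - (z2 - c2 s1) by ring.
have -> : c1 s1 - z1 = - (z1 - c1 s1) by ring.
have -> : c2 s1 - z2 = - (z2 - c2 s1) by ring.
have fin (k a b p q : R) : 0 <= (a - (- k * q)) ^+ 2 + (b - k * p) ^+ 2 - ((- (- k * q)) ^+ 2 + (- (k * p)) ^+ 2) ->
 0 <= a ^+ 2 + b ^+ 2 - 2 * k * (b * p - a * q).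
by move=> h; apply: le_trans h _; rewrite le_eqVlt; apply/orP; left; apply/eqP; ring.
by rewrite f1 f2; exact: fin.
Qed.

Definition far z1 z2 d := forall s, ~ (z1 - d < c1 s < z1 + d /\ z2 - d < c2 s < z2 + d).

(** The scale is an arbitrary one whose box misses the curve: among those, [wind] is constant
    ([wind_scale]). *)
Definition wn z1 z2 : R := wind z1 z2 (get [set d : R | 0 < d /\ far z1 z2 d]).

Lemma wind_scale z1 z2 d d' : 0 < d -> 0 < d' -> far z1 z2 d -> far z1 z2 d' -> wind z1 z2 d = wind z1 z2 d'.
Proof.
move=> d0 d0' f f'.
have main e e' : 0 < e -> e <= e' -> far z1 z2 e' -> wind z1 z2 e = wind z1 z2 e'.
move=> e0 ee fe; apply: (wind_box J (a := z1 - e') (b := z1 + e') (c := z2 - e') (e := z2 + e')) => //.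
 by split => //; exact: lt_le_trans e0 ee.
by split; split; lras ee.
by have [h|/ltW h] := leP d d'; [exact: main|apply/esym; exact: main].
Qed.

Lemma wnE z1 z2 d : 0 < d -> far z1 z2 d -> wn z1 z2 = wind z1 z2 d.
Proof.
move=> d0 f; rewrite /wn; have [] := @getPex _ [set d : R | 0 < d /\ far z1 z2 d] (ex_intro _ d (conj d0 f)).
by move: (get _) => e e0 fe; exact: wind_scale.
Qed.

Lemma offset_far s r : r != 0 -> ballc s r -> far (E1 s r) (E2 s r) (`|r| / 2).
Proof.
move=> r0 b s' [/andP[h1 h2] /andP[h3 h4]]; have := offset_dist s' b.
have a0 : 0 < `|r| by rewrite normr_gt0.
have q1 : `|E1 s r - c1 s'| <= `|r| / 2 by rewrite ler_norml; apply/andP; split; lras h1 h2.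
have q2 : `|E2 s r - c2 s'| <= `|r| / 2 by rewrite ler_norml; apply/andP; split; lras h3 h4.
have k1 := sq_le (normr_ge0 _) q1; have k2 := sq_le (normr_ge0 _) q2.
rewrite !real_normK ?num_real // in k1 k2; rewrite -[r ^+ 2]real_normK ?num_real //.
have e : (`|r| / 2) ^+ 2 = `|r| ^+ 2 / 4 by field.
rewrite e in k1 k2; have p2 : 0 < `|r| ^+ 2 by rewrite exprn_gt0.
by move: (`|r| ^+ 2) (_ ^+ 2) ((E2 s r - c2 s') ^+ 2) k1 k2 p2 => A B C' k1 k2 p2 k3; lras k1 k2 p2 k3.
Qed.

Lemma offC z1 z2 : ~ C (z1, z2) -> exists2 d : R, 0 < d & far z1 z2 d.
Proof.
move=> nC; have [s1 [r [e1 e2 b]]] := nearest z1 z2.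
have r0 : r != 0.
apply/negP => /eqP r0; apply: nC; exists s1 => //.
by rewrite e1 e2 r0 /offset1 /offset2 !mul0r subr0 addr0.
exists (`|r| / 2); first by rewrite divr_gt0 // normr_gt0.
by rewrite e1 e2; exact: offset_far.
Qed.

Lemma far_off z1 z2 d : 0 < d -> far z1 z2 d -> ~ C (z1, z2).
Proof.
move=> d0 f [s _ [e1 e2]]; apply: (f s); rewrite e1 e2.
by split; apply/andP; split; lras d0.
Qed.

Lemma wn_local z1 z2 z1' z2' d : 0 < d -> far z1 z2 (2 * d) -> `|z1' - z1| <= d -> `|z2' - z2| <= d ->
wn z1' z2' = wn z1 z2.
Proof.
move=> d0 f; rewrite !ler_norml => /andP[h1 h2] /andP[h3 h4].
have f1 : far z1 z2 d.
by move=> s [/andP[g1 g2] /andP[g3 g4]]; apply: (f s); split; apply/andP; split; lras g1 g2 g3 g4 d0.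
have f2 : far z1' z2' d.
by move=> s [/andP[g1 g2] /andP[g3 g4]]; apply: (f s); split; apply/andP; split; lras g1 g2 g3 g4 h1 h2 h3 h4 d0.
rewrite (wnE d0 f1) (wnE d0 f2).
apply: (wind_box J (a := z1 - 2 * d) (b := z1 + 2 * d) (c := z2 - 2 * d) (e := z2 + 2 * d)) => //.
by split; split; lras h1 h2 h3 h4 d0.
Qed.

Definition linked z1 z2 z1' z2' := wn z1 z2 = wn z1' z2' /\ (D (z1, z2) <-> D (z1', z2')).

Lemma path_component (g1 g2 : R -> R) a b : a <= b -> continuous g1 -> continuous g2 ->
(forall s, a <= s <= b -> ~ C (g1 s, g2 s)) ->
connected_component (~` C) (g1 a, g2 a) = connected_component (~` C) (g1 b, g2 b).
Proof.
move=> ab k1 k2 av; apply: same_connected_component.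
pose S := (fun s => (g1 s, g2 s)) @` `[a, b]%classic.
have Sa : S (g1 a, g2 a) by exists a => //=; rewrite in_itv /= lexx ab.
have Sb : S (g1 b, g2 b) by exists b => //=; rewrite in_itv /= lexx ab.
apply: (connected_component_max Sa _ _ Sb).
by move=> _ [s /= hs <-]; apply: av; move: hs; rewrite in_itv.
apply: connected_continuous_connected.
by apply/connected_intervalP; exact: interval_is_interval.
by apply: continuous_subspaceT => s; exact: (cvg_pair (k1 s) (k2 s)).
Qed.

(** The winding number is locally constant off the curve, so it has zero derivative along the path;
    membership in the region depends on the connected component only. *)
Lemma path_linked (g1 g2 : R -> R) a b : a <= b -> continuous g1 -> continuous g2 ->
(forall s, a <= s <= b -> ~ C (g1 s, g2 s)) -> linked (g1 a) (g2 a) (g1 b) (g2 b).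
Proof.
move=> ab k1 k2 av; split; last first.
have e := path_component ab k1 k2 av.
have na : ~ C (g1 a, g2 a) by apply: av; rewrite lexx.
have nb : ~ C (g1 b, g2 b) by apply: av; rewrite lexx ab.
by rewrite /enclosed /= e; split => -[_ h]; split.
have loc s : a <= s <= b -> exists2 d : R, 0 < d & forall s', `|s' - s| < d -> wn (g1 s') (g2 s') = wn (g1 s) (g2 s).
move=> hs; have [d d0 f] := offC (av s hs).
have d2 : 0 < d / 2 by rewrite divr_gt0.
have /cvgrPdist_lt/(_ _ d2)[e1 /= e10 H1] := k1 s.
have /cvgrPdist_lt/(_ _ d2)[e2 /= e20 H2] := k2 s.
exists (Num.min e1 e2) => [|s']; first by rewrite lt_min e10 e20.
rewrite distrC lt_min => /andP[/H1 q1 /H2 q2].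
have f' : far (g1 s) (g2 s) (2 * (d / 2)) by rewrite mulrC divfK.
by apply: (wn_local d2 f'); rewrite distrC ltW.
move: ab; rewrite le_eqVlt => /orP[/eqP -> //|ab].
have [||s _ E] := @mvt_open _ (fun s => wn (g1 s) (g2 s)) (fun=> 0) a b ab.
- move=> s /andP[h1 h2]; apply: eps_der => e e0.
have hs : a <= s <= b by rewrite !ltW.
have [d d0 Hd] := loc s hs.
exists d => // h hh; rewrite mul0r subr0 Hd ?subrr ?normr0 ?mulr_ge0 // ?ltW //.
by rewrite addrC addKr.
- move=> s hs e e0; have [d d0 Hd] := loc s hs; exists d => // s' _ hd.
by rewrite (Hd s' hd) subrr normr0.
by apply/esym/eqP; rewrite -subr_eq0 E mul0r.
Qed.

Lemma linked_sym a b a' b' : linked a b a' b' -> linked a' b' a b.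
Proof. by move=> [h1 h2]; split; [exact: esym|split => /h2]. Qed.

Lemma linked_trans a b a' b' a'' b'' : linked a b a' b' -> linked a' b' a'' b'' -> linked a b a'' b''.
Proof. by move=> [h1 h2] [h3 h4]; split; [exact: etrans h1 h3|split => [/h2/h4|/h4/h2]]. Qed.

Lemma offset_off s r : r != 0 -> ballc s r -> ~ C (E1 s r, E2 s r).
Proof. by move=> r0 b; apply: far_off (offset_far r0 b); rewrite divr_gt0 // normr_gt0. Qed.

Let cx : Cn 0 c1. Proof. by move=> s; exact: der_cvg (jordan_der0 J s).1. Qed.
Let cy : Cn 0 c2. Proof. by move=> s; exact: der_cvg (jordan_der0 J s).2. Qed.
Let cx1 : Cn 0 x1. Proof. by move=> s; exact: der_cvg (jordan_der1 J s).1. Qed.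
Let cy1 : Cn 0 y1. Proof. by move=> s; exact: der_cvg (jordan_der1 J s).2. Qed.
Let ccst (k : R) : Cn 0 (fun _ : R => k). Proof. by move=> s; exact: cvg_cst. Qed.
Let cid : Cn 0 (fun t : R => t). Proof. by move=> s; exact: cvg_id. Qed.

Lemma offset_linked_r s sg t t' : sg != 0 -> 0 < t <= t' -> (forall u, t <= u <= t' -> ballc s (sg * u)) ->
linked (E1 s (sg * t)) (E2 s (sg * t)) (E1 s (sg * t')) (E2 s (sg * t')).
Proof.
move=> sg0 /andP[t0 tt] b.
have g1 := CnD (@ccst (c1 s)) (CnN (CnM (CnM (@ccst sg) cid) (@ccst (y1 s)))).
have g2 := CnD (@ccst (c2 s)) (CnM (CnM (@ccst sg) cid) (@ccst (x1 s))).
apply: (@path_linked _ _ t t' tt g1 g2) => u hu; apply: offset_off; last exact: b.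
by rewrite mulf_neq0 // gt_eqF //; case/andP: hu => h _; exact: lt_le_trans t0 h.
Qed.

Lemma offset_linked_s s s' r : r != 0 -> (forall u, ballc u r) -> linked (E1 s r) (E2 s r) (E1 s' r) (E2 s' r).
Proof.
move=> r0 b.
have g1 := CnD cx (CnN (CnM (@ccst r) cy1)); have g2 := CnD cy (CnM (@ccst r) cx1).
have main u u' : u <= u' -> linked (E1 u r) (E2 u r) (E1 u' r) (E2 u' r).
by move=> uu; apply: (@path_linked _ _ u u' uu g1 g2) => v _; exact: offset_off.
by have [h|/ltW h] := leP s s'; [exact: main|apply: linked_sym; exact: main].
Qed.

Section TwoSides.
Variable rho : R.
Hypothesis hrho : 0 < rho /\ forall s1 r, `|r| <= rho -> ballc s1 r.

(** Move z along its normal to distance rho, staying in empty disks, then along the parallel curve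
    at distance rho to the parameter 0. So the complement has at most two classes. *)
Lemma side_rep z1 z2 : ~ C (z1, z2) -> exists2 sg : R, sg = 1 \/ sg = -1 &
linked z1 z2 (E1 0 (sg * rho)) (E2 0 (sg * rho)).
Proof.
move=> nC; have [r0 b] := hrho; have [s1 [r [e1 e2 br]]] := nearest z1 z2.
have rn : r != 0.
apply/negP => /eqP r00; apply: nC; exists s1 => //.
by rewrite e1 e2 r00 /offset1 /offset2 !mul0r subr0 addr0.
have [sg hsg rE] : exists2 sg : R, sg = 1 \/ sg = -1 & r = sg * `|r|.
case: (ltgtP r 0) => h; last by rewrite h eqxx in rn.
 by exists (-1); [right|rewrite ltr0_norm // mulN1r opprK].
by exists 1; [left|rewrite gtr0_norm // mul1r].
have sgn : sg != 0 by case: hsg => ->; rewrite ?oppr_eq0 oner_eq0.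
have sgu u : 0 <= u -> `|sg * u| = u by case: hsg => -> u0; rewrite ?mul1r ?mulN1r ?normrN ger0_norm.
have rp : 0 < `|r| by rewrite normr_gt0.
exists sg => //.
have ok u : 0 <= u -> u <= rho \/ u <= `|r| -> ballc s1 (sg * u).
move=> u0 [h|h]; first by apply: b; rewrite sgu.
have -> : sg * u = u / `|r| * r by rewrite {2}rE; field; exact: lt0r_neq0.
by apply: ballc_scale => //; rewrite divr_ge0 //= ler_pdivrMr // mul1r.
have l1 : linked z1 z2 (E1 s1 (sg * rho)) (E2 s1 (sg * rho)).
rewrite e1 e2 rE; case: (leP `|r| rho) => h.
 apply: offset_linked_r => //; first by rewrite rp.
 by move=> u /andP[u1 u2]; apply: ok; [exact: le_trans (ltW rp) u1|left].
apply: linked_sym; apply: offset_linked_r => //; first by rewrite r0 ltW.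
by move=> u /andP[u1 u2]; apply: ok; [exact: le_trans (ltW r0) u1|right].
apply: linked_trans l1 _; apply: offset_linked_s; first by rewrite mulf_neq0 // gt_eqF.
by move=> u; apply: b; rewrite sgu // ltW.
Qed.

Lemma inner_side : D (E1 0 (eps * rho), E2 0 (eps * rho)).
Proof.
have [r0 b] := hrho; case: O => he /(_ 0)[h0 h00 H].
pose h := Num.min (h0 / 2) rho.
have hp : 0 < h by rewrite lt_min r0 divr_gt0.
have h1 : h < h0 by apply: le_lt_trans (_ : h0 / 2 < _); [rewrite ge_min lexx|lras h00].
have h2 : h <= rho by rewrite ge_min lexx orbT.
have epn : eps != 0 by case: he => ->; rewrite ?oppr_eq0 oner_eq0.
have l : linked (E1 0 (eps * h)) (E2 0 (eps * h)) (E1 0 (eps * rho)) (E2 0 (eps * rho)).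
apply: offset_linked_r => //; first by rewrite hp.
move=> u /andP[u1 u2]; apply: b; have u0 : 0 <= u by exact: le_trans (ltW hp) u1.
by case: he => ->; rewrite ?mul1r ?mulN1r ?normrN ger0_norm.
apply: (proj1 l.2); have := H h; rewrite hp h1 => /(_ isT).
by rewrite /offset1 /offset2.
Qed.

Lemma jordan_bounded : exists2 B : R, 0 < B & forall s, `|c1 s| <= B /\ `|c2 s| <= B.
Proof.
have P0 := jordan_P J.
exists (`|c1 0| + `|c2 0| + P) => [|s]; first by rewrite ltr_wpDl // addr_ge0.
have [j [v [/andP[v0 vP] ->]]] := periodic_red s P0.
have per1 u : c1 (u + P) = c1 u by exact: (jordan_per J u).1.
have per2 u : c2 (u + P) = c2 u by exact: (jordan_per J u).2.
rewrite (periodic_int per1 j) (periodic_int per2 j).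
have x1_le u : `|x1 u| <= 1 by rewrite -sqrtr_sqr -[X in _ <= X]sqrtr1 ler_sqrt // -(jordan_unit J u) lerDl sqr_ge0.
have y1_le u : `|y1 u| <= 1 by rewrite -sqrtr_sqr -[X in _ <= X]sqrtr1 ler_sqrt // -(jordan_unit J u) lerDr sqr_ge0.
have b1 := der_bound v0 (fun u _ => (jordan_der0 J u).1) (fun u _ => x1_le u).
have b2 := der_bound v0 (fun u _ => (jordan_der0 J u).2) (fun u _ => y1_le u).
have t1 := lerB_dist (c1 v) (c1 0); have t2 := lerB_dist (c2 v) (c2 0).
have n1 := normr_ge0 (c1 0); have n2 := normr_ge0 (c2 0).
move: (`|c1 v|) (`|c2 v|) (`|c1 0|) (`|c2 0|) (`|c1 v - c1 0|) (`|c2 v - c2 0|) b1 b2 t1 t2 n1 n2.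
by move=> q1 q2 q3 q4 q5 q6 b1 b2 t1 t2 n1 n2; split; lras b1 b2 t1 t2 n1 n2 vP.
Qed.

(** A point above the curve: nothing crosses the half-line above it, and this half-line makes its
    component unbounded. *)
Lemma outer_point : exists z1 z2, [/\ ~ C (z1, z2), wn z1 z2 = 0 & ~ D (z1, z2)].
Proof.
have [B B0 HB] := jordan_bounded.
have up t s : 0 <= t -> c2 s <= B + 1 + t - 1.
by move=> t0; have := (HB s).2; rewrite ler_norml => /andP[_ h]; lras h t0.
have off t : 0 <= t -> ~ C (0, B + 1 + t).
by move=> t0 [s _ [_ e]]; have := up t s t0; rewrite e => h; lras h.
exists 0, (B + 1); have o0 := off 0 (lexx 0); rewrite addr0 in o0; split=> //.
have f : far 0 (B + 1) 1.
 by move=> s [_ /andP[h _]]; have := up 0 s (lexx 0); rewrite addr0 leNgt h.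
rewrite (wnE ltr01 f) /wind; set h := (X in cint P X).
have -> : h = fun=> 0.
 by apply/funext => s; rewrite /h ramp_left ?mul0r ?mulr0 ?mul0r //; have := up 0 s (lexx 0); rewrite addr0.
by rewrite (@cint_eq _ P _ (fun=> 0)) ?subrr // => s; [exact: der_cst|exact: cvg_cst].
case=> _ [M [_ HM]].
have M0 : 0 <= `|M| + 1 by rewrite addr_ge0.
have g2 := CnD (@ccst (B + 1)) cid.
have av s : 0 <= s <= `|M| + 1 -> ~ C (0, B + 1 + s) by move=> /andP[s0 _]; exact: off.
have e := @path_component (fun=> 0) (fun t => B + 1 + t) 0 (`|M| + 1) M0 (@ccst 0) g2 av.
have inC : connected_component (~` C) (0, B + 1) (0, B + 1 + (`|M| + 1)).
have e' : B + 1 + 0 = B + 1 by rewrite addr0.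
by rewrite /= e' in e; rewrite e; apply: connected_component_refl; exact: off.
have := HM (`|M| + 1) _ _ inC; rewrite ltr_pwDr ?ler_norm // => /(_ isT).
have h2 : `|B + 1 + (`|M| + 1)| <= `|(0 : R, B + 1 + (`|M| + 1))| by rewrite /Num.norm /= le_max lexx orbT.
move=> h3; have := le_trans h2 h3; rewrite ger0_norm; last by rewrite addr_ge0 // addr_ge0 // ltW.
by rewrite gerDr leNgt addr_gt0.
Qed.

(** The outer point cannot be linked to the inner reference point, so it represents the opposite
    side; every point off the curve is linked to one of these two. *)
Lemma inside_wn z1 z2 : ~ C (z1, z2) ->
(D (z1, z2) -> wn z1 z2 = wn (E1 0 (eps * rho)) (E2 0 (eps * rho))) /\ (~ D (z1, z2) -> wn z1 z2 = 0).
Proof.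
move=> nC; have [z1' [z2' [nC' w0 nD]]] := outer_point.
have [he _] := O; have inn := inner_side.
have out : linked z1' z2' (E1 0 (- eps * rho)) (E2 0 (- eps * rho)).
have [sg hsg l] := side_rep nC'.
have : sg <> eps by move=> e; apply: nD; apply: (proj2 l.2); rewrite e.
by case: he hsg l => -> [] -> l; rewrite ?opprK.
have [sg hsg l] := side_rep nC.
have [e|e] : sg = eps \/ sg = - eps by case: he hsg => -> [] ->; rewrite ?opprK; [left|right|right|left].
rewrite e in l; split=> [_|nDz]; first exact: l.1.
by exfalso; apply: nDz; exact: (proj2 l.2).
rewrite e in l; have l' := linked_trans l (linked_sym out); split=> [Dz|_]; last by rewrite l'.1.
by exfalso; apply: nD; exact: (proj1 l'.2).
Qed.

(** Just below a highest point the half-line above is crossed exactly once. On the arc around s0 the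
    ramp is saturated and the abscissa runs through the whole support of the tent, which integrates
    to 1 or -1; by [arc_near] no other part of the curve meets the kernel. *)
Lemma top_jump : exists z1 z2, ~ C (z1, z2) /\ (wn z1 z2 = 1 \/ wn z1 z2 = -1).
Proof.
have P0 := jordan_P J; have [rho0 hb] := hrho.
have [mu /andP[mu0 mu1] Hmu] := chord_arc0 J; have [kap kap0 Hk] := kurv0_bound J.
have [s0 _ H0] := @EVT_max R c2 0 P (ltW P0) (continuous_subspaceT (fun s => der_cvg (jordan_der0 J s).2)).
have top s : c2 s <= c2 s0.
have [j [w [hw ->]]] := periodic_red s P0.
have per v : c2 (v + P) = c2 v by exact: (jordan_per J v).2.
by rewrite (periodic_int per j w); apply: H0; rewrite in_itv.
have y0 : y1 s0 = 0.
have d : der (fun s => - c2 s) s0 (- y1 s0) by exact: derN (jordan_der0 J s0).2.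
have tp (h : R) : `|h| < 1 -> - c2 s0 <= - c2 (s0 + h) by rewrite lerN2.
by have /eqP := @min_der0 _ (fun s => - c2 s) s0 _ 1 ltr01 tp d; rewrite oppr_eq0 => /eqP.
have un := jordan_unit J s0; rewrite y0 expr0n /= addr0 in un.
(* In turn: the tangent disk of radius r is empty, the tangent turns by at most 1/4 over arc length
   q = 8 r / mu, the curve sinks by at most 3/4 r there, and this arc stays within half a period. *)
have [r r0 [r1 r2 r3 r4]] : exists2 r : R, 0 < r &
 [/\ r <= rho, 8 * r / mu * kap <= 1 / 4, kap * (8 * r / mu) * (8 * r / mu) <= 3 / 4 * r & 8 * r / mu <= P / 2].
have mk : 0 < mu / (32 * kap) by rewrite divr_gt0 // mulr_gt0.
have mk2 : 0 < mu ^+ 2 / (100 * kap) by rewrite divr_gt0 ?exprn_gt0 // mulr_gt0.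
have mp : 0 < mu * P / 16 by rewrite divr_gt0 // mulr_gt0.
pose r := Num.min (Num.min rho (mu / (32 * kap))) (Num.min (mu ^+ 2 / (100 * kap)) (mu * P / 16)).
have r0 : 0 < r by rewrite !lt_min rho0 mk mk2 mp.
have h1 : r <= rho by rewrite !ge_min lexx.
have h2 : r <= mu / (32 * kap) by rewrite !ge_min lexx orbT.
have h3 : r <= mu ^+ 2 / (100 * kap) by rewrite !ge_min lexx orbT.
have h4 : r <= mu * P / 16 by rewrite !ge_min lexx !orbT.
rewrite ler_pdivlMr ?mulr_gt0 // in h2; rewrite ler_pdivlMr ?mulr_gt0 // in h3.
exists r => //; split=> //.
- have -> : 8 * r / mu * kap = (r * (32 * kap)) / mu / 4 by field; exact: lt0r_neq0.
 by rewrite ler_pM2r // ler_pdivrMr // mul1r.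
- have -> : kap * (8 * r / mu) * (8 * r / mu) = (r * (100 * kap)) / mu ^+ 2 * (64 / 100 * r).
 by field; exact: lt0r_neq0.
 apply: le_trans (_ : 1 * (64 / 100 * r) <= _); last by lras r0.
 apply: ler_wpM2r; first by lras r0.
 by rewrite ler_pdivrMr ?exprn_gt0 // mul1r.
- by rewrite ler_pdivrMr //; lras h4.
pose z1 := c1 s0; pose z2 := c2 s0 - r.
pose q := 8 * r / mu; have q0 : 0 < q by rewrite divr_gt0 // mulr_gt0.
rewrite -/q in r2 r3 r4.
have qr : r <= q by rewrite /q ler_pdivlMr //; have := ler_wpM2l (ltW r0) mu1 => h; lras h r0.
pose d := r / 8; have d0 : 0 < d by rewrite divr_gt0.
have tau2 : x1 s0 = 1 \/ x1 s0 = -1.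
by move/eqP: un; rewrite -subr_eq0 subr_sqr_1 mulf_eq0 subr_eq0 addr_eq0 => /orP[] /eqP ->; [left|right].
have fr : far z1 z2 (r / 2).
pose r' := - x1 s0 * r.
have nr : `|r'| = r by rewrite /r'; case: tau2 => ->; rewrite ?opprK ?mul1r ?mulN1r ?normrN gtr0_norm.
have rn : r' != 0 by rewrite -normr_gt0 nr.
have := offset_far rn (hb s0 r' _); rewrite nr => /(_ r1).
have -> : E1 s0 r' = z1 by rewrite /offset1 y0 mulr0 subr0.
have -> : E2 s0 r' = z2 by rewrite /offset2 /r' /z2; case: tau2 => ->; ring.
by [].
have r20 : 0 < r / 2 by rewrite divr_gt0.
have fd : far z1 z2 d.
by move=> s [/andP[g1 g2] /andP[g3 g4]]; apply: (fr s); rewrite /d in g1 g2 g3 g4; split; apply/andP; split; lras g1 g2 g3 g4 r0.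
exists z1, z2; split; first exact: far_off r20 fr.
rewrite (wnE d0 fd) /wind; set f := (X in cint P X).
have cf : continuous f.
have cr : Cn 0 (ramp z2 d) by move=> s; exact: der_cvg (ramp_der z2 d s).
have cc (h c : R -> R) : Cn 0 h -> Cn 0 c -> Cn 0 (fun s => h (c s)).
 by move=> ch c0 s; apply: (@continuous_comp _ _ _ c h); [exact: c0|exact: ch].
by have h := CnM (CnM (CnM (cc _ _ (@tent_cont _ z1 d) cx) (@ccst d^-1)) (CnM (cc _ _ cr cy) (@ccst d^-1))) cx1.
have per s : f (s + P) = f s.
have p3 : x1 (s + P) = x1 s := (jordan_per_n J 1 s).1.
by rewrite /f (jordan_per J s).1 (jordan_per J s).2 p3.
have drift s : `|tangle0 c1 c2 s - tangle0 c1 c2 s0| <= kap * `|s - s0|.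
by apply: (der_bound_sym _ _ (tangle0_der J)) => v; exact: Hk.
have [tc ts] := tangle0P J s0; rewrite y0 in ts.
have cosx s : `|s - s0| <= q -> 31 / 32 <= x1 s * x1 s0.
move=> hs; have [<- _] := tangle0P J s; rewrite -tc.
have := cosB (tangle0 c1 c2 s) (tangle0 c1 c2 s0); rewrite ts mulr0 addr0 => <-.
have a1 : `|tangle0 c1 c2 s - tangle0 c1 c2 s0| <= 1 / 4.
 by apply: le_trans (drift s) _; apply: le_trans r2; rewrite mulrC ler_pM2r.
have := cos_ge (tangle0 c1 c2 s - tangle0 c1 c2 s0).
have : (tangle0 c1 c2 s - tangle0 c1 c2 s0) ^+ 2 <= (1 / 4) ^+ 2.
 by rewrite -[X in X <= _]real_normK ?num_real //; exact: sq_le.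
by move: (_ ^+ 2) (cos _) => g1 g2 k1 k2; lras k1 k2.
have y1s s : `|s - s0| <= q -> `|y1 s| <= kap * q.
move=> hs; apply: le_trans (_ : `|tangle0 c1 c2 s - tangle0 c1 c2 s0| <= _); last first.
 by apply: le_trans (drift s) _; rewrite ler_pM2l.
have -> : `|y1 s| = `|sin (tangle0 c1 c2 s - tangle0 c1 c2 s0)|.
 rewrite sinB ts mulr0 subr0 tc (tangle0P J s).2.
 by case: tau2 => ->; rewrite ?mulr1 ?mulrN1 ?normrN.
have hsin (w : R) : 0 <= w -> w <= pi -> `|sin w| <= w.
 by move=> w0 w1; rewrite ger0_norm; [exact: sin_le|apply: sin_ge0_pi; rewrite w0].
have a1 : `|tangle0 c1 c2 s - tangle0 c1 c2 s0| <= pi.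
 apply: le_trans (_ : 1 / 4 <= _); last by have := @pihalf_gt R => h; lras h.
 by apply: le_trans (drift s) _; apply: le_trans r2; rewrite mulrC ler_pM2r.
move: (_ - _) a1 => w a1; case: (leP 0 w) => w0.
 by rewrite [X in _ <= X]ger0_norm //; apply: hsin => //; rewrite ger0_norm in a1.
have e : `|w| = - w by exact: ltr0_norm.
have e2 : `|sin w| = `|sin (- w)| by rewrite sinN normrN.
by rewrite e in a1 *; rewrite e2; apply: hsin => //; rewrite oppr_ge0 ltW.
have low s : `|s - s0| <= q -> z2 + d <= c2 s.
move=> hs; have : `|c2 s - c2 s0| <= kap * q * q.
 case: (leP s0 s) => [le|/ltW le].
 have E : `|s - s0| = s - s0 by rewrite ger0_norm // subr_ge0.
 apply: le_trans (der_bound (m := kap * q) le (fun v _ => (jordan_der0 J v).2) _) _.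
  by move=> v /andP[v1 v2]; apply: y1s; rewrite ger0_norm ?subr_ge0 //; rewrite E in hs; lras hs v2.
 by apply: ler_wpM2l; [apply: mulr_ge0; exact: ltW|rewrite -E].
 have E : `|s - s0| = s0 - s by rewrite distrC ger0_norm // subr_ge0.
 rewrite distrC; apply: le_trans (der_bound (m := kap * q) le (fun v _ => (jordan_der0 J v).2) _) _.
 by move=> v /andP[v1 v2]; apply: y1s; rewrite ler0_norm ?subr_le0 //; rewrite E in hs; lras hs v1.
 by apply: ler_wpM2l; [apply: mulr_ge0; exact: ltW|rewrite -E].
rewrite ler_norml => /andP[h _]; rewrite /z2 /d; move: (kap * q * q) r3 h => K r3 h; lras r3 h r0.
have zero s : q <= `|s - s0| <= P / 2 -> f s = 0.
move=> /andP[g1 g2]; rewrite /f.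
case: (leP (c2 s) (z2 - d)) => h1; first by rewrite ramp_left // mul0r mulr0 mul0r.
case: (leP d `|c1 s - z1|) => h2; first by rewrite tent_out // !mul0r.
have D0 : 0 < 2 * r by rewrite mulr_gt0.
have k1 : `|c1 s - c1 s0| <= 2 * r by apply: le_trans (ltW h2) _; rewrite /d; lras r0.
have k2 : `|c2 s - c2 s0| <= 2 * r.
 by rewrite ler0_norm ?subr_le0 ?top //; rewrite /z2 /d in h1; lras h1 r0.
have := arc_near J mu0 Hmu D0 k1 k2 g2.
have -> : 4 * (2 * r) / mu = q by rewrite /q; ring.
by rewrite ltNge g1.
have dp := prim_der cf.
have Z1 : prim f (s0 + P / 2) - prim f (s0 + q) = 0.
apply/eqP; rewrite -normr_le0 -(mul0r (s0 + P / 2 - (s0 + q))).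
apply: (@der_bound _ (prim f) f _ _ 0); [by lras r4|by move=> s _; exact: dp|].
move=> s /andP[g1 g2]; rewrite zero ?normr0 //; rewrite ger0_norm; last by lras g1 q0.
by apply/andP; split; lras g1 g2.
have Z2 : prim f (s0 - q) - prim f (s0 - P / 2) = 0.
apply/eqP; rewrite -normr_le0 -(mul0r (s0 - q - (s0 - P / 2))).
apply: (@der_bound _ (prim f) f _ _ 0); [by lras r4|by move=> s _; exact: dp|].
move=> s /andP[g1 g2]; rewrite zero ?normr0 //; rewrite ler0_norm; last by lras g2 q0.
by apply/andP; split; lras g1 g2.
have Mid : prim f (s0 + q) - prim f (s0 - q) = (ramp z1 d (c1 (s0 + q)) - ramp z1 d (c1 (s0 - q))) / d.
have le : s0 - q <= s0 + q by lras q0.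
pose G s := prim f s - ramp z1 d (c1 s) / d.
have : `|G (s0 + q) - G (s0 - q)| <= 0 * (s0 + q - (s0 - q)).
 apply: (@der_bound _ G (fun=> 0) _ _ 0 le) => [s /andP[g1 g2]|s _]; last by rewrite normr0.
 have hs : `|s - s0| <= q by rewrite ler_norml; apply/andP; split; lras g1 g2.
 apply: der_eq (derB (dp s) (derM (@der_comp _ (ramp z1 d) c1 s _ _ (ramp_der z1 d _) (jordan_der0 J s).1) (der_cst d^-1 s))) _.
 by rewrite /f (ramp_right d0 (low s hs)) mulfV ?lt0r_neq0 // mulr1 mulr0 addr0; ring.
rewrite mul0r normr_le0 subr_eq0 /G => /eqP.
move: (prim f (s0 + q)) (prim f (s0 - q)) (ramp z1 d (c1 (s0 + q))) (ramp z1 d (c1 (s0 - q))) => w1 w2 w3 w4 h.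
have -> : w1 = w2 - w4 / d + w3 / d by rewrite -h subrK.
by ring.
have cE : cint P f = (ramp z1 d (c1 (s0 + q)) - ramp z1 d (c1 (s0 - q))) / d.
rewrite -Mid -(cint_shift (s0 - P / 2) cf per).
have -> : s0 - P / 2 + P = s0 + P / 2 by field.
have -> : prim f (s0 + P / 2) - prim f (s0 - P / 2) = (prim f (s0 + P / 2) - prim f (s0 + q))
 + (prim f (s0 + q) - prim f (s0 - q)) + (prim f (s0 - q) - prim f (s0 - P / 2)) by ring.
by rewrite Z1 Z2 add0r addr0.
have G1 : 31 / 32 * q <= (c1 (s0 + q) - c1 s0) * x1 s0.
have le : s0 <= s0 + q by lras q0.
have : 0 - 0 <= (c1 (s0 + q) - c1 s0) * x1 s0 - 31 / 32 * (s0 + q - s0).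
 have -> : 0 - 0 = (c1 s0 - c1 s0) * x1 s0 - 31 / 32 * (s0 - s0) by ring.
 apply: (@der_ge0_le _ (fun s => (c1 s - c1 s0) * x1 s0 - 31 / 32 * (s - s0)) (fun s => x1 s * x1 s0 - 31 / 32) _ _ le) => s /andP[g1 g2].
 apply: der_eq (derB (derM (derB (jordan_der0 J s).1 (der_cst _ s)) (der_cst _ s)) (derM (der_cst _ s) (derB (der_id s) (der_cst _ s)))) _.
 by rewrite mul0r mulr0 !subr0 addr0 add0r mulr1.
 by rewrite subr_ge0; apply: cosx; rewrite ger0_norm ?subr_ge0 //; lras g2.
by move: (_ * x1 s0) => w h; lras h.
have G2 : (c1 (s0 - q) - c1 s0) * x1 s0 <= - (31 / 32 * q).
have le : s0 - q <= s0 by lras q0.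
have : (c1 (s0 - q) - c1 s0) * x1 s0 - 31 / 32 * (s0 - q - s0) <= (c1 s0 - c1 s0) * x1 s0 - 31 / 32 * (s0 - s0).
 apply: (@der_ge0_le _ (fun s => (c1 s - c1 s0) * x1 s0 - 31 / 32 * (s - s0)) (fun s => x1 s * x1 s0 - 31 / 32) _ _ le) => s /andP[g1 g2].
 apply: der_eq (derB (derM (derB (jordan_der0 J s).1 (der_cst _ s)) (der_cst _ s)) (derM (der_cst _ s) (derB (der_id s) (der_cst _ s)))) _.
 by rewrite mul0r mulr0 !subr0 addr0 add0r mulr1.
 by rewrite subr_ge0; apply: cosx; rewrite ler0_norm ?subr_le0 //; lras g1.
by rewrite !subrr mul0r mulr0 subrr; move: (_ * x1 s0) => w h; lras h.
have dq : d <= 31 / 32 * q by rewrite /d; lras qr r0.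
rewrite cE; case: tau2 => t; rewrite t ?mulr1 ?mulrN1 in G1 G2.
left; rewrite ramp_right // ?ramp_left //; [by rewrite subr0 mulfV // lt0r_neq0|by rewrite /z1; lras G2 dq|by rewrite /z1; lras G1 dq].
right; rewrite ramp_left // ?ramp_right //; [by rewrite sub0r mulNr mulfV // lt0r_neq0|by rewrite /z1; lras G2 dq|by rewrite /z1; lras G1 dq].
Qed.

End TwoSides.

End Sides.

(** * Grid sums of the winding number *)

Lemma card_window n (A : pred 'I_n) k : (forall i j, A i -> A j -> (i <= j + k)%N) ->
(\sum_(i < n) (A i : nat) <= k.+1)%N.
Proof.
move=> H; have -> : (\sum_(i < n) (A i : nat) = #|A|)%N.
by rewrite -sum1_card [RHS]big_mkcond /=; apply: eq_bigr => i _; rewrite unfold_in; case: (A i).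
case: (pickP A) => [i0 hi0|none]; last by rewrite (eq_card0 none).
have [m hm Hm] := arg_minnP (fun i : 'I_n => i : nat) hi0.
pose f (i : 'I_n) : 'I_k.+1 := inord (i - m).
rewrite -[k.+1]card_ord -(card_in_image (f := f) (A := A)); first exact: max_card.
move=> i j hi hj /(congr1 val); have := Hm i hi; have := Hm j hj.
have := H i m hi hm; have := H j m hj hm => h1 h2 h3 h4.
rewrite /= !inordK; [|lia|lia] => e; apply: val_inj => /=; lia.
Qed.

Lemma hull {R : realType} (z z' d : R) : 0 < d -> - (6 * d) <= z - z' -> z - z' <= 6 * d ->
exists a, a <= z - d /\ a <= z' - d /\ z + d <= a + 10 * d /\ z' + d <= a + 10 * d.
Proof.
move=> d0 h1 h2; case: (leP z z') => h; first by exists (z - d); repeat split; lra.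
by exists (z' - d); repeat split; lra.
Qed.

Section GridSum.
Context {R : realType}.
Implicit Types (z d s r t : R).
Variables (c1 c2 : R -> R) (P eps : R).
Hypothesis J : arclength_jordan c1 c2 P.
Hypothesis O : inward_orientation c1 c2 eps.
Notation x1 := (derive1 c1).
Notation y1 := (derive1 c2).
Notation C := (curve_image c1 c2).
Notation D := (enclosed C).
Notation wind := (wind c1 c2 P).
Notation wn := (wn c1 c2 P).
Notation far := (far c1 c2).

(** The value inside is that of the inner reference point. The point of [top_jump] has value 1 or
    -1, so it is not outside, and it determines this value. *)
Lemma winding_values : exists wp : R, (wp = 1 \/ wp = -1) /\ forall z1 z2, ~ C (z1, z2) ->
(D (z1, z2) -> wn z1 z2 = wp) /\ (~ D (z1, z2) -> wn z1 z2 = 0).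
Proof.
have [rho r0 hb] := reach J; have hrho := conj r0 hb.
have [z1 [z2 [nC hw]]] := top_jump J hrho.
have I z1 z2 := @inside_wn _ c1 c2 P eps J O rho hrho z1 z2.
exists (wn (offset1 c1 c2 0 (eps * rho)) (offset2 c1 c2 0 (eps * rho))); split => //.
have [hD hnD] := I z1 z2 nC; have [dz|dz] := pselect (D (z1, z2)); first by rewrite -(hD dz).
by move: hw; rewrite (hnD dz) => -[/esym/eqP|/esym/eqP]; rewrite ?oppr_eq0 oner_eq0.
Qed.

(** If the box at scale d is free, this is a winding number. Otherwise z is within 2 d of the curve;
    moving it along the normal to the offset 4 d, by at most 6 d, frees the box and changes [wind]
    by at most 160 / mu, uniformly in d. *)
Lemma wind_bounded : exists d0 K : R, [/\ 0 < d0, 0 <= K & forall z1 z2 d, 0 < d <= d0 -> `|wind z1 z2 d| <= K].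
Proof.
have [rho r0 hb] := reach J; have [mu /andP[mu0 _] Hmu] := chord_arc0 J.
have [wp [hwp Hw]] := winding_values.
have small z1 z2 d : 0 < d -> far z1 z2 d -> `|wind z1 z2 d| <= 1.
move=> d0 f; rewrite -(wnE J d0 f); have [h1 h2] := Hw z1 z2 (far_off d0 f).
have [dz|dz] := pselect (D (z1, z2)); last by rewrite (h2 dz) normr0.
by rewrite (h1 dz); case: hwp => ->; rewrite ?normrN normr1.
exists (rho / 4), (1 + 160 / mu); split; [by rewrite divr_gt0|by rewrite addr_ge0 // divr_ge0 // ltW|].
move=> z1 z2 d /andP[d0 dr]; have [s1 [r [e1 e2 br]]] := nearest J z1 z2.
have m0 : 0 <= 160 / mu by rewrite divr_ge0 // ltW.
have farO r' : 2 * d <= `|r'| -> ballc c1 c2 s1 r' -> far (offset1 c1 c2 s1 r') (offset2 c1 c2 s1 r') d.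
move=> h b s [/andP[g1 g2] /andP[g3 g4]].
have rn : r' != 0 by rewrite -normr_gt0; lras h d0.
by apply: (offset_far J rn b (s := s1)); split; apply/andP; split; [lras g1 h|lras g2 h|lras g3 h|lras g4 h].
have [hr|hr] := leP (2 * d) `|r|.
by rewrite e1 e2; apply: le_trans (small _ _ _ d0 (farO r hr br)) _; rewrite lerDl.
have h4 : ballc c1 c2 s1 (4 * d) by apply: hb; rewrite ger0_norm; lras d0 dr.
have f4 := farO (4 * d) (_ : 2 * d <= `|4 * d|) h4.
have {}f4 := f4 ltac:(by rewrite ger0_norm; lras d0).
have s4 := small _ _ _ d0 f4.
have x1_le s : `|x1 s| <= 1 by rewrite -sqrtr_sqr -[X in _ <= X]sqrtr1 ler_sqrt // -(jordan_unit J s) lerDl sqr_ge0.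
have y1_le s : `|y1 s| <= 1 by rewrite -sqrtr_sqr -[X in _ <= X]sqrtr1 ler_sqrt // -(jordan_unit J s) lerDr sqr_ge0.
have mv (w : R) : `|w| <= 1 -> `|(4 * d - r) * w| <= 6 * d.
move=> hw; rewrite normrM -[X in _ <= X]mulr1; apply: ler_pM => //.
by move: hr; rewrite ltr_norml => /andP[g1 g2]; rewrite ler_norml; apply/andP; split; [lras g1 g2 d0|lras g1 g2 d0].
set z1' := offset1 c1 c2 s1 (4 * d) in f4 s4; set z2' := offset2 c1 c2 s1 (4 * d) in f4 s4.
have k1 : `|z1 - z1'| <= 6 * d.
by rewrite e1 /z1' /offset1 (_ : _ - _ = (4 * d - r) * y1 s1); [exact: mv|ring].
have k2 : `|z2 - z2'| <= 6 * d.
by rewrite distrC e2 /z2' /offset2 (_ : _ - _ = (4 * d - r) * x1 s1); [exact: mv|ring].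
clearbody z1' z2'; rewrite !ler_norml in k1 k2; have /andP[a1 a2] := k1; have /andP[b1 b2] := k2.
have near : `|wind z1 z2 d - wind z1' z2' d| <= 16 * (10 * d) / (mu * d).
have [lo1 [p1 [p2 [p3 p4]]]] := hull d0 a1 a2; have [lo2 [q1 [q2 [q3 q4]]]] := hull d0 b1 b2.
apply: (@wind_near _ c1 c2 P J z1 z2 d z1' z2' d lo1 (lo1 + 10 * d) lo2 (lo2 + 10 * d)) => //.
- by lras d0.
- by lras d0.
have e16 : 16 * (10 * d) / (mu * d) = 160 / mu.
by have g1 := lt0r_neq0 mu0; have g2 := lt0r_neq0 d0; field; rewrite g1 g2.
rewrite e16 in near; apply: le_trans (lerD s4 near).
by rewrite -lerBlDl; exact: lerB_dist.
Qed.

(** Outside the bounding square the winding number vanishes: either the kernel misses the curve, or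
    the ramp is saturated along the whole curve and the integrand is an exact derivative. *)
Lemma enclosed_bounded B z1 z2 : (forall s, `|c1 s| <= B /\ `|c2 s| <= B) -> D (z1, z2) -> `|z1| <= B /\ `|z2| <= B.
Proof.
move=> HB Dz; have [nC _] := Dz; have [d d0 f] := offC J nC.
have [wp [hwp Hw]] := winding_values.
have wne : wn z1 z2 <> 0.
have -> := (Hw z1 z2 nC).1 Dz.
by case: hwp => -> /eqP; rewrite ?oppr_eq0 oner_eq0.
have shr e : 0 < e -> exists d' : R, [/\ 0 < d', d' <= e & far z1 z2 d'].
move=> e0; exists (Num.min d e); split; [by rewrite lt_min d0|by rewrite ge_min lexx orbT|].
have h : Num.min d e <= d by rewrite ge_min lexx.
by move: (Num.min d e) h => m h s [/andP[g1 g2] /andP[g3 g4]]; apply: (f s); split; apply/andP; split; lras g1 g2 g3 g4 h.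
have cint0 : cint P (fun _ => 0 : R) = 0.
by rewrite (@cint_eq _ P _ (fun=> 0)) ?subrr // => s; [exact: der_cst|exact: cvg_cst].
split; rewrite leNgt; apply/negP => hb; apply: wne.
have e0 : 0 < `|z1| - B by rewrite subr_gt0.
have [d' [d0' dd f']] := shr _ e0; rewrite (wnE J d0' f') /wind -[RHS]cint0; congr cint; apply/funext => s.
rewrite tent_out // ?mul0r ?mul0r //.
have := lerB_dist z1 (c1 s); rewrite distrC => t; have [b _] := HB s.
by move: (`|z1|) (`|c1 s|) (`|c1 s - z1|) t b dd => w1 w2 w3 t b dd; lras t b dd.
have e0 : 0 < `|z2| - B by rewrite subr_gt0.
have [d' [d0' dd f']] := shr _ e0; rewrite (wnE J d0' f') /wind.
have bb s : - B <= c2 s <= B by rewrite -ler_norml; exact: (HB s).2.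
case: (leP 0 z2) => hz.
rewrite -[RHS]cint0; congr cint; apply/funext => s; rewrite ramp_left // ?mul0r ?mulr0 ?mul0r //.
by have /andP[_ b] := bb s; rewrite ger0_norm // in dd; lras dd b.
have rr s : ramp z2 d' (c2 s) = d'.
by apply: ramp_right => //; have /andP[b _] := bb s; rewrite ltr0_norm // in dd; lras dd b.
pose G s := ramp z1 d' (c1 s) / d'.
have dG s : der G s (tent z1 d' (c1 s) / d' * (ramp z2 d' (c2 s) / d') * x1 s).
apply: der_eq (derM (@der_comp _ (ramp z1 d') c1 s _ _ (ramp_der z1 d' _) (jordan_der0 J s).1) (der_cst d'^-1 s)) _.
by rewrite rr mulfV ?lt0r_neq0 // mulr1 mulr0 addr0 mulrAC.
rewrite (cint_eq P dG); first by rewrite /G -[P]add0r (jordan_per J 0).1 subrr.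
have cr : Cn 0 (ramp z2 d') by move=> s; exact: der_cvg (ramp_der z2 d' s).
have cc (h c : R -> R) : Cn 0 h -> Cn 0 c -> Cn 0 (fun s => h (c s)).
by move=> ch k0 s; apply: (@continuous_comp _ _ _ c h); [exact: k0|exact: ch].
have ccst (k : R) : Cn 0 (fun _ : R => k) by move=> s; exact: cvg_cst.
have cx : Cn 0 c1 by move=> s; exact: der_cvg (jordan_der0 J s).1.
have cy : Cn 0 c2 by move=> s; exact: der_cvg (jordan_der0 J s).2.
have cx1 : Cn 0 x1 by move=> s; exact: der_cvg (jordan_der1 J s).1.
by have h := CnM (CnM (CnM (cc _ _ (@tent_cont _ z1 d') cx) (ccst d'^-1)) (CnM (cc _ _ cr cy) (ccst d'^-1))) cx1.
Qed.

Lemma cell_linked z1 z2 d p1 p2 : 0 < d -> far z1 z2 (2 * d) -> `|p1 - z1| <= d -> `|p2 - z2| <= d ->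
~ C (p1, p2) /\ (D (p1, p2) <-> D (z1, z2)).
Proof.
move=> d0 f; rewrite !ler_norml => /andP[a1 a2] /andP[b1 b2].
have ccst (k : R) : Cn 0 (fun _ : R => k) by move=> s; exact: cvg_cst.
have cid : Cn 0 (fun t : R => t) by move=> s; exact: cvg_id.
have g1 := CnD (ccst z1) (CnM cid (ccst (p1 - z1))).
have g2 := CnD (ccst z2) (CnM cid (ccst (p2 - z2))).
have av t : 0 <= t <= 1 -> ~ C (z1 + t * (p1 - z1), z2 + t * (p2 - z2)).
move=> /andP[t0 t1] [s _ [e1 e2]]; apply: (f s); rewrite e1 e2.
have bd (w : R) : - d <= w -> w <= d -> - d <= t * w <= d.
 move=> w1 w2; rewrite -ler_norml normrM (ger0_norm t0) -[X in _ <= X]mul1r; apply: ler_pM => //.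
 by rewrite ler_norml w1 w2.
have /andP[q1 q2] := bd _ a1 a2; have /andP[q3 q4] := bd _ b1 b2.
by split; apply/andP; split; [lras q1 d0|lras q2 d0|lras q3 d0|lras q4 d0].
have [_ l] := @path_linked _ c1 c2 P J _ _ 0 1 ler01 g1 g2 av.
have E (z p : R) : z + 1 * (p - z) = p by ring.
have h01 : 0 <= (1 : R) <= 1 by rewrite ler01 lexx.
have := av 1 h01; rewrite !E => nC; split => //.
by rewrite !E !mul0r !addr0 in l; split => /l.
Qed.

(** An identity, not an approximation: on the curve the tents of the grid sum to 1 and the ramps to
    the ordinate plus a constant, so the sum is the integral of (y + const) dx, the negative of the
    signed area. *)
Lemma grid_sum (B d : R) n : 0 < d -> n%:R * d = 2 * B -> (forall s, `|c1 s| <= B /\ `|c2 s| <= B) ->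
\sum_(i < n.+1) \sum_(j < n.+1) d ^+ 2 * wind (- B + i%:R * d) (- B + j%:R * d) d = - area0 c1 c2 P.
Proof.
move=> d0 nd HB.
have ccst (k : R) : Cn 0 (fun _ : R => k) by move=> s; exact: cvg_cst.
have cx : Cn 0 c1 by move=> s; exact: der_cvg (jordan_der0 J s).1.
have cy : Cn 0 c2 by move=> s; exact: der_cvg (jordan_der0 J s).2.
have cx1 : Cn 0 x1 by move=> s; exact: der_cvg (jordan_der1 J s).1.
have cy1 : Cn 0 y1 by move=> s; exact: der_cvg (jordan_der1 J s).2.
have cr z : Cn 0 (ramp z d) by move=> s; exact: der_cvg (ramp_der z d s).
have cc (h c : R -> R) : Cn 0 h -> Cn 0 c -> Cn 0 (fun s => h (c s)).
by move=> ch k0 s; apply: (@continuous_comp _ _ _ c h); [exact: k0|exact: ch].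
pose f (i j : nat) s := d ^+ 2 * (tent (- B + i%:R * d) d (c1 s) / d * (ramp (- B + j%:R * d) d (c2 s) / d) * x1 s).
have cw z1 z2 : continuous (fun s => tent z1 d (c1 s) / d * (ramp z2 d (c2 s) / d) * x1 s).
by have h := CnM (CnM (CnM (cc _ _ (@tent_cont _ z1 d) cx) (ccst d^-1)) (CnM (cc _ _ (cr z2) cy) (ccst d^-1))) cx1.
have cf i j : continuous (f i j) by have h := CnM (ccst (d ^+ 2)) (@cw (- B + i%:R * d) (- B + j%:R * d) : Cn 0 _).
have inner (i : 'I_n.+1) := @cint_sum _ P n.+1 (fun j => f i j) (fun j => @cf i j).
have [outer _] := @cint_sum _ P n.+1 (fun i s => \sum_(j < n.+1) f i j s) (fun i => (inner i).2).
have -> : \sum_(i < n.+1) \sum_(j < n.+1) d ^+ 2 * wind (- B + i%:R * d) (- B + j%:R * d) d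
= cint P (fun s => \sum_(i < n.+1) \sum_(j < n.+1) f i j s).
rewrite outer; apply: eq_bigr => i _; rewrite (inner i).1; apply: eq_bigr => j _.
by rewrite /f cintZ //; exact: cw.
have -> : (fun s => \sum_(i < n.+1) \sum_(j < n.+1) f i j s) = fun s => (c2 s + (B + d / 2)) * x1 s.
apply/funext => s.
have bnd (v : R) : `|v| <= B -> - B <= v <= - B + n%:R * d.
 by rewrite nd ler_norml => /andP[h1 h2]; apply/andP; split; [lras h1|lras h2].
have b1 := bnd _ (HB s).1; have b2 := bnd _ (HB s).2.
have st := sum_tent d0 b1; have sr := sum_ramp d0 b2.
transitivity ((\sum_(i < n.+1) tent (- B + i%:R * d) d (c1 s)) * (\sum_(j < n.+1) ramp (- B + j%:R * d) d (c2 s)) * x1 s).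
 rewrite mulr_suml mulr_suml; apply: eq_bigr => i _; rewrite mulr_sumr mulr_suml; apply: eq_bigr => j _.
 by rewrite /f; have := lt0r_neq0 d0 => dn; field.
by rewrite st sr mul1r; congr (_ * _); ring.
have [cA cB] : continuous (fun s => c1 s * y1 s - c2 s * x1 s) /\ continuous (fun s => (c2 s + (B + d / 2)) * x1 s).
by split; [have h := CnD (CnM cx cy1) (CnN (CnM cy cx1))|have h := CnM (CnD cy (ccst (B + d / 2))) cx1].
pose G s := (c1 s * c2 s) / 2 - prim (fun s => c1 s * y1 s - c2 s * x1 s) s / 2 + (B + d / 2) * c1 s.
have dG s : der G s ((c2 s + (B + d / 2)) * x1 s).
have [dx dy] := jordan_der0 J s.
apply: der_eq (derD (derB (derM (derM dx dy) (der_cst 2^-1 s)) (derM (prim_der cA s) (der_cst 2^-1 s))) (derM (der_cst _ s) dx)) _.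
by move: (x1 s) (y1 s) (c1 s) (c2 s) (prim _ _) => p q u v w; field.
rewrite (cint_eq P dG cB) /G /area0 /=.
have [p1 p2] := jordan_per J 0; rewrite add0r in p1 p2; rewrite p1 p2.
by move: (prim _ P) (prim _ 0) (c1 0) (c2 0) => u v w z; field.
Qed.

(** A node whose box meets the curve is within 3 d, in each coordinate, of one of the sample points
    at arc lengths k d, and each sample point has at most 7 times 7 such nodes. *)
Lemma near_count (B d : R) n : 0 < d ->
\sum_(i < n) \sum_(j < n) ((~~ `[< far (- B + i%:R * d) (- B + j%:R * d) (2 * d) >]) : nat)%:R
<= 49 * (P / d + 1) :> R.
Proof.
move=> d0; have P0 := jordan_P J.
pose K := (Num.truncn (P / d)).+1.
have Pd : 0 <= P / d by rewrite divr_ge0 // ltW.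
have Kle : K%:R <= P / d + 1 :> R.
by rewrite -natr1 lerD2r; have /andP[] := truncn_itv Pd.
have Kgt : P / d < K%:R by have /andP[] := truncn_itv Pd.
pose near1 k (i : 'I_n) := `|- B + i%:R * d - c1 (k%:R * d)| <= 3 * d.
pose near2 k (i : 'I_n) := `|- B + i%:R * d - c2 (k%:R * d)| <= 3 * d.
have wnd (v : R) (i j : 'I_n) : `|- B + i%:R * d - v| <= 3 * d -> `|- B + j%:R * d - v| <= 3 * d -> (i <= j + 6)%N.
rewrite !ler_norml => /andP[a1 a2] /andP[b1 b2].
have : i%:R * d <= (j + 6)%:R * d by rewrite natrD mulrDl; move: (i%:R * d) (j%:R * d) a1 a2 b1 b2 => w1 w2 a1 a2 b1 b2; lras a2 b1.
by rewrite ler_pM2r // ler_nat.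
have cnt1 k : (\sum_(i < n) (near1 k i : nat) <= 7)%N by apply: card_window => i j; exact: wnd.
have cnt2 k : (\sum_(i < n) (near2 k i : nat) <= 7)%N by apply: card_window => i j; exact: wnd.
have x1_le s : `|x1 s| <= 1 by rewrite -sqrtr_sqr -[X in _ <= X]sqrtr1 ler_sqrt // -(jordan_unit J s) lerDl sqr_ge0.
have y1_le s : `|y1 s| <= 1 by rewrite -sqrtr_sqr -[X in _ <= X]sqrtr1 ler_sqrt // -(jordan_unit J s) lerDr sqr_ge0.
have pt (i j : 'I_n) : (((~~ `[< far (- B + i%:R * d) (- B + j%:R * d) (2 * d) >]) : nat) <= \sum_(k < K) (near1 k i : nat) * (near2 k j : nat))%N.
case: asboolP => //= nf.
have [s [/andP[a1 a2] /andP[b1 b2]]] : exists s, - B + i%:R * d - 2 * d < c1 s < - B + i%:R * d + 2 * d /\ - B + j%:R * d - 2 * d < c2 s < - B + j%:R * d + 2 * d.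
 by apply: contrapT => no; apply: nf => s hs; apply: no; exists s.
have [m [v [/andP[v0 vP] sE]]] := periodic_red s P0.
have per1 u : c1 (u + P) = c1 u by exact: (jordan_per J u).1.
have per2 u : c2 (u + P) = c2 u by exact: (jordan_per J u).2.
rewrite sE (periodic_int per1 m) in a1 a2; rewrite sE (periodic_int per2 m) in b1 b2.
have vd : 0 <= v / d by rewrite divr_ge0 // ltW.
have /andP[k1 k2] := truncn_itv vd; set k := Num.truncn (v / d) in k1 k2.
rewrite ler_pdivlMr // in k1; rewrite ltr_pdivrMr // -natr1 mulrDl mul1r in k2.
have kK : (k < K)%N by rewrite ltnS; apply: le_truncn; rewrite ler_pM2r ?invr_gt0.
have le : k%:R * d <= v by exact: k1.
have m1 := der_bound le (fun u _ => (jordan_der0 J u).1) (fun u _ => x1_le u).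
have m2 := der_bound le (fun u _ => (jordan_der0 J u).2) (fun u _ => y1_le u).
rewrite (bigD1 (Ordinal kK)) //=.
have -> : near1 k i.
 rewrite /near1; move: m1; rewrite !ler_norml => /andP[m3 m4].
 by apply/andP; split; [lras a1 a2 k2 m3 m4|lras a1 a2 k2 m3 m4].
have -> : near2 k j.
 rewrite /near2; move: m2; rewrite !ler_norml => /andP[m3 m4].
 by apply/andP; split; [lras b1 b2 k2 m3 m4|lras b1 b2 k2 m3 m4].
by rewrite muln1 add1n.
have tot : (\sum_(i < n) \sum_(j < n) ((~~ `[< far (- B + i%:R * d) (- B + j%:R * d) (2 * d) >]) : nat) <= K * 49)%N.
apply: leq_trans (_ : \sum_(i < n) \sum_(j < n) \sum_(k < K) (near1 k i : nat) * (near2 k j : nat) <= _)%N.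
 by apply: leq_sum => i _; apply: leq_sum => j _; exact: pt.
have -> : (\sum_(i < n) \sum_(j < n) \sum_(k < K) (near1 k i : nat) * (near2 k j : nat)
 = \sum_(k < K) (\sum_(i < n) (near1 k i : nat)) * (\sum_(j < n) (near2 k j : nat)))%N.
 under eq_bigr do rewrite exchange_big /=.
 rewrite exchange_big /=; apply: eq_bigr => k _; rewrite big_distrl /=; apply: eq_bigr => i _.
 by rewrite big_distrr.
apply: leq_trans (_ : \sum_(k < K) 49 <= _)%N; last by rewrite sum_nat_const card_ord.
by apply: leq_sum => k _; apply: (leq_mul (cnt1 k) (cnt2 k)).
have -> : \sum_(i < n) \sum_(j < n) ((~~ `[< far (- B + i%:R * d) (- B + j%:R * d) (2 * d) >]) : nat)%:R
= (\sum_(i < n) \sum_(j < n) ((~~ `[< far (- B + i%:R * d) (- B + j%:R * d) (2 * d) >]) : nat))%:R :> R.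
by rewrite natr_sum; apply: eq_bigr => i _; rewrite natr_sum.
apply: le_trans (_ : (K * 49)%:R <= _); first by rewrite ler_nat.
by rewrite natrM mulrC ler_wpM2l.
Qed.

End GridSum.

(** * Lebesgue measure of the enclosed region *)

Section GreenMeasure.
Context {R : realType}.
Implicit Types (z d s r t : R).
Notation mu2 := ((@lebesgue_measure R) \x (@lebesgue_measure R))%E.

Section Cells.
Variables (B d : R).
Hypothesis hd : 0 < d.
Definition cell_itv (i : nat) : set R := `[- B + i%:R * d, - B + i%:R * d + d[%classic.

Lemma cell_itvP i z : cell_itv i z <-> - B + i%:R * d <= z < - B + i%:R * d + d.
Proof. by rewrite /cell_itv /= in_itv. Qed.

Lemma cell_inj i j z : cell_itv i z -> cell_itv j z -> i = j.
Proof.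
move=> /cell_itvP/andP[a1 a2] /cell_itvP/andP[b1 b2].
have lt (k l : nat) : k%:R * d < l%:R * d + d -> (k <= l)%N.
by rewrite -[X in _ < _ + X]mul1r -mulrDl natr1 ltr_pM2r // ltr_nat ltnS.
apply/eqP; rewrite eqn_leq; apply/andP; split; apply: lt.
by move: (i%:R * d) (j%:R * d) a1 a2 b1 b2 => w1 w2 a1 a2 b1 b2; lras a1 b2.
by move: (i%:R * d) (j%:R * d) a1 a2 b1 b2 => w1 w2 a1 a2 b1 b2; lras a2 b1.
Qed.

Lemma cell_index n z : n%:R * d = 2 * B -> - B <= z <= B -> exists2 i, (i < n.+1)%N & cell_itv i z.
Proof.
move=> nd /andP[z1 z2].
have q0 : 0 <= (z + B) / d by rewrite divr_ge0 ?(ltW hd) //; lras z1.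
have /andP[k1 k2] := truncn_itv q0; exists (Num.truncn ((z + B) / d)).
have e : n.+1%:R * d = 2 * B + d by rewrite -[n.+1%:R]natr1 mulrDl mul1r nd.
have zb : z + B <= 2 * B by lra.
by rewrite ltnS truncn_le_nat ltr_pdivrMr // e; apply: le_lt_trans zb _; rewrite ltrDl.
rewrite ler_pdivlMr // in k1; rewrite ltr_pdivrMr // -natr1 mulrDl mul1r in k2.
by apply/cell_itvP; move: (_%:R * d) k1 k2 => w k1 k2; apply/andP; split; [lras k1|lras k2].
Qed.

Lemma cell_itv_measurable i : measurable (cell_itv i).
Proof. exact: measurable_itv. Qed.

Lemma cell_measure i j : mu2 (cell_itv i `*` cell_itv j) = (d ^+ 2)%:E.
Proof.
rewrite product_measure1E; [|exact: measurable_itv|exact: measurable_itv].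
have len k : lebesgue_measure (cell_itv k) = d%:E.
rewrite /cell_itv lebesgue_measure_itv /= lte_fin ltrDl hd -EFinB; congr EFin; ring.
rewrite expr2 EFinM; congr (_ * _)%E; exact: len.
Qed.

Lemma slices_sum (E : set (R * R)) n : n%:R * d = 2 * B -> measurable E ->
(forall p, E p -> - B <= p.1 <= B /\ - B <= p.2 <= B) ->
mu2 E = (\sum_(i < n.+1) \sum_(j < n.+1) mu2 (E `&` (cell_itv i `*` cell_itv j)))%E.
Proof.
move=> nd mE bE.
have mI i := cell_itv_measurable i.
pose F i := E `&` (cell_itv i `*` setT).
have mF i : measurable (F i) by apply: measurableI => //; apply: measurableX.
have tF : trivIset setT F.
by move=> i j _ _ [p [[_ [h1 _]] [_ [h2 _]]]]; exact: cell_inj h1 h2.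
have eF : E = \big[setU/set0]_(i < n.+1) F i.
rewrite -bigcup_mkord; apply/seteqP; split=> [p Ep|p [i _ []//]].
by have [i hi ci] := cell_index nd (bE p Ep).1; exists i.
rewrite {1}eF (measure_bigsetU mu2 mF tF); apply: eq_bigr => i _.
pose G j := E `&` (cell_itv i `*` cell_itv j).
have mG j : measurable (G j) by apply: measurableI => //; apply: measurableX.
have tG : trivIset setT G.
by move=> j k _ _ [p [[_ [_ h1]] [_ [_ h2]]]]; exact: cell_inj h1 h2.
have eG : F i = \big[setU/set0]_(j < n.+1) G j.
rewrite -bigcup_mkord; apply/seteqP; split=> [p [Ep [h1 _]]|p [j _ [Ep [h1 h2]]]]; last by split.
by have [j hj cj] := cell_index nd (bE p Ep).2; exists j.
by rewrite eG (measure_bigsetU mu2 mG tG).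
Qed.

End Cells.

Variables (c1 c2 : R -> R) (P eps : R).
Hypothesis J : arclength_jordan c1 c2 P.
Hypothesis O : inward_orientation c1 c2 eps.
Notation C := (curve_image c1 c2).
Notation D := (enclosed C).
Notation wind := (wind c1 c2 P).
Notation far := (far c1 c2).

Let node B d (i : nat) : R := - B + i%:R * d.

Lemma cell_full B d i j : 0 < d -> far (node B d i) (node B d j) (2 * d) ->
(D (node B d i, node B d j) -> D `&` (cell_itv B d i `*` cell_itv B d j) = cell_itv B d i `*` cell_itv B d j) /\
(~ D (node B d i, node B d j) -> D `&` (cell_itv B d i `*` cell_itv B d j) = set0).
Proof.
move=> d0 f.
have lk p : (cell_itv B d i `*` cell_itv B d j) p -> D p <-> D (node B d i, node B d j).
case: p => p1 p2 [/= /cell_itvP/andP[a1 a2] /cell_itvP/andP[b1 b2]].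
apply: (cell_linked J d0 f _ _).2.
 by rewrite ger0_norm ?subr_ge0 // /node; lras a2.
by rewrite ger0_norm ?subr_ge0 // /node; lras b2.
split=> hD; apply/seteqP; split=> p //.
- by case.
- by move=> hp; split=> //; apply/(lk p hp).
- by case=> Dp hp; apply: hD; apply/(lk p hp).
Qed.

(** The region is a countable union of cells, over all grid sizes: those with node inside and with a
    box of twice the cell size free of the curve. *)
Lemma enclosed_measurable : measurable D.
Proof.
have [B B0 HB] := jordan_bounded J.
pose d (n : nat) := 2 * B / n.+1%:R.
have d0 n : 0 < d n by rewrite divr_gt0 // mulr_gt0.
pose A n i j : set (R * R) := if `[< far (node B (d n) i) (node B (d n) j) (2 * d n) /\ D (node B (d n) i, node B (d n) j) >]
then cell_itv B (d n) i `*` cell_itv B (d n) j else set0.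
have mA n i j : measurable (A n i j).
by rewrite /A; case: ifP => _ //; apply: measurableX; exact: cell_itv_measurable.
have -> : D = \bigcup_n \bigcup_i \bigcup_j A n i j; last first.
by apply: bigcup_measurable => n _; apply: bigcup_measurable => i _; apply: bigcup_measurable => j _.
apply/seteqP; split=> [[z1 z2] Dz|p [n _ [i _ [j _]]]]; last first.
by rewrite /A; case: asboolP => // -[f hD] hp; have [h _] := cell_full (d0 n) f; rewrite -(h hD) in hp; case: hp.
have [nC _] := Dz; have [e e0 f] := offC J nC.
have e8 : 0 < e / (8 * B) by rewrite divr_gt0 // mulr_gt0.
have [n hn] := inv_nat_small e8; have {}hn := hn n (leqnn n).
have dn : 4 * d n < e.
have -> : 4 * d n = n.+1%:R^-1 * (8 * B) by rewrite /d; ring.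
by rewrite -ltr_pdivlMr // mulr_gt0.
have nd : n.+1%:R * d n = 2 * B by rewrite /d mulrC divfK // pnatr_eq0.
have [b1 b2] := enclosed_bounded J O HB Dz; rewrite !ler_norml in b1 b2.
have [i _ ci] := cell_index (d0 n) nd b1; have [j _ cj] := cell_index (d0 n) nd b2.
exists n => //; exists i => //; exists j => //.
have /cell_itvP/andP[a1 a2] := ci; have /cell_itvP/andP[a3 a4] := cj.
have fn : far (node B (d n) i) (node B (d n) j) (2 * d n).
move=> s [/andP[g1 g2] /andP[g3 g4]]; apply: (f s); rewrite /node in g1 g2 g3 g4.
split; apply/andP; split; [lras a1 a2 g1 dn|lras a1 a2 g2 dn|lras a3 a4 g3 dn|lras a3 a4 g4 dn].
rewrite /A; case: asboolP => [_|]; first by split.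
case; split => //.
apply: (proj1 (cell_linked J (d0 n) fn _ _).2 Dz).
by rewrite ger0_norm ?subr_ge0 // /node; lras a2.
by rewrite ger0_norm ?subr_ge0 // /node; lras a4.
Qed.

(** Cells away from the curve contribute exactly the winding number times d^2, up to the sign wp.
    The other cells are O(1 / d) in number and cost O(d^2) each, so the error is O(d), while neither
    total depends on d. *)
Theorem green_area : mu2 D = (`|area0 c1 c2 P|)%:E.
Proof.
have [B B0 HB] := jordan_bounded J; have P0 := jordan_P J.
have [wp [hwp Hw]] := winding_values J O.
have [d0 [K [d00 K0 HK]]] := wind_bounded J O.
have mD := enclosed_measurable.
have bD p : D p -> - B <= p.1 <= B /\ - B <= p.2 <= B.
by case: p => p1 p2 /(enclosed_bounded J O HB) [h1 h2] /=; rewrite -!ler_norml.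
have key n (d := 2 * B / n.+1%:R) : d <= d0 -> d <= 1 -> exists2 M : R, mu2 D = M%:E &
 0 <= M /\ `|M + wp * area0 c1 c2 P| <= 49 * (1 + K) * (P + 1) * d.
move=> dd0 d1; have dp : 0 < d by rewrite divr_gt0 // mulr_gt0.
have nd : n.+1%:R * d = 2 * B by rewrite /d mulrC divfK // pnatr_eq0.
have cellm i j : measurable (D `&` (cell_itv B d i `*` cell_itv B d j)).
 by apply: measurableI => //; apply: measurableX; exact: cell_itv_measurable.
have le i j : (mu2 (D `&` (cell_itv B d i `*` cell_itv B d j)) <= (d ^+ 2)%:E)%E.
 rewrite -(cell_measure B dp i j).
 have mc : measurable (cell_itv B d i `*` cell_itv B d j) by apply: measurableX; exact: cell_itv_measurable.
 by apply: le_measure; [rewrite inE; exact: cellm|rewrite inE; exact: mc|move=> p []].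
pose m i j := fine (mu2 (D `&` (cell_itv B d i `*` cell_itv B d j))).
have mE i j : mu2 (D `&` (cell_itv B d i `*` cell_itv B d j)) = (m i j)%:E.
 rewrite fineK // ge0_fin_numE //; apply: le_lt_trans (le i j) (ltry _).
have m0 i j : 0 <= m i j by rewrite fine_ge0.
have m1 i j : m i j <= d ^+ 2 by rewrite -lee_fin -mE.
pose nr i j : R := (((~~ `[< far (node B d i) (node B d j) (2 * d) >]) : bool) : nat)%:R.
(* No error where the box of the node is free; elsewhere the two terms are at most d^2 and K d^2. *)
have cmp i j : `|m i j - wp * (d ^+ 2 * wind (node B d i) (node B d j) d)| <= (1 + K) * d ^+ 2 * nr i j.
 have d2 : 0 <= d ^+ 2 by exact: sqr_ge0.
 rewrite /nr; case: asboolP => [f|_] /=; last first.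
 rewrite mulr1; apply: le_trans (ler_normB _ _) _; rewrite (ger0_norm (m0 i j)) mulrDl mul1r.
 apply: lerD => //; rewrite normrM (_ : `|wp| = 1); last by case: hwp => ->; rewrite ?normrN normr1.
 rewrite mul1r normrM (ger0_norm d2) mulrC ler_wpM2r //; apply: HK; by rewrite dp.
 rewrite mulr0 normr_le0 subr_eq0; apply/eqP.
 have f1 : far (node B d i) (node B d j) d.
 by move=> s [/andP[g1 g2] /andP[g3 g4]]; apply: (f s); split; apply/andP; split; [lras g1 dp|lras g2 dp|lras g3 dp|lras g4 dp].
 have nC := far_off dp f1; rewrite -(wnE J dp f1).
 have [h1 h2] := cell_full dp f; have [w1 w2] := Hw _ _ nC.
 have [dz|dz] := pselect (D (node B d i, node B d j)).
 rewrite (w1 dz) /m (h1 dz) (cell_measure B dp) /=.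
 by case: hwp => ->; ring.
 by rewrite (w2 dz) /m (h2 dz) measure0 /= !mulr0.
exists (\sum_(i < n.+2) \sum_(j < n.+2) m i j).
 rewrite (slices_sum dp nd mD bD) -sumEFin; apply: eq_bigr => i _.
 by rewrite -sumEFin; apply: eq_bigr => j _; exact: mE.
split; first by apply: sumr_ge0 => i _; apply: sumr_ge0 => j _.
have gs := grid_sum J dp nd HB.
have -> : \sum_(i < n.+2) \sum_(j < n.+2) m i j + wp * area0 c1 c2 P
 = \sum_(i < n.+2) \sum_(j < n.+2) (m i j - wp * (d ^+ 2 * wind (node B d i) (node B d j) d)).
 have -> : wp * area0 c1 c2 P = - (wp * - area0 c1 c2 P) by rewrite mulrN opprK.
 rewrite -gs mulr_sumr -sumrB; apply: eq_bigr => i _.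
 by rewrite mulr_sumr -sumrB.
apply: le_trans (_ : \sum_(i < n.+2) \sum_(j < n.+2) (1 + K) * d ^+ 2 * nr i j <= _).
 apply: le_trans (ler_norm_sum _ _ _) _; apply: ler_sum => i _.
 by apply: le_trans (ler_norm_sum _ _ _) _; apply: ler_sum => j _; exact: cmp.
have -> : \sum_(i < n.+2) \sum_(j < n.+2) (1 + K) * d ^+ 2 * nr i j
 = (1 + K) * d ^+ 2 * \sum_(i < n.+2) \sum_(j < n.+2) nr i j.
 by rewrite mulr_sumr; apply: eq_bigr => i _; rewrite mulr_sumr.
have nc := near_count J B n.+2 dp.
have K1 : 0 <= 1 + K by rewrite addr_ge0.
apply: le_trans (_ : (1 + K) * d ^+ 2 * (49 * (P / d + 1)) <= _).
 by apply: ler_wpM2l => //; apply: mulr_ge0 => //; exact: sqr_ge0.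
have -> : (1 + K) * d ^+ 2 * (49 * (P / d + 1)) = 49 * (1 + K) * (P + d) * d.
 by have := lt0r_neq0 dp => dn; field.
apply: ler_wpM2r; first exact: ltW.
by apply: ler_wpM2l; [rewrite mulr_ge0|rewrite lerD2l].
have dsmall (e : R) : 0 < e -> exists n, 2 * B / n.+1%:R < e.
move=> e0; have e8 : 0 < e / (2 * B) by rewrite divr_gt0 // mulr_gt0.
have [n hn] := inv_nat_small e8; exists n; have := hn n (leqnn n).
by rewrite ltr_pdivlMr ?mulr_gt0 // mulrC.
have mn : 0 < Num.min d0 1 by rewrite lt_min d00 ltr01.
have [n0 hn0] := dsmall _ mn; move: hn0; rewrite lt_min => /andP[/ltW q1 /ltW q2].
have [M ME [M0 _]] := key n0 q1 q2.
have Meq : M + wp * area0 c1 c2 P = 0.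
apply/eqP; rewrite -normr_le0 leNgt; apply/negP => hv.
set v := `|_| in hv; have K1 : 0 < 49 * (1 + K) * (P + 1).
 by rewrite !mulr_gt0 // ltr_wpDr.
have e0 : 0 < Num.min (Num.min d0 1) (v / (49 * (1 + K) * (P + 1))) by rewrite lt_min mn divr_gt0.
have [n hn] := dsmall _ e0; move: hn; rewrite !lt_min => /andP[/andP[/ltW g1 /ltW g2] g3].
have [M' ME' [_ h]] := key n g1 g2.
have MM : M' = M by move: ME'; rewrite ME => -[].
rewrite MM -/v in h; rewrite ltr_pdivlMr // mulrC in g3.
by move: h; rewrite leNgt g3.
have E : `|M| = `|wp * area0 c1 c2 P| by rewrite -[RHS]normrN; congr (`|_|); apply/eqP; rewrite -addr_eq0 Meq.
rewrite ME; congr EFin; rewrite -[LHS](ger0_norm M0) E normrM.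
by case: hwp => ->; rewrite ?normrN normr1 mul1r.
Qed.

End GreenMeasure.

(** * Parabolic maximum principle and nested bounding boxes *)

Section MaximumPrinciple.
Context {R : realType}.
Implicit Types (u s t : R).

(** Subtract dl (s - t0). At a maximum of the perturbed function after t0 the time derivative of f
    is at least dl > 0, whereas the sign hypothesis makes it nonpositive. *)
Lemma parabolic_max (f f1 f2 ft : R -> R -> R) (P t0 t1 B : R) : 0 < P -> t0 <= t1 ->
(forall u s, t0 <= s <= t1 -> f (u + P) s = f u s) ->
cont_on [set s : R | t0 <= s <= t1] f ->
(forall u s, t0 < s <= t1 ->
 [/\ der (f ^~ s) u (f1 u s), der (f1 ^~ s) u (f2 u s) & der (f u) s (ft u s)]) ->
(forall u s, t0 < s <= t1 -> f1 u s = 0 -> f2 u s <= 0 -> ft u s <= 0) ->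
(forall u, f u t0 <= B) -> forall u, f u t1 <= B.
Proof.
move=> P0 t01 per cf ders sgn hB u; apply/ler_addgt0Pr => e e0.
have q0 : 0 < t1 - t0 + 1 by rewrite ltr_wpDl // subr_ge0.
pose dl := e / (t1 - t0 + 1); have dl0 : 0 < dl by rewrite divr_gt0.
pose F v s := f v s - dl * (s - t0).
have cF : cont_on [set s : R | t0 <= s <= t1] F.
apply: cont_onB => //; apply: cont_onM; first exact: cont_on_cst.
apply: cont_onB; last exact: cont_on_cst.
by move=> v s _ e1 e10; exists e1 => // ? ? _ _.
have cA : compact (`[0, P] `*` `[t0, t1] : set (R * R)) by apply: compact_setX; exact: segment_compact.
have A0 : (`[0, P] `*` `[t0, t1] : set (R * R)) !=set0.
by exists (0, t0); split; rewrite /= in_itv /= lexx; [exact: ltW P0|exact: t01].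
have cw : {within (`[0, P] `*` `[t0, t1] : set (R * R)), continuous (fun z : R * R => F z.1 z.2)}.
move/cont_onP : cF; apply: continuous_subspaceW => z [_] /=; by rewrite in_itv.
have [[us ss] /set_mem[/= + +] hmax] := compact_EVT_max A0 cA cw.
rewrite !in_itv /= => hus hss.
have hM v s : t0 <= s <= t1 -> F v s <= F us ss.
move=> hs; have [j [w [hw ->]]] := periodic_red v P0.
have -> : F (w + j%:~R * P) s = F w s.
 by rewrite /F (@periodic_int _ _ (f ^~ s) P (fun z => per z s hs)).
by apply: (hmax (w, s)); rewrite inE; split; rewrite /= in_itv.
have fin : F us ss <= B -> f u t1 <= B + e.
move=> hf; have t11 : t0 <= t1 <= t1 by rewrite t01 lexx.
have := le_trans (hM u t1 t11) hf; rewrite /F lerBlDr => /le_trans; apply.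
rewrite lerD2l /dl mulrAC ler_pdivrMr // ler_wpM2l ?(ltW e0) // lerDl.
exact: ler01.
case/andP: (hss) => ts0 st1; move: ts0; rewrite le_eqVlt => /orP[/eqP tss|ts].
by apply: fin; rewrite -tss /F subrr mulr0 subr0.
have hs : t0 < ss <= t1 by rewrite ts.
have [d1 d2 d3] := ders us ss hs.
have mx v : f v ss <= f us ss by have := hM v ss hss; rewrite /F lerD2r.
have z1 : f1 us ss = 0.
apply/eqP; rewrite -oppr_eq0; apply/eqP; apply: (@min_der0 _ (fun v => - f v ss) us _ 1) (derN d1) => //.
by move=> h _; rewrite lerN2.
have z2 : f2 us ss <= 0.
rewrite -oppr_ge0; apply: (@min_der2 _ (fun v => - f v ss) (fun v => - f1 v ss) us _ 1) (derN d2) _ => //.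
 by move=> v _; apply: derN; case: (ders v ss hs).
by move=> h _; rewrite lerN2.
have := sgn us ss hs z1 z2.
have d4 : der (fun s => - F us s) ss (- (ft us ss - dl)).
apply: derN; apply: der_eq (derB d3 (derM (der_cst dl ss) (derB (der_id ss) (der_cst t0 ss)))) _.
by rewrite mul0r add0r subr0 mulr1.
have := @left_der_le0 _ (fun s => - F us s) ss _ (ss - t0) _ _ d4.
rewrite subr_gt0 => /(_ ts) h.
have {}h : - (ft us ss - dl) <= 0.
apply: h => h /andP[h0 h1]; rewrite lerN2; apply: hM.
by case/andP: hss => _ h2; apply/andP; split; [lraw h1|lraw h0 h2].
by move=> h3; exfalso; lraw h3 h dl0.
Qed.

Section FlowBox.
Variables (a : R -> R) (eps : R) (c1 c2 : R -> R) (P : R) (x y : R -> R -> R) (T : R).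
Hypothesis F : flowing a eps c1 c2 P x y T.
Let H := flowing_sol F.

Let speed_alg (aa kk g X1 Y1 X2 Y2 : R) : 0 < aa -> 0 < g -> kk = (X1 * Y2 - Y1 * X2) / g ^+ 3 ->
(X1 = 0 -> - (aa * kk) * (Y1 / g) = aa * (Y1 / g ^+ 2) ^+ 2 * X2) /\
(Y1 = 0 -> aa * kk * (X1 / g) = aa * (X1 / g ^+ 2) ^+ 2 * Y2).
Proof. by move=> a0 g0 ->; split=> ->; field; rewrite gt_eqF. Qed.

(** At a critical point of a coordinate, its velocity is a nonnegative multiple of its second
    derivative, whatever the mobility; the sign sg covers maxima and minima. *)
Lemma flow_box sg t1 t2 B : sg = 1 \/ sg = -1 -> 0 <= t1 -> t1 <= t2 -> t2 < T ->
((forall u, sg * x u t1 <= B) -> forall u, sg * x u t2 <= B) /\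
((forall u, sg * y u t1 <= B) -> forall u, sg * y u t2 <= B).
Proof.
move=> hsg t10 t12 t2T.
have sub s : t1 <= s <= t2 -> 0 <= s < T.
by case/andP=> h1 h2; rewrite (le_trans t10 h1) (le_lt_trans h2 t2T).
have sub' s : t1 < s <= t2 -> 0 < s < T.
by case/andP=> h1 h2; rewrite (le_lt_trans t10 h1) (le_lt_trans h2 t2T).
have subw s : t1 < s <= t2 -> 0 <= s < T.
by move/sub' => /andP[/ltW -> ->].
have [cx cy] := flow_cont H 0.
have cs (f : R -> R -> R) : cont_on [set t : R | 0 <= t < T] f ->
 cont_on [set s : R | t1 <= s <= t2] (fun u s => sg * f u s).
move=> cf; apply: cont_onM; first exact: cont_on_cst.
exact: (cont_on_sub sub cf).
have dm (f : R -> R) u l : der f u l -> der (fun v => sg * f v) u (sg * l).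
by move=> d; apply: der_eq (derM (der_cst sg u) d) _; rewrite mul0r add0r.
have sg0 z : sg * z = 0 -> z = 0.
by case: hsg => ->; rewrite ?mulN1r ?mul1r // => /eqP; rewrite oppr_eq0 => /eqP.
have al u s (hs : t1 < s <= t2) := speed_alg (flowing_a0 F (tangle x y u s)) (speed_gt0 H u (subw s hs))
(erefl (kurv x y u s)).
split; apply: (@parabolic_max (fun u s => sg * _ u s) (fun u s => sg * du _ u s)
(fun u s => sg * du (du _) u s) (fun u s => sg * dt _ u s) P t1 t2 B (flowing_P F) t12).
- by move=> u s hs; rewrite (flow_periodic F u (sub s hs)).1.
- exact: (cs _ cx).
- move=> u s hs; split; apply: dm.
+ exact: (flow_space0 F u (subw s hs)).1.
+ exact: (flow_space1 H u (subw s hs)).1.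
+ exact: (flow_time H 0 u (sub' s hs)).1.
- move=> u s hs /sg0 z1 z2; have e := (al u s hs).1 z1.
rewrite ((flow_eq (flowing_eps F) H u (sub' s hs)).1) e mulrCA.
by apply: mulr_ge0_le0 => //; apply: mulr_ge0; [exact: ltW (flowing_a0 F _)|exact: sqr_ge0].
- by move=> u s hs; rewrite (flow_periodic F u (sub s hs)).2.
- exact: (cs _ cy).
- move=> u s hs; split; apply: dm.
+ exact: (flow_space0 F u (subw s hs)).2.
+ exact: (flow_space1 H u (subw s hs)).2.
+ exact: (flow_time H 0 u (sub' s hs)).2.
- move=> u s hs /sg0 z1 z2; have e := (al u s hs).2 z1.
rewrite ((flow_eq (flowing_eps F) H u (sub' s hs)).2) e mulrCA.
by apply: mulr_ge0_le0 => //; apply: mulr_ge0; [exact: ltW (flowing_a0 F _)|exact: sqr_ge0].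
Qed.

Lemma dist_later t1 t2 u : 0 <= t1 -> t1 <= t2 -> t2 < T ->
`|x u t2 - x 0 t1| <= alen x y 0 P t1 /\ `|y u t2 - y 0 t1| <= alen x y 0 P t1.
Proof.
move=> t10 t12 t2T; have ht : 0 <= t1 < T by rewrite t10 (le_lt_trans t12 t2T).
have D v := dist_le_length F 0 v ht.
have [p1 p2] := @flow_box 1 t1 t2 (x 0 t1 + alen x y 0 P t1) (or_introl erefl) t10 t12 t2T.
have [_ p3] := @flow_box 1 t1 t2 (y 0 t1 + alen x y 0 P t1) (or_introl erefl) t10 t12 t2T.
have [n1 _] := @flow_box (-1) t1 t2 (- x 0 t1 + alen x y 0 P t1) (or_intror erefl) t10 t12 t2T.
have [_ n3] := @flow_box (-1) t1 t2 (- y 0 t1 + alen x y 0 P t1) (or_intror erefl) t10 t12 t2T.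
have Dx v : - alen x y 0 P t1 <= x v t1 - x 0 t1 <= alen x y 0 P t1 by rewrite -ler_norml; exact: (D v).1.
have Dy v : - alen x y 0 P t1 <= y v t1 - y 0 t1 <= alen x y 0 P t1 by rewrite -ler_norml; exact: (D v).2.
move: (alen x y 0 P t1) => l in p1 p2 p3 n1 n3 Dx Dy *.
have h1 : 1 * x u t2 <= x 0 t1 + l.
by apply: p1 => v; have /andP[d1 d2] := Dx v; lras d1 d2.
have h2 : -1 * x u t2 <= - x 0 t1 + l.
by apply: n1 => v; have /andP[d1 d2] := Dx v; lras d1 d2.
have h3 : 1 * y u t2 <= y 0 t1 + l.
by apply: p3 => v; have /andP[d1 d2] := Dy v; lras d1 d2.
have h4 : -1 * y u t2 <= - y 0 t1 + l.
by apply: n3 => v; have /andP[d1 d2] := Dy v; lras d1 d2.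
by rewrite !ler_norml; split; apply/andP; split; lras h1 h2 h3 h4.
Qed.

End FlowBox.
End MaximumPrinciple.

(** * Uniform decay of the length at extinction *)

Section NearExtinction.
Context {R : realType}.
Implicit Types (u s t : R).

Lemma dissip_le (a : R -> R) eps c1 c2 P x y T K0 t (F : flowing a eps c1 c2 P x y T) :
0 <= t < T -> (forall s, a s <= 1) -> (forall u, `|kurv x y u t| <= K0) ->
dissip a x y 0 P t <= K0 ^+ 2 * alen x y 0 P t :> R.
Proof.
move=> ht a1 hk; have H := flowing_sol F; have P0 := flowing_P F.
pose D := prim (fun v => a (tangle x y v t) * kurv x y v t ^+ 2 * speed x y v t).
pose S := prim (speed x y ^~ t).
have dD u : der D u (a (tangle x y u t) * kurv x y u t ^+ 2 * speed x y u t).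
exact: (dissip_der (fun s => @flowing_da _ _ _ _ _ _ _ _ _ F s) H u ht).
have dS u : der S u (speed x y u t) by exact: (arc_der H u ht).
have h : K0 ^+ 2 * S 0 - D 0 <= K0 ^+ 2 * S P - D P.
apply: (@der_ge0_le _ (fun u => K0 ^+ 2 * S u - D u)
 (fun u => K0 ^+ 2 * speed x y u t - a (tangle x y u t) * kurv x y u t ^+ 2 * speed x y u t)); first exact: ltW.
 move=> u _; apply: derB (dD u); apply: der_eq (derM (der_cst _ u) (dS u)) _.
 by rewrite mul0r add0r.
move=> u _; rewrite -mulrBl mulr_ge0 ?(ltW (speed_gt0 H u ht)) // subr_ge0.
have k2 : kurv x y u t ^+ 2 <= K0 ^+ 2.
 by rewrite -real_normK ?num_real // ler_sqr ?nnegrE ?(le_trans _ (hk u)) ?normr_ge0.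
by apply: le_trans k2; rewrite ler_piMl ?sqr_ge0 // a1.
rewrite /dissip /alen -/D -/S; move: (D P) (D 0) (S P) (S 0) h => d1 d0 s1 s0 h.
by rewrite mulrBr; lraw h.
Qed.

(** If the length were at least e at time t, then as long as it is at least e / 2 the curvature is
    bounded by some k and the length decays at a rate of at most k^2, too slowly to halve before T.
    The curvature would be bounded up to T, against [bounded_no_shrink]. *)
Lemma length_small (c1 c2 : R -> R) (P K Tm e : R) : arclength_jordan c1 c2 P -> 0 <= K -> 0 <= Tm -> 0 < e ->
exists e0 c : R, [/\ 0 < e0, 0 < c & forall a eps x y T e1 t, flowing a eps c1 c2 P x y T ->
 admissible a K e1 -> 0 <= e1 <= e0 -> T <= Tm -> 0 <= t < T -> T - t < c -> alen x y 0 P t < e].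
Proof.
move=> J K0 Tm0 e0; have e20 : 0 < e / 2 by rewrite divr_gt0.
have [d [k [d0 hk]]] := curvature_bound J K0 e20 Tm0.
pose m := k ^+ 2 + 1; have m0 : 0 < m by rewrite ltr_wpDl ?sqr_ge0.
exists (Num.min d (1 / 1000)), (2 * m)^-1; split.
- by rewrite lt_min d0 /=; lraw m0.
- by rewrite invr_gt0 mulr_gt0.
move=> a eps x y T e1 t F ad /andP[e10 ed] TTm /andP[t0 tT] hc.
have e1d : 0 <= e1 <= d by rewrite e10 (le_trans ed) // ge_min lexx.
have e1s : e1 <= 1 / 1000 by rewrite (le_trans ed) // ge_min lexx orbT.
have H := flowing_sol F; have P0 := flowing_P F.
rewrite ltNge; apply/negP => hL.
have [L LE] : exists L : R -> R, L = alen x y 0 P by eexists.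
have hL' : e <= L t by rewrite LE.
have mono s1 s2 : 0 <= s1 -> s1 <= s2 -> s2 < T -> L s2 <= L s1 by rewrite LE; exact: (length_noninc F).
have cb s : 0 <= s < T -> e / 2 <= L s -> forall u r, 0 <= r <= s -> `|kurv x y u r| <= k.
move=> hs0 hs; apply: (hk a eps x y T s e1 F ad e1d hs0).
 by case/andP: hs0 => _ sT; exact: le_trans (ltW sT) TTm.
move=> r /andP[r0 rs]; case/andP: hs0 => _ sT; exact: (le_trans (le_trans hs (mono r s r0 rs sT)) (eq_ind_r (fun z : R -> R => z r <= _) (lexx _) LE)).
have a1 s : a s <= 1 by have /andP[_ q] := admissible_bounds s ad e1s; lraw q.
have z0 (v d' : R) : 0 < d' -> `|v - v| < d' by rewrite subrr normr0.
have Lc s : 0 <= s < T -> forall e', 0 < e' -> exists2 d' : R, 0 < d' &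
forall t', 0 <= t' < T -> `|t' - s| < d' -> `|L t' - L s| < e'.
rewrite LE; move=> hs e' e'0; have [d' d'0 h] := alen_cont F 0 P hs e'0.
exists d'; first exact: d'0.
by move=> t' ht' hd; exact: (h 0 P t' ht' (z0 0 d' d'0) (z0 P d' d'0) hd).
have big s : 0 <= s < T -> e / 2 <= L s.
move=> /andP[s0 sT]; rewrite leNgt; apply/negP => hs.
have ts : t < s.
 rewrite ltNge; apply/negP => st; have := mono s t s0 st tT.
 by move=> q; lraw q hs hL' e0.
have cont r1 r2 : 0 <= r1 -> r2 < T -> forall r, r1 <= r <= r2 -> forall e', 0 < e' ->
 exists2 d' : R, 0 < d' & forall t', r1 <= t' <= r2 -> `|t' - r| < d' -> `|L t' - L r| < e'.
 move=> r10 r2T r /andP[q1 q2] e' e'0.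
 have hr : 0 <= r < T by rewrite (le_trans r10) //= (le_lt_trans q2).
 have [d' d'0 h] := Lc r hr e' e'0; exists d'; first exact: d'0.
 move=> t' /andP[q3 q4] hd; apply: h; last exact: hd.
 by rewrite (le_trans r10) //= (le_lt_trans q4).
have cw : {within `[t, s], continuous L} by apply: within_eps; exact: (cont t s t0 sT).
have [s2 /andP[q1 q2] Ls2] : exists2 r : R, t <= r <= s & L r = e / 2.
 apply: (ivt_within (ltW ts) cw); right; apply/andP; split; first exact: ltW.
 by lraw hL' e0.
have s2T : s2 < T := le_lt_trans q2 sT.
have ts2 : t < s2.
 by rewrite lt_neqAle q1 andbT; apply/eqP => E; move: Ls2; rewrite -E => q; lraw q hL' e0.
have hs2 : 0 <= s2 < T by rewrite (le_trans t0 q1).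
have bk := cb s2 hs2 (eq_ind_r (fun z => e / 2 <= z) (lexx _) Ls2).
have dL r : t < r < s2 -> der L r (- dissip a x y 0 P r).
 case/andP=> q3 q4; have hr : 0 < r < T by rewrite (le_lt_trans t0 q3) (lt_trans q4 s2T).
 by rewrite LE; exact: (arc_time (flowing_eps F) (fun s => @flowing_da _ _ _ _ _ _ _ _ _ F s) H (ltW P0) hr).
have [r /andP[r1 r2] Er] := mvt_open ts2 dL (cont t s2 t0 s2T).
have r0 : 0 <= r := le_trans t0 (ltW r1).
have rT : 0 <= r < T by rewrite r0 (lt_trans r2).
have dl : dissip a x y 0 P r <= k ^+ 2 * L r.
 by rewrite LE; apply: (dissip_le F rT a1) => u; apply: bk; rewrite r0 (ltW r2).
have Lr : L r <= L t := mono t r t0 (ltW r1) (lt_trans r2 s2T).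
have hcm : (s2 - t) * m <= 1 / 2.
 have : (s2 - t) * m <= (2 * m)^-1 * m.
 by rewrite ler_pM2r //; lraw hc s2T.
 by move/le_trans; apply; rewrite invfM mulfVK ?gt_eqF // div1r.
have k2 := sqr_ge0 k.
have Lr0 : 0 <= L r by rewrite LE; exact: (alen_ge0 F (ltW P0) rT).
have dl' : dissip a x y 0 P r <= (m - 1) * L t.
 apply: le_trans dl _; rewrite /m addrK; exact: ler_wpM2l.
have g0 : 0 < s2 - t by rewrite subr_gt0.
have g1 : dissip a x y 0 P r * (s2 - t) <= (m - 1) * L t * (s2 - t) by rewrite ler_pM2r.
have Lt0 : 0 < L t := lt_le_trans e0 hL'.
have g2 : (s2 - t) * m * L t <= 1 / 2 * L t by rewrite ler_pM2r.
have g3 : 0 < L t * (s2 - t) by rewrite mulr_gt0.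
move: Er g1; rewrite Ls2 mulNr; move: (dissip a x y 0 P r * (s2 - t)) => z Er g1.
have g4 : (m - 1) * L t * (s2 - t) = (s2 - t) * m * L t - L t * (s2 - t) by ring.
rewrite g4 in g1; move: ((s2 - t) * m * L t) (L t * (s2 - t)) g1 g2 g3 => z1 z2 g1 g2 g3.
by lraw Er g1 g2 g3 hL'.
apply: (bounded_no_shrink F (K := k)) => u r hr.
by apply: (cb r hr (big r hr)); case/andP: hr => -> _; rewrite lexx.
Qed.

End NearExtinction.

(** * Uniform data of the regularised flows *)

Section Assembly.
Context {R : realType}.
Implicit Types (u s t w e : R).

Lemma sqrt_lip (v w : R) : 1 / 16 <= v -> 1 / 16 <= w -> `|Num.sqrt v - Num.sqrt w| <= 2 * `|v - w|.
Proof.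
have s4 (z : R) : 1 / 16 <= z -> 1 / 4 <= Num.sqrt z.
move=> hz; have -> : 1 / 4 = Num.sqrt (1 / 16) :> R.
 have -> : 1 / 16 = (1 / 4) ^+ 2 :> R by field.
 by rewrite sqrtr_sqr ger0_norm.
by apply: ler_wsqrtr.
move=> hv hw; have v0 : 0 <= v by lraw hv.
have w0 : 0 <= w by lraw hw.
have E : v - w = (Num.sqrt v - Num.sqrt w) * (Num.sqrt v + Num.sqrt w).
by rewrite -subr_sqr !sqr_sqrtr.
have h1 := s4 v hv; have h2 := s4 w hw.
have p0 : 0 <= Num.sqrt v + Num.sqrt w by lraw h1 h2.
rewrite E normrM (ger0_norm p0).
rewrite mulrCA; apply: ler_peMr; [exact: normr_ge0|lraw h1 h2].
Qed.

(** Capping the tolerance at 1/1000 keeps the mobilities above 1/16, where the square root is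
    2-Lipschitz; this gives [K] from the Lipschitz constant of the family. *)
Lemma family_flowing (c1 c2 : R -> R) (P eps : R) (aw : R -> R -> R) (X Y : R -> R -> R -> R) (Tw : R -> R) :
(eps = 1 \/ eps = -1) -> 0 < P -> approx_family aw ->
(forall w, 0 < w < 1 -> flow_solution (aw w) eps c1 c2 P (X w) (Y w) (Tw w)) ->
exists2 K, 0 <= K & forall e, 0 < e -> exists2 d : R, 0 < d <= 1 & forall w, 0 < w < d ->
 flowing (aw w) eps c1 c2 P (X w) (Y w) (Tw w) /\ admissible (aw w) K e.
Proof.
move=> heps P0 [sm [pos [per [[C lip] unif]]]] sol.
exists (2 * `|C|) => [|e e0]; first by rewrite mulr_ge0.
have m0 : 0 < Num.min e (1 / 1000) by rewrite lt_min e0 /=; lraw e0.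
have [d d0 hd] := unif _ m0.
exists (Num.min d 1) => [|w]; first by rewrite lt_min d0 ltr01 ge_min lexx orbT.
rewrite lt_min => /andP[w0 /andP[wd w1]]; have hw : 0 < w < 1 by rewrite w0.
have wd' : 0 < w < d by rewrite w0.
have cl s : `|aw w s - aniso s| < Num.min e (1 / 1000) by exact: hd.
have per4 s : aw w (s + 2 * pi) = aw w s.
rewrite (_ : s + 2 * pi = s + pi / 2 + pi / 2 + pi / 2 + pi / 2) ?per //; first by field.
have lb s : 1 / 16 <= aw w s.
have := cl s; rewrite lt_min => /andP[_]; rewrite ltr_norml => /andP[q1 _].
by have /andP[q2 _] := aniso_bounds s; lraw q1 q2.
split.
split=> //; split=> //; split; first by move=> s; exact: (sm w hw 0 s).
split; first by move=> s; exact: pos.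
by split; [exact: per4|exact: sol].
split.
- by move=> s; exact: pos.
- by move=> s; exact: per.
- move=> s t; apply: le_trans (sqrt_lip (lb s) (lb t)) _.
rewrite -mulrA ler_pM2l //; apply: le_trans (lip w s t hw) _.
by rewrite ler_wpM2r // ler_norm.
- by move=> s; have := cl s; rewrite lt_min => /andP[/ltW].
Qed.

(** I is the absolute integral of the mobility over a full turn, and 8 bounds 2 pi. The last
    estimate compares the remaining area with the squared length: it keeps the length away from 0
    before extinction. *)
Lemma extinction_data (a : R -> R) eps c1 c2 P x y T K e :
arclength_jordan c1 c2 P -> flowing a eps c1 c2 P x y T -> admissible a K e ->
exists I : R, [/\ 0 <= I, `|I - 2| <= 8 * e, `|area0 c1 c2 P| = I * T &
 forall t, 0 <= t < T -> I * (T - t) <= alen x y 0 P t ^+ 2].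
Proof.
move=> J F ad; have [n [hn tn]] := umlaufsatz J.
have dG s : der (prim a) s (a s).
apply: prim_der => z; exact: (@der_cvg _ _ _ _ (der_derive1 (@flowing_da _ _ _ _ _ _ _ _ _ F z))).
have T0 : 0 < T by case: (flowing_sol F).
set I := prim a (2 * pi) - prim a 0.
have EA := extinction_time J F dG tn; rewrite -/I in EA.
have n1 : `|n%:~R| = 1 :> R by case: hn => ->; rewrite ?mulrNz ?normrN normr1.
have e0 : 0 <= e by case: ad => _ _ _ /(_ 0); apply: le_trans; exact: normr_ge0.
exists `|I|; split.
- exact: normr_ge0.
- have h1 := admissible_integral ad dG; rewrite -/I in h1.
have h2 := ler_dist_dist I 2; rewrite (ger0_norm (x := 2)) // in h2.
apply: le_trans h2 (le_trans h1 _).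
by rewrite mulrC ler_wpM2r //; have /andP[_] := @pihalf_02 R; move: (pi : R) => p hp; lraw hp.
- by rewrite EA !normrM n1 mul1r (gtr0_norm T0).
- move=> t ht; apply: le_trans (sarea_le_length F ht).
rewrite (sarea_linear J F dG tn ht) -/I EA -mulrBr !normrM n1 mul1r.
by rewrite (gtr0_norm (x := T - t)) // subr_gt0; case/andP: ht.
Qed.

Lemma left_limit (f : R -> R) h : (forall e, 0 < e -> exists2 d : R, 0 < d &
 forall t t', h - d < t < h -> h - d < t' < h -> `|f t - f t'| < e) ->
exists p, forall e, 0 < e -> exists2 d : R, 0 < d & forall t, h - d < t < h -> `|f t - p| < e.
Proof.
move=> H; have : cvg (f @ h^'-).
apply: cauchy_cvg; apply: cauchy_exP => e e0; have [d d0 hd] := H e e0.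
exists (f (h - d / 2)).
have : \forall t \near h^'-, ball (f (h - d / 2)) e (f t).
 near=> t; rewrite -ball_normE /=; apply: hd.
 by apply/andP; split; lraw d0.
 by apply/andP; split; near: t; [apply: nbhs_left_gt; lraw d0|exact: nbhs_left_lt].
by [].
move/cvg_ex => [p /cvgrPdist_lt cp]; exists p => e e0.
have e2 : 0 < e / 2 by lraw e0.
have [d d0 hd] := H _ e2; exists d => // t ht.
have : \forall t' \near h^'-, `|p - f t'| < e / 2 /\ h - d < t' < h.
near=> t'; split; first by near: t'; exact: cp.
by apply/andP; split; near: t'; [apply: nbhs_left_gt; lraw d0|exact: nbhs_left_lt].
move=> q; case: (@filter_ex _ _ (at_left_proper_filter h) _ q) => t' [h1 h2]; have h3 := hd t t' ht h2; rewrite distrC in h1.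
move: (f t) (f t') (p) h1 h3 => q1 q2 q3 h1 h3.
have -> : q1 - q3 = (q1 - q2) + (q2 - q3) by ring.
by apply: le_lt_trans (ler_normD _ _) _; lraw h1 h3.
Unshelve. all: by end_near. Qed.

End Assembly.

(** * The limit of the times [T_K] *)

Section Limits.
Context {R : realType}.
Implicit Types (u s t w e : R).
Variables (c1 c2 : R -> R) (P eps : R) (aw : R -> R -> R) (X Y : R -> R -> R -> R) (Tw : R -> R).
Hypothesis J : arclength_jordan c1 c2 P.
Hypothesis heps : eps = 1 \/ eps = -1.
Hypothesis AF : approx_family aw.
Hypothesis FS : forall w, 0 < w < 1 -> flow_solution (aw w) eps c1 c2 P (X w) (Y w) (Tw w).
Notation h := (`|area0 c1 c2 P| / 2).
Notation len w t := (alen (X w) (Y w) 0 P t).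

Lemma eventually_flow : 0 < h /\ exists2 K, 0 <= K & forall e, 0 < e -> exists2 d : R, 0 < d <= 1 &
forall w, 0 < w < d -> [/\ flowing (aw w) eps c1 c2 P (X w) (Y w) (Tw w), admissible (aw w) K e,
 `|Tw w - h| < e & forall t, 0 <= t < Tw w -> Tw w - t <= len w t ^+ 2].
Proof.
have [K K0 hK] := family_flowing heps (jordan_P J) AF FS.
have base e : 0 < e -> e <= 1 / 8 -> exists2 d : R, 0 < d <= 1 & forall w, 0 < w < d ->
 [/\ flowing (aw w) eps c1 c2 P (X w) (Y w) (Tw w), admissible (aw w) K e, 0 < Tw w <= 2 * h,
 `|Tw w - h| <= 8 * e * h & forall t, 0 <= t < Tw w -> Tw w - t <= len w t ^+ 2].
move=> e0 e8; have [d d0 hd] := hK e e0; exists d => // w hw.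
have [F ad] := hd w hw; have [I [I0 hI EA hL]] := extinction_data J F ad.
have T0 : 0 < Tw w by case: (flowing_sol F).
have /andP[I1 I2] : - (8 * e) <= I - 2 <= 8 * e by rewrite -ler_norml.
have I3 : 1 <= I by lras I1 e8.
have hE : h = I * Tw w / 2 by rewrite EA.
have TI : Tw w <= I * Tw w by rewrite ler_peMl // ltW.
have T2 : Tw w <= 2 * h by rewrite hE; move: (I * Tw w) TI => z TI; lras TI.
split=> //; first by rewrite T0.
 have -> : Tw w - h = - ((I - 2) * (Tw w / 2)) by rewrite hE; field.
 rewrite normrN normrM (ger0_norm (x := Tw w / 2)); last by rewrite divr_ge0 // ltW.
 apply: ler_pM => //; first by rewrite divr_ge0 // ltW.
 by move: T2; move: (h) => z T2; lras T2.
move=> t ht; apply: le_trans (hL t ht); rewrite ler_peMl //.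
by case/andP: ht => _ /ltW; rewrite subr_ge0.
have e80 : 0 < 1 / 8 :> R by lras K0.
(* Positivity of the area is read off from the positive extinction time of a single regularised
   flow. *)
have h0 : 0 < h.
have [d /andP[d0 d1] hd] := base (1 / 8) e80 (lexx _).
have hw : 0 < d / 2 < d by apply/andP; split; lras d0.
have [_ _ /andP[q1 q2] _ _] := hd _ hw.
by have := lt_le_trans q1 q2; rewrite pmulr_rgt0.
split=> //; exists K => // e e0.
have q0 : 0 < 8 * (h + 1) by rewrite mulr_gt0 // addr_gt0.
pose e' := Num.min (Num.min e (1 / 8)) (e / (8 * (h + 1))).
have e'0 : 0 < e' by rewrite !lt_min e0 e80 divr_gt0.
have ee : e' <= e by rewrite /e' !ge_min lexx.
have e8 : e' <= 1 / 8 by rewrite /e' !ge_min lexx orbT.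
have eh : 8 * e' * h < e.
have : e' * (8 * (h + 1)) <= e.
 by rewrite -ler_pdivlMr // /e' ge_min lexx orbT.
move: (h) h0 (e') e'0 => z z0 e1 e10 q.
have E : 8 * e1 * z = e1 * (8 * (z + 1)) - 8 * e1 by ring.
by rewrite E; move: (e1 * _) q => z1 q; lras q e10.
have [d d0 hd] := base e' e'0 e8; exists d => // w hw.
have [F [a1 a2 a3 a4] _ b c] := hd w hw; split=> //; last exact: le_lt_trans b eh.
by split=> // s; apply: le_trans (a4 s) ee.
Qed.

Let norm_curv (x y : R -> R -> R) u t : `|curv eps x y u t| = `|kurv x y u t|.
Proof.
rewrite curvE [LHS]normrM (_ : `|eps| = 1) ?mul1r //.
by case: heps => ->; rewrite ?normrN normr1.
Qed.

(** Beyond h, a regularised flow would become extinct before t with curvature bounded by K / 2,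
    against [bounded_no_shrink]. *)
Lemma T_K_le K : (T_K eps X Y Tw K <= h%:E)%E.
Proof.
apply: ge_ereal_sup => _ [t [t0 ht]] <-; rewrite lee_fin leNgt; apply/negP => th.
have [_ [d /andP[d0 d1] <-] hd] := ereal_inf_lt ht.
have [_ [K1 K10 ev]] := eventually_flow.
have th0 : 0 < t - h by rewrite subr_gt0.
have [d2 /andP[d20 _] hd2] := ev _ th0.
pose w := Num.min d d2 / 2; have m0 : 0 < Num.min d d2 by rewrite lt_min d0.
have wd : 0 < w < d /\ 0 < w < d2.
have w0 : 0 < w by rewrite divr_gt0.
have : w < Num.min d d2 by rewrite /w ltr_pdivrMr // ltr_pMr // ltr1n.
by rewrite lt_min w0 => /andP[-> ->].
have [F _ hT _] := hd2 w wd.2.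
have Tt : Tw w < t by move: hT; rewrite ltr_norml ltrD2r => /andP[].
apply: (bounded_no_shrink F (K := K / 2)) => u r /andP[r0 rT].
rewrite -lee_fin; apply: le_trans (ltW hd).
apply: le_trans (ereal_sup_ubound _); last by exists w; [exact: wd.1|reflexivity].
apply: ereal_sup_ubound; exists u, r; split; first by rewrite r0 ltW // (lt_trans rT).
by split=> //; rewrite norm_curv.
Qed.

(** Up to t < h the remaining area keeps the length above sqrt dl for all small w, so
    [curvature_bound] gives one bound k; K > 2 k is asked because [T_K] compares with K / 2. *)
Lemma T_K_ge t : 0 <= t < h -> exists M : R, forall K, M < K -> (t%:E <= T_K eps X Y Tw K)%E.
Proof.
move=> /andP[t0 th]; have [h0 [K K0 ev]] := eventually_flow.
pose dl := (h - t) / 2; have dl0 : 0 < dl by rewrite divr_gt0 // subr_gt0.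
have s0 : 0 < Num.sqrt dl by rewrite sqrtr_gt0.
have [e0 [k [e00 hk]]] := curvature_bound J K0 s0 t0.
have m0 : 0 < Num.min e0 dl by rewrite lt_min e00.
have [d hd0 hd] := ev _ m0.
exists (2 * k) => L hL; apply: ereal_sup_ubound; exists t => //; split=> //.
apply: (@le_lt_trans _ _ k%:E); last by rewrite lte_fin ltr_pdivlMr // mulrC.
apply: le_trans (ereal_inf_lbound _) _; first by exists d; [exact: hd0|reflexivity].
apply: ge_ereal_sup => _ [w hw <-]; apply: ge_ereal_sup => _ [u [r [/andP[r0 rt] [rT ->]]]].
have [F ad hT hL2] := hd w hw.

rewrite lee_fin norm_curv.
have dT : dl <= Tw w - t.
move: hT; rewrite lt_min => /andP[_]; rewrite ltr_norml => /andP[q _].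
by move: q; rewrite /dl; move: (h) => z q; lras q.
have tT : t < Tw w by rewrite -subr_gt0 (lt_le_trans dl0).
apply: (hk (aw w) eps (X w) (Y w) (Tw w) t (Num.min e0 dl) F ad _ _ (lexx t)).
- by rewrite ltW //= ge_min lexx.
- by rewrite t0.
- move=> s /andP[q1 q2]; have hs : 0 <= s < Tw w by rewrite q1 (le_lt_trans q2).
rewrite -(ger0_norm (alen_ge0 F (ltW (jordan_P J)) hs)) -sqrtr_sqr; apply: ler_wsqrtr.
by apply: le_trans (hL2 s hs); apply: le_trans dT _; rewrite lerD2l lerN2.
- by rewrite r0.
Qed.

Lemma T_K_cvg : T_K eps X Y Tw K @[K --> +oo] --> h%:E.
Proof.
have [h0 _] := eventually_flow.
have fin K t : 0 <= t -> (t%:E <= T_K eps X Y Tw K)%E -> T_K eps X Y Tw K \is a fin_num.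
move=> _ q; rewrite fin_numE; apply/andP; split; apply/eqP => E.
 by move: q; rewrite E leNgt ltNyr.
by have := T_K_le K; rewrite E leNgt ltry.
have hh : 0 <= h / 2 < h.
by apply/andP; split; move: (h) h0 => z z0; lras z0.
have [M0 hM0] := T_K_ge hh; have /andP[hh0 _] := hh.
apply/fine_cvgP; split.
near=> K; apply: (fin K (h / 2)) => //; apply: hM0; near: K; apply: nbhs_pinfty_gt; exact: num_real.
apply/cvgrPdist_lt => e e0.
have ht : 0 <= Num.max 0 (h - e / 2) < h.
rewrite le_max lexx gt_max h0 /=; move: (h) => z; lras e0.
have [M hM] := T_K_ge ht.
near=> K; have q1 : (T_K eps X Y Tw K <= h%:E)%E := T_K_le K.
have q2 : ((Num.max 0 (h - e / 2))%:E <= T_K eps X Y Tw K)%E.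
by apply: hM; near: K; apply: nbhs_pinfty_gt; exact: num_real.
have fK := fin K _ (proj1 (andP ht)) q2; rewrite /=.
move: q1 q2; rewrite -(fineK fK) !lee_fin /=; move: (fine _) => f q1.
rewrite ge_max => /andP[_ q2]; rewrite ger0_norm ?subr_ge0 //.
by move: q1 q2; move: (h) => z q1 q2; lras q1 q2 e0.
Unshelve. all: by end_near. Qed.

End Limits.

(** * Convergence of the limit curves to a point *)

Section ShrinkToPoint.
Context {R : realType}.
Implicit Types (u s t w e : R).
Variables (c1 c2 : R -> R) (P eps : R) (aw : R -> R -> R) (X Y : R -> R -> R -> R) (Tw : R -> R).
Hypothesis J : arclength_jordan c1 c2 P.
Hypothesis heps : eps = 1 \/ eps = -1.
Hypothesis AF : approx_family aw.
Hypothesis FS : forall w, 0 < w < 1 -> flow_solution (aw w) eps c1 c2 P (X w) (Y w) (Tw w).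
Variable C : R -> set (R * R).
Notation h := (`|area0 c1 c2 P| / 2).
Hypothesis HC : forall t, 0 <= t -> t < h -> hausdorff_limit0 X Y Tw t (C t).

Lemma dist4 (e z a b c d : R) : `|a - z| < e / 4 -> `|a - b| < e / 4 -> `|c - b| < e / 4 ->
`|c - d| < e / 4 -> `|z - d| < e.
Proof.
rewrite !ltr_norml => /andP[h1 h2] /andP[h3 h4] /andP[h5 h6] /andP[h7 h8].
by apply/andP; split; lras h1 h2 h3 h4 h5 h6 h7 h8.
Qed.

(** For small w both limit curves are close to one regularised flow, whose later curve stays within
    the length of the earlier one of a fixed point ([dist_later]); near h that length is small
    uniformly in w ([length_small]). *)
Lemma limit_cauchy e : 0 < e -> exists2 d : R, 0 < d <= h & forall t t' z z',
h - d < t < h -> h - d < t' < h -> C t z -> C t' z' -> `|z.1 - z'.1| < e /\ `|z.2 - z'.2| < e.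
Proof.
move=> e0; have [h0 [K K0 ev]] := eventually_flow J heps AF FS.
have e4 : 0 < e / 4 by lras e0.
have h1 : 0 <= h + 1 by rewrite addr_ge0 // ltW.
have [e1 [c [e10 c0 hs]]] := length_small J K0 h1 e4.
(* The other half of c is kept for the error of the extinction time; the bound by h keeps the times
   nonnegative. *)
exists (Num.min (c / 2) h); first by rewrite lt_min h0 divr_gt0 // ge_min lexx orbT.
suff wl t t' z z' : t <= t' -> h - Num.min (c / 2) h < t < h -> h - Num.min (c / 2) h < t' < h ->
 C t z -> C t' z' -> `|z.1 - z'.1| < e /\ `|z.2 - z'.2| < e.
move=> t t' z z' ht ht' Cz Cz'; case: (leP t t') => tt; first exact: (wl t t').
by rewrite distrC [`|z.2 - _|]distrC; exact: (wl t' t _ _ (ltW tt)).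
move=> tt /andP[t1 t2] /andP[_ t'2] Cz Cz'.
have t0 : 0 <= t.
by apply: ltW; apply: le_lt_trans t1; rewrite subr_ge0 ge_min lexx orbT.
have tc : h - c / 2 < t by apply: le_lt_trans t1; rewrite lerD2l lerN2 ge_min lexx.
have t'0 : 0 <= t' := le_trans t0 tt.
have [d1 /andP[d10 _] H1] := HC t0 t2 e4.
have [d2 /andP[d20 _] H2] := HC t'0 t'2 e4.
have m0 : 0 < Num.min e1 (Num.min (c / 2) 1) by rewrite !lt_min e10 ltr01 divr_gt0.
have [d3 /andP[d30 _] H3] := ev _ m0.
pose m := Num.min d1 (Num.min d2 d3); have mm0 : 0 < m by rewrite !lt_min d10 d20.
pose w := m / 2; have w0 : 0 < w by rewrite divr_gt0.
have wm : w < m by rewrite /w ltr_pdivrMr // ltr_pMr // ltr1n.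
have [w1 w2 w3] : [/\ 0 < w < d1, 0 < w < d2 & 0 < w < d3].
by move: wm; rewrite !lt_min w0 => /and3P[-> -> ->].
have [tT [_ /(_ z Cz) [u bu]]] := H1 w w1.
have [tT' [_ /(_ z' Cz') [u' bu']]] := H2 w w2.
have [F ad hT _] := H3 w w3.
move: hT; rewrite !lt_min => /and3P[_ hTc hT1].
have Tc : Tw w - t < c.
move: hTc; rewrite ltr_norml => /andP[_]; move: (h) tc => q tc hTc; lras tc hTc.
have Th : Tw w <= h + 1.
by apply: ltW; move: hT1; rewrite ltr_norml => /andP[_]; rewrite ltrBlDl.
have me : 0 <= Num.min e1 (Num.min (c / 2) 1) <= e1 by rewrite (ltW m0) ge_min lexx.
have htT : 0 <= t < Tw w by rewrite t0.
have Ls := hs _ _ _ _ _ _ t F ad me Th htT Tc.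
have [p1 p2] := dist_later F u t0 (lexx t) tT.
have [p3 p4] := dist_later F u' t0 tt tT'.
case: bu => b1 b2; case: bu' => b3 b4.
split; [apply: (@dist4 e _ _ (X w 0 t) _ _ b1 _ _ b3)|apply: (@dist4 e _ _ (Y w 0 t) _ _ b2 _ _ b4)].
- exact: le_lt_trans p1 Ls.
- exact: le_lt_trans p3 Ls.
- exact: le_lt_trans p2 Ls.
- exact: le_lt_trans p4 Ls.
Qed.

(** One chosen point on each curve has coordinates satisfying Cauchy's criterion at h; the same
    criterion at equal times controls the rest of the curve. *)
Lemma limit_point : exists p : R * R, forall e, 0 < e -> exists2 d : R, 0 < d &
forall t, h - d < t < h -> C t `<=` ball p e.
Proof.
have /choice[z hz] : forall t, exists z : R * R, 0 <= t < h -> C t z.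
move=> t; have [/andP[t0 th]|_] := boolP (0 <= t < h); last by exists (0, 0).
have [d /andP[d0 _] hd] := HC t0 th ltr01.
have hw : 0 < d / 2 < d by rewrite divr_gt0 //= ltr_pdivrMr // ltr_pMr // ltr1n.
by have [_ [/(_ 0) [p Cp _] _]] := hd _ hw; exists p.
have z0 d t : d <= h -> h - d < t < h -> C t (z t).
move=> dh /andP[q1 q2]; apply: hz; rewrite q2 andbT; apply: ltW.
by apply: le_lt_trans q1; rewrite subr_ge0.
have [p1 hp1] : exists p, forall e, 0 < e -> exists2 d : R, 0 < d &
 forall t, h - d < t < h -> `|(z t).1 - p| < e.
apply: left_limit => e e0; have [d /andP[d0 dh] hd] := limit_cauchy e0.
by exists d => // t t' q1 q2; have [] := hd t t' _ _ q1 q2 (z0 d t dh q1) (z0 d t' dh q2).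
have [p2 hp2] : exists p, forall e, 0 < e -> exists2 d : R, 0 < d &
 forall t, h - d < t < h -> `|(z t).2 - p| < e.
apply: left_limit => e e0; have [d /andP[d0 dh] hd] := limit_cauchy e0.
by exists d => // t t' q1 q2; have [] := hd t t' _ _ q1 q2 (z0 d t dh q1) (z0 d t' dh q2).
exists (p1, p2) => e e0; have e2 : 0 < e / 2 by rewrite divr_gt0.
have [d1 d10 hd1] := hp1 _ e2; have [d2 d20 hd2] := hp2 _ e2.
have [d3 /andP[d30 d3h] hd3] := limit_cauchy e2.
exists (Num.min d1 (Num.min d2 d3)); first by rewrite !lt_min d10 d20.
move=> t /andP[q1 q2] v Cv.
have sub d : Num.min d1 (Num.min d2 d3) <= d -> h - d < t < h.
by move=> q; rewrite q2 andbT (le_lt_trans _ q1) // lerD2l lerN2.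
have s1 := sub d1 ltac:(by rewrite ge_min lexx).
have s2 := sub d2 ltac:(by rewrite !ge_min lexx orbT).
have s3 := sub d3 ltac:(by rewrite !ge_min lexx !orbT).
have [r1 r2] := hd3 t t _ _ s3 s3 Cv (z0 d3 t d3h s3).
have r3 := hd1 t s1; have r4 := hd2 t s2.
have tri (a b c : R) : `|a - b| < e / 2 -> `|b - c| < e / 2 -> `|c - a| < e.
rewrite !ltr_norml => /andP[g1 g2] /andP[g3 g4].
by apply/andP; split; lras g1 g2 g3 g4.
by split; [exact: tri r1 r3|exact: tri r2 r4].
Qed.

End ShrinkToPoint.

Theorem theorem3p2 (R : realType) (c1 c2 : R -> R) (L eps : R)
(aw : R -> R -> R) (X Y : R -> R -> R -> R) (Tw : R -> R) :
arclength_jordan c1 c2 L ->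
finitely_many_inflections c1 c2 L ->
inward_orientation c1 c2 eps ->
approx_family aw ->
(forall w, 0 < w < 1 -> flow_solution (aw w) eps c1 c2 L (X w) (Y w) (Tw w)) ->
let D := enclosed (curve_image c1 c2) in
let halfArea := ((lebesgue_measure \x lebesgue_measure) D * (2^-1)%:E)%E in
(T_K eps X Y Tw K @[K --> +oo]) --> halfArea /\
(forall C : R -> set (R * R),
 (forall t, 0 <= t -> (t%:E < halfArea)%E ->
  hausdorff_limit0 X Y Tw t (C t)) ->
 exists p : R * R, forall e, 0 < e -> exists2 d : R, 0 < d &
 forall t, (halfArea - d%:E < t%:E < halfArea)%E -> C t `<=` ball p e).
Proof.
move=> J _ O AF FS D halfArea; have heps := O.1.
(* Green's formula identifies half the measure with half the absolute line integral, in which all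
   flow estimates are expressed. *)
have hE : halfArea = (`|area0 c1 c2 L| / 2)%:E by rewrite /halfArea /D (green_area J O) -EFinM.
clearbody halfArea; subst halfArea; split; first exact: (T_K_cvg J heps AF FS).
move=> C HC; have HC' t : 0 <= t -> t < `|area0 c1 c2 L| / 2 -> hausdorff_limit0 X Y Tw t (C t).
by move=> t0 th; apply: HC => //; rewrite lte_fin.
have [p hp] := limit_point J heps AF FS HC'.
by exists p => e e0; have [d d0 hd] := hp e e0; exists d.
Qed.
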